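(* Let $X=(X_t)_{t\ge 0}$ be a killed subordinator which is not identically zero, with Laplace exponent $\Phi$, Lévy measure $\Pi$ and potential measure $U$. Let $N\in\mathbb{N}$ be fixed. Assume the following two conditions. (A) There exist constants $n\in\mathbb{N}\cup\{0\}$, $c_0\in(0,+\infty)$, $c_1,\dots,c_n\in\mathbb{R}\setminus\{0\}$ and $\alpha_0>\alpha_1>\dots>\alpha_n>-N+1$ with $\alpha_0=\alpha\in[0,1]$, and a locally integrable function $R:(0,+\infty)\to(0,+\infty)$ such that $R(t)$ is non-increasing on $(0,r)$ for some $r>0$, $R(t)=o(t^{-N-\alpha_n})$ as $t\to 0+$, and $$\Big(\frac{d}{dz}\Big)^{N}\Big(\frac{1}{\Phi(z)}-\sum_{k=0}^n\frac{1}{c_k z^{\alpha_k}}\Big)=O(R(|z|)),\quad\text{as } z\to 0 \text{ in } \{z\in\mathbb{C}\mid \mathrm{Re}\,z>0\}.$$ (B) For any $r>0$, $$\sup_{\lambda>0}\int_{\mathbb{R}\setminus(-r,r)}\Big|\Big(\Big(\frac{d}{dz}\Big)^N\frac{1}{\Phi}\Big)(\lambda+i\theta)\Big|\,d\theta<+\infty.$$ Let $u(x)$ $(0<x<+\infty)$ be the continuous density of $U|_{(0,+\infty)}$ (which exists under these assumptions), and put $$\varepsilon_1(x)=x^{-N-1}R(x^{-1})+x^{-N}\int_{x^{-1}}^{1}R(t)\,dt.$$ Define $\varepsilon_2:(0,+\infty)\to\mathbb{R}$ by $$\Pi((x,+\infty))=\mathbf{1}_{\{\alpha>0\}}\frac{c_0x^{-\alpha}}{\Gamma(1-\alpha)}+\varepsilon_2(x),\quad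 0<x<+\infty,$$ and set $\varepsilon_3(s,x)=s\,\Pi((s-sx,+\infty))\,\varepsilon_1(sx)$. Then, for $s\in(0,+\infty)$, the finite measure $$\mathbb{P}\Big(\frac{X_{T(s)-}}{s}\in dx,\;0<\frac{X_{T(s)-}}{s}<1\Big),\quad 0<x<1,$$ admits the density $s\,\Pi((s-sx,+\infty))\,u(sx)$, and $$\begin{aligned} s\,\Pi((s-sx,+\infty))\,u(sx) ={}&\frac{\sin(\pi\alpha)}{\pi}x^{-1+\alpha}(1-x)^{-\alpha}\\ &+\mathbf{1}_{\{\alpha>0\}}\sum_{k=1}^n\frac{c_0s^{\alpha_k-\alpha}}{c_k\Gamma(\alpha_k)\Gamma(1-\alpha)}x^{-1+\alpha_k}(1-x)^{-\alpha}\\ &+\sum_{k=0}^n\frac{s^{\alpha_k}}{c_k\Gamma(\alpha_k)}x^{-1+\alpha_k}\varepsilon_2(s-sx)+O(\varepsilon_3(s,x)),\quad\text{as } s\to+\infty, \end{aligned}$$ uniformly in $x\in I$ for any closed interval $I\subset(0,1)$. Therefore, for any closed interval $I\subset(0,1)$, $$\begin{aligned} \mathbb{P}\Big(\frac{X_{T(s)-}}{s}\in I\Big) ={}&\frac{\sin(\pi\alpha)}{\pi}\int_I x^{-1+\alpha}(1-x)^{-\alpha}\,dx\\ &+\mathbf{1}_{\{\alpha>0\}}\sum_{k=1}^n\frac{c_0s^{\alpha_k-\alpha}}{c_k\Gamma(\alpha_k)\Gamma(1-\alpha)}\int_I x^{-1+\alpha_k}(1-x)^{-\alpha}\,dx\\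 &+\sum_{k=0}^n\frac{s^{\alpha_k}}{c_k\Gamma(\alpha_k)}\int_I x^{-1+\alpha_k}\varepsilon_2(s-sx)\,dx+O\Big(\sup_{x\in I}\varepsilon_3(s,x)\Big),\quad\text{as } s\to+\infty. \end{aligned}$$
   Context: $\mathbb{N}=\{1,2,\dots\}$. A killed subordinator is a process $X$ for which there are a one-dimensional non-decreasing Lévy process $Y$ with $Y_0=0$ and an independent $(0,+\infty]$-valued exponentially distributed random variable $\zeta$ (with $\zeta=+\infty$ a.s. allowed, i.e. killing rate $0$) such that $X_t=Y_t$ for $t<\zeta$ and $X_t=\partial$ (a cemetery point) for $t\ge\zeta$. Its Laplace exponent $\Phi$ is determined by $\mathbb{E}[\exp(-zX_t)]=\exp(-\Phi(z)t)$ for $t\ge0$, $z\in\mathbb{C}$ with $\mathrm{Re}\,z\ge0$ (with $e^{-z\partial}=0$), and has the form $$\Phi(z)=a+bz+\int_{(0,+\infty)}(1-e^{-zx})\,\Pi(dx),\quad \mathrm{Re}\,z\ge 0,$$ with killing rate $a\ge0$, drift coefficient $b\ge0$ and Lévy measure $\Pi$, a $\sigma$-finite measure on $(0,+\infty)$ with $\int_{(0,+\infty)}(1\wedge x)\,\Pi(dx)<+\infty$. ''$X$ is not identically zero'' means $a>0$ or $b>0$ or $\Pi((0,+\infty))>0$; then $\mathrm{Re}\,\Phi(z)>0$ for $\mathrm{Re}\,z>0$. The potential measure $U$ is the locally finite measure on $[0,+\infty)$ defined by $U(A)=\mathbb{E}\big[\int_0^{+\infty}\mathbf{1}_{\{X_t\in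 A\}}\,dt\big]$ for Borel $A\subset[0,+\infty)$. For $s>0$, $T(s)=\inf\{t\ge0\mid X_t>s\}$ is the first passage time strictly above $s$; $X_{t-}=\lim_{u\to t-}X_u$ is the left limit, with $X_{0-}=X_0=0$. Events involving $X_{T(s)-}$ are understood on $\{T(s)<\zeta\}$, i.e. $\mathbb{P}(X_{T(s)-}\in dx)=\mathbb{P}(X_{T(s)-}\in dx,\,T(s)<\zeta)$. Complex powers are principal values: $z^w=\exp(w\log z)$ with $\mathrm{Im}\log z\in(-\pi,\pi)$ for $z\in\mathbb{C}\setminus(-\infty,0]$. $1/\Gamma$ denotes the (entire) reciprocal gamma function, so $1/\Gamma(-m)=0$ for $m\in\mathbb{N}\cup\{0\}$. $f=g+O(h)$ as $x\to a$ means $|f(x)-g(x)|\le C h(x)$ on some neighborhood of $a$ for some constant $C\in(0,+\infty)$; ''uniformly in $x\in I$'' means the constant and the neighborhood (of $s=+\infty$) do not depend on $x\in I$ (they may depend on $I$). $f=g+o(h)$ means $|f-g|/h\to0$. *)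

(* Defs.v *)
From HB Require Import structures.
From mathcomp Require Import all_boot all_order all_algebra complex.
From mathcomp Require Import all_classical all_reals all_analysis measurable_realfun.

Set Implicit Arguments.
Unset Strict Implicit.
Unset Printing Implicit Defensive.

Import Order.TTheory GRing.Theory Num.Theory.
Import numFieldNormedType.Exports.

#[global] Open Scope classical_set_scope.
#[global] Open Scope ring_scope.
#[global] Open Scope complex_scope.

(** ** Complex numbers *)

Notation cRe := complex.Re.
Notation cIm := complex.Im.
Notation cmod := ComplexField.Normc.normc.

Definition cexp (R : realType) (z : R[i]) : R[i] :=
  (expR (cRe z) * cos (cIm z)) +i* (expR (cRe z) * sin (cIm z)).

(* The argument in ]-pi, pi[ of a point off the cut ]-oo, 0], by the half-angle
   formula tan (arg z / 2) = Im z / (|z| + Re z). *)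
Definition carg (R : realType) (z : R[i]) : R :=
  2 * atan (cIm z / (cmod z + cRe z)).

Definition clog (R : realType) (z : R[i]) : R[i] := ln (cmod z) +i* carg z.

Definition cpow (R : realType) (z w : R[i]) : R[i] := cexp (w * clog z).

Definition cintegral (d : measure_display) (T : measurableType d) (R : realType)
    (mu : {measure set T -> \bar R}) (D : set T) (f : T -> R[i]) : R[i] :=
  (\int[mu]_(x in D) cRe (f x)) +i* (\int[mu]_(x in D) cIm (f x)).

(* The N-th complex derivative: the scalar field here is R[i]. *)
Definition cderive (R : realType) (N : nat) (f : R[i] -> R[i]) : R[i] -> R[i] :=
  derive1n N (f : R[i] -> R[i]^o).

(** ** The reciprocal gamma function *)

Definition Gamma_pos (R : realType) (x : R) : R :=
  \int[lebesgue_measure]_(t in `]0, +oo[) (t `^ (x - 1) * expR (- t)).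

(* 1 / Gamma x = x (x + 1) ... (x + m - 1) / Gamma (x + m), with m large enough
   for Euler's integral to converge at x + m > 0. *)
Definition invGamma (R : realType) (x : R) : R :=
  let m := `|Num.floor x|%N.+1 in
  (\prod_(i < m) (x + i%:R)) / Gamma_pos (x + m%:R).

(** ** Killed subordinators *)

Record is_subordinator (d : measure_display) (Omega : measurableType d)
    (R : realType) (P : probability Omega R) (Y : R -> Omega -> R) : Prop := {
  subord_meas : forall t : R, 0 <= t -> measurable_fun setT (Y t) ;
  subord_0 : forall w, Y 0 w = 0 ;
  subord_ndecr : forall w (s t : R), 0 <= s -> s <= t -> Y s w <= Y t w ;
  subord_rcont : forall w (t : R), 0 <= t -> Y u w @[u --> t^'+] --> Y t w ;
  subord_llim : forall w (t : R), 0 < t -> cvg (Y u w @[u --> t^'-]) ;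
  subord_indep : forall (n : nat) (t : nat -> R) (B : nat -> set R),
    0 <= t 0%N -> (forall i, t i <= t i.+1) -> (forall i, measurable (B i)) ->
    P (\bigcap_(i < n) [set w | B i (Y (t i.+1) w - Y (t i) w)]) =
    (\prod_(i < n) P [set w | B i (Y (t i.+1) w - Y (t i) w)%R])%E ;
  subord_stat : forall (s t : R) (B : set R),
    0 <= s -> 0 <= t -> measurable B ->
    P [set w | B (Y (s + t) w - Y s w)] = P [set w | B (Y t w)]
}.

(* The rate q = 0 gives zeta = +oo almost surely. *)
Definition is_exponential (d : measure_display) (Omega : measurableType d)
    (R : realType) (P : probability Omega R) (zeta : Omega -> \bar R) : Prop :=
  [/\ measurable_fun setT zeta, (forall w, (0 < zeta w)%E) &
      exists2 q : R, 0 <= q & forall t : R, 0 <= t ->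
        P [set w | (t%:E < zeta w)%E] = (expR (- (q * t)))%:E].

Definition indep_process_rv (d : measure_display) (Omega : measurableType d)
    (R : realType) (P : probability Omega R)
    (Y : R -> Omega -> R) (zeta : Omega -> \bar R) : Prop :=
  forall (n : nat) (t : nat -> R) (B : nat -> set R) (C : set (\bar R)),
    (forall i, 0 <= t i) -> (forall i, measurable (B i)) -> measurable C ->
    P ((\bigcap_(i < n) (Y (t i) @^-1` B i)) `&` (zeta @^-1` C)) =
    (P (\bigcap_(i < n) (Y (t i) @^-1` B i)) * P (zeta @^-1` C))%E.

(* [None] is the cemetery point. *)
Definition is_killed_subordinator (d : measure_display)
    (Omega : measurableType d) (R : realType) (P : probability Omega R)
    (X : R -> Omega -> option R) : Prop :=
  exists Y : R -> Omega -> R, exists zeta : Omega -> \bar R,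
    [/\ is_subordinator P Y, is_exponential P zeta, indep_process_rv P Y zeta &
        forall (t : R) w, 0 <= t ->
          X t w = if (t%:E < zeta w)%E then Some (Y t w) else None].

(* A measure on ]0, +oo[ is represented by a measure on R that does not charge
   ]-oo, 0]. *)
Definition is_levy_measure (R : realType) (Pi : {measure set R -> \bar R}) :
    Prop :=
  [/\ Pi [set x : R | x <= 0] = 0%E, sigma_finite setT Pi &
      (\int[Pi]_(x in `]0%R, +oo[) (Num.min 1 x)%:E < +oo)%E].

Definition levy_khintchine (R : realType) (a b : R)
    (Pi : {measure set R -> \bar R}) (z : R[i]) : R[i] :=
  a%:C + b%:C * z + cintegral Pi `]0, +oo[ (fun x => 1 - cexp (- z * x%:C)).

(* a, b and Pi are the killing rate, the drift and the Levy measure of X. *)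
Definition has_characteristics (d : measure_display) (Omega : measurableType d)
    (R : realType) (P : probability Omega R) (X : R -> Omega -> option R)
    (a b : R) (Pi : {measure set R -> \bar R}) : Prop :=
  [/\ 0 <= a, 0 <= b, is_levy_measure Pi &
      forall (t : R) (z : R[i]), 0 <= t -> 0 <= cRe z ->
        cintegral P setT
          (fun w => if X t w is Some y then cexp (- z * y%:C) else 0) =
        cexp (- levy_khintchine a b Pi z * t%:C)].

Definition potential (d : measure_display) (Omega : measurableType d)
    (R : realType) (P : probability Omega R) (X : R -> Omega -> option R)
    (A : set R) : \bar R :=
  (\int[P]_w \int[lebesgue_measure]_(t in `[0%R, +oo[)
     (\1_[set t | exists2 y, X t w = Some y & A y] t)%:E)%E.

Definition is_continuous_density (R : realType) (U : set R -> \bar R)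
    (u : R -> R) : Prop :=
  [/\ {in `]0, +oo[, continuous u}, (forall x, 0 < x -> 0 <= u x) &
      forall A : set R, measurable A -> A `<=` `]0, +oo[ ->
        U A = (\int[lebesgue_measure]_(x in A) (u x)%:E)%E].

Definition lifetime (Omega : Type) (R : realType) (X : R -> Omega -> option R)
    (w : Omega) : \bar R :=
  ereal_inf [set t%:E | t in [set t : R | 0 <= t /\ X t w = None]].

Definition passage_time (Omega : Type) (R : realType)
    (X : R -> Omega -> option R) (s : R) (w : Omega) : \bar R :=
  ereal_inf [set t%:E | t in
    [set t : R | 0 <= t /\ exists2 y, X t w = Some y & s < y]].

(* Only used at times t before the lifetime, where the default value given to
   the cemetery point is irrelevant. *)
Definition left_limit (Omega : Type) (R : realType)
    (X : R -> Omega -> option R) (t : R) (w : Omega) : R :=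
  if t == 0 then 0 else lim (odflt 0 (X u w) @[u --> t^'-]).

(* The event { X_{T(s)-} / s \in B, T(s) < zeta }. *)
Definition undershoot_in (Omega : Type) (R : realType)
    (X : R -> Omega -> option R) (s : R) (B : set R) : set Omega :=
  [set w | (passage_time X s w < lifetime X w)%E /\
           B (left_limit X (fine (passage_time X s w)) w / s)].

(** ** Assumptions and error terms *)

Definition condition_A (R : realType) (Phi : R[i] -> R[i]) (N n : nat)
    (c alpha : nat -> R) (rho : R -> R) : Prop :=
  [/\ 0 < c 0%N /\ (forall k, (1 <= k <= n)%N -> c k != 0),
      [/\ 0 <= alpha 0%N, alpha 0%N <= 1,
          (forall k, (k < n)%N -> alpha k.+1 < alpha k) &
          1 - N%:R < alpha n],
      [/\ (forall t, 0 < t -> 0 < rho t),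
          locally_integrable `]0, +oo[ rho,
          (exists2 r, 0 < r & forall x y, 0 < x -> x <= y -> y < r ->
             rho y <= rho x) &
          rho t / t `^ (- N%:R - alpha n) @[t --> 0^'+] --> 0] &
      exists2 C : R, 0 < C &
        \forall z \near within [set z : R[i] | 0 < cRe z] (nbhs (0 : R[i]^o)),
          cmod (cderive N (fun z => (Phi z)^-1 -
              \sum_(0 <= k < n.+1) ((c k)%:C * cpow z (alpha k)%:C)^-1) z)
          <= C * rho (cmod z)].

Definition condition_B (R : realType) (Phi : R[i] -> R[i]) (N : nat) : Prop :=
  forall r : R, 0 < r ->
  (ereal_sup [set \int[lebesgue_measure]_(theta in ~` `](- r)%R, r[)
       (cmod (cderive N (fun z => (Phi z)^-1) (lambda +i* theta)))%:E
     | lambda in [set lambda : R | (0 < lambda)%R]] < +oo)%E.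

(* Integral with oriented endpoints. *)
Definition orint (R : realType) (a b : R) (f : R -> R) : R :=
  \int[lebesgue_measure]_(t in `[a, b]) f t -
  \int[lebesgue_measure]_(t in `[b, a]) f t.

Definition levy_tail (R : realType) (Pi : {measure set R -> \bar R}) (x : R) :
    R := fine (Pi `]x, +oo[%classic).

Definition eps1 (R : realType) (N : nat) (rho : R -> R) (x : R) : R :=
  x ^- N.+1 * rho x^-1 + x ^- N * orint x^-1 1 rho.

Definition eps2 (R : realType) (Pi : {measure set R -> \bar R}) (c0 alpha : R)
    (x : R) : R :=
  levy_tail Pi x - (0 < alpha)%R%:R * (c0 * x `^ (- alpha) * invGamma (1 - alpha)).

Definition eps3 (R : realType) (Pi : {measure set R -> \bar R}) (N : nat)
    (rho : R -> R) (s x : R) : R :=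
  s * levy_tail Pi (s - s * x) * eps1 N rho (s * x).

(* Main.v *)
Require Import Defs.
From HB Require Import structures.
From mathcomp Require Import all_boot all_order all_algebra complex.
From mathcomp Require Import all_classical all_reals all_analysis measurable_realfun.
From mathcomp Require Import ring lra.
Import Order.TTheory GRing.Theory Num.Theory.
Import numFieldNormedType.Exports.

(** The density of the undershoot is the product of the tail of the Levy measure
    at [s - s x] and of the potential density at [s x], and each factor is
    expanded separately.

    Expansion of the potential density.  On [Re z > 0] the function [1 / Phi] is
    the Laplace transform of the potential measure [U] ([laplace_potential]).
    On the line [Re z = l] its [N]-th derivative is, up to a sign, the Fourier
    transform of the finite measure [x^N exp (- l x) U (dx)].  By [condition_B]
    this transform is integrable, so that Fourier inversion
    ([fourier_inversion]) gives a continuous density, which does not depend on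
    [l] once the tilting is undone ([regular_density], [udens_indep]).  The
    terms [1 / (c_k z^alpha_k)], differentiated [N] times, are multiples of
    powers [z^(- p)] with [p > 1], which are transforms of gamma laws
    ([gammaL_pow]); their inverse transforms are the powers of [x] in the
    expansion.  The difference is the inverse transform of a remainder, taken
    at the point [x] on the line [Re z = 1 / x].  Near the origin
    [condition_A] bounds it by [rho], and far from the origin [condition_B]
    bounds its integral by a constant, whence the error [eps1]
    ([density_expansion]).

    Law of the undershoot.  Observe the process on a grid of mesh [h].  By the
    independence and the stationarity of increments and the lack of memory of
    the lifetime, the probability of jumping over [s] during a given cell from
    a position in [ ]p, q] ] lies between [P (p < X_t <= q)] times
    [P (X_h > s - p)] and the same with [P (X_h >= s - q)], where [t] is the
    left end of the cell.  Summed over the cells, the first factors times [h]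
    form a Riemann sum of [U ( ]p, q] )] ([riemann_sum_potential]).  The second
    factors divided by [h] tend to tails of the Levy measure
    ([survival_tail_ge], [survival_tail_le]): the measures
    [(1 - exp (- M x)) P (X_h in dx) / h] are finite and their Fourier
    transforms converge, so that an open set portmanteau inequality applies
    ([portmanteau_open]).  Letting [h] tend to 0 therefore encloses the
    probability that the undershoot lies in [ ]p, q] ] between
    [Pi ( ]s - p, +oo[ ) U ( ]p, q] )] and [Pi ( [s - q, +oo[ ) U ( ]p, q] )]
    ([undershoot_itv_ge], [undershoot_itv_le]).  The measure with the announced
    density satisfies the same bounds, and two such measures differ on small
    intervals by quantities of second order, hence coincide
    ([small_increments_cst], [undershoot_density]).

    Conclusion.  Multiplying the expansion of the density by the tail gives the
    terms of the theorem ([expansion_product]); the reflection formula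
    ([invGamma_reflection]) turns the leading coefficient
    [1 / (Gamma (alpha) Gamma (1 - alpha))] into [sin (pi alpha) / pi].  The
    estimate is uniform on closed subintervals of [ ]0, 1[ ], where it may be
    integrated. *)

Set Implicit Arguments.
Unset Strict Implicit.
Unset Printing Implicit Defensive.

Local Open Scope classical_set_scope.
Local Open Scope ring_scope.
Local Open Scope complex_scope.

(** * Complex exponential, logarithm and powers *)

Section ComplexCalculus.
Context {R : realType}.
Implicit Types (z w u h : R[i]) (a b x : R).

Lemma cReD z w : cRe (z + w) = cRe z + cRe w. Proof. by case: z; case: w. Qed.
Lemma cImD z w : cIm (z + w) = cIm z + cIm w. Proof. by case: z; case: w. Qed.
Lemma cReN z : cRe (- z) = - cRe z. Proof. by case: z. Qed.
Lemma cImN z : cIm (- z) = - cIm z. Proof. by case: z. Qed.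
Lemma cReM z w : cRe (z * w) = cRe z * cRe w - cIm z * cIm w.
Proof. by case: z; case: w. Qed.
Lemma cImM z w : cIm (z * w) = cRe z * cIm w + cIm z * cRe w.
Proof. by case: z; case: w. Qed.
Lemma cReZ x z : cRe (x%:C * z) = x * cRe z.
Proof. by rewrite cReM /= mul0r subr0. Qed.
Lemma cImZ x z : cIm (x%:C * z) = x * cIm z.
Proof. by rewrite cImM /= mul0r addr0. Qed.
Lemma cReZr x z : cRe (z * x%:C) = cRe z * x.
Proof. by rewrite cReM /= mulr0 subr0. Qed.
Lemma cImZr x z : cIm (z * x%:C) = cIm z * x.
Proof. by rewrite cImM /= mulr0 add0r. Qed.

Definition cE := (cReD, cImD, cReN, cImN, cReM, cImM).

Lemma complexP z w : cRe z = cRe w -> cIm z = cIm w -> z = w.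
Proof. by case: z; case: w => ? ? ? ? /= -> ->. Qed.

Lemma real_complexM a b : (a * b)%:C = a%:C * b%:C :> R[i].
Proof. by apply: complexP; rewrite !cE /= ?(mulr0, mul0r, subr0, addr0). Qed.
Lemma real_complexD a b : (a + b)%:C = a%:C + b%:C :> R[i].
Proof. by apply: complexP; rewrite !cE /= ?addr0. Qed.
Lemma real_complexN a : (- a)%:C = - a%:C :> R[i].
Proof. by apply: complexP; rewrite !cE /= ?oppr0. Qed.
Lemma real_complexX a n : (a ^+ n)%:C = a%:C ^+ n :> R[i].
Proof. by elim: n => // n IH; rewrite !exprS real_complexM IH. Qed.
Lemma real_complexV a : (a^-1)%:C = (a%:C)^-1 :> R[i].
Proof.
have [->|a0] := eqVneq a 0; first by rewrite !invr0.
apply: (@mulfI _ a%:C); first by rewrite eq_complex /= eqxx andbT.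
rewrite -real_complexM divff// divff//.
by rewrite eq_complex /= eqxx andbT.
Qed.

Lemma cmodE z : cmod z = Num.sqrt (cRe z ^+ 2 + cIm z ^+ 2).
Proof. by case: z. Qed.
Lemma cmod_ge0 z : 0 <= cmod z. Proof. by rewrite cmodE sqrtr_ge0. Qed.
Lemma sqr_cmod z : cmod z ^+ 2 = cRe z ^+ 2 + cIm z ^+ 2.
Proof. by rewrite cmodE sqr_sqrtr// addr_ge0 ?sqr_ge0. Qed.
Lemma normc_cmod z : `|z| = (cmod z)%:C. Proof. by []. Qed.
Lemma cmodM z w : cmod (z * w) = cmod z * cmod w.
Proof. exact: ComplexField.Normc.normcM. Qed.
Lemma cmodD z w : cmod (z + w) <= cmod z + cmod w.
Proof. exact: le_normcD. Qed.
Lemma cmodN z : cmod (- z) = cmod z. Proof. exact: normcN. Qed.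
Lemma cmodB z w : cmod (z - w) <= cmod z + cmod w.
Proof. by rewrite (le_trans (cmodD _ _))// cmodN. Qed.
Lemma cmodV z : cmod z^-1 = (cmod z)^-1.
Proof. exact: ComplexField.Normc.normcV. Qed.
Lemma cmod0 : cmod (0 : R[i]) = 0. Proof. exact: ComplexField.Normc.normc0. Qed.
Lemma cmod1 : cmod (1 : R[i]) = 1. Proof. exact: ComplexField.Normc.normc1. Qed.
Lemma cmod_real a : cmod (a%:C) = `|a|.
Proof. by rewrite cmodE /= expr0n /= addr0 sqrtr_sqr. Qed.
Lemma cmodX z n : cmod (z ^+ n) = cmod z ^+ n.
Proof. by elim: n => [|n IH]; rewrite ?expr0 ?cmod1// !exprS cmodM IH. Qed.
Lemma cmod_gt0 z : (0 < cmod z) = (z != 0).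
Proof.
rewrite lt_neqAle cmod_ge0 andbT eq_sym; apply/idP/idP; apply: contra.
  by move=> /eqP ->; rewrite cmod0.
by move=> /eqP /ComplexField.Normc.eq0_normc ->.
Qed.
Lemma normRe_le z : `|cRe z| <= cmod z.
Proof. by rewrite cmodE -sqrtr_sqr ler_wsqrtr// lerDl sqr_ge0. Qed.
Lemma normIm_le z : `|cIm z| <= cmod z.
Proof. by rewrite cmodE -sqrtr_sqr ler_wsqrtr// lerDr sqr_ge0. Qed.
Lemma cRe_le z : cRe z <= cmod z.
Proof. exact: le_trans (ler_norm _) (normRe_le z). Qed.
Lemma cmod_le z : cmod z <= `|cRe z| + `|cIm z|.
Proof.
rewrite -(@ler_pXn2r _ 2)// ?nnegrE ?cmod_ge0 ?addr_ge0// sqr_cmod sqrrD.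
by rewrite !real_normK ?num_real// -addrA [X in _ <= _ + X]addrC addrA lerDl mulrn_wge0// mulr_ge0.
Qed.
Lemma cmod_gt0_Re z : 0 < cRe z -> 0 < cmod z.
Proof. by move=> /lt_le_trans; apply; exact: cRe_le. Qed.
Lemma neq0_Re z : 0 < cRe z -> z != 0.
Proof. by move=> /cmod_gt0_Re; rewrite cmod_gt0. Qed.
Lemma cmod_distr z w : `|cmod z - cmod w| <= cmod (z - w).
Proof.
rewrite ler_norml; apply/andP; split.
  rewrite lerNl opprB lerBlDr -(cmodN (z - w)) opprB.
  by apply: le_trans (cmodD _ _); rewrite subrK.
by rewrite lerBlDr; apply: le_trans (cmodD _ _); rewrite subrK.
Qed.

Lemma cexp0 : cexp 0 = 1 :> R[i].
Proof. by rewrite /cexp /= expR0 cos0 sin0 mulr1 mulr0. Qed.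
Lemma cexpD z w : cexp (z + w) = cexp z * cexp w.
Proof.
by apply: complexP; rewrite !cE /= !cE expRD ?cosD ?sinD; ring.
Qed.
Lemma cmod_cexp z : cmod (cexp z) = expR (cRe z).
Proof.
rewrite cmodE /cexp /= !exprMn -mulrDr cos2Dsin2 mulr1 sqrtr_sqr.
by rewrite ger0_norm ?expR_ge0.
Qed.
Lemma cexp_real a : cexp a%:C = (expR a)%:C.
Proof. by rewrite /cexp /= cos0 sin0 mulr1 mulr0. Qed.
Lemma cexpN z : cexp (- z) = (cexp z)^-1.
Proof.
have n0 : cexp z != 0 by rewrite -cmod_gt0 cmod_cexp expR_gt0.
by apply: (mulfI n0); rewrite -cexpD subrr cexp0 divff.
Qed.

Lemma expR_bound1 a : `|expR a - 1| <= `|a| * expR `|a|.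
Proof.
have [a0|a0] := leP 0 a.
  have h := expR_ge1Dx (- a); rewrite expRN in h.
  have e1 : 1 <= expR a by rewrite -expR0 ler_expR.
  have e0 := expR_gt0 a.
  rewrite !ger0_norm ?subr_ge0//.
  move: h; rewrite -(ler_pM2r e0) mulVf ?gt_eqF//; lra.
have e1 : expR a < 1 by rewrite -expR0 ltr_expR.
rewrite !ltr0_norm ?subr_lt0//.
have h := expR_ge1Dx a.
have : 1 <= expR (- a) by rewrite -expR0 ler_expR; lra.
nra.
Qed.

Lemma expR_bound2 a : `|expR a - 1 - a| <= a ^+ 2 * expR `|a|.
Proof.
have h : 0 <= expR a - 1 - a by have := expR_ge1Dx a; lra.
rewrite ger0_norm//; have [a0|a0] := leP 0 a.
  have := expR_bound1 a; rewrite !ger0_norm//; last first.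
    by rewrite subr_ge0 -expR0 ler_expR.
  have : 1 <= expR a by rewrite -expR0 ler_expR.
  nra.
have h1 := expR_ge1Dx (- a); rewrite expRN in h1.
have e0 := expR_gt0 a.
move: h1; rewrite -(ler_pM2r e0) mulVf ?gt_eqF// => h1.
have : 1 <= expR `|a| by rewrite -expR0 ler_expR.
nra.
Qed.

Lemma sin_bound1 a : `|sin a| <= `|a|.
Proof.
wlog a0 : a / 0 <= a.
  move=> H; have [|/ltW a0] := leP 0 a; first exact: H.
  by have := H (- a); rewrite sinN !normrN oppr_ge0; apply.
have [|c _ E] := @MVT_segment R sin cos 0 a a0 (fun x _ => is_derive_sin x).
  by apply: continuous_subspaceT => x; exact: continuous_sin.
move: E; rewrite sin0 !subr0 => ->; rewrite normrM ler_piMl// ler_norml.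
by rewrite cos_geN1 cos_le1.
Qed.

Lemma cos_bound a : `|cos a - 1| <= a ^+ 2 / 2.
Proof.
have -> : cos a = 1 - sin (a / 2) ^+ 2 *+ 2.
  rewrite {1}(_ : a = (a / 2) *+ 2); last by rewrite -mulr_natr divfK.
  by rewrite cos_mulr2n cos2sin2; ring.
have := sin_bound1 (a / 2); rewrite -(@ler_pXn2r _ 2)// ?nnegrE//.
rewrite !real_normK ?num_real// => h.
have := sqr_ge0 (sin (a / 2)) => h0.
rewrite ler0_norm; lra.
Qed.

Lemma sin_bound2 a : `|sin a - a| <= a ^+ 2.
Proof.
wlog a0 : a / 0 <= a.
  move=> H; have [|/ltW a0] := leP 0 a; first exact: H.
  have := H (- a); rewrite sinN oppr_ge0 -opprD normrN sqrrN; exact.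
have D x : is_derive x (1 : R) (fun x => sin x - x) (cos x - 1).
  by apply: is_deriveB.
have [|c cI E] := @MVT_segment R (fun x => sin x - x) (fun x => cos x - 1) 0 a a0
  (fun x _ => D x).
  apply: continuous_subspaceT => x.
  by apply: cvgB; [exact: continuous_sin|exact: cvg_id].
move: E; rewrite sin0 !subr0 => ->; rewrite normrM (ger0_norm a0) expr2.
apply: ler_wpM2r => //.
have -> : cos c = 1 - sin (c / 2) ^+ 2 *+ 2.
  rewrite {1}(_ : c = (c / 2) *+ 2); last by rewrite -mulr_natr divfK.
  by rewrite cos_mulr2n cos2sin2; ring.
move: cI; rewrite in_itv /= => /andP[c0 ca].
have := sin_bound1 (c / 2); have := sin_max (c / 2).
rewrite (ger0_norm (_ : 0 <= c / 2)); last lra.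
move=> h1 h2; rewrite -(real_normK (num_real (sin (c / 2)))).
have := normr_ge0 (sin (c / 2)); set s := `|sin _| in h1 h2 * => h0.
rewrite ler0_norm; nra.
Qed.

(** Each of the four terms of the splitting below is at most [|u|^2 exp |u|],
    by the real bounds above. *)
Lemma cexp_bound2 u : cmod (cexp u - 1 - u) <= 5 * cmod u ^+ 2 * expR (cmod u).
Proof.
have -> : cexp u - 1 - u = (expR (cRe u) * (cos (cIm u) - 1))%:C
  + (0 +i* (expR (cRe u) * (sin (cIm u) - cIm u)))
  + (expR (cRe u) - 1 - cRe u)%:C + (0 +i* (cIm u * (expR (cRe u) - 1))).
  by case: u => a b; apply: complexP; rewrite !cE /cexp /=; ring.
set r := cmod u.
have aR : `|cRe u| <= r := normRe_le u.
have bR : `|cIm u| <= r := normIm_le u.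
have r0 : 0 <= r := cmod_ge0 u.
have ea : expR (cRe u) <= expR r by rewrite ler_expR (le_trans (ler_norm _)).
have ea' : expR `|cRe u| <= expR r by rewrite ler_expR.
have e0 := expR_gt0 r; have e0' := expR_gt0 (cRe u).
have e0'' := expR_gt0 `|cRe u|.
have b2 : cIm u ^+ 2 <= r ^+ 2.
  by rewrite -(real_normK (num_real (cIm u))) ler_pXn2r// nnegrE.
have a2 : cRe u ^+ 2 <= r ^+ 2.
  by rewrite -(real_normK (num_real (cRe u))) ler_pXn2r// nnegrE.
have im x : cmod (0 +i* x) = `|x| by rewrite cmodE /= expr0n add0r sqrtr_sqr.
apply: le_trans (cmodD _ _) _; rewrite im.
apply: le_trans (lerD (cmodD _ _) (lexx _)) _; rewrite cmod_real.
apply: le_trans (lerD (lerD (cmodD _ _) (lexx _)) (lexx _)) _.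
rewrite cmod_real im !normrM (gtr0_norm e0').
have h1 := cos_bound (cIm u); have h2 := sin_bound2 (cIm u).
have h3 := expR_bound2 (cRe u); have h4 := expR_bound1 (cRe u).
have r2 : 0 <= r ^+ 2 by rewrite exprn_ge0.
have k1 : expR (cRe u) * `|cos (cIm u) - 1| <= expR r * r ^+ 2.
  by apply: ler_pM => //; lra.
have k2 : expR (cRe u) * `|sin (cIm u) - cIm u| <= expR r * r ^+ 2.
  by apply: ler_pM => //; lra.
have k3 : `|expR (cRe u) - 1 - cRe u| <= expR r * r ^+ 2.
  by apply: le_trans h3 _; rewrite mulrC; apply: ler_pM => //; exact: sqr_ge0.
have k4 : `|cIm u| * `|expR (cRe u) - 1| <= expR r * r ^+ 2.
  apply: le_trans (ler_pM (normr_ge0 _) (normr_ge0 _) bR (lexx _)) _.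
  rewrite expr2 mulrCA; apply: ler_wpM2l => //.
  by apply: le_trans h4 _; rewrite mulrC ler_pM// ltW.
have : 0 <= expR r * r ^+ 2 by rewrite mulr_ge0// ltW.
lra.
Qed.

(** Complex differentiability with a quadratic remainder.  It composes well and
    spares all manipulations of limits of difference quotients. *)
Definition qdiff (f : R[i] -> R[i]) z l : Prop :=
  exists C, exists2 e : R, 0 < e &
    forall h, cmod h < e -> cmod (f (z + h) - f z - h * l) <= C * cmod h ^+ 2.

Lemma qdiff_pos f z l : qdiff f z l -> exists C, exists e : R,
  [/\ 0 <= C, 0 < e, e <= 1 &
    forall h, cmod h < e -> cmod (f (z + h) - f z - h * l) <= C * cmod h ^+ 2].
Proof.
move=> [C [e e0 H]]; exists `|C|, (Num.min e 1); split => //.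
- by rewrite lt_min e0 /=.
- by rewrite ge_min lexx orbT.
move=> h; rewrite lt_min => /andP[he _]; apply: le_trans (H h he) _.
by rewrite ler_wpM2r ?sqr_ge0 ?ler_norm.
Qed.

Lemma nbhs0_cmod (e : R) : 0 < e -> \forall h \near (0 : R[i]^o), cmod h < e.
Proof.
move=> e0; apply/nbhs_normP; exists e%:C; first by rewrite /= ltcR.
by move=> h /=; rewrite sub0r normrN normc_cmod ltcR.
Qed.

Lemma nbhs_cmodP z (P : R[i] -> Prop) :
  (\forall w \near (z : R[i]^o), P w) <->
  exists2 e : R, 0 < e & forall h, cmod h < e -> P (z + h).
Proof.
split=> [/nbhs_normP[e /= e0 H]|[e e0 H]].
  case: e e0 H => a b; rewrite ltcE /= => /andP[/eqP -> a0] H.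
  exists a => // h ha; apply: H => /=.
  by rewrite opprD addrA subrr add0r normrN normc_cmod ltcR.
apply/nbhs_normP; exists e%:C; first by rewrite /= ltcR.
move=> w /=; rewrite normc_cmod ltcR => zw.
by rewrite -(subrK z w) addrC; apply: H; rewrite -cmodN opprB.
Qed.

Lemma qdiff_is_derive f z l :
  qdiff f z l -> is_derive (z : R[i]^o) 1 (f : R[i]^o -> R[i]^o) l.
Proof.
move=> /qdiff_pos[C [e [C0 e0 e1 H]]].
have lim : (fun h : R[i]^o => h^-1 *: ((f (h *: 1 + z) - f z) : R[i]^o)) @ 0^'
    --> (l : R[i]^o).
  apply/cvgrPdist_lt => eps eps0.
  case: eps eps0 => a b; rewrite ltcE /= => /andP[/eqP -> a0].
  have d0 : 0 < Num.min e (a / (C + 1)) by rewrite lt_min e0 divr_gt0// ltr_wpDl.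
  have := nbhs0_cmod d0; rewrite /dnbhs /within /=.
  apply: filterS => h hd hn0.
  rewrite normc_cmod ltcR.
  move: hd; rewrite lt_min => /andP[he ha].
  have hp : 0 < cmod h by rewrite cmod_gt0; exact: hn0.
  have := H h he.
  have -> : l - h^-1 *: (f (h *: 1 + z) - f z)
     = - (h^-1 * (f (z + h) - f z - h * l)) :> R[i].
    rewrite mulrBr mulrA mulVf // mul1r opprB; congr (_ - _ * _).
    by congr (f _ - _); rewrite addrC; congr (_ + _); exact: mulr1.
  rewrite cmodN cmodM cmodV => K.
  rewrite mulrC ltr_pdivrMr//; apply: le_lt_trans K _.
  rewrite expr2 mulrA ltr_pM2r//.
  move: ha; rewrite ltr_pdivlMr ?ltr_wpDl//; nra.
by split; [apply/cvg_ex; exists l | exact: cvg_lim lim].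
Qed.

Lemma qdiff_comp f g z l m :
  qdiff f z l -> qdiff g (f z) m -> qdiff (g \o f) z (l * m).
Proof.
move=> /qdiff_pos[C [e [C0 e0 e1 H]]] /qdiff_pos[D [d [D0 d0 d1 K]]].
pose L := cmod l + C.
have L0 : 0 <= L by rewrite addr_ge0// cmod_ge0.
exists (D * L ^+ 2 + C * cmod m), (Num.min e (d / (L + 1))).
  by rewrite lt_min e0 divr_gt0// ltr_wpDl.
move=> h; rewrite lt_min => /andP[he hd] /=.
have h0 := cmod_ge0 h.
pose k := f (z + h) - f z.
have kE : f (z + h) = f z + k by rewrite /k; ring.
have Hh := H h he.
have kL : cmod k <= L * cmod h.
  rewrite /k -(subrK (h * l) (f (z + h) - f z)).
  apply: le_trans (cmodD _ _) _; rewrite cmodM /L mulrDl addrC.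
  apply: lerD; first by rewrite mulrC.
  apply: le_trans Hh _; rewrite expr2 ler_wpM2l// ler_piMl//; lra.
have kd : cmod k < d.
  apply: le_lt_trans kL _; move: hd; rewrite ltr_pdivlMr ?ltr_wpDl//; nra.
rewrite kE.
have -> : g (f z + k) - g (f z) - h * (l * m) =
  (g (f z + k) - g (f z) - k * m) + (k - h * l) * m by ring.
apply: le_trans (cmodD _ _) _; rewrite [leRHS]mulrDl (cmodM (k - _)); apply: lerD.
  apply: le_trans (K k kd) _; rewrite -mulrA ler_wpM2l// -exprMn.
  by rewrite ler_pXn2r// nnegrE ?cmod_ge0// mulr_ge0.
by rewrite mulrAC ler_wpM2r ?cmod_ge0.
Qed.

Lemma qdiffZ (c : R[i]) z : qdiff (fun w => c * w) z c.
Proof.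
exists 0, 1 => // h _; rewrite mul0r.
by rewrite (_ : _ - _ = 0) ?cmod0//; ring.
Qed.

Lemma qdiff_cexp z : qdiff (@cexp R) z (cexp z).
Proof.
exists (expR (cRe z) * (5 * expR 1)), 1 => // h h1.
have -> : cexp (z + h) - cexp z - h * cexp z = cexp z * (cexp h - 1 - h).
  by rewrite cexpD; ring.
rewrite cmodM cmod_cexp -mulrA ler_wpM2l ?expR_ge0//.
apply: le_trans (cexp_bound2 h) _; rewrite mulrAC ler_wpM2r ?sqr_ge0//.
by rewrite ler_wpM2l// ler_expR ltW.
Qed.

(** With [t = tan (arg z / 2)], the duplication formulas express [cos (arg z)]
    and [sin (arg z)] as rational functions of [t]. *)
Lemma clogK z : 0 < cRe z -> cexp (clog z) = z.
Proof.
move=> z0; have m0 := cmod_gt0_Re z0.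
have s0 : 0 < cmod z + cRe z by rewrite addr_gt0.
rewrite /clog /cexp /carg /=; set t := _ / _.
rewrite lnK ?posrE//.
have q0 : 0 < 1 + t ^+ 2 by rewrite ltr_pwDl// sqr_ge0.
have c2 : cos (atan t) ^+ 2 = (1 + t ^+ 2)^-1.
  by rewrite cos_atan exprVn sqr_sqrtr// ltW.
have cn0 : cos (atan t) != 0 by rewrite cos_atan invr_neq0// gt_eqF// sqrtr_gt0.
have st : sin (atan t) = t * cos (atan t).
  by have := atanK t; rewrite /tan => {2}<-; rewrite divfK.
rewrite -[2]/(1 + 1 : R) mulrDl mul1r.
rewrite cosD sinD st.
have cs : cos (atan t) * cos (atan t) = (1 + t ^+ 2)^-1 by rewrite -expr2 c2.
have qE : 1 + t ^+ 2 = 2 * cmod z / (cmod z + cRe z).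
  have E := sqr_cmod z; rewrite /t.
  rewrite exprMn exprVn.
  have -> : cIm z ^+ 2 = (cmod z - cRe z) * (cmod z + cRe z).
    by rewrite -subr_sqr E; ring.
  by field; rewrite gt_eqF.
apply: complexP => /=.
  have -> : cos (atan t) * cos (atan t) - t * cos (atan t) * (t * cos (atan t)) =
     (cos (atan t) * cos (atan t)) * (2 - (1 + t ^+ 2)) by ring.
  rewrite cs mulrBr mulVf ?gt_eqF// qE.
  by field; rewrite !gt_eqF.
have -> : t * cos (atan t) * cos (atan t) + cos (atan t) * (t * cos (atan t)) =
     (cos (atan t) * cos (atan t)) * (2 * t) by ring.
rewrite cs qE /t.
by field; rewrite !gt_eqF.
Qed.

Lemma cvg_cmod z (f : R[i] -> R) l : (forall e, 0 < e -> exists2 d : R, 0 < d &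
    forall h, cmod h < d -> `|l - f (z + h)| < e) ->
  f @ nbhs (z : R[i]^o) --> l.
Proof.
move=> H; apply/(@cvgrPdist_lt _ _ _ (nbhs (z : R[i]^o))) => e e0.
by apply/nbhs_cmodP; exact: H.
Qed.

Lemma cRe_cvg z : (@cRe R) @ nbhs (z : R[i]^o) --> cRe z.
Proof.
apply: cvg_cmod => e e0; exists e => // h he.
by rewrite cReD opprD addrA subrr sub0r normrN (le_lt_trans (normRe_le h)).
Qed.

Lemma cIm_cvg z : (@cIm R) @ nbhs (z : R[i]^o) --> cIm z.
Proof.
apply: cvg_cmod => e e0; exists e => // h he.
by rewrite cImD opprD addrA subrr sub0r normrN (le_lt_trans (normIm_le h)).
Qed.

Lemma cmod_cvg z : (@ComplexField.Normc.normc R) @ nbhs (z : R[i]^o) --> cmod z.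
Proof.
apply: cvg_cmod => e e0; exists e => // h he.
by rewrite (le_lt_trans (cmod_distr _ _))// opprD addrA subrr sub0r cmodN.
Qed.

Lemma clog_continuous z (eta : R) : 0 < cRe z -> 0 < eta ->
  exists2 e : R, 0 < e & forall h, cmod h < e -> cmod (clog (z + h) - clog z) < eta.
Proof.
move=> z0 eta0; have m0 := cmod_gt0_Re z0.
have e20 : 0 < eta / 2 by rewrite divr_gt0.
have cre : (fun w => cRe (clog w)) @ nbhs (z : R[i]^o) --> cRe (clog z).
  rewrite /clog /=; apply: (@cvg_comp _ _ _ _ (@ln R) _ (nbhs (cmod z))).
    exact: cmod_cvg.
  exact: continuous_ln.
have cim : (fun w => cIm (clog w)) @ nbhs (z : R[i]^o) --> cIm (clog z).
  rewrite /clog /carg /=; apply: cvgM; first exact: cvg_cst.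
  apply: (@cvg_comp _ _ _ (fun w => cIm w / (cmod w + cRe w)) (@atan R) _
    (nbhs (cIm z / (cmod z + cRe z)))); last exact: continuous_atan.
  apply: cvgM; first exact: cIm_cvg.
  apply: cvgV; first by rewrite gt_eqF// addr_gt0.
  by apply: cvgD; [exact: cmod_cvg|exact: cRe_cvg].
have /(@nbhs_cmodP z)[d1 d10 H1] :
    \forall w \near nbhs (z : R[i]^o), `|cRe (clog z) - cRe (clog w)| < eta / 2.
  exact: (@cvgr_dist_lt _ _ _ _ _ _ _ cre _ e20).
have /(@nbhs_cmodP z)[d2 d20 H2] :
    \forall w \near nbhs (z : R[i]^o), `|cIm (clog z) - cIm (clog w)| < eta / 2.
  exact: (@cvgr_dist_lt _ _ _ _ _ _ _ cim _ e20).
exists (Num.min d1 d2); first by rewrite lt_min d10.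
move=> h; rewrite lt_min => /andP[h1 h2].
rewrite -cmodN; apply: le_lt_trans (cmod_le _) _.
rewrite opprB !(cReD, cImD, cReN, cImN).
by rewrite (splitr eta) ltrD// ?H1 ?H2.
Qed.

(** The logarithm is a continuous right inverse of [cexp], so that the
    quadratic remainder of [cexp] at [clog z] can be inverted. *)
Lemma qdiff_clog z : 0 < cRe z -> qdiff (@clog R) z z^-1.
Proof.
move=> z0; have m0 := cmod_gt0_Re z0; have zn0 := neq0_Re z0.
have [C [d [C0 d0 d1 H]]] := qdiff_pos (qdiff_cexp (clog z)).
pose eta := Num.min d (cmod z / (2 * (C + 1))).
have eta0 : 0 < eta by rewrite lt_min d0 divr_gt0// mulr_gt0// ltr_wpDl.
have [e e0 K] := clog_continuous z0 eta0.
exists (C * (2 / cmod z) ^+ 2 / cmod z), (Num.min e (cRe z)).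
  by rewrite lt_min e0.
move=> h; rewrite lt_min => /andP[he hz].
pose k := clog (z + h) - clog z.
have := K h he; rewrite -/k lt_min => /andP[kd kz].
have zh0 : 0 < cRe (z + h).
  by rewrite cReD; have := normRe_le h; rewrite ler_norml => /andP[]; lra.
have := H k kd; rewrite (_ : clog z + k = clog (z + h)); last by rewrite /k; ring.
rewrite !clogK// (_ : z + h - z = h); last by ring.
move=> Hk.
have k0 := cmod_ge0 k.
(* the remainder is at most half of |k| |z|, hence |k| <= 2 |h| / |z| *)
have hk : cmod k <= 2 / cmod z * cmod h.
  have : cmod (k * z) <= cmod h + C * cmod k ^+ 2.
    rewrite (_ : k * z = h - (h - k * z)); last by ring.
    by apply: le_trans (cmodB _ _) _; rewrite lerD2l.
  rewrite cmodM mulrAC ler_pdivlMr//.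
  move: kz; rewrite ltr_pdivlMr ?mulr_gt0 ?ltr_wpDl//; nra.
rewrite (_ : clog (z + h) - clog z - h * z^-1 = - ((h - k * z) / z)); last first.
  by rewrite mulrBl mulfK// opprB.
rewrite cmodN cmodM cmodV mulrAC ler_wpM2r ?invr_ge0 ?cmod_ge0//.
apply: le_trans Hk _; rewrite -mulrA ler_wpM2l// -exprMn ler_pXn2r// nnegrE//.
by rewrite mulr_ge0 ?cmod_ge0// divr_ge0// cmod_ge0.
Qed.

Lemma cpowD z a b : cpow z (a + b)%:C = cpow z a%:C * cpow z b%:C.
Proof. by rewrite /cpow -cexpD -mulrDl real_complexD. Qed.

Lemma cpow1 z : 0 < cRe z -> cpow z 1%:C = z.
Proof. by move=> z0; rewrite /cpow (_ : 1%:C = 1 :> R[i])// mul1r clogK. Qed.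

Lemma cpowN z a : cpow z (- a)%:C = (cpow z a%:C)^-1.
Proof. by rewrite /cpow -cexpN real_complexN mulNr. Qed.

Lemma cmod_cpow z a : 0 < cRe z -> cmod (cpow z a%:C) = cmod z `^ a.
Proof.
move=> z0; rewrite /cpow cmod_cexp cReZ /clog /= /powR gt_eqF//.
exact: cmod_gt0_Re.
Qed.

Lemma cpow_neq0 z a : cpow z a%:C != 0.
Proof. by rewrite -cmod_gt0 cmod_cexp expR_gt0. Qed.

Lemma cpow_real x a : 0 < x -> cpow x%:C a%:C = (x `^ a)%:C.
Proof.
move=> x0; rewrite /cpow /clog /carg /= mul0r atan0 mulr0.
rewrite expr0n /= addr0 sqrtr_sqr gtr0_norm// -[ln x +i* 0]/((ln x)%:C) -real_complexM cexp_real.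
by rewrite /powR gt_eqF.
Qed.

Lemma qdiff_cpow z a : 0 < cRe z ->
  qdiff (fun w => cpow w a%:C) z (a%:C * cpow z (a - 1)%:C).
Proof.
move=> z0; have := qdiff_comp (qdiff_comp (qdiff_clog z0) (qdiffZ a%:C _))
  (qdiff_cexp _).
rewrite /comp /= -/(cpow z a%:C) cpowD cpowN cpow1//.
by rewrite (_ : _ * _ * _ = a%:C * (cpow z a%:C / z))//; ring.
Qed.

Lemma near_Re_gt0 z : 0 < cRe z -> \forall w \near (z : R[i]^o), 0 < cRe w.
Proof.
move=> z0; apply/nbhs_cmodP; exists (cRe z) => // h hz.
by rewrite cReD; have := normRe_le h; rewrite ler_norml => /andP[]; lra.
Qed.

(** A complex derivative may be computed from formulas valid on the half-plane
    [Re z > 0] only, because this half-plane is open. *)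
Lemma cderiveE (f : R[i] -> R[i]) (g : nat -> R[i] -> R[i]) :
  (forall z, 0 < cRe z -> f z = g 0%N z) ->
  (forall k z, 0 < cRe z ->
    is_derive (z : R[i]^o) 1 (g k : R[i]^o -> R[i]^o) (g k.+1 z)) ->
  forall N z, 0 < cRe z -> cderive N f z = g N z.
Proof.
move=> fg dg; elim=> [|N IH] z z0; first exact: fg.
rewrite /cderive derive1nS derive1E.
rewrite (@near_eq_derive _ _ _ _ (g N : R[i]^o -> R[i]^o)).
  by have := dg N z z0 => /@derive_val.
by apply: filterS (near_Re_gt0 z0) => w w0; exact: IH.
Qed.

End ComplexCalculus.

(** * Measures and integrals on the line *)

Section RealIntegrals.
Context {R : realType}.
Notation mu := (@lebesgue_measure R).
Local Open Scope ereal_scope.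

Lemma integrable_bound d (T : measurableType d) (m : {measure set T -> \bar R})
    (D : set T) (f g : T -> R) : measurable D -> measurable_fun D f ->
  (forall x, D x -> `|f x| <= g x)%R -> m.-integrable D (EFin \o g) ->
  m.-integrable D (EFin \o f).
Proof.
move=> mD mf fg; apply: le_integrable => //; first exact/measurable_EFinP.
move=> x Dx /=; rewrite lee_fin; apply: le_trans (fg x Dx) _; exact: ler_norm.
Qed.

Lemma Rdominated_cvg d (T : measurableType d) (m : {measure set T -> \bar R})
    (D : set T) (f_ : (T -> R)^nat) (f g : T -> R) : measurable D ->
  (forall n, measurable_fun D (f_ n)) -> measurable_fun D f ->
  (forall x, D x -> f_ ^~ x @ \oo --> f x) ->
  m.-integrable D (EFin \o g) ->
  (forall n x, D x -> `|f_ n x| <= g x)%R ->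
  (fun n => \int[m]_(x in D) f_ n x)%R @ \oo --> (\int[m]_(x in D) f x)%R.
Proof.
move=> mD mf_ mf ff ig fg.
have h : \int[m]_(x in D) (f_ n x)%:E @[n --> \oo] --> \int[m]_(x in D) (f x)%:E.
  apply: (@dominated_cvg _ _ _ m D mD (fun n x => (f_ n x)%:E) (EFin \o f)
    (EFin \o g)) => //.
  - by move=> n; exact/measurable_EFinP.
  - by move=> x Dx; apply: cvg_EFin; [exact: nearW|exact: ff].
have ifn : m.-integrable D (EFin \o f).
  apply: (integrable_bound mD mf _ ig) => x Dx.
  have fx : (`|f_ n x|%R @[n --> \oo] --> `|f x|%R) by apply: cvg_norm; exact: ff.
  rewrite -(cvg_lim _ fx)//; apply: limr_le; first by apply/cvg_ex; eexists; exact: fx.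
  by apply: nearW => n; exact: fg.
have : fine \o (fun n => \int[m]_(x in D) (f_ n x)%:E) @ \oo -->
    fine (\int[m]_(x in D) (f x)%:E).
  by apply: fine_cvg; rewrite fineK; [exact: h|exact: integrable_fin_num].
exact.
Qed.

(** The product bound makes the function, extended by zero outside [D1 * D2],
    integrable for the product measure. *)
Lemma Rfubini d1 d2 (T1 : measurableType d1) (T2 : measurableType d2)
    (m1 : {sigma_finite_measure set T1 -> \bar R})
    (m2 : {sigma_finite_measure set T2 -> \bar R})
    (D1 : set T1) (D2 : set T2) (f : T1 * T2 -> R) (g : T1 -> R) (h : T2 -> R) :
  measurable D1 -> measurable D2 -> measurable_fun setT f ->
  (forall x y, D1 x -> D2 y -> `|f (x, y)| <= g x * h y)%R ->
  m1.-integrable D1 (EFin \o g) -> m2.-integrable D2 (EFin \o h) ->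
  (\int[m1]_(x in D1) \int[m2]_(y in D2) f (x, y) =
   \int[m2]_(y in D2) \int[m1]_(x in D1) f (x, y))%R.
Proof.
move=> mD1 mD2 mf fgh ig ih.
pose F (z : T1 * T2) := (f z * \1_(D1 `*` D2) z)%R.
have FE x y : F (x, y) = (f (x, y) * \1_D1 x * \1_D2 y)%R.
  by rewrite /F -mulrA; congr *%R; rewrite !indicE -natrM mulnb in_setX.
have mF : measurable_fun setT F.
  by apply: measurable_funM => //; apply: measurable_indic; exact: measurableX.
pose G x := (`|g x| * \1_D1 x)%R; pose H y := (`|h y| * \1_D2 y)%R.
have iG : m1.-integrable setT (EFin \o G).
  have := integrable_abse ig; rewrite integrable_mkcond//; apply: eq_integrable => //.
  by move=> x _; rewrite /G /= patchE indicE; case: ifP; rewrite ?mulr1 ?mulr0.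
have iH : m2.-integrable setT (EFin \o H).
  have := integrable_abse ih; rewrite integrable_mkcond//; apply: eq_integrable => //.
  by move=> x _; rewrite /H /= patchE indicE; case: ifP; rewrite ?mulr1 ?mulr0.
have G0 x : (0 <= G x)%R by rewrite /G mulr_ge0// indicE.
have H0 x : (0 <= H x)%R by rewrite /H mulr_ge0// indicE.
have FGH x y : (`|F (x, y)| <= G x * H y)%R.
  rewrite FE /G /H !indicE.
  case: (boolP (x \in D1)) => [|_]; last by rewrite !(mulr0, mul0r) normr0.
  case: (boolP (y \in D2)) => [|_]; last by rewrite !(mulr0, mul0r) normr0.
  rewrite !inE !mulr1 => yD xD.
  by apply: le_trans (fgh _ _ xD yD) _; rewrite -normrM ler_norm.
have iF : (m1 \x m2).-integrable setT (EFin \o F).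
  apply/integrable12ltyP; first exact/measurable_EFinP.
  apply: (@le_lt_trans _ _ (\int[m1]_x \int[m2]_y ((G x)%:E * (H y)%:E))).
    apply: ge0_le_integral => //.
    - by move=> x _; apply: integral_ge0.
    - apply: (@measurable_fun_fubini_tonelli_F _ _ _ _ _ m2
        (fun z => `|(F z)%:E|)) => //.
      by do 2 apply: measurableT_comp => //.
    - apply: (@measurable_fun_fubini_tonelli_F _ _ _ _ _ m2
        (fun z => (G z.1)%:E * (H z.2)%:E)) => //.
      + apply: emeasurable_funM.
          by apply: (measurableT_comp (measurable_int m1 iG)).
        by apply: (measurableT_comp (measurable_int m2 iH)).
      + by move=> z; rewrite mule_ge0// lee_fin.
    - move=> x _; apply: ge0_le_integral => //.
      + apply: measurableT_comp => //; apply/measurable_EFinP.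
        exact: measurableT_comp mF _.
      + by apply: measurable_funeM; exact: (measurable_int m2 iH).
      + by move=> y _; rewrite /= lee_fin.
  have iHf : \int[m2]_y (H y)%:E \is a fin_num by exact: integrable_fin_num.
  rewrite (eq_integral (fun x => (G x)%:E * \int[m2]_y (H y)%:E)); last first.
    move=> x _; rewrite ge0_integralZl//.
    - exact: (measurable_int m2 iH).
    - by move=> y _; rewrite lee_fin.
    - by rewrite lee_fin.
  rewrite -(fineK iHf) ge0_integralZr//; last 3 first.
  - exact: (measurable_int m1 iG).
  - by move=> x _; rewrite lee_fin.
  - by rewrite lee_fin fine_ge0// integral_ge0// => y _; rewrite lee_fin.
  by rewrite fineK// ltey_eq fin_numM//; exact: integrable_fin_num iG.
have iFx x : m2.-integrable setT (fun y => (F (x, y))%:E).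
  apply: (@integrable_bound _ _ m2 setT _ (fun y => G x * H y)%R) => //.
    exact: measurableT_comp mF _.
  exact: (integrableZl measurableT (G x) iH).
have iFy y : m1.-integrable setT (fun x => (F (x, y))%:E).
  apply: (@integrable_bound _ _ m1 setT _ (fun x => H y * G x)%R) => //.
  - exact: measurableT_comp mF _.
  - by move=> x _; rewrite mulrC.
  - exact: (integrableZl measurableT (H y) iG).
rewrite /Rintegral; congr fine.
transitivity (\int[m1]_x \int[m2]_y (F (x, y))%:E).
  rewrite integral_mkcond; apply: eq_integral => x _.
  rewrite patchE; case: ifPn => xD.
    rewrite fineK.
      rewrite integral_mkcond; apply: eq_integral => y _.
      rewrite patchE FE !indicE xD mulr1; case: ifPn => _; by rewrite ?mulr1 ?mulr0.
    have /integrable_fin_num := iFx x => /(_ measurableT).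
    congr (_ \is a fin_num).
    rewrite [RHS]integral_mkcond; apply: eq_integral => y _.
    rewrite patchE FE !indicE xD mulr1; case: ifPn => _; by rewrite ?mulr1 ?mulr0.
  apply/esym; apply: integral0_eq => y _.
  by rewrite FE !indicE (negbTE xD) mulr0 mul0r.
rewrite (Fubini iF) [RHS]integral_mkcond; apply: eq_integral => y _.
rewrite patchE; case: ifPn => yD.
  rewrite fineK.
    rewrite [RHS]integral_mkcond; apply: eq_integral => x _.
    by rewrite patchE /= FE !indicE yD mulr1; case: ifPn => _; rewrite ?mulr1 ?mulr0.
  have := integrable_fin_num measurableT (iFy y).
  congr (_ \is a fin_num).
  rewrite [RHS]integral_mkcond; apply: eq_integral => x _.
  by rewrite patchE FE !indicE yD mulr1; case: ifPn => _; rewrite ?mulr1 ?mulr0.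
by apply: integral0_eq => x _; rewrite /= FE !indicE (negbTE yD) mulr0.
Qed.

(** Half-open intervals generate the Borel sets and are stable by intersection.
    The measures are compared after restriction to each [ ]a n, b n] ], where
    they are finite: they may be infinite near the boundary of the union. *)
Lemma measure_eq_itvoc (m1 m2 : {measure set R -> \bar R}) (a b : nat -> R) :
  (forall n p q, a n <= p -> p <= q -> q <= b n ->
    m1 `]p, q]%classic = m2 `]p, q]%classic)%R ->
  (forall n, m1 `]a n, b n]%classic < +oo) ->
  (forall n k, (n <= k)%N -> (a k <= a n)%R) ->
  (forall n k, (n <= k)%N -> (b n <= b k)%R) ->
  forall A, measurable A -> A `<=` \bigcup_n `]a n, b n]%classic -> m1 A = m2 A.
Proof.
move=> E fin na nb A mA AD.
pose D n := `]a n, b n]%classic : set R.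
have mD n : measurable (D n) by exact: measurable_itv.
have itvI p q n : `]p, q]%classic `&` D n = `]Num.max p (a n), Num.min q (b n)]%classic.
  rewrite /D; apply/seteqP; split=> x /=; rewrite !in_itv /= gt_max le_min.
    by move=> [/andP[-> ->] /andP[-> ->]].
  by move=> /andP[/andP[-> ->] /andP[-> ->]].
have key n B : measurable B -> m1 (B `&` D n) = m2 (B `&` D n).
  move=> mB.
  have := @measure_unique _ R R (@ocitv R)
    (fun k => `](- k%:R)%R, k%:R]%classic) _ (@ocitvI R) _ _
    (mrestr m1 (mD n)) (mrestr m2 (mD n)).
  apply => //.
  - by move=> i; exact: is_ocitv.
  - rewrite -subTset => x _ /=.
    exists (Num.bound `|x|%R) => //=; rewrite in_itv /=.
    have : (`|x| < (Num.bound `|x|)%:R)%R by rewrite archi_boundP.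
    by rewrite ltr_norml => /andP[-> /ltW ->].
  - move=> _ [[p q] _ <-] /=; rewrite /mrestr itvI.
    have [pq|pq] := leP (Num.max p (a n)) (Num.min q (b n)); last first.
      by rewrite set_itv_ge ?measure0// bnd_simp -leNgt ltW.
    by apply: (E n) => //; rewrite ?le_max ?lexx ?orbT// ge_min lexx orbT.
  - move=> k; rewrite /= /mrestr; apply: le_lt_trans (fin n).
    apply: le_measure; last exact: subIsetr.
      by rewrite inE; apply: measurableI; exact: measurable_itv.
    by rewrite inE; exact: measurable_itv.
have AE : A = \bigcup_n (A `&` D n).
  by rewrite -setI_bigcupr; apply/esym/setIidPl.
have nd : nondecreasing_seq (fun n => A `&` D n).
  move=> n k nk; apply/subsetPset => x [Ax]; rewrite /D /= !in_itv /= => /andP[x1 x2].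
  by split => //; rewrite (le_lt_trans (na _ _ nk) x1) (le_trans x2 (nb _ _ nk)).
have c (m : {measure set R -> \bar R}) : (fun n => m (A `&` D n)) @ \oo --> m A.
  rewrite {2}AE; apply: nondecreasing_cvg_mu => //.
    by move=> i; exact: measurableI.
  by rewrite -AE.
have c1 := c m1; have c2 := c m2.
have e : (fun n => m1 (A `&` D n)) = (fun n => m2 (A `&` D n)).
  by apply/funext => n; exact: key.
by rewrite -(cvg_lim _ c1)// -(cvg_lim _ c2)// e.
Qed.

(** Cutting an interval in two equal parts halves the bound on the increment of
    [D] over it, since the increments of [H] add up while the lengths are
    halved. Iterated bisection brings the bound to 0. *)
Lemma small_increments_cst (D H : R -> R) (a b : R) : (a <= b)%R ->
  (forall x y, a <= x -> x <= y -> y <= b ->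
     `|D y - D x| <= (y - x) * (H y - H x))%R ->
  D b = D a.
Proof.
move=> ab DH.
have halve k x y : (a <= x -> x <= y -> y <= b ->
    `|D y - D x| <= 2^-1 ^+ k * ((y - x) * (H y - H x)))%R.
  elim: k x y => [|k IH] x y ax xy yb; first by rewrite expr0 mul1r; exact: DH.
  set m := ((x + y) / 2)%R.
  have [xm my] : (x <= m)%R /\ (m <= y)%R by rewrite /m; split; lra.
  have h1 := IH x m ax xm (le_trans my yb).
  have h2 := IH m y (le_trans ax xm) my yb.
  rewrite (_ : D y - D x = (D m - D x) + (D y - D m))%R; last ring.
  apply: le_trans (ler_normD _ _) _; apply: le_trans (lerD h1 h2) _.
  rewrite exprS /m; set e := (_ ^+ k)%R.
  by rewrite le_eqVlt; apply/orP; left; apply/eqP; field.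
apply/eqP; rewrite -subr_eq0 -normr_le0; apply/ler_addgt0Pr => e e0; rewrite add0r.
set K := ((b - a) * (H b - H a))%R.
have K0 : (0 <= K)%R by apply: le_trans (DH a b _ _ _).
have [k Hk] : exists k, (K / e < k%:R)%R.
  by exists (Num.bound (K / e)%R); rewrite archi_boundP// divr_ge0// ltW.
apply: le_trans (halve k a b _ _ _) _ => //; rewrite -/K.
have k2 : (k%:R <= 2 ^+ k :> R)%R.
  by rewrite -natrX ler_nat; exact/ltnW/ltn_expl.
rewrite exprVn mulrC ler_pdivrMr ?exprn_gt0//.
move: Hk; rewrite ltr_pdivrMr// => Hk; apply: le_trans (ltW Hk) _.
by rewrite mulrC ler_wpM2l// ltW.
Qed.

End RealIntegrals.

Section RealDerivatives.
Context {R : realType}.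
Implicit Types (f g : R -> R) (x a b c : R).

Lemma dderive_cst c x : is_derive x (1 : R) (fun=> c) 0.
Proof. exact: is_derive_cst. Qed.
Lemma dderive_id x : is_derive x (1 : R) (fun x => x) 1.
Proof. exact: is_derive_id. Qed.
Lemma dderiveD f g x a b : is_derive x 1 f a -> is_derive x 1 g b ->
  is_derive x 1 (fun x => f x + g x) (a + b).
Proof. by move=> fa gb; exact: is_deriveD. Qed.
Lemma dderiveN f x a : is_derive x 1 f a -> is_derive x 1 (fun x => - f x) (- a).
Proof. by move=> fa; exact: is_deriveN. Qed.
Lemma dderiveB f g x a b : is_derive x 1 f a -> is_derive x 1 g b ->
  is_derive x 1 (fun x => f x - g x) (a - b).
Proof. by move=> fa gb; exact: is_deriveB. Qed.
Lemma dderiveM f g x a b : is_derive x 1 f a -> is_derive x 1 g b ->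
  is_derive x 1 (fun x => f x * g x) (a * g x + f x * b).
Proof.
by move=> fa gb; apply: (is_derive_eq (is_deriveM fa gb)); rewrite addrC [g x *: a]mulrC.
Qed.
Lemma dderiveZ f x a c : is_derive x 1 f a -> is_derive x 1 (fun x => c * f x) (c * a).
Proof. by move=> fa; exact: is_deriveZ. Qed.
Lemma dderive_comp f g x a b : is_derive (g x) 1 f a -> is_derive x 1 g b ->
  is_derive x 1 (fun x => f (g x)) (a * b).
Proof.
by move=> fa gb; apply: (is_derive_eq (is_derive1_comp fa gb)); rewrite mulrC.
Qed.
Lemma dderive_expR f x a : is_derive x 1 f a ->
  is_derive x 1 (fun x => expR (f x)) (expR (f x) * a).
Proof. by move=> fa; apply: dderive_comp fa; exact: is_derive_expR. Qed.
Lemma dderive_sin f x a : is_derive x 1 f a ->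
  is_derive x 1 (fun x => sin (f x)) (cos (f x) * a).
Proof. by move=> fa; apply: dderive_comp fa; exact: is_derive_sin. Qed.
Lemma dderive_cos f x a : is_derive x 1 f a ->
  is_derive x 1 (fun x => cos (f x)) (- sin (f x) * a).
Proof. by move=> fa; apply: dderive_comp fa; exact: is_derive_cos. Qed.
Lemma dderive_atan f x a : is_derive x 1 f a ->
  is_derive x 1 (fun x => atan (f x)) ((1 + f x ^+ 2)^-1 * a).
Proof. by move=> fa; apply: dderive_comp fa; exact: is_derive1_atan. Qed.
Lemma dderive_eq f g x a b : is_derive x 1 f a -> f =1 g -> a = b -> is_derive x 1 g b.
Proof. by move=> fa /funext <- <-. Qed.
Lemma dderive_continuous f df : (forall x, is_derive x 1 f (df x)) -> continuous f.
Proof.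
move=> H x; apply: differentiable_continuous.
by apply/derivable1_diffP; case: (H x).
Qed.

End RealDerivatives.

Section ExponentialIntegrals.
Context {R : realType}.
Notation mu := (@lebesgue_measure R).
Implicit Types u v x : R.

Lemma cvg_expRN_pinfty (u : R) : 0 < u -> expR (- (u * x)) @[x --> +oo] --> 0.
Proof.
move=> u0; apply: (@cvg_comp _ _ _ (fun x => u * x)%R (fun x => expR (- x)) _ +oo%R).
  apply/cvgryPge => A; apply: filterS (nbhs_pinfty_ge (num_real (A / u))) => x.
  by rewrite ler_pdivrMr// mulrC.
exact: cvgr_expR.
Qed.

Local Open Scope ereal_scope.

Let int_exp_aux (u : R) (f F : R -> R) (C : R) : (0 < u)%R ->
  (forall x, 0 <= x -> 0 <= f x)%R -> continuous f ->
  (forall x, is_derive x (1 : R)%R F (f x)) ->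
  (forall x, `|F x| <= C * expR (- (u * x)))%R ->
  \int[mu]_(x in `[0%R, +oo[) (f x)%:E = (- F 0%R)%:E.
Proof.
move=> u0 f0 cf dF FC.
rewrite (@ge0_continuous_FTC2y _ f F 0 0)//.
- by rewrite -EFinB sub0r.
- exact: continuous_subspaceT.
- apply/cvgr0Pnorm_le => e e0.
  have := cvg_expRN_pinfty u0 => /cvgr0Pnorm_le H.
  have C0 : (0 <= C)%R.
    by have := FC 0%R; rewrite mulr0 oppr0 expR0 mulr1; exact: le_trans.
  have e1 : (0 < e / (C + 1))%R by rewrite divr_gt0// ltr_wpDl.
  near=> x; apply: le_trans (FC x) _.
  have : (`|expR (- (u * x))| <= e / (C + 1))%R by near: x; exact: H.
  rewrite (ger0_norm (expR_ge0 _)) ler_pdivlMr ?ltr_wpDl//.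
  have := expR_ge0 (- (u * x)); nra.
- apply: cvg_at_right_filter; apply: differentiable_continuous.
  by apply/derivable1_diffP; case: (dF 0%R).
- by move=> x _; rewrite derive1E; case: (dF x).
Unshelve. all: by end_near. Qed.

Lemma dderive_expnux u x :
  is_derive x 1%R (fun x => expR (- (u * x))) (- u * expR (- (u * x)))%R.
Proof.
apply: (dderive_eq (dderive_expR (dderiveN (dderiveZ u (dderive_id x))))) => //.
by ring.
Qed.

Lemma integral_expRN (u : R) : (0 < u)%R ->
  \int[mu]_(x in `[0%R, +oo[) (expR (- (u * x)))%:E = (u^-1)%:E.
Proof.
move=> u0.
have d x : is_derive x 1%R (fun x => - u^-1 * expR (- (u * x)))%R (expR (- (u * x))).
  apply: (dderive_eq (dderiveZ (- u^-1)%R (@dderive_expnux u x))) => //.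
  by field; rewrite gt_eqF.
rewrite (@int_exp_aux u _ (fun x => - u^-1 * expR (- (u * x)))%R u^-1)//.
- by rewrite mulr0 oppr0 expR0 mulr1 opprK.
- exact: (dderive_continuous (@dderive_expnux u)).
- move=> x; rewrite normrM normrN (ger0_norm (expR_ge0 _)).
  by rewrite ger0_norm// invr_ge0 ltW.
Qed.

Lemma integrable_expRN (u : R) : (0 < u)%R ->
  mu.-integrable `[0%R, +oo[ (EFin \o (fun x => expR (- (u * x)))).
Proof.
move=> u0; apply/integrableP; split.
  apply/measurable_EFinP; apply: measurable_funTS.
  exact: continuous_measurable_fun (dderive_continuous (@dderive_expnux u)).
under eq_integral do rewrite /= (ger0_norm (expR_ge0 _)).
by rewrite integral_expRN// ltry.
Qed.

Local Close Scope ereal_scope.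

Lemma Rintegral_expRN u : 0 < u ->
  \int[mu]_(x in `[0, +oo[) expR (- (u * x)) = u^-1.
Proof. by move=> u0; rewrite /Rintegral integral_expRN. Qed.

(** The oscillating integrals are reduced to nonnegative integrands by adding
    the integral of [exp (- u x)] itself. *)
Lemma Rintegral_exp_cos_sin u v : 0 < u ->
  \int[mu]_(x in `[0, +oo[) (expR (- (u * x)) * cos (v * x)) = u / (u ^+ 2 + v ^+ 2)
  /\ \int[mu]_(x in `[0, +oo[) (expR (- (u * x)) * sin (v * x)) = v / (u ^+ 2 + v ^+ 2).
Proof.
move=> u0; have q0 : 0 < u ^+ 2 + v ^+ 2 by rewrite ltr_pwDl ?sqr_ge0// exprn_gt0.
have qn0 : u ^+ 2 + v ^+ 2 != 0 by rewrite gt_eqF.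
pose E x := expR (- (u * x)).
have dE x : is_derive x 1 E (- u * E x) := dderive_expnux u x.
have dvx x : is_derive x 1 (fun x => v * x) (v * 1) := dderiveZ v (dderive_id x).
have dc x := dderive_cos (dvx x); have ds x := dderive_sin (dvx x).
have cE : continuous E := dderive_continuous dE.
have cc : continuous (fun x => cos (v * x)) := dderive_continuous dc.
have cs : continuous (fun x => sin (v * x)) := dderive_continuous ds.
have E0 x : 0 <= E x := expR_ge0 _.
have step (g h : R -> R) (l : R) : continuous g -> (forall x, `|g x| <= 1) ->
    (forall x, is_derive x 1 (fun x => E x * h x) (E x * g x)) ->
    (forall x, `|h x| <= l) ->
    \int[mu]_(x in `[0, +oo[) (E x * g x) = - h 0.
  move=> cg g1 dh hl.
  have mg : measurable_fun setT g by exact: continuous_measurable_fun.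
  have mE : measurable_fun setT E by exact: continuous_measurable_fun.
  have iE := integrable_expRN u0.
  have iEg : mu.-integrable `[0, +oo[ (EFin \o (fun x => E x * g x)).
    apply: (integrable_bound _ _ _ iE) => //.
      by apply: measurable_funTS; exact: measurable_funM.
    by move=> x _; rewrite normrM (ger0_norm (E0 x)) ler_piMr.
  have A1 x : 0 <= x -> 0 <= E x * (1 + g x).
    by move=> _; rewrite mulr_ge0//; have := g1 x; rewrite ler_norml => /andP[]; lra.
  have A2 : continuous (fun x => E x * (1 + g x)).
    move=> x; apply: cvgM; first exact: cE.
    by apply: cvgD; [exact: cvg_cst|exact: cg].
  have A3 x : is_derive x 1 (fun x => - u^-1 * E x + E x * h x) (E x * (1 + g x)).
    apply: (dderive_eq (dderiveD (dderiveZ (- u^-1) (dE x)) (dh x))) => //.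
    by field; rewrite gt_eqF.
  have A4 x : `|- u^-1 * E x + E x * h x| <= (u^-1 + l) * E x.
    apply: le_trans (ler_normD _ _) _; rewrite mulrDl.
    rewrite !normrM normrN (ger0_norm (E0 x)) (@ger0_norm _ u^-1) ?invr_ge0 ?(ltW u0)//.
    by rewrite lerD2l mulrC ler_wpM2r.
  have := congr1 fine (int_exp_aux u0 A1 A2 A3 A4).
  rewrite -[fine (integral _ _ _)]/(\int[mu]_(x in `[0, +oo[) (E x * (1 + g x))) /=.
  have -> : E 0 = 1 by rewrite /E mulr0 oppr0 expR0.
  rewrite mul1r mulr1 => K.
  have <- : \int[mu]_(x in `[0, +oo[) (E x * (1 + g x)) - u^-1 =
     \int[mu]_(x in `[0, +oo[) (E x * g x).
    under eq_Rintegral do rewrite mulrDr mulr1.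
    by rewrite RintegralD// Rintegral_expRN//; ring.
  by rewrite K; ring.
split.
- pose h x := (v * sin (v * x) - u * cos (v * x)) / (u ^+ 2 + v ^+ 2).
  transitivity (- h 0); last by rewrite /h mulr0 sin0 cos0; ring.
  apply: (@step _ h ((`|v| + `|u|) / (u ^+ 2 + v ^+ 2))) => //.
  + by move=> x; rewrite ler_norml cos_geN1 cos_le1.
  + move=> x; apply: (dderive_eq (dderiveM (dE x) (dderiveM (dderiveB
      (dderiveZ v (ds x)) (dderiveZ u (dc x)))
      (dderive_cst ((u ^+ 2 + v ^+ 2)^-1) x)))) => //.
    by field.
  + move=> x; rewrite normrM (@ger0_norm _ (_^-1)) ?invr_ge0 ?(ltW q0)//.
    rewrite ler_wpM2r ?invr_ge0 ?(ltW q0)//; apply: le_trans (ler_normB _ _) _.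
    rewrite !normrM lerD// ler_piMr// ler_norml.
      by rewrite sin_geN1 sin_le1.
    by rewrite cos_geN1 cos_le1.
- pose h x := (- u * sin (v * x) - v * cos (v * x)) / (u ^+ 2 + v ^+ 2).
  transitivity (- h 0); last by rewrite /h mulr0 sin0 cos0; ring.
  apply: (@step _ h ((`|u| + `|v|) / (u ^+ 2 + v ^+ 2))) => //.
  + by move=> x; rewrite ler_norml sin_geN1 sin_le1.
  + move=> x; apply: (dderive_eq (dderiveM (dE x) (dderiveM (dderiveB
      (dderiveZ (- u) (ds x)) (dderiveZ v (dc x)))
      (dderive_cst ((u ^+ 2 + v ^+ 2)^-1) x)))) => //.
    by field.
  + move=> x; rewrite normrM (@ger0_norm _ (_^-1)) ?invr_ge0 ?(ltW q0)//.
    rewrite ler_wpM2r ?invr_ge0 ?(ltW q0)//; apply: le_trans (ler_normB _ _) _.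
    rewrite !normrM normrN lerD// ler_piMr// ler_norml.
      by rewrite sin_geN1 sin_le1.
    by rewrite cos_geN1 cos_le1.
Qed.

End ExponentialIntegrals.

Section WeightedLaw.
Context d1 d2 (T1 : measurableType d1) (T2 : measurableType d2) (R : realType).
Variables (m : {measure set T1 -> \bar R}) (w : T1 -> R) (xi : T1 -> T2).

(** Tilted potential measures, gamma laws, laws of increments over short times
    and measures given by a density are all of this form, and their integrals
    reduce to those of [m] by [ge0_integral_wlaw] and [integral_wlaw]. *)
Definition wlaw (mw : measurable_fun setT w) (w0 : forall t, 0 <= w t)
    (mxi : measurable_fun setT xi) (A : set T2) : \bar R :=
  (\int[m]_(t in xi @^-1` A) (w t)%:E)%E.

Hypotheses (mw : measurable_fun setT w) (w0 : forall t, 0 <= w t)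
  (mxi : measurable_fun setT xi).
Local Notation nu := (wlaw mw w0 mxi).
Local Open Scope ereal_scope.

Let mpre A : measurable A -> measurable (xi @^-1` A).
Proof. by move=> mA; rewrite -[X in measurable X]setTI; exact: mxi. Qed.

Let wlaw_0 : nu set0 = 0.
Proof. by rewrite /wlaw preimage_set0 integral_set0. Qed.

Let wlaw_ge0 A : 0 <= nu A.
Proof. by apply: integral_ge0 => t _; rewrite lee_fin. Qed.

Let wlaw_sigma_additive : semi_sigma_additive nu.
Proof.
move=> F mF tF mUF; rewrite /wlaw preimage_bigcup.
apply: (@semi_sigma_additive_nng_induced _ _ _ m (EFin \o w)) => //.
- exact/measurable_EFinP.
- by move=> n; exact: mpre.
- apply/trivIsetP => /= i j _ _ ij; rewrite -preimage_setI.
  by move/trivIsetP : tF => /(_ _ _ _ _ ij) ->//; rewrite preimage_set0.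
- by rewrite -preimage_bigcup; exact: mpre.
Qed.

HB.instance Definition _ := isMeasure.Build _ _ _ nu
  wlaw_0 wlaw_ge0 wlaw_sigma_additive.

Import HBNNSimple.

Let ge0_integral_wlaw_nnsfun (f : {nnsfun T2 >-> R}) :
  \int[nu]_x (f x)%:E = \int[m]_t (w t * f (xi t))%:E.
Proof.
transitivity (\int[m]_t (\sum_(r \in range f)
    (w t)%:E * (r * \1_(f @^-1` [set r]) (xi t))%:E)).
  rewrite ge0_integral_fsum//; last 2 first.
  - move=> r; apply/measurable_EFinP; apply: measurable_funM => //.
    apply: measurable_funM => //.
    exact: (measurableT_comp (measurable_indic _)).
  - move=> r t _; rewrite mule_ge0 ?lee_fin//.
    by have := @nnfun_muleindic_ge0 _ _ _ f r (xi t); rewrite -EFinM lee_fin.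
  rewrite integralT_nnsfun sintegralE; apply: eq_fsbigr => r _.
  have mr : measurable (f @^-1` [set r]) by exact: measurable_sfunP.
  have [r0|r0] := leP 0%R r; last first.
    rewrite preimage_nnfun0// measure0 mule0 integral0_eq// => t _.
    by rewrite indicE in_set0 mulr0 mule0.
  transitivity (r%:E * \int[m]_(t in xi @^-1` (f @^-1` [set r])) (w t)%:E) => //.
  rewrite integral_mkcond -ge0_integralZl//; last 2 first.
  - apply/(measurable_restrictT _ (mpre mr)).
    by apply/measurable_funTS/measurable_EFinP.
  - by move=> t _; rewrite patchE; case: ifP; rewrite ?lee_fin.
  apply: eq_integral => t _; rewrite patchE indicE.
  have -> : (t \in xi @^-1` (f @^-1` [set r])) = (xi t \in f @^-1` [set r]).
    by apply/idP/idP; rewrite !inE.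
  by case: ifP => _; rewrite ?mulr1 ?mulr0 ?mule0// muleC.
apply: eq_integral => t _.
rewrite EFinM fimfunE -fsumEFin// ge0_mule_fsumr// => r.
by rewrite EFinM nnfun_muleindic_ge0.
Qed.

Lemma ge0_integral_wlaw (g : T2 -> \bar R) : measurable_fun setT g ->
  (forall x, 0 <= g x) -> \int[nu]_x g x = \int[m]_t ((w t)%:E * g (xi t)).
Proof.
move=> mg g0; pose g_ := nnsfun_approx measurableT mg.
transitivity (limn (fun n => \int[nu]_x (g_ n x)%:E)).
  rewrite -monotone_convergence//=.
  - apply: eq_integral => x _; apply/esym/cvg_lim => //=.
    exact: cvg_nnsfun_approx.
  - by move=> n; exact/measurable_EFinP.
  - by move=> n x _; rewrite lee_fin.
  - by move=> x _ a b ab; rewrite lee_fin//; exact/lefP/nd_nnsfun_approx.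
under eq_fun do rewrite ge0_integral_wlaw_nnsfun.
rewrite -monotone_convergence//=; last 3 first.
- by move=> n; apply/measurable_EFinP/measurable_funM => //; exact: measurableT_comp.
- by move=> n x _; rewrite lee_fin mulr_ge0.
- move=> x _ a b ab; rewrite lee_fin ler_wpM2l//.
  exact/lefP/nd_nnsfun_approx.
apply: eq_integral => t _; apply/cvg_lim => //.
under eq_fun do rewrite EFinM.
by apply: cvgeZl => //; exact: cvg_nnsfun_approx.
Qed.

Lemma integrable_wlaw (g : T2 -> R) : measurable_fun setT g ->
  m.-integrable setT (fun t => (w t * g (xi t))%:E) ->
  nu.-integrable setT (EFin \o g).
Proof.
move=> mg /integrableP[mwg ioo]; apply/integrableP; split; first exact/measurable_EFinP.
rewrite ge0_integral_wlaw//; last by do 2 apply: measurableT_comp => //.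
apply: le_lt_trans ioo; rewrite le_eqVlt; apply/orP; left; apply/eqP.
by apply: eq_integral => t _ /=; rewrite normrM (ger0_norm (w0 _)) EFinM.
Qed.

Lemma integral_wlaw (g : T2 -> R) : measurable_fun setT g ->
  m.-integrable setT (fun t => (w t * g (xi t))%:E) ->
  (\int[nu]_x g x = \int[m]_t (w t * g (xi t)))%R.
Proof.
move=> mg ig; rewrite /Rintegral integralE [in RHS]integralE.
have mgE : measurable_fun setT (EFin \o g) by exact/measurable_EFinP.
rewrite !ge0_integral_wlaw//; [|exact: measurable_funeneg|exact: measurable_funepos].
congr (fine (_ - _)); apply: eq_integral => t _ /=.
  rewrite !funeposE /= -!EFin_max -EFinM; congr EFin.
  by rewrite maxr_pMr// mulr0.
rewrite !funenegE /= -!EFin_max -EFinM; congr EFin.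
by rewrite maxr_pMr// mulr0 mulrN.
Qed.

End WeightedLaw.

(** * Fourier analysis of finite measures on the line *)

Section Basics.
Context {R : realType}.
Notation mu := (@lebesgue_measure R).

Lemma Rintegral_FTC (F f : R -> R) (p q : R) : p <= q -> continuous f ->
  (forall x, is_derive x (1 : R) F (f x)) ->
  \int[mu]_(x in `[p, q]) f x = F q - F p.
Proof.
rewrite le_eqVlt => /predU1P[<- _ _|pq cf dF].
  by rewrite subrr set_itv1 Rintegral_set1.
rewrite /Rintegral (@continuous_FTC2 _ f F)//.
- exact: continuous_subspaceT.
- have cF : continuous F := dderive_continuous dF.
  split => [x _||].
  + by case: (dF x).
  + exact: cvg_at_right_filter (cF p).
  + exact: cvg_at_left_filter (cF q).
- by move=> x _; rewrite derive1E; case: (dF x).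
Qed.

Lemma integrable_finite d (T : measurableType d) (nu : {measure set T -> \bar R})
    (D : set T) (f : T -> R) (K : R) : measurable D -> (nu D < +oo)%E ->
  measurable_fun D f -> (forall x, D x -> `|f x| <= K) ->
  nu.-integrable D (EFin \o f).
Proof.
move=> mD fin mf fK; apply: (integrable_bound (g := cst K)) => //.
apply/integrableP; split; first exact/measurable_EFinP.
under eq_integral do rewrite /=.
have finD : nu D \is a fin_num by rewrite ge0_fin_numE.
by rewrite integral_cst// -(fineK finD) -EFinM ltry.
Qed.

Lemma itv_fin (p q : R) : (mu `[p, q]%classic < +oo)%E.
Proof. by rewrite lebesgue_measure_itv /=; case: ifP => _; rewrite ?ltry. Qed.

Lemma measurable_fun_lebesgue (D : set R) (f : R -> R) : measurable_fun setT f ->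
  @measurable_fun _ _ (measurableTypeR R) R D f.
Proof. by move=> mf; exact: measurable_funTS. Qed.

Lemma Rintegral_itv_cst (p q K : R) : p <= q ->
  \int[mu]_(x in `[p, q]) K = K * (q - p).
Proof.
move=> pq; have -> : q - p = fine (mu `[p, q]%classic).
  rewrite lebesgue_measure_itv /= lte_fin.
  by case: ltP => // qp; apply/eqP; rewrite subr_eq0 eq_le qp.
by rewrite Rintegral_cst.
Qed.

Lemma le_Rintegral_bound (p q K : R) (f : R -> R) : p <= q ->
  measurable_fun `[p, q] f ->
  (forall x, x \in `[p, q] -> `|f x| <= K) ->
  `|\int[mu]_(x in `[p, q]) f x| <= K * (q - p).
Proof.
move=> pq mf fK.
have ifn : mu.-integrable `[p, q] (EFin \o f).
  by apply: integrable_finite => //; [exact: itv_fin|exact: fK].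
apply: le_trans (le_normr_Rintegral _ ifn) _ => //.
rewrite -Rintegral_itv_cst//.
apply: le_Rintegral => //.
- by apply: (integrable_finite (K := K)) => //; [exact: itv_fin|exact: measurableT_comp|move=> x /fK; rewrite normr_id].
- by apply: (integrable_finite (K := `|K|)) => //; exact: itv_fin.
Qed.

(** If [f x] were negative, [f] would be at most [f x / 2] on a small interval
    on the right of [x], and its integral there would be negative. *)
Lemma ge0_Rintegral_itv (f : R -> R) (x : R) : {for x, continuous f} ->
  measurable_fun setT f ->
  (forall y, x < y -> 0 <= \int[mu]_(t in `[x, y]) f t) -> 0 <= f x.
Proof.
move=> cf mf If; rewrite leNgt; apply/negP => fx0.
have e0 : 0 < - f x / 2 by rewrite divr_gt0// oppr_gt0.
have Hn : nbhs x (fun t => `|f x - f t| < - f x / 2).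
  exact: (@cvgr_dist_lt _ _ _ _ _ _ _ cf _ e0).
case: Hn => d /= d0 H.
have fle t : t \in `[x, x + d / 2] -> `|f t - f x| <= - f x / 2.
  rewrite in_itv /= => /andP[xt td]; rewrite distrC ltW//; apply: H.
  rewrite /ball_ /= ler0_norm; lra.
have m' : @measurable_fun _ _ (measurableTypeR R) R `[x, x + d / 2] f.
  exact: measurable_fun_lebesgue.
have d2 : x < x + d / 2 by rewrite ltrDl divr_gt0.
have := If _ d2; apply/negP; rewrite -ltNge.
have h : `|\int[mu]_(t in `[x, x + d / 2]) (f t - f x)| <= - f x / 2 * (x + d / 2 - x).
  apply: le_Rintegral_bound => //; first exact: ltW.
  by apply: measurable_funB.
have ifn : mu.-integrable `[x, x + d / 2] (EFin \o f).
  apply: (integrable_finite (K := - f x / 2 + `|f x|)) => //; first exact: itv_fin.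
  move=> t /fle; rewrite -{2}(subrK (f x) (f t)) => ht.
  by apply: le_trans (ler_normD _ _) _; rewrite lerD2r.
have ic : mu.-integrable `[x, x + d / 2] (EFin \o cst (f x)).
  by apply: (integrable_finite (K := `|f x|)) => //; exact: itv_fin.
move: h; rewrite RintegralB// Rintegral_itv_cst ?(ltW d2)//.
have -> : x + d / 2 - x = d / 2 by ring.
rewrite ler_norml => /andP[_]; nra.
Qed.

End Basics.

Section Fourier.
Context {R : realType}.
Notation mu := (@lebesgue_measure R).
Implicit Types (nu : {measure set R -> \bar R}) (x y p q e : R).

Definition fcos nu (t : R) : R := \int[nu]_x cos (t * x).
Definition fsin nu (t : R) : R := \int[nu]_x sin (t * x).
(** The real part of [exp(i t y)] times the characteristic function at [-t]. *)
Definition fker nu (y t : R) : R := cos (t * y) * fcos nu t + sin (t * y) * fsin nu t.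

Variable nu0 : {measure set R -> \bar R}.
Hypothesis nu_fin : (nu0 setT < +oo)%E.
Let nu := (nu0 : set R -> \bar R).
HB.instance Definition _ := Measure.on nu.
Let nu_isfin : fin_num_fun nu.
Proof.
apply: lty_fin_num_fun; exact: nu_fin.
Qed.
HB.instance Definition _ := Measure_isFinite.Build _ _ _ nu nu_isfin.

Let M := fine (nu setT).

Let M0 : 0 <= M. Proof. by rewrite fine_ge0. Qed.

Let ibnd (f : R -> R) (K : R) : measurable_fun setT f -> (forall x, `|f x| <= K) ->
  nu0.-integrable setT (EFin \o f).
Proof. by move=> mf fK; apply: (@integrable_finite _ _ _ nu0 _ _ K). Qed.

Let le_bnd (f : R -> R) (K : R) : measurable_fun setT f -> (forall x, `|f x| <= K) ->
  `|\int[nu0]_x f x| <= K * M.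
Proof.
move=> mf fK; have ifn := ibnd mf fK.
apply: le_trans (le_normr_Rintegral _ ifn) _ => //.
have -> : K * M = \int[nu0]_x K by rewrite Rintegral_cst.
apply: le_Rintegral => //.
  by apply: (ibnd (K := K)); [exact: measurableT_comp|move=> x; rewrite normr_id].
exact: (ibnd (K := `|K|)).
Qed.

Let cos1 (x : R) : `|cos x| <= 1. Proof. by rewrite ler_norml cos_geN1 cos_le1. Qed.
Let sin1 (x : R) : `|sin x| <= 1. Proof. by rewrite ler_norml sin_geN1 sin_le1. Qed.

Let mcos (t : R) : measurable_fun setT (fun x => cos (t * x)).
Proof.
apply: continuous_measurable_fun => x.
apply: continuous_comp; last exact: continuous_cos.
exact: mulrl_continuous.
Qed.
Let msin (t : R) : measurable_fun setT (fun x => sin (t * x)).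
Proof.
apply: continuous_measurable_fun => x.
apply: continuous_comp; last exact: continuous_sin.
exact: mulrl_continuous.
Qed.

Lemma fcos_bound t : `|fcos nu0 t| <= M.
Proof. by rewrite -[M]mul1r; apply: le_bnd. Qed.
Lemma fsin_bound t : `|fsin nu0 t| <= M.
Proof. by rewrite -[M]mul1r; apply: le_bnd. Qed.

Lemma fcos_continuous : continuous (fcos nu0).
Proof.
move=> a.
have := @continuity_under_integral R _ _ nu0 (fun t x => cos (t * x)) setT
  measurableT (a - 1) (a + 1).
move=> H; apply: (H _ _ (cst 1)) => //.
- by move=> x _; exact: (ibnd (K := 1)).
- apply: aeW => y _ t _; apply: continuous_comp; last exact: continuous_cos.
  exact: mulrr_continuous.
- by apply: (ibnd (K := 1)) => // x; rewrite normr1.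
- by move=> x _; apply: aeW => y _; exact: cos1.
- by rewrite inE /= in_itv /=; apply/andP; split; lra.
Qed.

Lemma fsin_continuous : continuous (fsin nu0).
Proof.
move=> a.
have := @continuity_under_integral R _ _ nu0 (fun t x => sin (t * x)) setT
  measurableT (a - 1) (a + 1).
move=> H; apply: (H _ _ (cst 1)) => //.
- by move=> x _; exact: (ibnd (K := 1)).
- apply: aeW => y _ t _; apply: continuous_comp; last exact: continuous_sin.
  exact: mulrr_continuous.
- by apply: (ibnd (K := 1)) => // x; rewrite normr1.
- by move=> x _; apply: aeW => y _; exact: sin1.
- by rewrite inE /= in_itv /=; apply/andP; split; lra.
Qed.

Lemma fkerE y t : fker nu0 y t = \int[nu0]_x cos (t * (y - x)).
Proof.
rewrite /fker /fcos /fsin.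
rewrite -RintegralZl//; last exact: (ibnd (K := 1)).
rewrite -RintegralZl//; last exact: (ibnd (K := 1)).
rewrite -RintegralD//.
- apply: eq_Rintegral => x _.
  by rewrite mulrBr cosB.
- apply: (ibnd (K := 1)) => [|x]; first exact: measurable_funM.
  by rewrite normrM mulr_ile1.
- apply: (ibnd (K := 1)) => [|x]; first exact: measurable_funM.
  by rewrite normrM mulr_ile1.
Qed.

Definition patan e p q x : R := atan ((q - x) / e) - atan ((p - x) / e).

(** Integrating against the kernel [e / (e^2 + (y - x)^2)] amounts to damping
    the characteristic function by [exp (- e t)]. *)
Lemma poisson_formula e p q : 0 < e -> p <= q ->
  \int[nu0]_x patan e p q x =
  \int[mu]_(y in `[p, q]) \int[mu]_(t in `[0, +oo[) (expR (- (e * t)) * fker nu0 y t).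
Proof.
move=> e0 pq.
have e2 (u : R) : 0 < e ^+ 2 + u ^+ 2 by rewrite ltr_pwDl ?sqr_ge0// exprn_gt0.
have inner y : \int[mu]_(t in `[0, +oo[) (expR (- (e * t)) * fker nu0 y t) =
    \int[nu0]_x (e / (e ^+ 2 + (y - x) ^+ 2)).
  transitivity (\int[mu]_(t in `[0, +oo[) \int[nu0]_x
      (expR (- (e * t)) * cos (t * (y - x)))).
    apply: eq_Rintegral => t _; rewrite fkerE RintegralZl//.
    apply: (ibnd (K := 1)) => // .
    apply: (measurableT_comp (mcos t)).
    exact: measurable_funB.
  rewrite (@Rfubini _ _ _ _ _ mu nu `[0, +oo[ setT
    (fun z => expR (- (e * z.1)) * cos (z.1 * (y - z.2)))
    (fun t => expR (- (e * t))) (cst 1))//.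
  - apply: eq_Rintegral => x _.
    have [<- _] := Rintegral_exp_cos_sin (y - x) e0.
    by apply: eq_Rintegral => t _; rewrite /= (mulrC (y - x)).
  - apply: measurable_funM.
      apply: measurableT_comp => //; apply: measurableT_comp => //.
      exact: measurable_funM.
    apply: (measurableT_comp (f := @cos R)).
      exact: continuous_measurable_fun (@continuous_cos R).
    by apply: measurable_funM => //; exact: measurable_funB.
  - by move=> t x _ _; rewrite normrM mulr1 (ger0_norm (expR_ge0 _)) ler_piMr ?expR_ge0.
  - exact: integrable_expRN.
  - by apply: (ibnd (K := 1)) => // x; rewrite normr1.
under [RHS]eq_Rintegral do rewrite inner.
rewrite (@Rfubini _ _ _ _ _ mu nu `[p, q] setT
    (fun z => e / (e ^+ 2 + (z.1 - z.2) ^+ 2)) (cst e^-1) (cst 1))//.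
- apply: eq_Rintegral => x _ /=; apply/esym.
  apply: (@Rintegral_FTC _ (fun y => atan ((y - x) / e))
    (fun y => e / (e ^+ 2 + (y - x) ^+ 2))) => //.
  + move=> y; apply: cvgM; first exact: cvg_cst.
    apply: cvgV; first by rewrite gt_eqF.
    apply: cvgD; first exact: cvg_cst.
    apply: (@cvg_comp _ _ _ (fun y => y - x) (fun u => u ^+ 2) _ (nbhs (y - x))).
      by apply: cvgB; [exact: cvg_id|exact: cvg_cst].
    exact: exprn_continuous.
  + move=> y; apply: (dderive_eq (dderive_atan (dderiveM
      (dderiveB (dderive_id y) (dderive_cst x y)) (dderive_cst e^-1 y)))) => //.
    rewrite subr0 mul1r mulr0 addr0.
    have := e2 (y - x) => /lt0r_neq0 h.
    have h2 : 1 + ((y - x) / e) ^+ 2 != 0 by rewrite gt_eqF// ltr_pwDl// sqr_ge0.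
    by field; rewrite h gt_eqF.
- apply: measurable_funM => //.
  apply: (measurableT_comp (f := fun u : R => (e ^+ 2 + u ^+ 2)^-1)).
    apply: continuous_measurable_fun => u; apply: cvgV; first by rewrite gt_eqF.
    by apply: cvgD; [exact: cvg_cst|exact: exprn_continuous].
  exact: measurable_funB.
- move=> y x _ _; rewrite mulr1 /= ger0_norm ?divr_ge0 ?(ltW e0)// ?(ltW (e2 _))//.
  rewrite ler_pdivrMr// mulrDr.
  rewrite (_ : e^-1 * e ^+ 2 = e); last by field; rewrite gt_eqF.
  by rewrite lerDl mulr_ge0 ?sqr_ge0// invr_ge0 ltW.
- by apply: (integrable_finite (K := `|e^-1|)) => //; exact: itv_fin.
- by apply: (ibnd (K := 1)) => // x; rewrite normr1.
Qed.

End Fourier.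

Section PatanLimit.
Context {R : realType}.
Implicit Types p q x e y : R.

Lemma patan_ge0 e p q x : 0 < e -> p <= q -> 0 <= patan e p q x.
Proof.
move=> e0 pq; rewrite /patan subr_ge0 le_atan//.
by rewrite ler_pM2r ?invr_gt0// lerD2r.
Qed.

Lemma patan_le e p q x : patan e p q x <= pi.
Proof.
rewrite /patan; have := atan_ltpi2 ((q - x) / e); have := atan_gtNpi2 ((p - x) / e).
lra.
Qed.

Lemma patan_continuous e p q : continuous (patan e p q).
Proof.
have d y x : is_derive x (1 : R) (fun x => atan ((y - x) / e)) _ :=
  dderive_atan (dderiveM (dderiveB (dderive_cst y x) (dderive_id x)) (dderive_cst e^-1 x)).
exact: (dderive_continuous (fun x => dderiveB (d q x) (d p x))).
Qed.

Lemma cvg_atan_seq (u : R) :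
  (fun n : nat => atan (u / n.+1%:R^-1)) @ \oo --> pi / 2 * Num.sg u.
Proof.
have lim (v : R) : 0 < v -> (fun n : nat => atan (v / n.+1%:R^-1)) @ \oo --> pi / 2.
  move=> v0; apply: (@cvg_comp _ _ _ (fun n : nat => v / n.+1%:R^-1) (@atan R) _ +oo).
    apply/cvgryPge => A; near=> n; rewrite invrK mulrC -ler_pdivrMr//.
    have : A / v <= n%:R by near: n; exact: nbhs_infty_ger.
    by move=> h; rewrite (le_trans h)// ler_nat.
  exact: cvgy_atan.
case: (ltrgtP 0 u) => [u0|u0|<-].
- by rewrite gtr0_sg// mulr1; exact: lim.
- rewrite ltr0_sg// mulrN1.
  have -> : (fun n : nat => atan (u / n.+1%:R^-1)) = (fun n => - atan (- u / n.+1%:R^-1)).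
    by apply/funext => n; rewrite mulNr atanN opprK.
  by apply: cvgN; apply: lim; rewrite oppr_gt0.
- rewrite sgr0 mulr0; under eq_fun do rewrite mul0r atan0; exact: cvg_cst.
Unshelve. all: by end_near. Qed.

Lemma cvg_patan p q x : (fun n : nat => patan n.+1%:R^-1 p q x) @ \oo -->
  pi / 2 * (Num.sg (q - x) - Num.sg (p - x)).
Proof. by rewrite mulrBr; apply: cvgB; exact: cvg_atan_seq. Qed.

End PatanLimit.

Section Inversion.
Context {R : realType}.
Notation mu := (@lebesgue_measure R).
Variable nu : {measure set R -> \bar R}.
Hypothesis nu_fin : (nu setT < +oo)%E.

Lemma fker_le y t : `|fker nu y t| <= `|fcos nu t| + `|fsin nu t|.
Proof.
rewrite /fker; apply: le_trans (ler_normD _ _) _; rewrite !normrM lerD//.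
  by rewrite ler_piMl// ler_norml cos_geN1 cos_le1.
by rewrite ler_piMl// ler_norml sin_geN1 sin_le1.
Qed.

Lemma fker_continuous y : continuous (fker nu y).
Proof.
move=> t; apply: cvgD; apply: cvgM.
- apply: continuous_comp; last exact: continuous_cos.
  exact: mulrr_continuous.
- exact: fcos_continuous.
- apply: continuous_comp; last exact: continuous_sin.
  exact: mulrr_continuous.
- exact: fsin_continuous.
Qed.

Lemma measurable_fker y : measurable_fun setT (fker nu y).
Proof. exact: continuous_measurable_fun (@fker_continuous y). Qed.

Lemma fint_continuous (phi psi : R -> R) : measurable_fun setT phi ->
  mu.-integrable `[0, +oo[ (EFin \o psi) ->
  (forall t, 0 <= t -> `|phi t| * (`|fcos nu t| + `|fsin nu t|) <= psi t) ->
  continuous (fun y => \int[mu]_(t in `[0, +oo[) (phi t * fker nu y t)).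
Proof.
move=> mphi ipsi bnd a.
have h y t : 0 <= t -> `|phi t * fker nu y t| <= psi t.
  move=> t0; rewrite normrM; apply: le_trans (bnd t t0).
  by rewrite ler_wpM2l// fker_le.
have := @continuity_under_integral R _ _ mu (fun y t => phi t * fker nu y t)
  `[0, +oo[ (measurable_itv _) (a - 1) (a + 1).
move=> H; apply: (H _ _ psi) => //.
- move=> y _; apply: (integrable_bound _ _ _ ipsi) => //.
    by apply: measurable_funTS; apply: measurable_funM => //; exact: measurable_fker.
  by move=> t; rewrite /= in_itv /= andbT; exact: h.
- apply: aeW => t _ y _; apply: cvgM; first exact: cvg_cst.
  apply: cvgD; apply: cvgM; (try exact: cvg_cst).
    by apply: continuous_comp; [exact: mulrl_continuous|exact: continuous_cos].
  by apply: continuous_comp; [exact: mulrl_continuous|exact: continuous_sin].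
- by move=> y _; apply: aeW => t; rewrite /= in_itv /= andbT; exact: h.
- by rewrite inE /= in_itv /=; apply/andP; split; lra.
Qed.

Hypothesis icos : mu.-integrable `[0, +oo[ (EFin \o fcos nu).
Hypothesis isin : mu.-integrable `[0, +oo[ (EFin \o fsin nu).

Let psi (t : R) : R := `|fcos nu t| + `|fsin nu t|.

Let ipsi : mu.-integrable `[0, +oo[ (EFin \o psi).
Proof.
have mI : measurable (`[0%R, +oo[%classic : set (measurableTypeR R)) by exact: measurable_itv.
exact: (integrableD mI (integrable_abse icos) (integrable_abse isin)).
Qed.

(** The inverse Fourier transform: the integral over the whole line is twice
    the one over the half-line, the integrand being even. *)
Definition fdens (m : {measure set R -> \bar R}) (y : R) : R :=
  pi^-1 * \int[mu]_(t in `[0, +oo[) fker m y t.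

Lemma fdens_continuous : continuous (fdens nu).
Proof.
have H : continuous (fun y => \int[mu]_(t in `[0, +oo[) (cst 1 t * fker nu y t)).
  by apply: (fint_continuous _ ipsi) => // t _; rewrite normr1 mul1r.
have -> : fdens nu = (fun y => pi^-1 * \int[mu]_(t in `[0, +oo[) (cst 1 t * fker nu y t)).
  by apply/funext => z; rewrite /fdens; under [in RHS]eq_Rintegral do rewrite mul1r.
by move=> y; apply: cvgM; [exact: cvg_cst|exact: H].
Qed.

Let expR_le1 (e t : R) : 0 < e -> 0 <= t -> `|expR (- (e * t))| <= 1.
Proof.
move=> e0 t0; rewrite ger0_norm ?expR_ge0// -expR0 ler_expR oppr_le0.
by rewrite mulr_ge0// ltW.
Qed.

(** The limit of [poisson_formula] as [e] tends to 0, by dominated convergence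
    on both sides. The kernel becomes [pi] inside the interval and [pi / 2] at
    its end points. *)
Lemma fdens_sg p q : p <= q ->
  \int[nu]_x (pi / 2 * (Num.sg (q - x) - Num.sg (p - x))) =
  pi * \int[mu]_(y in `[p, q]) fdens nu y.
Proof.
move=> pq; have pi0 := pi_gt0 R.
have msg (u : R) : measurable_fun setT (fun x : R => Num.sg (u - x)).
  apply: (measurableT_comp (f := @Num.sg R)); last exact: measurable_funB.
  rewrite (_ : @Num.sg R = (fun x => if x == 0 then 0 else if x < 0 then -1 else 1))//.
  apply: measurable_fun_ifT => //; first exact: measurable_fun_eqr.
  by apply: measurable_fun_ifT => //; exact: measurable_fun_ltr.
have L : (fun n : nat => \int[nu]_x patan n.+1%:R^-1 p q x) @ \oo -->
    \int[nu]_x (pi / 2 * (Num.sg (q - x) - Num.sg (p - x))).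
  apply: (@Rdominated_cvg _ _ _ nu setT (fun n => patan n.+1%:R^-1 p q) _ (cst pi)) => //.
  - by move=> n; exact: continuous_measurable_fun (@patan_continuous _ _ _ _).
  - by apply: measurable_funM => //; exact: measurable_funB.
  - by move=> x _; exact: cvg_patan.
  - by apply: (integrable_finite (K := `|pi|)).
  - by move=> n x _; rewrite ger0_norm ?patan_le// patan_ge0.
pose J n y := \int[mu]_(t in `[0, +oo[) (expR (- (n.+1%:R^-1 * t)) * fker nu y t).
pose Jl y := \int[mu]_(t in `[0, +oo[) fker nu y t.
have Jb n y t : 0 <= t -> `|expR (- (n.+1%:R^-1 * t)) * fker nu y t| <= psi t.
  move=> t0; rewrite normrM; apply: le_trans (fker_le y t).
  by rewrite ler_piMl// expR_le1.
have mE n : measurable_fun setT (fun t : R => expR (- (n.+1%:R^-1 * t))).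
  exact: continuous_measurable_fun (dderive_continuous (@dderive_expnux _ _)).
have mI (D : set R) n y : @measurable_fun _ _ (measurableTypeR R) R D
    (fun t => expR (- (n.+1%:R^-1 * t)) * fker nu y t).
  by apply: measurable_fun_lebesgue; apply: measurable_funM => //; exact: measurable_fker.
have iJ n y : mu.-integrable `[0, +oo[
    (EFin \o (fun t => expR (- (n.+1%:R^-1 * t)) * fker nu y t)).
  apply: (integrable_bound _ _ _ ipsi) => //.
  by move=> t; rewrite /= in_itv /= andbT; exact: Jb.
have cJ n : continuous (J n).
  apply: (@fint_continuous _ psi) => // t t0.
  by rewrite ler_piMl ?expR_le1// addr_ge0.
have cJl : continuous Jl.
  have -> : Jl = (fun y => pi * fdens nu y).
    by apply/funext => y; rewrite /fdens mulrA divff ?gt_eqF// mul1r.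
  by move=> y; apply: cvgM; [exact: cvg_cst|exact: fdens_continuous].
have L2 : (fun n : nat => \int[mu]_(y in `[p, q]) J n y) @ \oo -->
    \int[mu]_(y in `[p, q]) Jl y.
  apply: (@Rdominated_cvg _ _ _ mu `[p, q] J Jl
    (cst (\int[mu]_(t in `[0, +oo[) psi t))) => //.
  - by move=> n; apply: measurable_funTS; exact: continuous_measurable_fun.
  - by apply: measurable_funTS; exact: continuous_measurable_fun.
  - move=> y _; apply: (@Rdominated_cvg _ _ _ mu `[0, +oo[
      (fun n t => expR (- (n.+1%:R^-1 * t)) * fker nu y t) _ psi) => //.
    + by apply: measurable_fun_lebesgue; exact: measurable_fker.
    + move=> t _; rewrite -[X in _ --> X]mul1r.
      have cE : (fun n : nat => expR (- (n.+1%:R^-1 * t))) @ \oo --> expR (- (0 * t)).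
        apply: continuous_cvg; first exact: continuous_expR.
        apply: cvgN; apply: cvgM; last exact: cvg_cst.
        exact: cvg_harmonic.
      rewrite mul0r oppr0 expR0 in cE.
      by apply: cvgM; [exact: cE|exact: cvg_cst].
    + by move=> n t; rewrite /= in_itv /= andbT; exact: Jb.
  - apply: (integrable_finite (K := `|\int[mu]_(t in `[0, +oo[) psi t|)) => //.
    exact: itv_fin.
  - move=> n y _; apply: le_trans (le_normr_Rintegral _ (iJ n y)) _ => //.
    apply: le_Rintegral => //.
      apply: (integrable_bound _ _ _ ipsi) => //.
        exact: (measurableT_comp (@normr_measurable R _) (mI _ n y)).
      by move=> t; rewrite /= in_itv /= andbT normr_id; exact: Jb.
    by move=> t; rewrite /= in_itv /= andbT; exact: Jb.
have E : (fun n : nat => \int[nu]_x patan n.+1%:R^-1 p q x) =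
    (fun n : nat => \int[mu]_(y in `[p, q]) J n y).
  by apply/funext => n; rewrite poisson_formula.
rewrite -(cvg_lim _ L)// E (cvg_lim _ L2)//.
rewrite -RintegralZl//; last first.
  apply: continuous_compact_integrable; first exact: segment_compact.
  by apply: continuous_subspaceT; exact: fdens_continuous.
by apply: eq_Rintegral => y _; rewrite /fdens mulrA divff ?gt_eqF// mul1r.
Qed.

Lemma fdens_le y : `|fdens nu y| <= pi^-1 * \int[mu]_(t in `[0, +oo[) psi t.
Proof.
rewrite /fdens normrM ger0_norm ?invr_ge0 ?pi_ge0// ler_wpM2l ?invr_ge0 ?pi_ge0//.
have mk : @measurable_fun _ _ (measurableTypeR R) R `[0, +oo[ (fker nu y).
  by apply: measurable_fun_lebesgue; exact: measurable_fker.
have ik : mu.-integrable `[0, +oo[ (EFin \o fker nu y).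
  by apply: (integrable_bound _ _ _ ipsi) => // t _; exact: fker_le.
apply: le_trans (le_normr_Rintegral _ ik) _ => //.
apply: le_Rintegral => //; last by move=> t _; exact: fker_le.
exact: (integrable_abse ik).
Qed.

Let mnu (A : set R) : R := fine (nu A).
Let mnu_fin A : measurable A -> nu A \is a fin_num.
Proof.
move=> mA; rewrite ge0_fin_numE//; apply: le_lt_trans nu_fin.
by apply: le_measure; rewrite ?inE.
Qed.
Let mnu_le A B : measurable A -> measurable B -> A `<=` B -> mnu A <= mnu B.
Proof.
by move=> mA mB AB; rewrite fine_le ?mnu_fin// le_measure ?inE.
Qed.
Let Rint_indic A : measurable A -> \int[nu]_x (\1_A x : R) = mnu A.
Proof. by move=> mA; rewrite /Rintegral integral_indic// setIT. Qed.
Let i_indic (k : R) A : measurable A -> nu.-integrable setT (EFin \o (fun x => k * \1_A x)).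
Proof.
move=> mA; apply: (integrable_finite (K := `|k|)) => //.
  by apply: measurable_funM => //; exact: measurable_indic.
by move=> x _; rewrite normrM ler_piMr// indicE; case: (_ \in _); rewrite ?normr1 ?normr0.
Qed.
Let Rint_kindic (k : R) A : measurable A -> \int[nu]_x (k * \1_A x) = k * mnu A.
Proof.
move=> mA; rewrite RintegralZl// ?Rint_indic//.
by have := i_indic 1 mA; apply: eq_integrable => // x _; rewrite /= mul1r.
Qed.

Let g p q x : R := pi / 2 * (Num.sg (q - x) - Num.sg (p - x)).

Let sg_gap (p q x : R) : p < q -> let S := Num.sg (q - x) - Num.sg (p - x) in
  [/\ 0 <= S, S <= 2, p < x -> x < q -> S = 2, x = p -> S = 1
    & ~~ (p <= x <= q) -> S = 0].
Proof.
move=> pq /=.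
case: (ltrgtP p x) => px.
- rewrite (ltr0_sg (_ : p - x < 0)) ?subr_lt0//.
  case: (ltrgtP x q) => xq.
  + by rewrite gtr0_sg ?subr_gt0//; split => //; lra.
  + by rewrite ltr0_sg ?subr_lt0//; split => //; lra.
  + by rewrite xq subrr sgr0; split => //; lra.
- have xq := lt_trans px pq.
  by rewrite !gtr0_sg ?subr_gt0//; split => //; lra.
- by rewrite -px subrr sgr0 gtr0_sg ?subr_gt0//; split => //; try lra; rewrite lexx (ltW pq).
Qed.

Let ig p q : p < q -> nu.-integrable setT (EFin \o g p q).
Proof.
move=> pq; apply: (integrable_finite (K := pi)) => //.
  have msg (u : R) : measurable_fun setT (fun x : R => Num.sg (u - x)).
    apply: (measurableT_comp (f := @Num.sg R)); last exact: measurable_funB.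
    rewrite (_ : @Num.sg R = (fun x => if x == 0 then 0 else if x < 0 then -1 else 1))//.
    apply: measurable_fun_ifT => //; first exact: measurable_fun_eqr.
    by apply: measurable_fun_ifT => //; exact: measurable_fun_ltr.
  by apply: measurable_funM => //; exact: measurable_funB.
move=> x _; rewrite /g; have [h1 h2 _ _ _] := sg_gap x pq.
have pi0 := pi_gt0 R.
by rewrite ger0_norm; nra.
Qed.

Let F p q := \int[mu]_(y in `[p, q]) fdens nu y.

Let sg_bound p q : p < q -> [/\ pi * mnu `]p, q[%classic <= pi * F p q,
  pi * F p q <= pi * mnu `[p, q]%classic & pi / 2 * mnu [set p] <= pi * F p q].
Proof.
move=> pq; have pi0 := pi_gt0 R; have igpq := ig pq.
rewrite /F -fdens_sg ?(ltW pq)// -!Rint_kindic//; last first.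
have G x : pi / 2 * (Num.sg (q - x) - Num.sg (p - x)) = g p q x by [].
split; (apply: le_Rintegral; [by []| | |]); (try by apply: i_indic); (try exact: igpq);
  move=> x _; have [S0 S2 Sm Sp Sn] := sg_gap x pq; rewrite /g indicE.
- have [xA|xA] := pselect (`]p, q[%classic x); last by rewrite memNset//= mulr0; nra.
  rewrite mem_set//; move: xA; rewrite /= in_itv /= => /andP[px xq].
  by rewrite Sm//; nra.
- have [xA|xA] := pselect (`[p, q]%classic x); first by rewrite mem_set//=; nra.
  by rewrite memNset// Sn ?mulr0//; apply/negP; move: xA; rewrite /= in_itv.
- have [xA|xA] := pselect ([set p] x); last by rewrite memNset//= mulr0; nra.
  by rewrite mem_set// Sp//; nra.
Qed.

(** The density is bounded, so that short intervals have small mass. Hence the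
    weights [pi / 2] at the end points in [fdens_sg] do not matter. *)
Let no_atom p : mnu [set p] = 0.
Proof.
have pi0 := pi_gt0 R.
apply/eqP; rewrite eq_le fine_ge0// andbT.
set K := pi^-1 * \int[mu]_(t in `[0, +oo[) psi t.
have K0 : 0 <= K by apply: le_trans (fdens_le 0).
apply/ler_addgt0Pr => e e0; rewrite add0r.
pose dl := e / (2 * (K + 1)).
have K1 : 0 < K + 1 by rewrite ltr_wpDl.
have d0 : 0 < dl by rewrite divr_gt0// mulr_gt0.
have pd : p < p + dl by rewrite ltrDl.
have [_ _ h] := sg_bound pd.
have : F p (p + dl) <= K * (p + dl - p).
  apply: le_trans (ler_norm _) _; apply: le_Rintegral_bound.
  - by rewrite lerDl ltW.
  - by apply: measurable_fun_lebesgue; exact: continuous_measurable_fun fdens_continuous.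
  - by move=> x _; exact: fdens_le.
rewrite addrAC subrr add0r => h2.
have h3 : K * dl <= e / 2.
  rewrite /dl mulrA ler_pdivrMr ?mulr_gt0//.
  by rewrite (_ : e / 2 * (2 * (K + 1)) = e * (K + 1)); [nra|field].
have : pi / 2 * mnu [set p] <= pi * (e / 2) by nra.
have -> : pi * (e / 2) = pi / 2 * e by ring.
by rewrite ler_pM2l ?divr_gt0.
Qed.

Lemma fourier_inversion_itv p q : p <= q ->
  nu `]p, q]%classic = (\int[mu]_(y in `[p, q]) fdens nu y)%:E.
Proof.
rewrite le_eqVlt => /predU1P[<-|pq].
  by rewrite set_itvoc0 measure0 set_itv1 Rintegral_set1.
have pi0 := pi_gt0 R; have [h1 h2 _] := sg_bound pq.
rewrite ler_pM2l// in h1; rewrite ler_pM2l// in h2.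
have mo : measurable (`]p, q[%classic : set R) by exact: measurable_itv.
have moc : measurable (`]p, q]%classic : set R) by exact: measurable_itv.
have mcc : measurable (`[p, q]%classic : set R) by exact: measurable_itv.
rewrite -[LHS]fineK ?mnu_fin//; congr EFin; rewrite -/(mnu _).
have s1 : mnu `]p, q[%classic <= mnu `]p, q]%classic.
  by apply: mnu_le => // x /=; rewrite !in_itv /= => /andP[-> /ltW ->].
have s2 : mnu `]p, q]%classic <= mnu `]p, q[%classic.
  rewrite -(addr0 (mnu `]p, q[%classic)) -(no_atom q) /mnu -fineD ?mnu_fin//.
  rewrite fine_le ?fin_numD ?mnu_fin//.
  apply: le_trans (measureU2 _ _ _) => //.
  apply: le_measure; rewrite ?inE//; first exact: measurableU.
  move=> x /=; rewrite !in_itv /= => /andP[-> xq].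
  by move: xq; rewrite le_eqVlt => /predU1P[->|->]; [right|left].
have s3 : mnu `[p, q]%classic <= mnu `]p, q]%classic.
  rewrite -(addr0 (mnu `]p, q]%classic)) -(no_atom p) /mnu -fineD ?mnu_fin//.
  rewrite fine_le ?fin_numD ?mnu_fin//.
  apply: le_trans (measureU2 _ _ _) => //.
  apply: le_measure; rewrite ?inE//; first exact: measurableU.
  move=> x /=; rewrite !in_itv /= => /andP[px ->].
  by move: px; rewrite le_eqVlt => /predU1P[->|->]; [right|left].
rewrite -/(F p q); lra.
Qed.

Lemma fdens_ge0 y : 0 <= fdens nu y.
Proof.
apply: (@ge0_Rintegral_itv _ (fdens nu) y).
- exact: fdens_continuous.
- exact: continuous_measurable_fun fdens_continuous.
by move=> q yq; rewrite -lee_fin -fourier_inversion_itv// ltW.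
Qed.

Lemma fourier_inversion A : measurable A ->
  nu A = (\int[mu]_(y in A) (fdens nu y)%:E)%E.
Proof.
move=> mA; have mf := continuous_measurable_fun fdens_continuous.
have mid : measurable_fun setT (id : measurableTypeR R -> R) by exact: measurable_id.
have -> : (\int[mu]_(y in A) (fdens nu y)%:E)%E =
   wlaw mu (mf : @measurable_fun _ _ (measurableTypeR R) R setT _) fdens_ge0 mid A by [].
apply: (@measure_eq_itvoc _ _ _ (fun n => - n%:R) (fun n => n%:R)) => //.
- move=> n p q _ pq _; rewrite fourier_inversion_itv//= /wlaw.
  rewrite -[RHS]/(\int[mu]_(y in `]p, q]%classic) (fdens nu y)%:E)%E.
  rewrite integral_itv_obnd_cbnd; last first.
    by apply/measurable_EFinP; exact: measurable_fun_lebesgue.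
  rewrite /Rintegral fineK//; apply: integrable_fin_num => //.
  apply: continuous_compact_integrable; first exact: segment_compact.
  by apply: continuous_subspaceT; exact: fdens_continuous.
- by move=> n; apply: le_lt_trans nu_fin; apply: le_measure; rewrite ?inE.
- by move=> n k nk; rewrite lerN2 ler_nat.
- by move=> n k nk; rewrite ler_nat.
- move=> x _; exists (Num.bound `|x|) => //=; rewrite in_itv /=.
  have : `|x| < (Num.bound `|x|)%:R by rewrite archi_boundP.
  by rewrite ltr_norml => /andP[-> /ltW ->].
Qed.

End Inversion.

Section Portmanteau.
Context {R : realType}.
Notation mu := (@lebesgue_measure R).
Variables (nun : nat -> {measure set R -> \bar R}) (nu : {measure set R -> \bar R}).
Variable M : R.
Hypothesis nun_le : forall n, (nun n setT <= M%:E)%E.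
Hypothesis nu_le : (nu setT <= M%:E)%E.
Hypothesis cvg_cos : forall t, 0 <= t -> (fun n => fcos (nun n) t) @ \oo --> fcos nu t.
Hypothesis cvg_sin : forall t, 0 <= t -> (fun n => fsin (nun n) t) @ \oo --> fsin nu t.

Let fin_le (m : {measure set R -> \bar R}) : (m setT <= M%:E)%E -> (m setT < +oo)%E.
Proof. by move=> h; exact: le_lt_trans h (ltry _). Qed.

Let M0 : 0 <= M. Proof. by rewrite -lee_fin; apply: le_trans nu_le. Qed.

Let bnd (m : {measure set R -> \bar R}) : (m setT <= M%:E)%E ->
  forall t, `|fcos m t| + `|fsin m t| <= 2 * M.
Proof.
move=> h t; have fm := fin_le h.
have fM : fine (m setT) <= M.
  by rewrite -lee_fin fineK// ge0_fin_numE.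
have := fcos_bound fm t; have := fsin_bound fm t; lra.
Qed.

(** The damping factor [exp (- e t)] in [poisson_formula] dominates the
    integrands uniformly in [n], although the transforms themselves need not be
    integrable. *)
Lemma cvg_integral_patan e p q : 0 < e -> p <= q ->
  (fun n => \int[nun n]_x patan e p q x) @ \oo --> \int[nu]_x patan e p q x.
Proof.
move=> e0 pq.
pose psi (t : R) : R := expR (- (e * t)) * (2 * M).
pose J (m : {measure set R -> \bar R}) y :=
  \int[mu]_(t in `[0, +oo[) (expR (- (e * t)) * fker m y t).
have mE : measurable_fun setT (fun t : R => expR (- (e * t))).
  exact: continuous_measurable_fun (dderive_continuous (@dderive_expnux _ _)).
have ipsi : mu.-integrable `[0, +oo[ (EFin \o psi).
  have := integrable_expRN e0.
  have mI : measurable (`[0%R, +oo[%classic : set (measurableTypeR R)) by exact: measurable_itv.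
  move=> /(integrableZr mI (2 * M)); exact: eq_integrable.
have Jb (m : {measure set R -> \bar R}) : (m setT <= M%:E)%E -> forall y t,
    `|expR (- (e * t)) * fker m y t| <= psi t.
  move=> hm y t; rewrite normrM (ger0_norm (expR_ge0 _)) /psi ler_wpM2l ?expR_ge0//.
  by apply: le_trans (fker_le _ _ _) _; exact: bnd.
have mI (m : {measure set R -> \bar R}) : (m setT <= M%:E)%E -> forall y (D : set R),
    @measurable_fun _ _ (measurableTypeR R) R D (fun t => expR (- (e * t)) * fker m y t).
  move=> hm y D; apply: measurable_fun_lebesgue; apply: measurable_funM => //.
  by apply: measurable_fker; exact: fin_le.
have cJ (m : {measure set R -> \bar R}) : (m setT <= M%:E)%E -> continuous (J m).
  move=> hm; apply: (fint_continuous (fin_le hm) mE ipsi) => t t0.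
  by rewrite (ger0_norm (expR_ge0 _)) /psi ler_wpM2l ?expR_ge0//; exact: bnd.
have E (m : {measure set R -> \bar R}) : (m setT <= M%:E)%E ->
    \int[m]_x patan e p q x = \int[mu]_(y in `[p, q]) J m y.
  by move=> hm; rewrite poisson_formula//; exact: fin_le.
rewrite E// (_ : (fun n => \int[nun n]_x patan e p q x) =
    (fun n => \int[mu]_(y in `[p, q]) J (nun n) y)); last first.
  by apply/funext => n; exact: E.
apply: (@Rdominated_cvg _ _ _ mu `[p, q] (fun n => J (nun n)) (J nu)
    (cst (\int[mu]_(t in `[0, +oo[) psi t))) => //.
- by move=> n; apply: measurable_fun_lebesgue; exact: continuous_measurable_fun (cJ _ _).
- by apply: measurable_fun_lebesgue; exact: continuous_measurable_fun (cJ _ _).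
- move=> y _; apply: (@Rdominated_cvg _ _ _ mu `[0, +oo[
      (fun n t => expR (- (e * t)) * fker (nun n) y t) _ psi) => //.
  + by move=> n; exact: mI.
  + exact: mI.
  + move=> t; rewrite /= in_itv /= andbT => t0; apply: cvgM; first exact: cvg_cst.
    by apply: cvgD; apply: cvgM; [exact: cvg_cst|exact: cvg_cos|exact: cvg_cst|exact: cvg_sin].
  + by move=> n t _; exact: Jb.
- apply: (integrable_finite (K := `|\int[mu]_(t in `[0, +oo[) psi t|)) => //.
  exact: itv_fin.
- move=> n y _.
  have iJ : mu.-integrable `[0, +oo[ (EFin \o (fun t => expR (- (e * t)) * fker (nun n) y t)).
    by apply: (integrable_bound _ _ _ ipsi) => //; [exact: mI|move=> t _; exact: Jb].
  apply: le_trans (le_normr_Rintegral _ iJ) _ => //.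
  apply: le_Rintegral => //; first exact: (integrable_abse iJ).
  by move=> t _; exact: Jb.
Qed.

(** The smoothed indicator [patan] is at most [eta] outside an open interval and
    almost [pi] well inside it; only this one-sided comparison survives the
    limit. *)
Lemma portmanteau_open p q e : p < q -> 0 < e ->
  \forall n \near \oo, fine (nu `]p, q[%classic) - e <= fine (nun n `]p, q[%classic).
Proof.
move=> pq e0; have pi0 := pi_gt0 R.
set A := `]p, q[%classic.
have mA : measurable (A : set R) by exact: measurable_itv.
have mfin (m : {measure set R -> \bar R}) B : (m setT <= M%:E)%E -> measurable B ->
    m B \is a fin_num.
  move=> hm mB; rewrite ge0_fin_numE//; apply: le_lt_trans (fin_le hm).
  by apply: le_measure; rewrite ?inE.
have mle (m : {measure set R -> \bar R}) B : (m setT <= M%:E)%E -> measurable B ->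
    fine (m B) <= M.
  move=> hm mB; rewrite -lee_fin fineK ?mfin//; apply: le_trans hm.
  by apply: le_measure; rewrite ?inE.
pose B k : set R := `[p + 2 * k.+1%:R^-1, q - 2 * k.+1%:R^-1]%classic.
have mB k : measurable (B k) by exact: measurable_itv.
have kinv k j : (k <= j)%N -> j.+1%:R^-1 <= k.+1%:R^-1 :> R.
  by move=> kj; rewrite lef_pV2 ?posrE// ler_nat.
have AB : A = \bigcup_k B k.
  apply/seteqP; split => x; rewrite /A /B /=.
    rewrite in_itv /= => /andP[px xq].
    have m0 : 0 < Num.min (x - p) (q - x) by rewrite lt_min !subr_gt0 px.
    exists (Num.bound (2 / Num.min (x - p) (q - x))) => //=.
    rewrite in_itv /=.
    set k := Num.bound _.
    have hk : 2 / Num.min (x - p) (q - x) < k.+1%:R.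
      by rewrite (lt_trans (archi_boundP _))// ?ltr_nat// divr_ge0// ltW.
    have : 2 * k.+1%:R^-1 <= Num.min (x - p) (q - x).
      by rewrite ler_pdivrMr// mulrC -ler_pdivrMr// ltW.
    rewrite le_min; move: (k.+1%:R^-1) => r /andP[h1 h2]; apply/andP; split; lra.
  move=> [k _] /=; rewrite !in_itv /=.
  have : 0 < k.+1%:R^-1 :> R by rewrite invr_gt0.
  by move: (k.+1%:R^-1) => r h /andP[h1 h2]; apply/andP; split; lra.
have cB : (fun k => nu (B k)) @ \oo --> nu A.
  rewrite AB; apply: nondecreasing_cvg_mu => //; first by rewrite -AB.
  move=> k j kj; apply/subsetPset => x; rewrite /B /= !in_itv /=.
  by have := kinv _ _ kj; move: (k.+1%:R^-1) (j.+1%:R^-1) => r1 r2 h /andP[h1 h2]; apply/andP; split; lra.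
pose e1 := e / 8.
have e10 : 0 < e1 by rewrite divr_gt0.
have {}cB : (fun k => fine (nu (B k))) @ \oo --> fine (nu A).
  by apply: fine_cvg; rewrite fineK ?mfin.
have [k Hk] : exists k, fine (nu A) - e1 <= fine (nu (B k)).
  have : \forall k \near \oo, `|fine (nu A) - fine (nu (B k))| < e1.
    exact: (@cvgr_dist_lt _ _ _ _ _ _ _ cB _ e10).
  case=> k0 _ H; exists k0; have := H k0 (leqnn _).
  by rewrite ltr_norml => /andP[_]; lra.
have shrink (x : R) : 0 < x -> p + 2 * x <= q - 2 * x -> p + x <= q - x.
  by move=> x0 h; lra.
have [qBp|pBq] := ltP (q - 2 * k.+1%:R^-1) (p + 2 * k.+1%:R^-1).
  (* the shrunken interval is empty: the whole mass is small *)
  move: Hk; rewrite /B set_itv_ge ?measure0; last by rewrite bnd_simp -ltNge.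
  move=> Hk; apply: nearW => n; apply: (@le_trans _ _ 0); last exact: fine_ge0.
  by rewrite /= in Hk; rewrite /e1 in Hk; lra.
pose d : R := k.+1%:R^-1.
have d0 : 0 < d by rewrite invr_gt0.
(* eta bounds the error of the smoothed indicator; integrated against a mass at
   most M it costs at most e1 *)
pose eta := e1 / (M + 1).
have eta0 : 0 < eta by rewrite divr_gt0// ltr_wpDl.
have etaM : eta * M <= e1.
  by rewrite /eta mulrAC ler_pdivrMr ?ltr_wpDl//; nra.
have [ep ep0 Hep] : exists2 ep : R, 0 < ep & pi / 2 - atan (d / ep) <= eta.
  have h : \forall x \near +oo, `|pi / 2 - atan x| < eta.
    exact: (@cvgr_dist_lt _ _ _ _ _ _ _ (@cvgy_atan R) _ eta0).
  have [x [x0 Hx]] : exists x, 0 < x /\ `|pi / 2 - atan x| < eta.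
    near (+oo : set_system R) => x.
    exists x; split; [near: x; exact: nbhs_pinfty_gt|near: x; exact: h].
  exists (d / x); first by rewrite divr_gt0.
  rewrite (_ : d / (d / x) = x); last by field; rewrite !gt_eqF.
  by move: Hx; rewrite ltr_norml => /andP[_ /ltW].
pose K := patan ep (p + d) (q - d).
have pdq : p + d <= q - d by exact: shrink d0 pBq.
have K0 x : 0 <= K x by exact: patan_ge0.
have mK : measurable_fun setT K by exact: continuous_measurable_fun (@patan_continuous _ _ _ _).
have KA x : K x <= pi * \1_A x + eta.
  have [xA|xA] := pselect (A x).
    by rewrite indicE mem_set//= mulr1 ler_wpDr ?(ltW eta0)// patan_le.
  rewrite indicE memNset//= mulr0 add0r; apply: le_trans Hep.
  rewrite /K /patan.
  have hN : atan (- (d / ep)) = - atan (d / ep) by rewrite atanN.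
  have [xp|px] := leP x p.
    have : atan (d / ep) <= atan ((p + d - x) / ep).
      by apply: le_atan; rewrite ler_pM2r ?invr_gt0//; lra.
    by have := atan_ltpi2 ((q - d - x) / ep); lra.
  have qx : q <= x.
    by rewrite leNgt; apply/negP => xq; apply: xA; rewrite /A /= in_itv /= px xq.
  have : atan ((q - d - x) / ep) <= atan (- (d / ep)).
    by apply: le_atan; rewrite -mulNr ler_pM2r ?invr_gt0//; lra.
  by have := atan_gtNpi2 ((p + d - x) / ep); lra.
have KB x : (pi - 2 * eta) * \1_(B k) x <= K x.
  have [xB|xB] := pselect (B k x); last by rewrite indicE memNset//= mulr0.
  rewrite indicE mem_set//= mulr1.
  move: xB; rewrite /B /= in_itv /= -/d => /andP[h1 h2].
  have a1 : atan (d / ep) <= atan ((q - d - x) / ep).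
    by apply: le_atan; rewrite ler_pM2r ?invr_gt0//; lra.
  have a2 : atan ((p + d - x) / ep) <= - atan (d / ep).
    by rewrite -atanN; apply: le_atan; rewrite -mulNr ler_pM2r ?invr_gt0//; lra.
  by rewrite /K /patan; lra.
have iK (m : {measure set R -> \bar R}) : (m setT <= M%:E)%E -> m.-integrable setT (EFin \o K).
  move=> hm; apply: (integrable_finite (K := pi)) => //; first exact: fin_le.
  by move=> x _; rewrite ger0_norm// patan_le.
have ii (m : {measure set R -> \bar R}) C : (m setT <= M%:E)%E -> measurable C ->
    m.-integrable setT (EFin \o (\1_C : R -> R)).
  move=> hm mC; apply: (integrable_finite (K := 1)) => //; first exact: fin_le.
  by move=> x _; rewrite indicE; case: (_ \in _); rewrite ?normr1 ?normr0.
have iind (m : {measure set R -> \bar R}) C : measurable C ->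
    \int[m]_x (\1_C x : R) = fine (m C).
  by move=> mC; rewrite /Rintegral integral_indic// setIT.
have lowK : (pi - 2 * eta) * fine (nu (B k)) <= \int[nu]_x K x.
  rewrite -iind// -RintegralZl//; last exact: ii.
  apply: le_Rintegral => //; last exact: iK.
  by have := integrableZl measurableT (pi - 2 * eta) (ii _ _ nu_le (mB k)); exact: eq_integrable.
have upK n : \int[nun n]_x K x <= pi * fine (nun n A) + eta * M.
  have i1 : (nun n).-integrable setT (EFin \o (fun x => pi * \1_A x)).
    by have := integrableZl measurableT (pi : R) (ii _ _ (nun_le n) mA); exact: eq_integrable.
  have i2 : (nun n).-integrable setT (EFin \o (fun _ : R => eta)).
    by apply: (integrable_finite (K := `|eta|)) => //; exact: fin_le.
  apply: le_trans (le_Rintegral _ (iK _ (nun_le n)) (integrableD measurableT i1 i2) _) _ => //.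
  rewrite RintegralD// RintegralZl//; last exact: ii.
  rewrite iind// Rintegral_cst// lerD2l ler_wpM2l ?(ltW eta0)//.
  exact: mle.
have := cvg_integral_patan ep0 pdq => cK.
have : \forall n \near \oo, `|\int[nu]_x K x - \int[nun n]_x K x| < e1.
  exact: (@cvgr_dist_lt _ _ _ _ _ _ _ cK _ e10).
apply: filterS => n; rewrite ltr_norml => /andP[_ hn].
have h1 := upK n.
have hB : fine (nu (B k)) <= M by exact: mle.
have hB0 : 0 <= fine (nu (B k)) by exact: fine_ge0.
have h2 : eta * fine (nu (B k)) <= e1 by nra.
have h3 : pi * (fine (nu (B k)) - fine (nun n A)) <= 4 * e1.
  by rewrite mulrBr; lra.
have pi2 : 2 <= pi :> R by have := pi_ge2 R.
have : fine (nu (B k)) - fine (nun n A) <= 2 * e1 by nra.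
by rewrite /e1 in Hk *; lra.
Unshelve. all: by end_near. Qed.

End Portmanteau.

(** * Complex integrals and Laplace transforms *)

Section ComplexIntegral.
Context d (T : measurableType d) (R : realType).
Variables (m : {measure set T -> \bar R}) (D : set T).
Hypothesis mD : measurable D.
Implicit Types f g : T -> R[i].

Definition cintegrable f : Prop :=
  m.-integrable D (fun x => (cRe (f x))%:E) /\ m.-integrable D (fun x => (cIm (f x))%:E).

Definition cmeasurable f : Prop :=
  measurable_fun D (fun x => cRe (f x)) /\ measurable_fun D (fun x => cIm (f x)).

Lemma cintegrable_bound f (g : T -> R) : cmeasurable f ->
  (forall x, D x -> cmod (f x) <= g x) -> m.-integrable D (EFin \o g) -> cintegrable f.
Proof.
move=> [m1 m2] fg ig; split.
  by apply: (integrable_bound mD m1 _ ig) => x Dx; apply: le_trans (normRe_le _) (fg x Dx).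
by apply: (integrable_bound mD m2 _ ig) => x Dx; apply: le_trans (normIm_le _) (fg x Dx).
Qed.

Lemma cintegrable_measurable f : cintegrable f -> cmeasurable f.
Proof.
by move=> [/integrableP[/measurable_EFinP ? _] /integrableP[/measurable_EFinP ? _]].
Qed.

Lemma cintegralD f g : cintegrable f -> cintegrable g ->
  cintegral m D (fun x => f x + g x) = cintegral m D f + cintegral m D g.
Proof.
move=> [f1 f2] [g1 g2]; rewrite /cintegral; apply: complexP => /=.
  by under eq_Rintegral do rewrite cReD; rewrite RintegralD.
by under eq_Rintegral do rewrite cImD; rewrite RintegralD.
Qed.

Lemma cintegrableD f g : cintegrable f -> cintegrable g ->
  cintegrable (fun x => f x + g x).
Proof.
move=> [f1 f2] [g1 g2]; split.
  by apply: eq_integrable (integrableD mD f1 g1) => // x _; rewrite cReD.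
by apply: eq_integrable (integrableD mD f2 g2) => // x _; rewrite cImD.
Qed.

Lemma cintegrableZ c f : cintegrable f -> cintegrable (fun x => c * f x).
Proof.
move=> [f1 f2]; split.
  apply: eq_integrable (integrableB mD (integrableZl mD (cRe c) f1)
    (integrableZl mD (cIm c) f2)) => // x _.
  by rewrite /= cReM.
apply: eq_integrable (integrableD mD (integrableZl mD (cRe c) f2)
  (integrableZl mD (cIm c) f1)) => // x _.
by rewrite /= cImM.
Qed.

Lemma cintegralZ c f : cintegrable f ->
  cintegral m D (fun x => c * f x) = c * cintegral m D f.
Proof.
move=> [f1 f2]; have Z (k : R) h : m.-integrable D (fun x => (h x)%:E) ->
  m.-integrable D (fun x => (k * h x)%:E) by move=> /(integrableZl mD k).
rewrite /cintegral; apply: complexP; rewrite !cE /=.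
  under eq_Rintegral do rewrite cReM.
  by rewrite RintegralB//; [rewrite !RintegralZl|exact: Z|exact: Z].
under eq_Rintegral do rewrite cImM.
by rewrite RintegralD//; [rewrite !RintegralZl|exact: Z|exact: Z].
Qed.

Lemma cmod_cintegral f (g : T -> R) : cmeasurable f ->
  (forall x, D x -> cmod (f x) <= g x) -> m.-integrable D (EFin \o g) ->
  cmod (cintegral m D f) <= 2 * \int[m]_(x in D) g x.
Proof.
move=> mf fg ig; have [f1 f2] := cintegrable_bound mf fg ig.
have aux (h : T -> R) : m.-integrable D (EFin \o h) ->
    (forall x, D x -> `|h x| <= g x) -> `|\int[m]_(x in D) h x| <= \int[m]_(x in D) g x.
  move=> ih hg; apply: le_trans (le_normr_Rintegral mD ih) _.
  by apply: le_Rintegral => //; have := integrable_norm ih.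
apply: le_trans (cmod_le _) _; rewrite mulr_natl mulr2n; apply: lerD.
  by apply: aux => // x Dx; apply: le_trans (normRe_le _) (fg x Dx).
by apply: aux => // x Dx; apply: le_trans (normIm_le _) (fg x Dx).
Qed.

End ComplexIntegral.

Section Laplace.
Context d (T : measurableType d) (R : realType).
Variables (m : {measure set T -> \bar R}) (w xi : T -> R).
Hypotheses (mw : measurable_fun setT w) (mxi : measurable_fun setT xi)
  (w0 : forall t, 0 <= w t) (xi0 : forall t, 0 <= xi t)
  (iw : forall l : R, 0 < l ->
     m.-integrable setT (fun t => (w t * expR (- (l * xi t)))%:E)).

Definition laplace k (z : R[i]) : R[i] :=
  cintegral m setT (fun t => (w t * xi t ^+ k)%:C * cexp (- z * (xi t)%:C)).

(** The [k]-th power of [e x <= exp (e x)], with [e] small enough for [k e <=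
    l]. *)
Lemma exp_dominates_power (k : nat) (l : R) : 0 < l ->
  exists2 C, 0 <= C & forall x, 0 <= x -> x ^+ k <= C * expR (l * x).
Proof.
move=> l0; pose e := l / k.+1%:R; have e0 : 0 < e by rewrite divr_gt0.
exists (e^-1 ^+ k); first by rewrite exprn_ge0// invr_ge0 ltW.
move=> x x0; apply: (@le_trans _ _ ((e^-1 * expR (e * x)) ^+ k)).
  apply: lerXn2r; rewrite ?nnegrE//; first by rewrite mulr_ge0 ?invr_ge0 ?expR_ge0 ?(ltW e0).
  rewrite -[leLHS](mulKf (lt0r_neq0 e0)) ler_pM2l ?invr_gt0//.
  by apply: le_trans (expR_ge1Dx _); rewrite lerDr.
rewrite exprMn -expRM_natl ler_wpM2l ?exprn_ge0 ?invr_ge0 ?(ltW e0)// ler_expR.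
rewrite mulrA ler_wpM2r// /e mulrCA ger_pMr// ler_pdivrMr// mul1r ler_nat.
exact: leqnSn.
Qed.

Lemma integrable_moment k l : 0 < l ->
  m.-integrable setT (fun t => (w t * xi t ^+ k * expR (- (l * xi t)))%:E).
Proof.
move=> l0; have l20 : 0 < l / 2 by rewrite divr_gt0.
have [C C0 HC] := exp_dominates_power k l20.
have iC : m.-integrable setT (EFin \o (fun t => C * (w t * expR (- (l / 2 * xi t))))).
  by have := integrableZl measurableT C (iw l20); exact: eq_integrable.
apply: (integrable_bound measurableT _ _ iC).
  apply: measurable_funM; first by apply: measurable_funM => //; exact: measurable_funX.
  by apply: measurableT_comp => //; apply: measurableT_comp => //; exact: measurable_funM.
move=> t _; rewrite ger0_norm; last by rewrite !mulr_ge0 ?exprn_ge0 ?expR_ge0.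
rewrite mulrCA -mulrA ler_wpM2l//.
have -> : expR (- (l * xi t)) = expR (- (l / 2 * xi t)) * expR (- (l / 2 * xi t)).
  by rewrite -expRD; congr expR; field.
rewrite mulrA ler_wpM2r ?expR_ge0//.
rewrite expRN -ler_pdivlMr ?invr_gt0 ?expR_gt0// invrK; exact: HC.
Qed.

Let mterm k z : cmeasurable setT (fun t => (w t * xi t ^+ k)%:C * cexp (- z * (xi t)%:C)).
Proof.
have mZ (a : R) : measurable_fun setT (fun t => a * xi t) by exact: measurable_funM.
have mk : measurable_fun setT (fun t => w t * xi t ^+ k).
  by apply: measurable_funM => //; exact: measurable_funX.
have me : measurable_fun setT (fun t => expR (cRe (- z) * xi t)) by exact: measurableT_comp.
have mc : measurable_fun setT (fun t => cos (cIm (- z) * xi t)).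
  by apply: measurableT_comp => //; exact: continuous_measurable_fun (@continuous_cos R).
have ms : measurable_fun setT (fun t => sin (cIm (- z) * xi t)).
  by apply: measurableT_comp => //; exact: continuous_measurable_fun (@continuous_sin R).
split.
  under eq_fun do rewrite cReZ /cexp /= cReZr cImZr.
  exact: (measurable_funM mk (measurable_funM me mc)).
under eq_fun do rewrite cImZ /cexp /= cReZr cImZr.
exact: (measurable_funM mk (measurable_funM me ms)).
Qed.

Let termE k z t : cmod ((w t * xi t ^+ k)%:C * cexp (- z * (xi t)%:C)) =
  w t * xi t ^+ k * expR (- (cRe z * xi t)).
Proof.
rewrite cmodM cmod_real ger0_norm ?mulr_ge0 ?exprn_ge0// cmod_cexp cReZr cReN.
by rewrite mulNr.
Qed.

Lemma cintegrable_laplace k z : 0 < cRe z ->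
  cintegrable m setT (fun t => (w t * xi t ^+ k)%:C * cexp (- z * (xi t)%:C)).
Proof.
move=> z0; apply: (cintegrable_bound measurableT (mterm k z) _ (integrable_moment k z0)).
by move=> t _; rewrite termE.
Qed.

(** Differentiation under the integral sign. For [|h| < Re z / 2] the quadratic
    remainder of [cexp] is dominated by the moment of order [k + 2] at the
    abscissa [Re z / 2]. *)
Lemma qdiff_laplace k z : 0 < cRe z -> qdiff (laplace k) z (- laplace k.+1 z).
Proof.
move=> z0; pose l := cRe z / 2; have l0 : 0 < l by rewrite divr_gt0.
pose I := \int[m]_t (w t * xi t ^+ k.+2 * expR (- (l * xi t))).
exists (10 * I), l => // h hl.
have zh0 : 0 < cRe (z + h).
  by rewrite cReD; have := normRe_le h; rewrite ler_norml => /andP[+ _]; rewrite /l in hl; lra.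
pose e j y t : R[i] := (w t * xi t ^+ j)%:C * cexp (- y * (xi t)%:C).
have iA : cintegrable m setT (e k (z + h)) by exact: cintegrable_laplace.
have iB : cintegrable m setT (fun t => -1 * e k z t).
  by apply: cintegrableZ => //; exact: cintegrable_laplace.
have iC : cintegrable m setT (fun t => h * e k.+1 z t).
  by apply: cintegrableZ => //; exact: cintegrable_laplace.
have iAB := cintegrableD measurableT iA iB.
have iABC := cintegrableD measurableT iAB iC.
pose rem t : R[i] := e k (z + h) t + -1 * e k z t + h * e k.+1 z t.
have remE t : rem t = e k z t * (cexp (- h * (xi t)%:C) - 1 - (- h * (xi t)%:C)).
  by rewrite /rem /e opprD mulrDl cexpD exprSr !real_complexM; ring.
have -> : laplace k (z + h) - laplace k z - h * - laplace k.+1 z = cintegral m setT rem.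
  rewrite mulrN opprK -[- laplace k z]mulN1r /rem !cintegralD// !cintegralZ//;
  exact: cintegrable_laplace.
have iI : m.-integrable setT
    (EFin \o (fun t => 5 * cmod h ^+ 2 * (w t * xi t ^+ k.+2 * expR (- (l * xi t))))).
  by have := integrableZl measurableT (5 * cmod h ^+ 2) (integrable_moment k.+2 l0); exact: eq_integrable.
have -> : 10 * I * cmod h ^+ 2 = 2 *
   \int[m]_t (5 * cmod h ^+ 2 * (w t * xi t ^+ k.+2 * expR (- (l * xi t)))).
  by rewrite RintegralZl//; [rewrite /I; ring|exact: integrable_moment].
apply: cmod_cintegral => //; first exact: cintegrable_measurable iABC.
move=> t _; rewrite remE cmodM termE.
set u := - h * _.
have cu : cmod u = cmod h * xi t.
  by rewrite /u cmodM cmodN cmod_real ger0_norm.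
have := cexp_bound2 u; rewrite cu => H.
have e2 : expR (- (cRe z * xi t)) * expR (cmod h * xi t) <= expR (- (l * xi t)).
  rewrite -expRD ler_expR -mulNr -mulrDl -mulNr ler_wpM2r//.
  by rewrite /l in hl *; lra.
have p0 : 0 <= w t * xi t ^+ k by rewrite mulr_ge0 ?exprn_ge0.
have E0 := expR_ge0 (- (cRe z * xi t)).
apply: le_trans (ler_wpM2l _ H) _; first by rewrite mulr_ge0.
rewrite [leLHS](_ : _ = 5 * cmod h ^+ 2 * (w t * xi t ^+ k.+2) *
   (expR (- (cRe z * xi t)) * expR (cmod h * xi t))); last first.
  by rewrite (exprSr _ k.+1) (exprSr _ k); ring.
rewrite [leRHS](_ : _ = 5 * cmod h ^+ 2 * (w t * xi t ^+ k.+2) * expR (- (l * xi t)));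
  last by ring.
apply: ler_wpM2l => //; rewrite mulr_ge0//; last by rewrite mulr_ge0 ?exprn_ge0.
by rewrite mulr_ge0 ?sqr_ge0.
Qed.

Section LaplaceFourier.
Variables (k : nat) (l : R).
Hypothesis l0 : 0 < l.

Definition tilt t : R := w t * xi t ^+ k * expR (- (l * xi t)).

Lemma measurable_tilt : measurable_fun setT tilt.
Proof.
apply: measurable_funM; first by apply: measurable_funM => //; exact: measurable_funX.
by apply: measurableT_comp => //; apply: measurableT_comp => //; exact: measurable_funM.
Qed.

Lemma tilt_ge0 t : 0 <= tilt t.
Proof. by rewrite !mulr_ge0 ?exprn_ge0 ?expR_ge0. Qed.

(** A finite measure, whose Fourier transform is the restriction of [laplace k]
    to the vertical line [Re z = l]: see [laplace_fcos] and [laplace_fsin]. *)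
Definition tilted : {measure set R -> \bar R} := wlaw m measurable_tilt tilt_ge0 mxi.

Lemma tilted_fin : (tilted setT < +oo)%E.
Proof.
have /integrableP[_] := integrable_moment k l0.
rewrite /tilted /= /wlaw preimage_setT; apply: le_lt_trans.
rewrite le_eqVlt; apply/orP; left; apply/eqP; apply: eq_integral => t _ /=.
by rewrite ger0_norm ?tilt_ge0.
Qed.

Let integrable_tilt (f : R -> R) : measurable_fun setT f -> (forall x, `|f x| <= 1) ->
  m.-integrable setT (fun t => (tilt t * f (xi t))%:E).
Proof.
move=> mf f1; apply: (integrable_bound measurableT _ _ (integrable_moment k l0)).
  by apply: measurable_funM; [exact: measurable_tilt|exact: measurableT_comp].
by move=> t _; rewrite normrM (ger0_norm (tilt_ge0 t)) ler_piMr ?tilt_ge0.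
Qed.

Lemma laplace_fcos t : cRe (laplace k (l +i* t)) = fcos tilted t.
Proof.
have mc : measurable_fun setT (fun x : R => cos (t * x)).
  apply: measurableT_comp; first exact: continuous_measurable_fun (@continuous_cos R).
  exact: measurable_funM.
rewrite /fcos /tilted integral_wlaw//; last first.
  by apply: (integrable_tilt mc) => x; rewrite ler_norml cos_geN1 cos_le1.
rewrite /laplace /cintegral /=; apply: eq_Rintegral => s _.
have -> : - l * xi s - - t * 0 = - (l * xi s) by ring.
have -> : - l * 0 + - t * xi s = - (t * xi s) by ring.
by rewrite cosN /tilt mul0r subr0 mulrA.
Qed.

Lemma laplace_fsin t : cIm (laplace k (l +i* t)) = - fsin tilted t.
Proof.
have mc : measurable_fun setT (fun x : R => sin (t * x)).
  apply: measurableT_comp; first exact: continuous_measurable_fun (@continuous_sin R).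
  exact: measurable_funM.
have it : m.-integrable setT (fun s => (tilt s * sin (t * xi s))%:E).
  by apply: (integrable_tilt mc) => x; rewrite ler_norml sin_geN1 sin_le1.
rewrite /fsin /tilted integral_wlaw// -[RHS]mulN1r -RintegralZl//.
rewrite /laplace /cintegral /=; apply: eq_Rintegral => s _.
have -> : - l * xi s - - t * 0 = - (l * xi s) by ring.
have -> : - l * 0 + - t * xi s = - (t * xi s) by ring.
by rewrite sinN /tilt mul0r addr0; ring.
Qed.

End LaplaceFourier.

End Laplace.

(** * The gamma function *)

Section HalfLineFTC.
Context {R : realType}.
Notation mu := (@lebesgue_measure R).

Lemma Rintegral_FTC_itv (F f : R -> R) (p q : R) : p <= q ->
  (forall x, p <= x -> x <= q -> is_derive x (1 : R) F (f x)) ->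
  (forall x, p <= x -> x <= q -> {for x, continuous f}) ->
  \int[mu]_(x in `[p, q]) f x = F q - F p.
Proof.
rewrite le_eqVlt => /predU1P[<- _ _|pq dF cf].
  by rewrite subrr set_itv1 Rintegral_set1.
have cF x : p <= x -> x <= q -> {for x, continuous F}.
  move=> px xq; apply: differentiable_continuous; apply/derivable1_diffP.
  by case: (dF x px xq).
rewrite /Rintegral (@continuous_FTC2 _ f F)//.
- apply: continuous_in_subspaceT => x; rewrite inE /= in_itv /= => /andP[? ?].
  exact: cf.
- split => [x||].
  + by rewrite in_itv /= => /andP[px xq]; case: (dF x (ltW px) (ltW xq)).
  + exact: cvg_at_right_filter (cF p (lexx _) (ltW pq)).
  + exact: cvg_at_left_filter (cF q (ltW pq) (lexx _)).
- by move=> x; rewrite in_itv /= derive1E => /andP[px xq]; case: (dF x (ltW px) (ltW xq)).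
Qed.

Lemma cvg_harmonic0 : (fun n => n.+1%:R^-1 : R) @ \oo --> (0 : R).
Proof. exact: cvg_harmonic. Qed.

(** The integrand may be singular at 0, so the half-line is exhausted by the
    segments from [1 / (n + 1)] to [n + 1]. *)
Lemma Rintegral_FTC_pos (F f : R -> R) (a b : R) :
  (forall x : R, 0 < x -> is_derive x (1 : R) F (f x)) ->
  (forall x : R, 0 < x -> {for x, continuous f}) ->
  mu.-integrable `]0%R, +oo[ (EFin \o f) ->
  (fun n => F n.+1%:R^-1) @ \oo --> a -> (fun n => F n.+1%:R) @ \oo --> b ->
  \int[mu]_(x in `]0%R, +oo[) f x = b - a.
Proof.
move=> dF cf intf Fa Fb.
pose I n : set R := `[n.+1%:R^-1, n.+1%:R]%classic.
have mI n : measurable (I n : set (measurableTypeR R)) by exact: measurable_itv.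
have I0 n : 0 < n.+1%:R^-1 :> R by rewrite invr_gt0.
have Ile n : n.+1%:R^-1 <= n.+1%:R :> R.
  by rewrite invf_ple ?posrE//; apply: (@le_trans _ _ 1); rewrite ?invf_le1 ?ler1n.
have mf : measurable_fun (`]0%R, +oo[ : set (measurableTypeR R)) f.
  by case/integrableP : intf => /measurable_EFinP.
have E n : \int[mu]_(x in `]0%R, +oo[) (f \_ (I n)) x = F n.+1%:R - F n.+1%:R^-1.
  rewrite -Rintegral_mkcondr (_ : _ `&` _ = I n); last first.
    apply/setIidPr => x; rewrite /I /= !in_itv /= andbT => /andP[h _].
    exact: lt_le_trans h.
  by apply: Rintegral_FTC_itv => // x h1 h2; [apply: dF|apply: cf]; exact: lt_le_trans h1.
have c1 : (fun n => \int[mu]_(x in `]0%R, +oo[) (f \_ (I n)) x) @ \oo --> b - a.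
  by under eq_fun do rewrite E; exact: cvgB.
have c2 : (fun n => \int[mu]_(x in `]0%R, +oo[) (f \_ (I n)) x) @ \oo -->
    \int[mu]_(x in `]0%R, +oo[) f x.
  apply: (@Rdominated_cvg _ _ (measurableTypeR R) mu _ _ f (fun x => `|f x|)) => //.
  - move=> n; apply: (iffLR (measurable_restrict _ _ _)) => //.
    by apply: (measurable_funS _ _ mf) => // x [].
  - move=> x; rewrite /= in_itv /= andbT => x0.
    apply: cvg_near_cst.
    exists (Num.bound x + Num.bound x^-1)%N => // n /= hn.
    have h1 : x <= n.+1%:R.
      apply: le_trans (ltW (archi_boundP (ltW x0))) _; rewrite ler_nat.
      by apply: leq_trans (leqW hn); exact: leq_addr.
    have h2 : n.+1%:R^-1 <= x.
      rewrite invf_ple ?posrE//.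
      apply: le_trans (ltW (archi_boundP _)) _; first by rewrite invr_ge0 ltW.
      by rewrite ler_nat; apply: leq_trans (leqW hn); exact: leq_addl.
    by rewrite patchE mem_set//= /I /= in_itv /= h1 h2.
  - by have := integrable_norm intf.
  - by move=> n x _; rewrite patchE; case: ifP; rewrite ?normr0.
exact: (cvg_unique _ c2 c1).
Qed.

End HalfLineFTC.

Section ZeroDerivative.
Context {R : realType}.

Lemma dderive0_quadratic (phi : R -> R) (t C e : R) : 0 < e ->
  (forall h, `|h| < e -> `|phi (t + h) - phi t| <= C * h ^+ 2) ->
  is_derive t (1 : R) phi 0.
Proof.
move=> e0 H.
have lim : (fun h => h^-1 *: (phi (h *: 1 + t) - phi t)) @ (0 : R)^' --> (0 : R).
  apply/cvgr0Pnorm_lt => eps eps0.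
  have d0 : 0 < Num.min e (eps / (`|C| + 1)) by rewrite lt_min e0 divr_gt0// ltr_wpDl.
  exists (Num.min e (eps / (`|C| + 1))) => //= h.
  rewrite /ball_ /= sub0r normrN lt_min => /andP[he heps] h0.
  rewrite normrM normfV [h *: 1]mulr1 addrC (addrC h).
  rewrite mulrC ltr_pdivrMr ?normr_gt0//.
  rewrite addrC; apply: le_lt_trans (H h he) _.
  rewrite ltr_pdivlMr ?ltr_wpDl// in heps.
  have h0' : 0 < `|h| by rewrite normr_gt0.
  rewrite -[h ^+ 2]real_normK ?num_real//.
  apply: (@le_lt_trans _ _ (`|C| * `|h| ^+ 2)).
    by rewrite ler_wpM2r ?exprn_ge0// ler_norm.
  by rewrite expr2 mulrA ltr_pM2r//; have := normr_ge0 C; nra.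
apply: DeriveDef; first by apply/cvg_ex; exists 0; exact: lim.
by apply: cvg_lim => //; exact: lim.
Qed.

(** Along the segment from 1 to [z], the real and imaginary parts of [G] have
    zero derivative. *)
Lemma qdiff0_cst (G : R[i] -> R[i]) : (forall z, 0 < cRe z -> qdiff G z 0) ->
  forall z, 0 < cRe z -> G z = G 1.
Proof.
move=> dG z z0.
have seg (f : R[i] -> R) : (forall u v, `|f u - f v| <= cmod (u - v)) -> f (G z) = f (G 1).
  move=> fle; pose phi (t : R) := f (G (1 + t%:C * (z - 1))).
  have d (t : R) : 0 <= t -> t <= 1 -> is_derive t (1 : R) phi 0.
    move=> t0 t1; set y := 1 + t%:C * (z - 1).
    have y0 : 0 < cRe y.
      rewrite /y cReD cReZ cReD cReN /=.
      by have [->|t1'] := eqVneq t 1; [lra|have : t < 1; [rewrite lt_neqAle t1' t1|nra]].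
    have [C [e [C0 e0 _ H]]] := qdiff_pos (dG y y0).
    pose k := cmod (z - 1); have k0 : 0 <= k := cmod_ge0 _.
    apply: (@dderive0_quadratic _ t (C * k ^+ 2) (e / (k + 1))).
      by rewrite divr_gt0// ltr_wpDl.
    move=> h; rewrite ltr_pdivlMr ?ltr_wpDl// => he.
    have hk : cmod (h%:C * (z - 1)) = `|h| * k by rewrite cmodM cmod_real.
    apply: le_trans (fle _ _) _.
    have := H (h%:C * (z - 1)); rewrite mulr0 subr0 hk.
    rewrite [in 1 + (t + h)%:C * _]real_complexD mulrDl addrA => H'.
    apply: le_trans (H' _) _; first by have := normr_ge0 h; nra.
    by rewrite exprMn real_normK ?num_real// mulrCA mulrC.
  have [||c _] := @MVT _ phi (fun=> 0) 0 1 ltr01.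
  - by move=> x; rewrite in_itv /= => /andP[a b]; apply: d; exact: ltW.
  - apply: continuous_in_subspaceT => x; rewrite inE /= in_itv /= => /andP[a b].
    by apply: differentiable_continuous; apply/derivable1_diffP; case: (d x a b).
  rewrite mul0r => /eqP; rewrite subr_eq0 => /eqP.
  by rewrite /phi !mul0r addr0 mul1r addrC subrK.
apply: complexP; apply: seg => u v.
  by rewrite -cReN -cReD; exact: normRe_le.
by rewrite -cImN -cImD; exact: normIm_le.
Qed.

Lemma qdiffM (f g : R[i] -> R[i]) z l m : qdiff f z l -> qdiff g z m ->
  qdiff (fun w => f w * g w) z (l * g z + f z * m).
Proof.
move=> /qdiff_pos[C [e [C0 e0 e1 H]]] /qdiff_pos[D [d [D0 d0 d1 K]]].
exists (C * (cmod (g z) + cmod m + D) + cmod l * (cmod m + D) + cmod (f z) * D), (Num.min e d).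
  by rewrite lt_min e0.
move=> h; rewrite lt_min => /andP[he hd].
have -> : f (z + h) * g (z + h) - f z * g z - h * (l * g z + f z * m) =
  (f (z + h) - f z - h * l) * g (z + h) + h * l * (g (z + h) - g z) +
  f z * (g (z + h) - g z - h * m) by ring.
have hr := cmod_ge0 h; have h1 : cmod h <= 1 by exact: le_trans (ltW hd) d1.
have Kh := K h hd; have Hh := H h he.
have gd : cmod (g (z + h) - g z) <= (cmod m + D) * cmod h.
  have -> : g (z + h) - g z = h * m + (g (z + h) - g z - h * m) by ring.
  apply: le_trans (cmodD _ _) _; rewrite cmodM mulrDl mulrC lerD2l.
  by apply: le_trans Kh _; rewrite ler_wpM2l// expr2 ler_piMr.
have gh : cmod (g (z + h)) <= cmod (g z) + cmod m + D.
  have -> : g (z + h) = g z + (g (z + h) - g z) by ring.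
  apply: le_trans (cmodD _ _) _; rewrite -addrA lerD2l; apply: le_trans gd _.
  by rewrite ler_piMr// addr_ge0// cmod_ge0.
apply: le_trans (cmodD _ _) _; rewrite [leRHS]mulrDl; apply: lerD; last first.
  by rewrite cmodM -mulrA ler_wpM2l ?cmod_ge0.
apply: le_trans (cmodD _ _) _; rewrite [leRHS]mulrDl; apply: lerD; rewrite !cmodM.
  rewrite mulrAC; apply: ler_pM => //; exact: cmod_ge0.
rewrite [leRHS](_ : _ = cmod l * ((cmod m + D) * cmod h) * cmod h); last by ring.
rewrite [leLHS](_ : _ = cmod l * cmod (g (z + h) - g z) * cmod h); last by ring.
by rewrite ler_wpM2r// ler_wpM2l// cmod_ge0.
Qed.

End ZeroDerivative.

Section GammaIntegrals.
Context {R : realType}.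
Notation mu := (@lebesgue_measure R).

Lemma lebesgue_measurable_itv (i : interval R) :
  measurable ([set` i] : set (measurableTypeR R)).
Proof. exact: measurable_itv. Qed.

Lemma dderive_powR (a x : R) : 0 < x ->
  is_derive x (1 : R) (fun x => x `^ a) (a * x `^ (a - 1)).
Proof.
move=> x0; have xin : x \in `]0, +oo[ by rewrite in_itv /= x0.
split; first exact: derivable_powR.
by rewrite -derive1E powR_derive1.
Qed.

Lemma dderive_continuous_at (f : R -> R) (x df : R) :
  is_derive x (1 : R) f df -> {for x, continuous f}.
Proof.
by move=> [d _]; apply: differentiable_continuous; apply/derivable1_diffP.
Qed.

Lemma powR_le_expR (a l : R) : 0 <= a -> 0 < l ->
  exists2 C, 0 <= C & forall x, 0 < x -> x `^ a <= C * expR (l * x).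
Proof.
move=> a0 l0; have [C C0 HC] := exp_dominates_power (Num.bound a) l0.
exists (1 + C); first by rewrite addr_ge0.
move=> x x0; have e1 : 1 <= expR (l * x) by rewrite -expR0 ler_expR mulr_ge0// ltW.
have [x1|x1] := leP x 1.
  have : x `^ a <= 1 `^ a by rewrite ge0_ler_powR// nnegrE// ltW.
  rewrite powR1 => h; apply: (le_trans h); nra.
apply: (@le_trans _ _ (x ^+ Num.bound a)).
  by rewrite -powR_mulrn ?(ltW x0)// ler_powR ?(ltW x1)// ltW// archi_boundP.
by apply: le_trans (HC x (ltW x0)) _; rewrite ler_wpM2r ?expR_ge0// lerDr.
Qed.

(** The gamma density and the identity are extended by zero to the negative
    half-line, because [laplace] asks for a nonnegative weight and a
    nonnegative variable defined everywhere. *)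
Definition gpow (p x : R) : R := if 0 < x then x `^ (p - 1) else 0.
Definition pospart (x : R) : R := if 0 < x then x else 0.

Lemma measurable_gpow p : measurable_fun setT (gpow p).
Proof.
apply: (measurable_fun_ifT (g := fun x : R => x `^ (p - 1)) (h := fun=> 0)) => //.
  exact: measurable_fun_ltr.
Qed.

Lemma measurable_pospart : measurable_fun setT pospart.
Proof.
apply: measurable_fun_ifT => //.
exact: measurable_fun_ltr.
Qed.

Lemma gpow_ge0 p x : 0 <= gpow p x.
Proof. by rewrite /gpow; case: ifP => // _; exact: powR_ge0. Qed.

Lemma pospart_ge0 x : 0 <= pospart x.
Proof. by rewrite /pospart; case: ifP => // /ltW. Qed.

Lemma integrable_expRN_pos (l C : R) : 0 < l -> mu.-integrable setT
  (EFin \o (fun x => if 0 < x then C * expR (- (l * x)) else 0)).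
Proof.
move=> l0.
have i1 : mu.-integrable `]0%R, +oo[ (EFin \o (fun x => C * expR (- (l * x)))).
  apply: (@integrableS _ _ _ mu `[0%R, +oo[%classic) => //.
    by apply: subset_itv => //; rewrite bnd_simp.
  by have := integrableZl (lebesgue_measurable_itv _) C (integrable_expRN l0); exact: eq_integrable.
have /(integrable_mkcond _ _) := i1; move=> /(_ (lebesgue_measurable_itv _)).
apply: eq_integrable => // x _; rewrite patchE /=.
have -> : (x \in `]0, +oo[%classic) = (0 < x).
  by apply/idP/idP; rewrite inE /= in_itv /= andbT.
by case: ifP.
Qed.

Lemma integrable_gpow p (l : R) : 1 <= p -> 0 < l ->
  mu.-integrable setT (fun x => (gpow p x * expR (- (l * pospart x)))%:E).
Proof.
move=> p1 l0; have l20 : 0 < l / 2 by rewrite divr_gt0.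
have p10 : 0 <= p - 1 by rewrite subr_ge0.
have [C C0 HC] := powR_le_expR p10 l20.
apply: (integrable_bound measurableT _ _ (integrable_expRN_pos C l20)).
  apply: measurable_funM; first exact: measurable_gpow.
  apply: measurableT_comp => //; apply: measurableT_comp => //.
  by apply: measurable_funM => //; exact: measurable_pospart.
move=> x _; rewrite ger0_norm ?mulr_ge0 ?gpow_ge0 ?expR_ge0//.
rewrite /gpow /pospart; case: ifP => x0; last by rewrite mul0r.
have -> : expR (- (l * x)) = expR (- (l / 2 * x)) * expR (- (l / 2 * x)).
  by rewrite -expRD; congr expR; field.
rewrite mulrA ler_wpM2r ?expR_ge0//.
by rewrite expRN -ler_pdivlMr ?invr_gt0 ?expR_gt0// invrK; exact: HC.
Qed.

Definition gammaL (p : R) : R[i] -> R[i] := laplace mu (gpow p) pospart 0.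

Lemma gammaL_next p : 1 <= p -> laplace mu (gpow p) pospart 1 = gammaL (p + 1).
Proof.
move=> p1; apply/funext => z; rewrite /gammaL /laplace; congr cintegral.
apply/funext => x; rewrite expr1 expr0 mulr1; congr (_%:C * _).
rewrite /gpow /pospart; case: ifP => x0; last by rewrite mul0r.
by rewrite mulrC mulr_powRB1 ?(ltW x0) ?addrK//; lra.
Qed.

Let G (a l : R) (f : R -> R) := \int[mu]_(x in `]0%R, +oo[) (x `^ a * expR (- (l * x)) * f x).

Let iG a l f K : 0 <= a -> 0 < l -> continuous f -> (forall x, `|f x| <= K) ->
  mu.-integrable `]0%R, +oo[ (EFin \o (fun x => x `^ a * expR (- (l * x)) * f x)).
Proof.
move=> a0 l0 cf fK; have a1 : 1 <= a + 1 by rewrite lerDr.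
have K0 : 0 <= K := le_trans (normr_ge0 _) (fK 0).
have i1 : mu.-integrable `]0%R, +oo[ (EFin \o (fun x => K * (gpow (a + 1) x * expR (- (l * pospart x))))).
  have := integrableZl measurableT K (integrable_gpow a1 l0).
  move=> i1; apply: eq_integrable (integrableS measurableT (lebesgue_measurable_itv `]0%R, +oo[)
    (@subsetT _ _) i1) => //; exact: lebesgue_measurable_itv.
apply: (integrable_bound (lebesgue_measurable_itv _) _ _ i1).
  apply: measurable_fun_lebesgue; apply: measurable_funM; last exact: (continuous_measurable_fun cf).
  apply: measurable_funM; first exact: measurable_powR.
  by apply: measurableT_comp => //; apply: measurableT_comp => //; exact: measurable_funM.
move=> x; rewrite /= in_itv /= andbT => x0; rewrite /gpow /pospart x0 addrK.
have h : 0 <= x `^ a * expR (- (l * x)) by rewrite mulr_ge0 ?powR_ge0 ?expR_ge0.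
by rewrite normrM ger0_norm// mulrC ler_wpM2r.
Qed.

Let GE p z : 1 <= p -> 0 < cRe z ->
  gammaL p z = G (p - 1) (cRe z) (fun x => cos (cIm z * x)) +i*
               (- G (p - 1) (cRe z) (fun x => sin (cIm z * x))).
Proof.
move=> p1 z0; have p10 : 0 <= p - 1 by rewrite subr_ge0.
have E (f g : R -> R) : (forall x, 0 < x -> f x = g x) -> (forall x, ~ 0 < x -> f x = 0) ->
    \int[mu]_x f x = \int[mu]_(x in `]0%R, +oo[) g x.
  move=> h1 h2; rewrite [RHS]Rintegral_mkcond; apply: eq_Rintegral => x _.
  rewrite patchE; case: ifPn; rewrite ?inE ?notin_setE /= in_itv /= andbT => H.
    exact: h1.
  exact: h2.
rewrite /gammaL /laplace /cintegral; congr (_ +i* _).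
  rewrite /G; apply: E => x x0; rewrite cReZ /gpow /pospart.
    rewrite x0 expr0 mulr1 /cexp /= cReZr cImZr cReN cImN !mulNr cosN mulrA//.
  by case: ifP => // _; rewrite !mul0r.
rewrite /G -[RHS]mulN1r -RintegralZl//; last first.
  apply: (@iG _ _ _ 1) => //.
    move=> x; apply: continuous_comp; last exact: continuous_sin.
    exact: mulrl_continuous.
  by move=> x; rewrite ler_norml sin_geN1 sin_le1.
apply: E => x x0; rewrite cImZ /gpow /pospart.
  rewrite x0 expr0 mulr1 /cexp /= cReZr cImZr cReN cImN !mulNr sinN.
  by rewrite mul1r !mulrN mulrA.
by case: ifP => // _; rewrite !mul0r.
Qed.

Let by_parts p l c d (K : R) : 1 <= p -> 0 < l ->
  (forall x, is_derive x (1 : R) c (d x)) -> continuous d ->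
  (forall x, `|c x| <= 1) -> (forall x, `|d x| <= K) ->
  p * G (p - 1) l c - l * G p l c + G p l d = 0.
Proof.
move=> p1 l0 dc cd c1 dK; have p0 : 0 < p by lra.
have cc : continuous c := dderive_continuous dc.
have p10 : 0 <= p - 1 by rewrite subr_ge0.
pose F x := x `^ p * expR (- (l * x)) * c x.
have i1 := iG p10 l0 cc c1; have i2 := iG (ltW p0) l0 cc c1; have i3 := iG (ltW p0) l0 cd dK.
have m0 := lebesgue_measurable_itv `]0%R, +oo[.
have j1 := integrableZl m0 p i1; have j2 := integrableZl m0 l i2.
rewrite /G -!RintegralZl// -RintegralB// -RintegralD//; last first.
  by have := integrableB m0 j1 j2; exact: eq_integrable.
have Fle x : 0 < x -> `|F x| <= x `^ p * expR (- (l * x)).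
  by move=> x0; rewrite /F normrM ger0_norm ?mulr_ge0 ?powR_ge0 ?expR_ge0// ler_piMr ?mulr_ge0 ?powR_ge0 ?expR_ge0.
apply: etrans (@Rintegral_FTC_pos _ F _ 0 0 _ _ _ _ _) (subrr 0).
- move=> x x0; have := dderiveM (dderiveM (dderive_powR p x0) (dderive_expnux l x)) (dc x).
  by move/dderive_eq; apply => //; ring.
- move=> x x0.
  have h a : {for x, continuous (fun x => x `^ a * expR (- (l * x)))}.
    exact: (dderive_continuous_at (dderiveM (dderive_powR a x0) (dderive_expnux l x))).
  apply: cvgD; last by apply: cvgM; [exact: h|exact: cd].
  by apply: cvgB; apply: cvgM; try exact: cvg_cst; apply: cvgM; try exact: cc; exact: h.
- by have := integrableD m0 (integrableB m0 j1 j2) i3; exact: eq_integrable.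
- apply: (@squeeze_cvgr _ _ _ _ (fun n => - n.+1%:R^-1) (fun n => n.+1%:R^-1)); last exact: cvg_harmonic0.
    near=> n; rewrite -ler_norml.
    have n0 : 0 < n.+1%:R^-1 :> R by rewrite invr_gt0.
    apply: le_trans (Fle _ n0) _; apply: (@le_trans _ _ (n.+1%:R^-1 `^ p)).
      rewrite ler_piMr ?powR_ge0// -expR0 ler_expR oppr_le0 mulr_ge0//; exact: ltW.
    by apply: ge1r_powR => //; rewrite n0 invf_le1 ?ler1n.
  by rewrite -oppr0; apply: cvgN; exact: cvg_harmonic0.
have l20 : 0 < l / 2 by rewrite divr_gt0.
have [C C0 HC] := powR_le_expR (ltW p0) l20.
have ex : (fun n => C * expR (- (l / 2 * n.+1%:R))) @ \oo --> (0 : R).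
  rewrite -[X in _ --> X](mulr0 C); apply: cvgM; first exact: cvg_cst.
  have := cvg_expRN_pinfty l20 => H.
  apply: (cvg_comp _ _ _ H); apply/cvgryPge => A.
  exists (Num.bound A) => // n /= hn.
  have [A0|A0] := leP 0 A; last by apply: le_trans (ltW A0) _.
  by apply: le_trans (ltW (archi_boundP A0)) _; rewrite ler_nat leqW.
apply: (@squeeze_cvgr _ _ _ _ (fun n => - (C * expR (- (l / 2 * n.+1%:R))))
  (fun n => C * expR (- (l / 2 * n.+1%:R)))); last exact: ex.
  near=> n; rewrite -ler_norml; apply: le_trans (Fle _ _) _ => //.
  have -> : expR (- (l * n.+1%:R)) = expR (- (l / 2 * n.+1%:R)) * expR (- (l / 2 * n.+1%:R)).
    by rewrite -expRD; congr expR; field.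
  rewrite mulrA ler_wpM2r ?expR_ge0//.
  by rewrite expRN -ler_pdivlMr ?invr_gt0 ?expR_gt0// invrK; exact: HC.
by rewrite -oppr0; exact: cvgN.
Unshelve. all: by end_near. Qed.

Let GZ a l (f : R -> R) (K c : R) : 0 <= a -> 0 < l -> continuous f -> (forall x, `|f x| <= K) ->
  G a l (fun x => c * f x) = c * G a l f.
Proof.
move=> a0 l0 cf fK; have i1 := iG a0 l0 cf fK.
rewrite /G -RintegralZl//.
by apply: eq_Rintegral => x _; rewrite mulrCA.
Qed.

(** Integration by parts against [x^p exp (- z x)], for the real and imaginary
    parts separately. *)
Lemma gammaL_recurrence p z : 1 <= p -> 0 < cRe z ->
  p%:C * gammaL p z = z * gammaL (p + 1) z.
Proof.
move=> p1 z0; have p0 : 0 <= p by lra.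
have p11 : 1 <= p + 1 by lra.
have dZ x : is_derive x (1 : R) (fun x => cIm z * x) (cIm z).
  by apply: (dderive_eq (dderiveZ (cIm z) (dderive_id x))) => //; rewrite mulr1.
have cc : continuous (fun x => cos (cIm z * x)).
  by apply: dderive_continuous => x; exact: dderive_cos (dZ x).
have cs : continuous (fun x => sin (cIm z * x)).
  by apply: dderive_continuous => x; exact: dderive_sin (dZ x).
have c1 x : `|cos (cIm z * x)| <= 1 by rewrite ler_norml cos_geN1 cos_le1.
have s1 x : `|sin (cIm z * x)| <= 1 by rewrite ler_norml sin_geN1 sin_le1.
have le1 (k u : R) : `|u| <= 1 -> `|k * u| <= `|k|.
  by move=> u1; rewrite normrM ler_piMr.
have h1 : p * G (p - 1) (cRe z) (fun x => cos (cIm z * x)) -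
   cRe z * G p (cRe z) (fun x => cos (cIm z * x)) +
   G p (cRe z) (fun x => - cIm z * sin (cIm z * x)) = 0.
  apply: (@by_parts _ _ _ _ `|- cIm z|) => //.
  - move=> x; apply: (dderive_eq (dderive_cos (dZ x))) => //.
    by rewrite mulrC mulNr mulrN.
  - by move=> x; apply: cvgM; [exact: cvg_cst|exact: cs].
  - by move=> x; exact: le1.
have h2 : p * G (p - 1) (cRe z) (fun x => sin (cIm z * x)) -
   cRe z * G p (cRe z) (fun x => sin (cIm z * x)) +
   G p (cRe z) (fun x => cIm z * cos (cIm z * x)) = 0.
  apply: (@by_parts _ _ _ _ `|cIm z|) => //.
  - move=> x; apply: (dderive_eq (dderive_sin (dZ x))) => //.
    by rewrite mulrC.
  - by move=> x; apply: cvgM; [exact: cvg_cst|exact: cc].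
  - by move=> x; exact: le1.
rewrite (GZ _ p0 z0 cs s1) in h1; rewrite (GZ _ p0 z0 cc c1) in h2.
rewrite (GE p1 z0) (GE p11 z0) addrK.
move: h1 h2; move: (G _ _ _) (G _ _ _) (G _ _ _) (G _ _ _) => A0 A1 B1 B0 h1 h2.
apply: complexP; rewrite ?cReZ ?cImZ !cE /=; lra.
Qed.

Lemma gammaL_real p : 1 <= p -> gammaL p 1 = (Gamma_pos p)%:C.
Proof.
move=> p1; rewrite GE//= /G /Gamma_pos; apply: complexP => /=.
  by apply: eq_Rintegral => x _; rewrite mul0r cos0 mulr1 mul1r.
under eq_Rintegral do rewrite mul0r sin0 mulr0.
by rewrite /Rintegral integral0 /= oppr0.
Qed.

(** Both [gammaL p] and the power satisfy the same first-order equation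
    [z f' = - p f], so that their quotient is constant. *)
Lemma gammaL_pow p z : 1 <= p -> 0 < cRe z ->
  gammaL p z = (Gamma_pos p)%:C * cpow z (- p)%:C.
Proof.
move=> p1 z0; pose H w := gammaL p w * cpow w p%:C.
have dH w : 0 < cRe w -> qdiff H w 0.
  move=> w0; have dg : qdiff (gammaL p) w (- gammaL (p + 1) w).
    rewrite -gammaL_next//; apply: qdiff_laplace => //.
    - exact: measurable_gpow.
    - exact: measurable_pospart.
    - exact: gpow_ge0.
    - exact: pospart_ge0.
    - by move=> l; exact: integrable_gpow.
  have := qdiffM dg (qdiff_cpow p w0).
  rewrite (_ : _ + _ = 0)//.
  rewrite (_ : p - 1 = p + (- 1))// cpowD cpowN cpow1// mulrA.
  rewrite (mulrC (gammaL p w)) gammaL_recurrence//.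
  by field; exact: neq0_Re.
have := qdiff0_cst dH z0; rewrite /H gammaL_real//.
have -> : cpow 1 p%:C = 1 :> R[i] by rewrite cpow_real// powR1.
rewrite mulr1 cpowN => <-.
by rewrite mulfK// cpow_neq0.
Qed.

Lemma Gamma_pos_gt0 p : 1 <= p -> 0 < Gamma_pos p :> R.
Proof.
move=> p1; have p10 : 0 <= p - 1 by lra.
apply: (@lt_le_trans _ _ (expR (- 2))); first exact: expR_gt0.
have i1 : mu.-integrable `]0%R, +oo[ (EFin \o (fun x => x `^ (p - 1) * expR (- x))).
  have : forall x : R, `|(cst 1 : R -> R) x| <= 1 by move=> x; rewrite normr1.
  move/(iG p10 ltr01 (@cst_continuous _ _ _)).
  by apply: eq_integrable => // x _; rewrite /= mul1r mulr1.
pose g := (fun=> expR (- 2)) \_ (`[1, 2]%classic : set R) : R -> R.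
have gE : \int[mu]_(x in `]0%R, +oo[) g x = expR (- 2).
  rewrite /g -Rintegral_mkcondr (_ : _ `&` _ = `[1, 2]%classic); last first.
    by apply/setIidPr => x /=; rewrite !in_itv /= => /andP[h _]; rewrite (lt_le_trans _ h).
  rewrite Rintegral_itv_cst; [by rewrite (_ : 2 - 1 = 1) ?mulr1//; ring|by lra].
rewrite -gE; apply: le_Rintegral => //.
  apply: (integrable_bound (lebesgue_measurable_itv _) _ _ i1).
    apply: measurable_fun_lebesgue.
    by apply: (iffLR (measurable_restrictT _ _)).
  move=> x; rewrite /= in_itv /= andbT => x0; rewrite /g patchE; case: ifPn; last first.
    by rewrite normr0 mulr_ge0 ?powR_ge0 ?expR_ge0.
  rewrite inE /= in_itv /= => /andP[x1 x2]; rewrite ger0_norm ?expR_ge0//.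
  have h1 : 1 <= x `^ (p - 1) by rewrite -[leLHS](powRr0 x); apply: ler_powR.
  have h2 : expR (- 2) <= expR (- x) by rewrite ler_expR lerN2.
  by apply: le_trans h2 _; rewrite ler_peMl ?expR_ge0.
move=> x; rewrite /= in_itv /= andbT => x0; rewrite /g patchE; case: ifPn; last first.
  by rewrite mulr_ge0 ?powR_ge0 ?expR_ge0.
rewrite inE /= in_itv /= => /andP[x1 x2].
have h1 : 1 <= x `^ (p - 1) by rewrite -[leLHS](powRr0 x); apply: ler_powR.
have h2 : expR (- 2) <= expR (- x) by rewrite ler_expR lerN2.
by apply: le_trans h2 _; rewrite ler_peMl ?expR_ge0.
Qed.

Lemma Gamma_posS p : 1 <= p -> Gamma_pos (p + 1) = p * Gamma_pos p :> R.
Proof.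
move=> p1; have p11 : 1 <= p + 1 by lra.
have := @gammaL_recurrence p 1 p1 ltr01.
by rewrite !gammaL_real// mul1r -real_complexM => -[].
Qed.

End GammaIntegrals.

Section GammaFormulas.
Context {R : realType}.
Notation mu := (@lebesgue_measure R).

(** By the functional equation, the quotient does not depend on the number of
    factors once the argument of [Gamma_pos] is at least 1. In particular the
    number of factors may be the order of differentiation. *)
Lemma invGammaE (x : R) m : 1 <= x + m%:R ->
  invGamma x = (\prod_(i < m) (x + i%:R)) / Gamma_pos (x + m%:R).
Proof.
have step n k : 1 <= x + n%:R ->
    (\prod_(i < n + k) (x + i%:R)) / Gamma_pos (x + (n + k)%:R) =
    (\prod_(i < n) (x + i%:R)) / Gamma_pos (x + n%:R).
  move=> xn; elim: k => [|k IH]; first by rewrite addn0.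
  have xnk : 1 <= x + (n + k)%:R by rewrite natrD addrA; apply: le_trans xn _; rewrite lerDl.
  rewrite addnS big_ord_recr /= -natr1 addrA Gamma_posS// -IH invfM mulrACA.
  have n0 : x + (n + k)%:R != 0 by rewrite gt_eqF// (lt_le_trans ltr01 xnk).
  by rewrite mulrA (divfK n0).
have m0 : 1 <= x + `|Num.floor x|%N.+1%:R.
  have h1 : (Num.floor x)%:~R <= x := floor_le x.
  have h2 : 0 <= (Num.floor x)%:~R + `|Num.floor x|%N%:R :> R.
    rewrite natr_absz -intrD ler0z.
    by have := ler_norm (- Num.floor x); rewrite normrN -subr_ge0 opprK addrC.
  by rewrite -natr1; lra.
move=> xm; rewrite /invGamma.
have [le|le] := leqP m `|Num.floor x|%N.+1.
  by have := step _ (`|Num.floor x|%N.+1 - m)%N xm; rewrite subnKC.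
have := step _ (m - `|Num.floor x|%N.+1)%N m0.
by rewrite (subnKC (ltnW le)) => ->.
Qed.

Lemma eq_continuous_density (f g : R -> R) (x : R) :
  {for x, continuous f} -> {for x, continuous g} ->
  measurable_fun setT f -> measurable_fun setT g ->
  (forall y, x < y -> mu.-integrable `[x, y] (EFin \o f)) ->
  (forall y, x < y -> mu.-integrable `[x, y] (EFin \o g)) ->
  (forall y, x < y -> \int[mu]_(t in `[x, y]) f t = \int[mu]_(t in `[x, y]) g t) ->
  f x = g x.
Proof.
move=> cf cg mf mg jf jg fg; apply/eqP; rewrite eq_le; apply/andP.
split; rewrite -subr_ge0.
  apply: (@ge0_Rintegral_itv _ (fun t => g t - f t)); first exact: cvgB.
    exact: measurable_funB.
  by move=> y xy; rewrite RintegralB ?fg ?subrr//; [exact: jg|exact: jf].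
apply: (@ge0_Rintegral_itv _ (fun t => f t - g t)); first exact: cvgB.
  exact: measurable_funB.
by move=> y xy; rewrite RintegralB ?fg ?subrr//; [exact: jf|exact: jg].
Qed.

Lemma integrable_powN p : 1 < p ->
  mu.-integrable `[0%R, +oo[ (EFin \o (fun t => (1 + t) `^ (- p))).
Proof.
move=> p1; have p10 : 0 < p - 1 by rewrite subr_gt0.
pose F (t : R) := - (p - 1)^-1 * (1 + t) `^ (- (p - 1)).
have dF (t : R) : - 1 < t -> is_derive t (1 : R) F ((1 + t) `^ (- p)).
  move=> t1; have t10 : 0 < 1 + t by lra.
  have d1 : is_derive t (1 : R) (fun t => 1 + t) 1.
    by apply: (dderive_eq (dderiveD (dderive_cst 1 t) (dderive_id t))) => //; rewrite add0r.
  have := dderiveZ (- (p - 1)^-1) (dderive_comp (dderive_powR (- (p - 1)) t10) d1).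
  move/dderive_eq; apply => //.
  rewrite (_ : - (p - 1) - 1 = - p); last by ring.
  by field; rewrite gt_eqF.
have cf (t : R) : - 1 < t -> {for t, continuous (fun t : R => (1 + t) `^ (- p))}.
  move=> t1; have t10 : 0 < 1 + t by lra.
  have d1 : is_derive t (1 : R) (fun t => 1 + t) 1.
    by apply: (dderive_eq (dderiveD (dderive_cst 1 t) (dderive_id t))) => //; rewrite add0r.
  exact: (dderive_continuous_at (dderive_comp (dderive_powR (- p) t10) d1)).
have I : (\int[mu]_(t in `[0%R, +oo[) ((1 + t) `^ (- p))%:E = 0%:E - (F 0)%:E)%E.
  apply: (@ge0_continuous_FTC2y _ _ F 0 0).
  - by move=> x _; exact: powR_ge0.
  - apply: continuous_in_subspaceT => x; rewrite inE /= in_itv /= andbT => x0.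
    by apply: cf; lra.
  - apply/cvgr0Pnorm_le => e e0.
    pose M := ((p - 1) * e) `^ (- (p - 1)^-1).
    have M0 : 0 < M by rewrite powR_gt0// mulr_gt0.
    near=> t.
    have t0 : M <= t by near: t; apply: nbhs_pinfty_ge; rewrite num_real.
    rewrite /F mulNr normrN ger0_norm ?mulr_ge0 ?powR_ge0 ?invr_ge0 ?(ltW p10)//.
    rewrite ler_pdivrMl// powRN invf_ple ?posrE ?powR_gt0 ?mulr_gt0//; last by lra.
    have -> : ((p - 1) * e)^-1 = M `^ (p - 1).
      by rewrite /M -powRrM mulNr mulVf ?gt_eqF// powR_inv1// ltW// mulr_gt0.
    by apply: ge0_ler_powR; rewrite ?nnegrE ?(ltW p10) ?(ltW M0)//; lra.
  - by move=> x x0; have x1 : - 1 < x by [lra]; case: (dF x x1).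
  - apply: cvg_at_right_filter; have x1 : - 1 < 0 :> R by [lra]; exact: (dderive_continuous_at (dF 0 x1)).
  - by move=> x; rewrite in_itv /= andbT => x0; rewrite derive1E; have x1 : - 1 < x by [lra]; case: (dF x x1).
apply/integrableP; split.
  apply/measurable_EFinP; apply: measurable_fun_lebesgue.
  apply: (@measurableT_comp _ _ _ _ _ _ (fun x : R => x `^ (- p))).
    exact: measurable_powR.
  exact: measurable_funD.
under eq_integral do rewrite /= (ger0_norm (powR_ge0 _ _)).
by rewrite I -EFinB ltry.
Unshelve. all: by end_near. Qed.

Section GammaInversion.
Variables (p l : R).
Hypotheses (p1 : 1 < p) (l0 : 0 < l).

(** The unnormalized gamma law, of density [x^(p - 1) exp (- l x)]. *)
Definition gamma_law : {measure set R -> \bar R} :=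
  tilted mu (@measurable_gpow R p) (@measurable_pospart R) (@gpow_ge0 R p)
    (@pospart_ge0 R) 0 l.

Lemma gamma_law_fin : (gamma_law setT < +oo)%E.
Proof. by apply: tilted_fin => // k k0; apply: integrable_gpow => //; exact: ltW. Qed.

Lemma gammaL_fcos t : cRe (gammaL p (l +i* t)) = fcos gamma_law t.
Proof. by apply: laplace_fcos => // k k0; apply: integrable_gpow => //; exact: ltW. Qed.

Lemma gammaL_fsin t : cIm (gammaL p (l +i* t)) = - fsin gamma_law t.
Proof. by apply: laplace_fsin => // k k0; apply: integrable_gpow => //; exact: ltW. Qed.

Lemma gamma_fsinE t : fsin gamma_law t = - cIm (gammaL p (l +i* t)).
Proof. by rewrite gammaL_fsin opprK. Qed.

Let K := Gamma_pos p * (Num.min l 1 / 2) `^ (- p).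

(** The modulus is [Gamma p |l + i t|^(- p)] by [gammaL_pow]. It is integrable
    in [t] because [p > 1]. *)
Lemma cmod_gammaL t : 0 <= t -> cmod (gammaL p (l +i* t)) <= K * (1 + t) `^ (- p).
Proof.
move=> t0; have p0 : 0 < p := lt_trans ltr01 p1.
have t10 : 0 < 1 + t by rewrite ltr_pwDl.
rewrite gammaL_pow ?(ltW p1)// cmodM cmod_real (ger0_norm (ltW (Gamma_pos_gt0 (ltW p1)))).
rewrite cmod_cpow// /K -mulrA ler_wpM2l ?(ltW (Gamma_pos_gt0 (ltW p1)))//.
have m0 : 0 < Num.min l 1 by rewrite lt_min l0 ltr01.
have m1 : Num.min l 1 <= 1 by rewrite ge_min lexx orbT.
have ml : Num.min l 1 <= l by rewrite ge_min lexx.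
rewrite -powRM ?divr_ge0 ?(ltW m0) ?(ltW t10)//.
have b0 : 0 < Num.min l 1 / 2 * (1 + t) by rewrite mulr_gt0 ?divr_gt0.
have h1 : l <= cmod (l +i* t).
  exact: le_trans (ler_norm _) (normRe_le (l +i* t)).
have h2 : t <= cmod (l +i* t).
  exact: le_trans (ler_norm _) (normIm_le (l +i* t)).
move: (Num.min l 1) m0 m1 ml b0 => m m0 m1 ml b0.
have mt : m * t <= t by rewrite ler_piMl.
have b1 : m / 2 * (1 + t) <= cmod (l +i* t).
  by move: (cmod _) h1 h2 => r h1 h2; lra.
rewrite !powRN lef_pV2 ?posrE ?powR_gt0//; last exact: lt_le_trans b1.
by apply: ge0_ler_powR; rewrite ?nnegrE ?(ltW p0) ?(ltW b0) ?cmod_ge0.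
Qed.

Let integrable_part (f : R -> R) : continuous f -> (forall t, 0 <= t -> `|f t| <= K * (1 + t) `^ (- p)) ->
  mu.-integrable `[0%R, +oo[ (EFin \o f).
Proof.
move=> cf fK.
have i1 : mu.-integrable `[0%R, +oo[ (EFin \o (fun t => K * (1 + t) `^ (- p))).
  by have := integrableZl (lebesgue_measurable_itv _) K (integrable_powN p1); exact: eq_integrable.
apply: (integrable_bound (lebesgue_measurable_itv _) _ _ i1).
  exact: measurable_fun_lebesgue (continuous_measurable_fun cf).
by move=> t; rewrite /= in_itv /= andbT => /fK.
Qed.

Lemma integrable_gamma_fcos : mu.-integrable `[0%R, +oo[ (EFin \o fcos gamma_law).
Proof.
apply: integrable_part; first exact: fcos_continuous gamma_law_fin.
move=> t t0; rewrite -gammaL_fcos; apply: le_trans (cmod_gammaL t0).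
exact: normRe_le.
Qed.

Lemma integrable_gamma_fsin : mu.-integrable `[0%R, +oo[ (EFin \o fsin gamma_law).
Proof.
apply: integrable_part; first exact: fsin_continuous gamma_law_fin.
move=> t t0; rewrite -normrN -gammaL_fsin; apply: le_trans (cmod_gammaL t0).
exact: normIm_le.
Qed.

(** Both sides are densities of [gamma_law] that are continuous on the open
    half-line, hence equal there. *)
Lemma gamma_inversion x : 0 < x ->
  x `^ (p - 1) * expR (- (l * x)) = fdens gamma_law x.
Proof.
move=> x0; have iw k : 0 < k -> mu.-integrable setT (fun x => (gpow p x * expR (- (k * pospart x)))%:E).
  by move=> k0; apply: integrable_gpow => //; exact: ltW.
pose g := tilt (@gpow R p) (@pospart R) 0 l.
have mg : measurable_fun setT g.
  by apply: measurable_tilt; [exact: measurable_gpow|exact: measurable_pospart].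
have gE y : 0 < y -> g y = y `^ (p - 1) * expR (- (l * y)).
  by move=> y0; rewrite /g /tilt /gpow /pospart y0 expr0 mulr1.
have g0 y : 0 <= g y by apply: tilt_ge0; [exact: gpow_ge0|exact: pospart_ge0].
have ig : mu.-integrable setT (EFin \o g).
  by have := iw l l0; apply: eq_integrable => // y _; rewrite /g /tilt /= expr0 mulr1.
rewrite -gE//.
have fl := fdens_continuous gamma_law_fin integrable_gamma_fcos integrable_gamma_fsin.
have cf := continuous_measurable_fun fl.
apply: eq_continuous_density => //.
- have H : (fun y => y `^ (p - 1) * expR (- (l * y))) @ nbhs x --> g x.
    rewrite gE//.
    exact: (dderive_continuous_at (dderiveM (dderive_powR (p - 1) x0) (dderive_expnux l x))).
  apply: cvg_trans H; apply: near_eq_cvg.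
  by near=> y; rewrite gE//; near: y; exact: lt_nbhsr.
- exact: fl.
- by move=> y xy; exact: (integrableS measurableT (lebesgue_measurable_itv _) (@subsetT _ _) ig).
- move=> y xy; apply: continuous_compact_integrable; first exact: segment_compact.
  exact: continuous_subspaceT.
move=> y xy.
have := fourier_inversion_itv gamma_law_fin integrable_gamma_fcos integrable_gamma_fsin (ltW xy).
rewrite /gamma_law /= /wlaw => H.
apply: EFin_inj; rewrite -H.
have -> : pospart @^-1` `]x, y] = `]x, y]%classic.
  apply/seteqP; split => t /=; rewrite /pospart !in_itv /=.
    by case: ifP => // _ /andP[/(lt_trans x0)]; rewrite ltxx.
  by move=> /andP[xt ty]; rewrite (lt_trans x0 xt) xt ty.
rewrite /Rintegral fineK; last first.
  apply: integrable_fin_num => //.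
  exact: (integrableS measurableT (lebesgue_measurable_itv _) (@subsetT _ _) ig).
rewrite -integral_itv_obnd_cbnd//.
by apply/measurable_EFinP; exact: measurable_fun_lebesgue.
Unshelve. all: by end_near. Qed.

End GammaInversion.

Lemma carg_vertical (t : R) : carg (1 +i* t) = atan t.
Proof.
rewrite /carg /=; set r := cmod (1 +i* t).
have r2 : r ^+ 2 = 1 + t ^+ 2 by rewrite sqr_cmod /= expr1n.
have r0 : 0 <= r := cmod_ge0 _.
have r10 : 0 < 1 + r by rewrite ltr_pwDl.
rewrite addrC -/r; set y := t / (1 + r).
have ty : t = y * (1 + r) by rewrite /y divfK// gt_eqF.
have y2 : y ^+ 2 < 1.
  rewrite /y expr_div_n ltr_pdivrMr ?exprn_gt0// mul1r; nra.
have y1 : - 1 < y /\ y < 1 by split; nra.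
have a1 : atan y < pi / 4 by rewrite -atan1; apply: lt_atan; case: y1.
have a2 : - (pi / 4) < atan y by rewrite -atan1 -atanN; apply: lt_atan; case: y1.
have pi0 := pi_gt0 R.
have c0 : cos (atan y) != 0.
  by rewrite gt_eqF// cos_gt0_pihalf//; apply/andP; split; lra.
have -> : 2 * atan y = atan y *+ 2 by rewrite mulr_natl.
have : tan (atan y *+ 2) = t.
  rewrite tan_mulr2n// atanK.
  have h : 1 - y ^+ 2 = 2 / (1 + r).
    have t2 : t ^+ 2 = (r - 1) * (1 + r) by move: r2; rewrite !expr2; lra.
    by rewrite /y expr_div_n t2; field; rewrite gt_eqF.
  rewrite h ty -[LHS]/(y *+ 2 / (2 / (1 + r))) -mulr_natr.
  by field; rewrite gt_eqF.
have dbl (P A : R) : - (P / 4) < A -> A < P / 4 -> - (P / 2) < A *+ 2 < P / 2.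
  by move=> h1 h2; rewrite [A *+ 2]mulr2n; apply/andP; split; lra.
by move=> <-; rewrite tanK// in_itv /=; exact: dbl.
Qed.

Let half_cosD_le1 (x y : R) : `|2^-1 * (cos x + cos y)| <= 1.
Proof.
have := cos_le1 x; have := cos_geN1 x; have := cos_le1 y; have := cos_geN1 y.
by rewrite ler_norml => *; apply/andP; split; lra.
Qed.

Let reflection_algebra (A B s a c : R) : a != 0 -> 1 - a != 0 -> c != 0 ->
  c^-1 * (A * B * (s / (4 * a * (1 - a)))) = 1 / 4 -> A * B * s = c * (a * (1 - a)).
Proof.
move=> na nb nc H.
have -> : A * B * s = c^-1 * (A * B * (s / (4 * a * (1 - a)))) * (c * (4 * a * (1 - a))).
  by field; rewrite na nb nc.
by rewrite H; field.
Qed.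

(** Put [p = 1 + a] and [q = 2 - a]. The product of the densities [x^(p - 1)
    exp (- x)] and [x^(q - 1) exp (- x)] is [x exp (- 2 x)], of mass [1 / 4].
    Parseval's formula expresses this mass through the transforms [Gamma p (1 +
    i t)^(- p)] and [Gamma q (1 + i t)^(- q)]. As the argument of [1 + i t] is
    [atan t], the resulting integrand has an explicit primitive in terms of
    [atan t], whose limit at infinity is a multiple of [sin (pi a)]. *)
Lemma Gamma_reflection (a : R) : 0 < a -> a < 1 ->
  Gamma_pos (1 + a) * Gamma_pos (2 - a) * sin (pi * a) = pi * (a * (1 - a)).
Proof.
move=> a0 a1; pose p := 1 + a; pose q := 2 - a.
have p1 : 1 < p by rewrite /p; lra.
have q1 : 1 < q by rewrite /q; lra.
have pi0 := pi_gt0 R.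
pose nu := gamma_law p 1.
have nufin : (nu setT < +oo)%E := gamma_law_fin p1 ltr01.
have ic := integrable_gamma_fcos p1 ltr01; have is_ := integrable_gamma_fsin p1 ltr01.
pose g := tilt (@gpow R q) (@pospart R) 0 1.
have mg : measurable_fun setT g.
  by apply: measurable_tilt; [exact: measurable_gpow|exact: measurable_pospart].
have g0 y : 0 <= g y by apply: tilt_ge0; [exact: gpow_ge0|exact: pospart_ge0].
have ig : mu.-integrable setT (EFin \o g).
  have := @integrable_gpow R q 1 (ltW q1) ltr01.
  by apply: eq_integrable => // y _; rewrite /g /tilt /= expr0 mulr1.
have gpos y : g (pospart y) * gpow p y = gpow 2 y * expR (- pospart y).
  have [y0|/negbTE y0] := boolP (0 < y); last first.
    by rewrite /gpow y0 mulr0 mul0r.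
  rewrite /g /tilt /gpow /pospart y0 y0 expr0 mulr1 mul1r mulrAC; congr (_ * _).
  rewrite -powRD; last by rewrite (gt_eqF y0) implybT.
  by congr (_ `^ _); rewrite /p /q; ring.
have gpos2 y : tilt (gpow p) (@pospart R) 0 1 y * g (pospart y) =
    gpow 2 y * expR (- (2 * pospart y)).
  rewrite /tilt expr0 mulr1 mul1r mulrAC [_ * g _]mulrC gpos -mulrA -expRD -opprD.
  by congr (_ * expR (- _)); ring.
have Gamma1 : Gamma_pos 1 = 1 :> R.
  rewrite /Gamma_pos subrr; under eq_Rintegral do rewrite powRr0 mul1r -[X in - X]mul1r.
  rewrite Rintegral_itv_obnd_cbnd ?Rintegral_expRN ?invr1//.
  apply: (integrableS (lebesgue_measurable_itv _) (lebesgue_measurable_itv _) _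
    (integrable_expRN ltr01)).
  by apply: subset_itv => //; rewrite bnd_simp.
have I1 : \int[nu]_x g x = 1 / 4.
  transitivity (cRe (gammaL 2 (2%:C : R[i]))).
    rewrite /nu /gamma_law /tilted integral_wlaw//; last first.
      have := @integrable_gpow R 2 2 ltac:(lra) ltac:(lra).
      by apply: eq_integrable => // y _; rewrite gpos2.
    rewrite /gammaL /laplace /cintegral /=; apply: eq_Rintegral => y _.
    rewrite gpos2 expr0 mulr1 !oppr0 !(mulr0, mul0r) !subr0 addr0 cos0 mulr1.
    by rewrite mulNr.
  have -> : gammaL 2 (2%:C : R[i]) = (Gamma_pos 2 * 2 `^ (- 2))%:C.
    rewrite gammaL_pow; [|by lra|by rewrite /=; lra].
    by rewrite cpow_real ?real_complexM.
  have -> : Gamma_pos 2 = 1 :> R.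
    by have := Gamma_posS (lexx (1 : R)); rewrite Gamma1 mulr1.
  by rewrite /= mul1r powR_invn// div1r; congr (_^-1); ring.
have fc := fdens_continuous nufin ic is_.
have mf : measurable_fun (setT : set (measurableTypeR R)) (fdens nu).
  exact: measurable_fun_lebesgue (continuous_measurable_fun fc).
have f0 := fdens_ge0 nufin ic is_.
have igf : mu.-integrable setT (EFin \o (fun x => fdens nu x * g x)).
  pose Kf := pi^-1 * \int[mu]_(t in `[0%R, +oo[) (`|fcos nu t| + `|fsin nu t|).
  have i1 : mu.-integrable setT (EFin \o (fun x => Kf * g x)).
    by have := integrableZl measurableT Kf ig; exact: eq_integrable.
  apply: (integrable_bound measurableT _ _ i1); first exact: measurable_funM.
  move=> x _; rewrite normrM (ger0_norm (g0 x)) ler_wpM2r//.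
  exact: (fdens_le nufin ic is_).
have I2 : \int[nu]_x g x = \int[mu]_x (g x * fdens nu x).
  have mid : measurable_fun setT (id : measurableTypeR R -> R) by exact: measurable_id.
  transitivity (\int[wlaw mu mf f0 mid]_x g x).
    rewrite /Rintegral; congr fine; apply: eq_measure_integral => A mA _.
    exact: (fourier_inversion nufin ic is_ mA).
  by rewrite integral_wlaw//; apply: eq_Rintegral => x _; rewrite mulrC.
pose psi t := `|fcos nu t| + `|fsin nu t|.
have cC := fcos_continuous nufin; have cS := fsin_continuous nufin.
have mtx : measurable_fun setT (fun z : measurableTypeR R * measurableTypeR R => z.2 * z.1 : R).
  by apply: measurable_funM; [exact: measurable_snd|exact: measurable_fst].
have m2 (f : R -> R) : continuous f ->
    measurable_fun setT (fun z : measurableTypeR R * measurableTypeR R => f z.2).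
  move=> cf; apply: (measurableT_comp (f := f)); last exact: measurable_snd.
  exact: continuous_measurable_fun.
have fdE x : \int[mu]_(t in `[0%R, +oo[) fker nu x t = pi * fdens nu x.
  by rewrite /fdens mulVKf// gt_eqF.
have ipsi : mu.-integrable `[0%R, +oo[ (EFin \o psi).
  have := integrableD (lebesgue_measurable_itv _) (integrable_norm ic) (integrable_norm is_).
  exact: eq_integrable.
have gk x : \int[mu]_(t in `[0%R, +oo[) (g x * fker nu x t) = g x * (pi * fdens nu x).
  rewrite -fdE RintegralZl//; apply: (integrable_bound (lebesgue_measurable_itv _) _ _ ipsi).
    exact: measurable_fun_lebesgue (measurable_fker nufin x).
  by move=> t _; exact: fker_le.
have I3 : \int[mu]_x (g x * fdens nu x) =
    pi^-1 * \int[mu]_(t in `[0%R, +oo[) (\int[mu]_x (g x * fker nu x t)).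
  rewrite -(@Rfubini _ _ _ _ _ mu mu setT `[0%R, +oo[%classic
    (fun z : R * R => g z.1 * fker nu z.1 z.2) g psi)//.
  - rewrite -RintegralZl//; last first.
      have := integrableZl measurableT pi igf; apply: eq_integrable => // x _ /=.
      by rewrite gk -EFinM; congr EFin; rewrite [RHS]mulrCA [g x * _]mulrC.
    apply: eq_Rintegral => x _; rewrite [X in _ = _ * X](gk x).
    by rewrite [X in _ = _ * X]mulrCA mulKf// gt_eqF.
  - apply: measurable_funM.
      by apply: (measurableT_comp (f := g)) => //; exact: measurable_fst.
    apply: measurable_funD; apply: measurable_funM; try exact: m2.
      exact: (measurableT_comp (continuous_measurable_fun (@continuous_cos R)) mtx).
    exact: (measurableT_comp (continuous_measurable_fun (@continuous_sin R)) mtx).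
  - by move=> x t _ _; rewrite normrM (ger0_norm (g0 _)) ler_wpM2l// fker_le.
(* this is (1 + t^2)^(- 3 / 2) cos ((q - p) atan t), in a form whose primitive is
   apparent *)
pose h (t : R) := 2^-1 * (cos (2 * a * atan t) + cos ((2 - 2 * a) * atan t)) / (1 + t ^+ 2).
have I4 t : 0 <= t -> \int[mu]_x (g x * fker nu x t) =
    Gamma_pos p * Gamma_pos q * h t.
  move=> t0; pose nuq := gamma_law q 1.
  have mk := measurable_fker nufin.
  have Iq (f : R -> R) : continuous f -> (forall x, `|f x| <= 1) ->
      \int[mu]_x (g x * f x) = \int[nuq]_x f x.
    move=> cf f1; have mcf := continuous_measurable_fun cf.
    have E y : g y * f (pospart y) = g y * f y.
      rewrite /pospart; case: ifPn => // /negbTE y0.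
      by rewrite /g /tilt /gpow y0 !mul0r.
    rewrite /nuq /gamma_law /tilted integral_wlaw//.
      by apply: eq_Rintegral => y _; rewrite -/(g y) E.
    apply: (integrable_bound measurableT _ _ ig).
      apply: measurable_funM => //.
      by apply: measurable_fun_lebesgue; apply: measurableT_comp => //; exact: measurable_pospart.
    by move=> y _; rewrite normrM ger0_norm// ler_piMr.
  have cZ (f : R -> R) : continuous f -> continuous (fun x => f (t * x)).
    move=> cf x; apply: (@cvg_comp _ _ _ (fun x => t * x) f); last exact: cf.
    by apply: cvgM; [exact: cvg_cst|exact: cvg_id].
  have cos1 (x : R) : `|cos x| <= 1 by rewrite ler_norml cos_geN1 cos_le1.
  have sin1 (x : R) : `|sin x| <= 1 by rewrite ler_norml sin_geN1 sin_le1.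
  have ig1 (f : R -> R) : continuous f -> (forall x, `|f x| <= 1) ->
      mu.-integrable setT (EFin \o (fun x => g x * f x)).
    move=> cf f1; apply: (integrable_bound measurableT _ _ ig).
      apply: measurable_funM => //.
      exact: measurable_fun_lebesgue (continuous_measurable_fun cf).
    by move=> y _; rewrite normrM ger0_norm// ler_piMr.
  have Icos := Iq _ (cZ _ (@continuous_cos R)) (fun x => cos1 (t * x)).
  have Isin := Iq _ (cZ _ (@continuous_sin R)) (fun x => sin1 (t * x)).
  have jcos := ig1 _ (cZ _ (@continuous_cos R)) (fun x => cos1 (t * x)).
  have jsin := ig1 _ (cZ _ (@continuous_sin R)) (fun x => sin1 (t * x)).
  transitivity (fcos nu t * fcos nuq t + fsin nu t * fsin nuq t).
    rewrite /fcos -/(fcos nu t) /fsin -/(fsin nu t) -Icos -Isin -!RintegralZl// -RintegralD//; last first.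
    - by have := integrableZl measurableT (fsin nu t) jsin; exact: eq_integrable.
    - by have := integrableZl measurableT (fcos nu t) jcos; exact: eq_integrable.
    by apply: eq_Rintegral => x _; rewrite /fker; ring.
  have z0 : 0 < cRe (1 +i* t) by exact: ltr01.
  rewrite /nu /nuq (gamma_fsinE p1 ltr01) (gamma_fsinE q1 ltr01).
  rewrite -(gammaL_fcos p1 ltr01) -(gammaL_fcos q1 ltr01).
  rewrite (gammaL_pow (ltW p1) z0) (gammaL_pow (ltW q1) z0).
  have cpE k : cpow (1 +i* t) k%:C = (expR (k * ln (cmod (1 +i* t))) * cos (k * atan t)) +i*
      (expR (k * ln (cmod (1 +i* t))) * sin (k * atan t)).
    by rewrite /cpow /cexp !cReZ !cImZ -carg_vertical.
  rewrite !cReZ !cImZ !cpE.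
  set r := cmod (1 +i* t); have r2 : r ^+ 2 = 1 + t ^+ 2 by rewrite sqr_cmod /= expr1n.
  have r0 : 0 < r by rewrite cmod_gt0_Re.
  have cosr : cos (atan t) = r^-1 by rewrite cos_atan -r2 sqrtr_sqr ger0_norm// ltW.
  have e3 : expR (- p * ln r) * expR (- q * ln r) = r ^- 3.
    rewrite -expRD -mulrDl (_ : - p + - q = - 3%:R); last by rewrite /p /q; ring.
    by rewrite mulNr expRN expRM_natl lnK.
  have hE : h t = r ^- 3 * cos ((q - p) * atan t).
    rewrite /h -r2.
    rewrite (_ : (q - p) * atan t = (1 - 2 * a) * atan t); last by rewrite /p /q; ring.
    rewrite (_ : 2 * a * atan t = atan t - (1 - 2 * a) * atan t); last by ring.
    rewrite (_ : (2 - 2 * a) * atan t = atan t + (1 - 2 * a) * atan t); last by ring.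
    rewrite cosB cosD cosr; move: (cos _) (sin _) (sin _) => c s1 s2.
    by field; rewrite gt_eqF.
  rewrite hE -e3 [(q - p) * _]mulrBl cosB.
  have -> : cos (- p * atan t) = cos (p * atan t) by rewrite mulNr cosN.
  have -> : cos (- q * atan t) = cos (q * atan t) by rewrite mulNr cosN.
  have -> : sin (- p * atan t) = - sin (p * atan t) by rewrite mulNr sinN.
  have -> : sin (- q * atan t) = - sin (q * atan t) by rewrite mulNr sinN.
  rewrite /=.
  move: (expR _) (expR _) (cos _) (cos _) (sin _) (sin _) => e1 e2 c1 c2 s1 s2.
  by ring.
have t2 (t : R) : 0 < 1 + t ^+ 2 by rewrite ltr_pwDl ?sqr_ge0.
have dk k t : is_derive t (1 : R) (fun t => k * atan t) (k / (1 + t ^+ 2)).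
  by apply: (dderive_eq (dderiveZ k (dderive_atan (dderive_id t)))) => //; rewrite mulr1.
have ch : continuous h.
  move=> t; apply: cvgM; first apply: cvgM; first exact: cvg_cst.
    apply: cvgD.
      exact: (dderive_continuous_at (dderive_cos (dk (2 * a) t))).
    exact: (dderive_continuous_at (dderive_cos (dk (2 - 2 * a) t))).
  by apply: cvgV; [rewrite gt_eqF|apply: cvgD; [exact: cvg_cst|exact: exprn_continuous]].
have ih : mu.-integrable `[0%R, +oo[ (EFin \o h).
  have i1 : mu.-integrable `[0%R, +oo[ (EFin \o (fun t : R => (1 + t ^+ 2)^-1)).
    apply/integrableP; split.
      apply/measurable_EFinP; apply: measurable_fun_lebesgue; apply: continuous_measurable_fun => t.
      by apply: cvgV; [rewrite gt_eqF|apply: cvgD; [exact: cvg_cst|exact: exprn_continuous]].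
    rewrite (_ : integral _ _ _ = (pi / 2)%:E) ?ltry// -integral0y_oneDsqr.
    by apply: eq_integral => t _; rewrite /= ger0_norm// invr_ge0 ltW.
  apply: (integrable_bound (lebesgue_measurable_itv _) _ _ i1).
    exact: measurable_fun_lebesgue (continuous_measurable_fun ch).
  move=> t _; rewrite /h normrM (ger0_norm (_ : 0 <= (1 + t ^+ 2)^-1)) ?invr_ge0 ?(ltW (t2 t))//.
  by rewrite ler_piMl ?invr_ge0 ?(ltW (t2 t))// half_cosD_le1.
have b0 : 0 < 1 - a by rewrite subr_gt0.
have I5 : \int[mu]_(t in `[0%R, +oo[) h t = sin (pi * a) / (4 * a * (1 - a)).
  pose F (t : R) := (4 * a)^-1 * sin (2 * a * atan t) + (4 * (1 - a))^-1 * sin ((2 - 2 * a) * atan t).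
  have dF t : is_derive t (1 : R) F (h t).
    have := dderiveD (dderiveZ (4 * a)^-1 (dderive_sin (dk (2 * a) t)))
      (dderiveZ (4 * (1 - a))^-1 (dderive_sin (dk (2 - 2 * a) t))).
    move/dderive_eq; apply => //; rewrite /h.
    by field; rewrite !gt_eqF.
  have cF := dderive_continuous dF.
  have ih' : mu.-integrable `]0%R, +oo[ (EFin \o h).
    apply: (integrableS (lebesgue_measurable_itv _) (lebesgue_measurable_itv _) _ ih).
    by apply: subset_itv => //; rewrite bnd_simp.
  rewrite -Rintegral_itv_obnd_cbnd//.
  have F0 : F 0 = 0 by rewrite /F atan0 !mulr0 sin0 !mulr0 addr0.
  have lim : (fun n => F n.+1%:R) @ \oo --> (4 * a)^-1 * sin (2 * a * (pi / 2)) +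
      (4 * (1 - a))^-1 * sin ((2 - 2 * a) * (pi / 2)).
    have at_ : (fun n => atan n.+1%:R : R) @ \oo --> pi / 2.
      have := @cvg_atan_seq R 1; rewrite sgr1 mulr1.
      by under eq_fun do rewrite invrK mul1r.
    have cs (k : R) : (fun n => sin (k * atan n.+1%:R)) @ \oo --> sin (k * (pi / 2)).
      apply: (@cvg_comp _ _ _ (fun n => k * atan n.+1%:R) sin _ (nbhs (k * (pi / 2)))).
        by apply: cvgM; [exact: cvg_cst|exact: at_].
      exact: continuous_sin.
    by apply: cvgD; apply: cvgM; try exact: cvg_cst; exact: cs.
  have lim0 : (fun n => F n.+1%:R^-1) @ \oo --> (0 : R).
    rewrite -F0; apply: (@cvg_comp _ _ _ (fun n => n.+1%:R^-1) F); first exact: cvg_harmonic0.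
    exact: cF.
  apply: etrans (@Rintegral_FTC_pos _ F _ _ _ _ _ ih' lim0 lim) _ => //.
    by move=> x _; exact: ch.
  rewrite subr0 (_ : 2 * a * (pi / 2) = pi * a); last by field.
  rewrite (_ : (2 - 2 * a) * (pi / 2) = - (pi * a) + pi); last by field.
  rewrite sinDpi sinN opprK; move: (sin _) => s.
  by field; rewrite !gt_eqF.
move: I1; rewrite I2 I3 (_ : \int[mu]_(t in `[0%R, +oo[) (\int[mu]_x (g x * fker nu x t)) =
   Gamma_pos p * Gamma_pos q * (sin (pi * a) / (4 * a * (1 - a)))); last first.
  rewrite -I5 -RintegralZl//.
  by apply: eq_Rintegral => t; rewrite inE /= in_itv /= andbT => /I4.
by apply: reflection_algebra; rewrite ?gt_eqF.
Qed.

(** The functional equation raises both arguments by one, to values at least 1. *)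
Lemma invGamma_reflection (a : R) : 0 <= a -> a <= 1 ->
  invGamma a * invGamma (1 - a) = sin (pi * a) / pi.
Proof.
move=> a0 a1; have h1 : 1 <= a + 1%:R by rewrite lerDr.
have h2 : 1 <= 1 - a + 1%:R by lra.
rewrite (invGammaE h1) (invGammaE h2) !big_ord1 !addr0.
move: a0 a1; rewrite !le_eqVlt => /predU1P[<-|a0].
  by rewrite !mul0r mulr0 sin0 mul0r.
move=> /predU1P[->|a1].
  by rewrite subrr !mul0r !mulr0 mulr1 sinpi mul0r.
have := Gamma_reflection a0 a1.
have -> : a + 1 = 1 + a by ring.
have -> : 1 - a + 1 = 2 - a by ring.
have g1 : Gamma_pos (1 + a) != 0 :> R by rewrite gt_eqF// Gamma_pos_gt0// lerDl ltW.
have g2 : Gamma_pos (2 - a) != 0 :> R by rewrite gt_eqF// Gamma_pos_gt0//; lra.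
have np : pi != 0 :> R by rewrite gt_eqF// pi_gt0.
move=> H; have -> : sin (pi * a) = pi * (a * (1 - a)) / (Gamma_pos (1 + a) * Gamma_pos (2 - a)).
  by rewrite -H mulrAC divff ?mul1r// mulf_neq0.
move: g1 g2 np {H}; move: (Gamma_pos _) (Gamma_pos _) (@pi R) => A B c g1 g2 np.
by field; rewrite g1 g2 np.
Qed.

End GammaFormulas.

(** * Laplace exponents *)

Section LaplaceExponent.
Context {R : realType}.
Variables (a b : R) (Pi : {measure set R -> \bar R}).
Hypotheses (a0 : 0 <= a) (b0 : 0 <= b) (levy : is_levy_measure Pi).
Let D : set R := `]0, +oo[%classic.
Let mD : measurable D. Proof. exact: measurable_itv. Qed.
Notation Phi := (levy_khintchine a b Pi).

Lemma cexp_bound1 (u : R[i]) :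
  cmod (cexp u - 1) <= cmod u + 5 * cmod u ^+ 2 * expR (cmod u).
Proof.
have -> : cexp u - 1 = u + (cexp u - 1 - u) by ring.
by apply: le_trans (cmodD _ _) _; rewrite lerD2l cexp_bound2.
Qed.

Lemma integrable_min1 : Pi.-integrable D (EFin \o (fun x => Num.min 1 x)).
Proof.
have [_ _ fin] := levy; apply/integrableP; split.
  by apply/measurable_EFinP; apply: measurable_minr => //; exact: measurable_funTS.
apply: le_lt_trans fin; rewrite le_eqVlt; apply/orP; left; apply/eqP.
apply: eq_integral => x; rewrite inE /D /= in_itv /= andbT => x0.
by rewrite ger0_norm// le_min ler01 ltW.
Qed.

Let mcexp z : cmeasurable D (fun x => 1 - cexp (- z * x%:C)).
Proof.
have me : measurable_fun D (fun x => expR (cRe (- z) * x)).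
  by apply: measurable_funTS; apply: measurableT_comp => //; exact: measurable_funM.
have mc : measurable_fun D (fun x => cos (cIm (- z) * x)).
  apply: measurable_funTS; apply: measurableT_comp; last exact: measurable_funM.
  exact: continuous_measurable_fun (@continuous_cos R).
have ms : measurable_fun D (fun x => sin (cIm (- z) * x)).
  apply: measurable_funTS; apply: measurableT_comp; last exact: measurable_funM.
  exact: continuous_measurable_fun (@continuous_sin R).
split.
  under eq_fun do rewrite cReD cReN /cexp /= cReZr cImZr.
  by apply: measurable_funB => //; exact: measurable_funM.
under eq_fun do rewrite cImD cImN /cexp /= cReZr cImZr.
by apply: measurable_funB => //; exact: measurable_funM.
Qed.

(** Near 0 the exponential is Lipschitz, and away from 0 its modulus is at most
    1 because [Re z >= 0]. *)
Lemma cmod_1Bcexp (z : R[i]) (x : R) : 0 <= cRe z -> 0 < x ->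
  cmod (1 - cexp (- z * x%:C)) <=
  (2 + cmod z + 5 * cmod z ^+ 2 * expR (cmod z)) * Num.min 1 x.
Proof.
move=> z0 x0; have c0 := cmod_ge0 z; have e0 := expR_ge0 (cmod z).
have k0 : 0 <= 5 * cmod z ^+ 2 * expR (cmod z) by rewrite !mulr_ge0 ?sqr_ge0.
have [x1|x1] := leP x 1.
  rewrite -cmodN opprB.
  apply: le_trans (cexp_bound1 _) _; rewrite cmodM cmodN cmod_real (ger0_norm (ltW x0)).
  have h1 : expR (cmod z * x) <= expR (cmod z) by rewrite ler_expR ler_piMr.
  have h2 : (cmod z * x) ^+ 2 <= cmod z ^+ 2 * x.
    by rewrite exprMn ler_wpM2l ?sqr_ge0// expr2 ler_piMr// ltW.
  have h3 : 5 * (cmod z * x) ^+ 2 * expR (cmod z * x) <= 5 * cmod z ^+ 2 * expR (cmod z) * x.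
    rewrite [leRHS]mulrAC; apply: ler_pM => //; rewrite ?expR_ge0 ?mulr_ge0 ?sqr_ge0 ?(ltW x0)//.
    by rewrite -[leRHS]mulrA ler_wpM2l.
  have := ltW x0; move: h3; lra.
rewrite mulr1; apply: le_trans (cmodB _ _) _.
rewrite cmod1 cmod_cexp cReZr cReN.
have : expR (- cRe z * x) <= 1 by rewrite expR_le1 mulNr oppr_le0 mulr_ge0// ltW.
by move: (expR (- _ * _)) => e e1; lra.
Qed.

Lemma cintegrable_levy z : 0 <= cRe z -> cintegrable Pi D (fun x => 1 - cexp (- z * x%:C)).
Proof.
move=> z0; set k := 2 + cmod z + 5 * cmod z ^+ 2 * expR (cmod z).
have ik : Pi.-integrable D (EFin \o (fun x => k * Num.min 1 x)).
  by have := integrableZl mD k integrable_min1; exact: eq_integrable.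
apply: (cintegrable_bound mD (mcexp z) _ ik) => x; rewrite /D /= in_itv /= andbT.
exact: cmod_1Bcexp.
Qed.

(** The exponent on the real half-line. It bounds [Re (Phi z)] from below by
    [lexp_le_Re], whence [Re (Phi z) > 0]. *)
Definition lexp (l : R) : R := a + b * l + \int[Pi]_(x in D) (1 - expR (- (l * x))).

Lemma integrable_1BexpR l : 0 <= l ->
  Pi.-integrable D (EFin \o (fun x => 1 - expR (- (l * x)))).
Proof.
move=> l0; have [+ _] := @cintegrable_levy l%:C l0; apply: eq_integrable => // x _.
rewrite /cexp /= !oppr0 !(mul0r, mulr0) subr0 addr0 cos0 mulr1.
by rewrite mulNr.
Qed.

Lemma levy_khintchine_real l : 0 <= l -> Phi l%:C = (lexp l)%:C.
Proof.
move=> l0; apply: complexP; rewrite /levy_khintchine /cintegral /lexp !cE /=.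
  congr (_ + _ + _); first by ring.
  by apply: eq_Rintegral => x _; rewrite oppr0 !(mul0r, mulr0) subr0 addr0 cos0 mulr1 mulNr.
rewrite (_ : Rintegral _ _ _ = 0); first by ring.
under eq_Rintegral do rewrite oppr0 !(mul0r, mulr0) addr0 sin0 mulr0 subr0.
by rewrite /Rintegral integral0.
Qed.

Lemma lexp_le_Re z : 0 <= cRe z -> lexp (cRe z) <= cRe (Phi z).
Proof.
move=> z0; rewrite /levy_khintchine /cintegral /lexp !cE /= mul0r subr0 lerD2l.
have [i1 _] := cintegrable_levy z0.
apply: le_Rintegral => //; first exact: integrable_1BexpR.
move=> x Dx; rewrite cReZr cReN !mulNr lerD2l lerN2.
by rewrite ler_piMr ?expR_ge0// cos_le1.
Qed.

Hypothesis nz : 0 < a \/ 0 < b \/ (0 < Pi D)%E.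

(** If [a = b = 0] and the integral vanished, the positive function [1 - exp (-
    l x)] would be zero almost everywhere for a nonzero measure. *)
Lemma lexp_gt0 l : 0 < l -> 0 < lexp l.
Proof.
move=> l0; have f0 x : D x -> 0 <= 1 - expR (- (l * x)).
  rewrite /D /= in_itv /= andbT => x0.
  by rewrite subr_ge0 expR_le1 oppr_le0 mulr_ge0// ltW.
have I0 : 0 <= \int[Pi]_(x in D) (1 - expR (- (l * x))) by exact: Rintegral_ge0.
have bl : 0 <= b * l by rewrite mulr_ge0// ltW.
rewrite /lexp; case: nz => [a1|[b1|P1]].
- by rewrite -addrA ltr_pwDl// addr_ge0.
- by rewrite ltr_pwDl// ltr_wpDl// mulr_gt0.
rewrite ltr_wpDl ?addr_ge0// lt_neqAle I0 andbT eq_sym; apply/eqP => I1.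
have iP := integrable_1BexpR (ltW l0).
have I2 : (\int[Pi]_(x in D) `|(1 - expR (- (l * x)))%:E| = 0)%E.
  rewrite -[RHS]/(0%R%:E) -I1 /Rintegral fineK; last exact: integrable_fin_num.
  by apply: eq_integral => x; rewrite inE => /f0 h /=; rewrite ger0_norm.
have mi : measurable_fun D (EFin \o (fun x => 1 - expR (- (l * x)))).
  by case/integrableP : iP.
have := (ae_eq_integral_abs Pi mD mi).1 I2 => -[A [mA A0 sub]].
have : (Pi D <= Pi A)%E.
  apply: le_measure; rewrite ?inE// => x Dx; apply: sub => /= /(_ Dx) [] /eqP.
  rewrite subr_eq0 eq_sym => /eqP h.
  have : expR (- (l * x)) < 1.
    move: Dx; rewrite /D /= in_itv /= andbT => x0.
    by rewrite -expR0 ltr_expR oppr_lt0 mulr_gt0.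
  by rewrite h ltxx.
by rewrite A0 leNgt P1.
Qed.

End LaplaceExponent.

(** * The Laplace transform of the potential measure *)

Section Process.
Context d (Omega : measurableType d) (R : realType) (P : probability Omega R).
Variables (Y : R -> Omega -> R) (zeta : Omega -> \bar R) (X : R -> Omega -> option R).
Hypotheses (Ysub : is_subordinator P Y) (mzeta : measurable_fun setT zeta)
  (XE : forall (t : R) w, 0 <= t ->
     X t w = if (t%:E < zeta w)%E then Some (Y t w) else None).
Notation mu := (@lebesgue_measure R).
Notation T := (Omega * measurableTypeR R)%type.

(** The process is seen as one random variable on the space of pairs (outcome,
    time), with the product of [P] and Lebesgue measure; negative times get
    weight 0. *)
Definition alive (z : T) : R := if (0 <= z.2) && (z.2%:E < zeta z.1)%E then 1 else 0.
Definition path (z : T) : R := Y (Num.max z.2 0) z.1.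

Lemma subordinator_ge0 t w : 0 <= t -> 0 <= Y t w.
Proof. by move=> t0; rewrite -(subord_0 Ysub w); exact: (subord_ndecr Ysub). Qed.

Lemma path_ge0 z : 0 <= path z.
Proof. by apply: subordinator_ge0; rewrite le_max lexx orbT. Qed.

Lemma alive_ge0 z : 0 <= alive z.
Proof. by rewrite /alive; case: ifP. Qed.

(** By right-continuity and monotonicity, [Y t < c] amounts to [Y q < c] for
    some rational [q > t], which is a countable union of rectangles. *)
Lemma measurable_path : measurable_fun setT path.
Proof.
apply: (measurability _ (RGenInftyO.measurableE R)) => // _ [_ [c ->] <-].
rewrite setTI; pose F (q : rat) : set T :=
  if 0 < ratr q :> R then [set w | Y (ratr q) w < c] `*` [set t : measurableTypeR R | (t < ratr q)%R] else set0.
have -> : path @^-1` `]-oo, c[ = \bigcup_q F q.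
  apply/seteqP; split => [[w t]|[w t] [q _]]; rewrite /path /=.
    rewrite in_itv /= => Yc; set s := Num.max t 0 in Yc.
    have s0 : 0 <= s by rewrite le_max lexx orbT.
    have cY : Y u w @[u --> s^'+] --> Y s w by exact: (subord_rcont Ysub).
    have e0 : 0 < c - Y s w by rewrite subr_gt0.
    have H : \forall u \near s^'+, `|Y s w - Y u w| < c - Y s w.
      exact: (@cvgr_dist_lt _ _ _ _ _ _ _ cY _ e0).
    case: H => e /= e1 He.
    have [q /andP[q1 q2]] : exists q : rat, s < ratr q < s + e.
      have se : s < s + e by rewrite ltrDl.
      by have [q H] := rat_in_itvoo se; exists q; move: H; rewrite in_itv.
    exists q => //; rewrite /F (le_lt_trans s0 q1); split => /=.
      have := He (ratr q); rewrite /ball_ /= distrC ger0_norm ?subr_ge0 ?(ltW q1)//.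
      move=> /(_ _ q1); rewrite ltrBlDl => /(_ q2).
      by rewrite ltr_norml => /andP[+ _]; lra.
    by apply: le_lt_trans q1; rewrite le_max lexx.
  rewrite /F; case: ifP => // q0 [/= Yc tq]; rewrite in_itv /=.
  apply: le_lt_trans Yc; apply: (subord_ndecr Ysub).
    by rewrite le_max lexx orbT.
  by rewrite ge_max (ltW tq) ltW.
apply: bigcupT_measurable_rat => q; rewrite /F; case: ifP => q0 //.
apply: measurableX.
  have := subord_meas Ysub (ltW q0) => /(_ measurableT _ (measurable_itv `]-oo, c[)).
  by rewrite setTI; congr (measurable _); apply/seteqP; split => w /=; rewrite in_itv.
by rewrite (_ : [set t | _] = `]-oo, ratr q[%classic)//; apply/seteqP; split => w /=; rewrite in_itv.
Qed.

Lemma measurable_alive : measurable_fun setT alive.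
Proof.
have h1 : measurable_fun setT (fun z : T => (0 <= z.2)%R).
  by apply: measurable_fun_ler => //; exact: measurable_snd.
have h2 : measurable_fun setT (fun z : T => (z.2%:E < zeta z.1)%E).
  apply: measurable_fun_lte.
    by apply/measurable_EFinP; exact: measurable_snd.
  by apply: measurableT_comp => //; exact: measurable_fst.
rewrite /alive; apply: measurable_fun_ifT => //; exact: measurable_and.
Qed.

Definition ptime : {measure set T -> \bar R} := (P \x mu)%E.

(** By Tonelli, the potential measure is the image by [path] of the measure of
    density [alive], so that it falls under the results on [laplace]. *)
Lemma potentialE (A : set R) : measurable A ->
  potential P X A = (\int[ptime]_z (alive z * \1_A (path z))%:E)%E.
Proof.
move=> mA; rewrite /ptime fubini_tonelli1; last 2 first.
- apply/measurable_EFinP; apply: measurable_funM; first exact: measurable_alive.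
  by apply: (measurableT_comp (measurable_indic mA)); exact: measurable_path.
- by move=> z; rewrite lee_fin mulr_ge0 ?alive_ge0// indicE.
rewrite /potential; apply: eq_integral => w _; rewrite /fubini_F.
rewrite [RHS](_ : _ = \int[mu]_(t in `[0%R, +oo[) (alive (w, t) * \1_A (path (w, t)))%:E)%E; last first.
  rewrite [RHS]integral_mkcond; apply: eq_integral => t _; rewrite patchE.
  case: ifPn => //; rewrite notin_setE /= in_itv /= andbT => /negP t0.
  by rewrite /alive /= (negbTE t0) mul0r.
apply: eq_integral => t; rewrite inE /= in_itv /= andbT => t0; congr EFin.
rewrite /alive /path /= t0 /= max_l//.
case: ifPn => tz; last first.
  by rewrite indicE memNset ?mul0r//= => -[y]; rewrite XE// (negbTE tz).
rewrite mul1r; have [Ay|Ay] := pselect (A (Y t w)).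
  by rewrite !indicE !mem_set//=; exists (Y t w); rewrite // XE// tz.
by rewrite !indicE !memNset//= => -[y]; rewrite XE// tz => -[<-].
Qed.

Lemma Rintegral_ptime (f : T -> R) (g : R -> R) :
  ptime.-integrable setT (EFin \o f) -> (forall w t, t < 0 -> f (w, t) = 0) ->
  (forall t, 0 <= t -> P.-integrable setT (fun w => (f (w, t))%:E)) ->
  (forall t, 0 <= t -> \int[P]_w f (w, t) = g t) ->
  \int[ptime]_z f z = \int[mu]_(t in `[0%R, +oo[) g t.
Proof.
move=> iF f0 iP fg; rewrite /Rintegral; congr fine.
rewrite /ptime -integral21_prod_meas1//= [RHS]integral_mkcond.
apply: eq_integral => t _; rewrite patchE; case: ifPn.
  rewrite inE /= in_itv /= andbT => t0.
  by rewrite -fg// /Rintegral fineK//; exact: integrable_fin_num (iP t t0).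
rewrite notin_setE /= in_itv /= andbT => /negP; rewrite -ltNge => t0.
by apply: integral0_eq => w _; rewrite f0.
Qed.

Variables (a b : R) (Pi : {measure set R -> \bar R}).
Hypotheses (a0 : 0 <= a) (b0 : 0 <= b) (levy : is_levy_measure Pi)
  (nz : 0 < a \/ 0 < b \/ (0 < Pi `]0%R, +oo[%classic)%E)
  (Xchar : forall (t : R) (z : R[i]), 0 <= t -> 0 <= cRe z ->
     cintegral P setT (fun w => if X t w is Some y then cexp (- z * y%:C) else 0) =
     cexp (- levy_khintchine a b Pi z * t%:C)).
Notation Phi := (levy_khintchine a b Pi).
Notation term z := (fun s : T => (alive s)%:C * cexp (- z * (path s)%:C)).

Let char_path (t : R) (z : R[i]) : 0 <= t -> 0 <= cRe z ->
  cintegral P setT (fun w => term z (w, t)) = cexp (- Phi z * t%:C).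
Proof.
move=> t0 z0; rewrite -Xchar//; congr cintegral; apply/funext => w.
rewrite XE// /alive /path /= t0 max_l//=.
by case: ifP; rewrite ?mul1r ?mul0r.
Qed.

Let measurable_term z : cmeasurable setT (term z).
Proof.
have mp (c : R) : measurable_fun setT (fun s => c * path s).
  by apply: measurable_funM => //; exact: measurable_path.
have me : measurable_fun setT (fun s => alive s * expR (cRe (- z) * path s)).
  by apply: measurable_funM; [exact: measurable_alive|exact: measurableT_comp].
have mc : measurable_fun setT (fun s => cos (cIm (- z) * path s)).
  by apply: measurableT_comp => //; exact: continuous_measurable_fun (@continuous_cos R).
have ms : measurable_fun setT (fun s => sin (cIm (- z) * path s)).
  by apply: measurableT_comp => //; exact: continuous_measurable_fun (@continuous_sin R).
split.
  under eq_fun do rewrite cReZ /cexp /= cReZr cImZr mulrA.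
  exact: measurable_funM me mc.
under eq_fun do rewrite cImZ /cexp /= cReZr cImZr mulrA.
exact: measurable_funM me ms.
Qed.

Let term_le z s : 0 <= cRe z -> cmod (term z s) <= alive s * expR (- (cRe z * path s)).
Proof.
move=> z0; rewrite cmodM cmod_real cmod_cexp ger0_norm ?alive_ge0// cReZr cReN.
by rewrite mulNr.
Qed.

Let integrable_section z t : 0 <= cRe z -> cintegrable P setT (fun w => term z (w, t)).
Proof.
move=> z0; have [m1 m2] := measurable_term z.
have bnd w : cmod (term z (w, t)) <= 1.
  apply: le_trans (term_le (w, t) z0) _.
  have e1 : expR (- (cRe z * path (w, t))) <= 1.
    by rewrite expR_le1 oppr_le0 mulr_ge0// path_ge0.
  rewrite /alive; case: ifP => _; last by rewrite mul0r.
  by rewrite mul1r.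
have P1 : (P setT < +oo)%E by rewrite probability_setT ltry.
split; apply: (integrable_finite (K := 1)) => //.
- by have := measurableT_comp m1 (measurable_pair2 t).
- by move=> w _; apply: le_trans (normRe_le _) (bnd w).
- by have := measurableT_comp m2 (measurable_pair2 t).
- by move=> w _; apply: le_trans (normIm_le _) (bnd w).
Qed.

(** By Tonelli, this integral is that of [exp (- t Phi l)] over the half-line. *)
Lemma integrable_alive l : 0 < l ->
  ptime.-integrable setT (fun s => (alive s * expR (- (l * path s)))%:E).
Proof.
move=> l0; have p0 := lexp_gt0 a0 b0 levy nz l0.
have E0 s : 0 <= alive s * expR (- (l * path s)) by rewrite mulr_ge0 ?alive_ge0 ?expR_ge0.
have cl : 0 <= cRe l%:C by exact: ltW.
have tE s : cRe (term l%:C s) = alive s * expR (- (l * path s)).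
  by rewrite -real_complexN -real_complexM cexp_real cReZ /= mulNr.
have mE : measurable_fun setT (fun s => (alive s * expR (- (l * path s)))%:E).
  apply/measurable_EFinP; apply: measurable_funM; first exact: measurable_alive.
  apply: measurableT_comp => //; apply: measurableT_comp => //.
  by apply: measurable_funM => //; exact: measurable_path.
apply/integrableP; split => //.
under eq_integral do rewrite /= (ger0_norm (E0 _)).
have E1 s : (0 <= (alive s * expR (- (l * path s)))%:E)%E by rewrite lee_fin.
rewrite /ptime (@fubini_tonelli1 _ _ _ _ _ P mu _ mE E1).
rewrite /fubini_F (@fubini_tonelli _ _ _ _ _ P mu _ mE E1).
rewrite [X in (X < _)%E](_ : _ = ((lexp a b Pi l)^-1)%:E) ?ltry//.
rewrite -integral_expRN// [RHS]integral_mkcond; apply: eq_integral => t _.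
rewrite patchE; case: ifPn.
  rewrite inE /= in_itv /= andbT => t0.
  have [i1 _] := integrable_section t cl.
  have -> : expR (- (lexp a b Pi l * t)) = \int[P]_w cRe (term l%:C (w, t)).
    have := char_path t0 cl; rewrite levy_khintchine_real ?(ltW l0)//.
    rewrite -real_complexN -real_complexM cexp_real => /(congr1 (@cRe R)) /= ->.
    by rewrite mulNr.
  rewrite /Rintegral fineK; last exact: integrable_fin_num i1.
  by apply: eq_integral => w _; rewrite tE.
rewrite notin_setE /= in_itv /= andbT => /negP t0.
by apply: integral0_eq => w _; rewrite /alive /= (negbTE t0) mul0r.
Qed.

Notation L := (laplace ptime alive path).

Let LE0 z : L 0 z = cintegral ptime setT (term z).
Proof.
by rewrite /laplace; congr cintegral; apply/funext => s; rewrite expr0 mulr1.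
Qed.

(** By Fubini and [E exp (- z X_t) = exp (- t Phi z)], the transform is the
    integral of [exp (- t Phi z)] over [t > 0]; it converges because [Re (Phi
    z) > 0]. *)
Lemma laplace_potential z : 0 < cRe z -> L 0 z = (Phi z)^-1.
Proof.
move=> z0; have z0' := ltW z0.
have al : 0 < cRe (Phi z).
  by apply: lt_le_trans (lexp_le_Re _ _ levy z0'); exact: lexp_gt0.
have [i1 i2] : cintegrable ptime setT (term z).
  apply: (cintegrable_bound measurableT (measurable_term z) _ (integrable_alive z0)).
  by move=> s _; exact: term_le.
have t0E w t : t < 0 -> term z (w, t) = 0.
  by move=> t0; rewrite /alive /= leNgt t0 /= mul0r.
have [c1 c2] := Rintegral_exp_cos_sin (cIm (Phi z)) al.
rewrite LE0 /cintegral (Rintegral_ptime (g := fun t => expR (- (cRe (Phi z) * t)) * cos (cIm (Phi z) * t)))//; last first.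
- move=> t t0; have := char_path t0 z0' => /(congr1 (@cRe R)) /= ->.
  by rewrite cReZr cImZr cReN cImN !mulNr cosN.
- by move=> t t0; have [] := integrable_section t z0'.
- by move=> w t t0; rewrite t0E.
rewrite (Rintegral_ptime (g := fun t => - (expR (- (cRe (Phi z) * t)) * sin (cIm (Phi z) * t))))//; last first.
- move=> t t0; have := char_path t0 z0' => /(congr1 (@cIm R)) /= ->.
  by rewrite cReZr cImZr cReN cImN !mulNr sinN mulrN.
- by move=> t t0; have [] := integrable_section t z0'.
- by move=> w t t0; rewrite t0E.
rewrite c1.
have -> : \int[mu]_(t in `[0%R, +oo[) (- (expR (- (cRe (Phi z) * t)) * sin (cIm (Phi z) * t))) =
    - (cIm (Phi z) / (cRe (Phi z) ^+ 2 + cIm (Phi z) ^+ 2)).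
  rewrite -c2 -mulN1r -RintegralZl//.
    by apply: eq_Rintegral => t _; rewrite mulN1r.
  apply: (integrable_bound (lebesgue_measurable_itv _) _ _ (integrable_expRN al)).
    apply: measurable_fun_lebesgue; apply: measurable_funM.
      apply: measurableT_comp => //; apply: measurableT_comp => //; exact: measurable_funM.
    apply: measurableT_comp; last exact: measurable_funM.
    exact: continuous_measurable_fun (@continuous_sin R).
  by move=> t _; rewrite normrM ger0_norm ?expR_ge0// ler_piMr ?expR_ge0// ler_norml sin_geN1 sin_le1.
by case: (Phi z).
Qed.

End Process.

(** * Expansion of the potential density *)

Lemma locally_integrable_itv (R : realType) (rho : R -> R) (x y : R) : locally_integrable `]0, +oo[ rho ->
  0 < x -> (@lebesgue_measure R).-integrable `[x, y] (EFin \o rho).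
Proof.
move=> [m1 _ H] x0.
have sub : `[x, y] `<=` `]0%R, +oo[.
  by move=> t; rewrite /= !in_itv /= andbT => /andP[+ _]; exact: lt_le_trans.
apply/integrableP; split; last by have := H _ sub (@segment_compact _ _ _).
apply/measurable_EFinP; apply: (measurable_funS _ sub m1).
exact: lebesgue_measurable_itv.
Qed.

Section QdiffSums.
Context {R : realType}.

Lemma qdiffD (f g : R[i] -> R[i]) z l m : qdiff f z l -> qdiff g z m ->
  qdiff (fun w => f w + g w) z (l + m).
Proof.
move=> /qdiff_pos[C [e [C0 e0 _ H]]] /qdiff_pos[D [d [D0 d0 _ K]]].
exists (C + D), (Num.min e d); first by rewrite lt_min e0.
move=> h; rewrite lt_min => /andP[he hd].
have -> : f (z + h) + g (z + h) - (f z + g z) - h * (l + m) =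
  (f (z + h) - f z - h * l) + (g (z + h) - g z - h * m) by ring.
by apply: le_trans (cmodD _ _) _; rewrite mulrDl lerD// ?H ?K.
Qed.

Lemma qdiff_scale (c : R[i]) (f : R[i] -> R[i]) z l :
  qdiff f z l -> qdiff (fun w => c * f w) z (c * l).
Proof.
move=> /qdiff_pos[C [e [C0 e0 _ H]]]; exists (cmod c * C), e => // h he.
have -> : c * f (z + h) - c * f z - h * (c * l) = c * (f (z + h) - f z - h * l) by ring.
by rewrite cmodM -mulrA ler_wpM2l ?cmod_ge0 ?H.
Qed.

Lemma qdiff_sum (I : Type) (r : seq I) (f : I -> R[i] -> R[i]) z (l : I -> R[i]) :
  (forall i, qdiff (f i) z (l i)) ->
  qdiff (fun w => \sum_(i <- r) f i w) z (\sum_(i <- r) l i).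
Proof.
move=> H; elim: r => [|i r IH].
  exists 0, 1 => // h _; rewrite !big_nil subrr mulr0 subr0 cmod0.
  by rewrite mul0r.
have := qdiffD (H i) IH; rewrite big_cons; congr (qdiff _ z _).
by apply/funext => w; rewrite big_cons.
Qed.

Lemma iter_cpow_derivative (al : R) k z : 0 < cRe z ->
  qdiff (fun w => ((-1) ^+ k * \prod_(i < k) (al + i%:R))%:C * cpow w (- (al + k%:R))%:C) z
    (((-1) ^+ k.+1 * \prod_(i < k.+1) (al + i%:R))%:C * cpow z (- (al + k.+1%:R))%:C).
Proof.
move=> z0; have := qdiff_scale ((-1) ^+ k * \prod_(i < k) (al + i%:R))%:C
   (qdiff_cpow (- (al + k%:R)) z0).
rewrite mulrA -real_complexM; congr (qdiff _ z (_%:C * cpow z _%:C)).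
  by rewrite big_ord_recr /= exprS; ring.
by rewrite -natr1; ring.
Qed.

End QdiffSums.

Section RegularPotential.
Context d (T : measurableType d) (R : realType).
Variables (m : {measure set T -> \bar R}) (w xi : T -> R).
Hypotheses (mw : measurable_fun setT w) (mxi : measurable_fun setT xi)
  (w0 : forall t, 0 <= w t) (xi0 : forall t, 0 <= xi t)
  (iw : forall l : R, 0 < l ->
     m.-integrable setT (fun t => (w t * expR (- (l * xi t)))%:E)).
Variables (Phi : R[i] -> R[i]) (N : nat).
Notation L := (laplace m w xi).
Hypothesis LPhi : forall z, 0 < cRe z -> L 0 z = (Phi z)^-1.
Hypothesis condB : condition_B Phi N.
Notation mu := (@lebesgue_measure R).

Let sgn_laplace k z : 0 < cRe z ->
  qdiff (fun z => (-1) ^+ k * L k z) z ((-1) ^+ k.+1 * L k.+1 z).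
Proof.
move=> z0; have := qdiff_scale ((-1) ^+ k) (qdiff_laplace mw mxi w0 xi0 iw k z0).
by congr (qdiff _ z _); rewrite exprS; ring.
Qed.

(** The reciprocal of [Phi] is a Laplace transform, and each derivative brings
    down a factor [- x]. *)
Lemma cderive_inverse_exponent z : 0 < cRe z ->
  cderive N (fun z => (Phi z)^-1) z = (-1) ^+ N * L N z.
Proof.
apply: (cderiveE (g := fun k z => (-1) ^+ k * L k z)) => [y y0|k y y0].
  by rewrite expr0 mul1r LPhi.
by apply: qdiff_is_derive; exact: sgn_laplace.
Qed.

Section Remainder.
Variables (n : nat) (c al : nat -> R).

(** Up to the sign [(-1)^N], the [N]-th derivative of the singular part of
    [1 / Phi] at the origin. *)
Definition singular_part (z : R[i]) : R[i] :=
  \sum_(0 <= k < n.+1) ((\prod_(i < N) (al k + i%:R)) / c k)%:C * cpow z (- (al k + N%:R))%:C.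

Lemma cderive_remainder z : 0 < cRe z ->
  cderive N (fun z => (Phi z)^-1 -
     \sum_(0 <= k < n.+1) ((c k)%:C * cpow z (al k)%:C)^-1) z =
  (-1) ^+ N * (L N z - singular_part z).
Proof.
pose h j k z : R[i] := ((-1) ^+ j * \prod_(i < j) (al k + i%:R))%:C * cpow z (- (al k + j%:R))%:C.
pose g j z : R[i] := (-1) ^+ j * L j z +
  \sum_(0 <= k < n.+1) - (c k)^-1%:C * h j k z.
move=> z0; transitivity (g N z).
  apply: (@cderiveE _ _ g) => // [y y0|j y y0].
    rewrite /g expr0 mul1r LPhi//; congr (_ + _); rewrite -sumrN.
    apply: eq_bigr => k _; rewrite /h expr0 mul1r big_ord0 mul1r addr0.
    by rewrite cpowN invfM -real_complexV mulNr.
  apply: qdiff_is_derive; apply: qdiffD; first exact: sgn_laplace.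
  by apply: qdiff_sum => k; apply: qdiff_scale; exact: iter_cpow_derivative.
rewrite /g mulrBr -mulrN -sumrN; congr (_ + _); rewrite mulr_sumr.
apply: eq_bigr => k _; rewrite /h.
have -> : (-1) ^+ N = ((-1) ^+ N)%:C :> R[i] by rewrite real_complexX real_complexN.
rewrite mulNr mulrN !mulrA -!real_complexM; congr (- (_%:C * _)).
by ring.
Qed.

End Remainder.

(** The measure [x^N exp (- l x) U (dx)], where [U] is the image by [xi] of the
    measure of density [w]. Up to a sign its Fourier transform is the [N]-th
    derivative of [1 / Phi] along the line [Re z = l], which [condition_B]
    makes integrable. *)
Definition regular_law (l : R) : {measure set R -> \bar R} :=
  tilted m mw mxi w0 xi0 N l.

Let law_fin l : 0 < l -> (regular_law l setT < +oo)%E.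
Proof. by move=> l0; apply: tilted_fin. Qed.

Lemma regular_law_fcos l t : 0 < l -> fcos (regular_law l) t = cRe (L N (l +i* t)).
Proof. by move=> l0; rewrite laplace_fcos. Qed.

Lemma regular_law_fsin l t : 0 < l -> fsin (regular_law l) t = - cIm (L N (l +i* t)).
Proof. by move=> l0; rewrite laplace_fsin// opprK. Qed.

Lemma measurable_cmod_laplace l : 0 < l ->
  measurable_fun setT (fun t : R => cmod (L N (l +i* t))).
Proof.
move=> l0; under eq_fun do rewrite cmodE.
apply: (measurableT_comp (f := @Num.sqrt R)); first exact: continuous_measurable_fun (@sqrt_continuous R).
have c1 := continuous_measurable_fun (fcos_continuous (law_fin l0)).
have c2 := continuous_measurable_fun (fsin_continuous (law_fin l0)).
apply: measurable_funD; apply: measurable_funX.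
  rewrite (_ : (fun x : R => _) = fcos (regular_law l))//.
  by apply/funext => t; rewrite regular_law_fcos.
rewrite (_ : (fun x : R => _) = (fun t => - fsin (regular_law l) t)).
  exact: measurableT_comp.
by apply/funext => t; rewrite regular_law_fsin// opprK.
Qed.

(** This is [condition_B]; what matters is that the bound does not depend on
    [l]. *)
Lemma laplace_tail_bound r : 0 < r -> exists2 K, 0 <= K &
  forall l, 0 < l -> mu.-integrable `[r, +oo[ (fun t => (cmod (L N (l +i* t)))%:E) /\
    \int[mu]_(t in `[r, +oo[) cmod (L N (l +i* t)) <= K.
Proof.
move=> r0; have := condB r0; set S := ereal_sup _ => S1.
have S0 : (0 <= S)%E.
  apply: le_trans (_ : _ <= \int[mu]_(theta in ~` `](- r)%R, r[)
       (cmod (cderive N (fun z => (Phi z)^-1) (1 +i* theta)))%:E)%E _.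
    by apply: integral_ge0 => t _; rewrite lee_fin cmod_ge0.
  by apply: ereal_sup_ubound; exists 1 => //=.
have Sfin : S \is a fin_num by rewrite ge0_fin_numE.
exists (fine S); first exact: fine_ge0.
move=> l l0.
have mL : measurable_fun (`[r, +oo[%classic : set (measurableTypeR R)) (fun t => cmod (L N (l +i* t))).
  exact: measurable_fun_lebesgue (measurable_cmod_laplace l0).
have I1 : (\int[mu]_(t in `[r, +oo[) (cmod (L N (l +i* t)))%:E <= S)%E.
  apply: le_trans (_ : (\int[mu]_(theta in ~` `](- r)%R, r[)
       (cmod (cderive N (fun z => (Phi z)^-1) (l +i* theta)))%:E)%E <= _)%E; last first.
    by apply: ereal_sup_ubound; exists l.
  under [leRHS]eq_integral do
    rewrite cderive_inverse_exponent// cmodM cmodX cmodN cmod1 expr1n mul1r.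
  apply: ge0_subset_integral => //.
  - by apply: measurableC; exact: lebesgue_measurable_itv.
  - apply/measurable_EFinP; exact: measurable_fun_lebesgue (measurable_cmod_laplace l0).
  - by move=> t _; rewrite lee_fin cmod_ge0.
  - by move=> t; rewrite /= !in_itv /= andbT => rt /andP[_]; rewrite ltNge rt.
have il : mu.-integrable `[r, +oo[ (fun t => (cmod (L N (l +i* t)))%:E).
  apply/integrableP; split; first exact/measurable_EFinP.
  apply: le_lt_trans S1; apply: le_trans I1; rewrite le_eqVlt; apply/orP; left; apply/eqP.
  by apply: eq_integral => t _; rewrite /= ger0_norm ?cmod_ge0.
split => //; apply: fine_le => //; exact: integrable_fin_num il.
Qed.

(** The transform of a finite measure is bounded, which is enough near 0. *)
Lemma integrable_cmod_laplace l : 0 < l ->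
  mu.-integrable `[0%R, +oo[ (fun t => (cmod (L N (l +i* t)))%:E).
Proof.
move=> l0; have [K K0 HK] := laplace_tail_bound ltr01; have [i1 _] := HK l l0.
have mL (D : set (measurableTypeR R)) : measurable_fun D (fun t => cmod (L N (l +i* t))).
  exact: measurable_fun_lebesgue (measurable_cmod_laplace l0).
have m1 := @lebesgue_measurable_itv R `[0, 1[; have m2 := @lebesgue_measurable_itv R `[1, +oo[.
have U : `[0%R, 1[ `|` `[1, +oo[ = `[0%R, +oo[%classic :> set R.
  apply/seteqP; split => t /=; rewrite !in_itv /= ?andbT.
    by move=> [/andP[]//|]; apply: le_trans.
  by move=> ->; have [|] := ltP t 1; [left|right].
apply/integrableP; split; first exact/measurable_EFinP.
rewrite -U ge0_integral_setU//=; last 2 first.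
- by apply/measurable_EFinP; apply: measurableT_comp => //.
- apply/disj_set2P; apply/seteqP; split => // t /= []; rewrite !in_itv /= andbT.
  by move=> /andP[_ t1] /(lt_le_trans t1); rewrite ltxx.
apply: lte_add_pinfty; last by case/integrableP : i1.
have M0 := law_fin l0.
have bnd : forall t, `|cmod (L N (l +i* t))| <= 2 * fine (regular_law l setT).
  move=> t; rewrite ger0_norm ?cmod_ge0//; apply: le_trans (cmod_le _) _.
  rewrite -regular_law_fcos// -[cIm _]opprK -regular_law_fsin// normrN mulr_natl mulr2n.
  by apply: lerD; [exact: fcos_bound|exact: fsin_bound].
have : mu.-integrable `[0%R, 1[ (EFin \o (fun t => cmod (L N (l +i* t)))).
  apply: (integrable_finite m1 _ _ (fun t _ => bnd t)) => //.
  have : (mu `[0%R, 1%R[%classic < +oo)%E.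
    by rewrite lebesgue_measure_itv /=; case: ifP => _; rewrite ?ltry.
  exact.
by case/integrableP.
Qed.

Lemma regular_law_integrable l : 0 < l ->
  mu.-integrable `[0%R, +oo[ (EFin \o fcos (regular_law l)) /\
  mu.-integrable `[0%R, +oo[ (EFin \o fsin (regular_law l)).
Proof.
move=> l0; have i1 := integrable_cmod_laplace l0; have mi := @lebesgue_measurable_itv R `[0, +oo[.
split; apply: (integrable_bound mi _ _ i1).
- exact: measurable_fun_lebesgue (continuous_measurable_fun (fcos_continuous (law_fin l0))).
- by move=> t _; rewrite regular_law_fcos// normRe_le.
- exact: measurable_fun_lebesgue (continuous_measurable_fun (fsin_continuous (law_fin l0))).
- by move=> t _; rewrite regular_law_fsin// normrN normIm_le.
Qed.

(** The tilting by [exp (- l x)] and [x ^ N] is undone. *)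
Definition udens (l x : R) : R := x `^ (- N%:R) * expR (l * x) * fdens (regular_law l) x.

Let law_continuous l : 0 < l -> continuous (fdens (regular_law l)).
Proof.
by move=> l0; have [i1 i2] := regular_law_integrable l0; exact: fdens_continuous (law_fin l0) i1 i2.
Qed.

Lemma udens_continuous l x : 0 < l -> 0 < x -> {for x, continuous (udens l)}.
Proof.
move=> l0 x0; apply: cvgM; last exact: law_continuous.
apply: cvgM; first exact: (dderive_continuous_at (dderive_powR (- N%:R) x0)).
have := dderive_expnux (- l) x; under eq_fun do rewrite mulNr opprK.
exact: dderive_continuous_at.
Qed.

Lemma udens_ge0 l x : 0 < l -> 0 <= udens l x.
Proof.
move=> l0; have [i1 i2] := regular_law_integrable l0.
by apply: mulr_ge0; [rewrite mulr_ge0 ?powR_ge0 ?expR_ge0|exact: (fdens_ge0 (law_fin l0) i1 i2)].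
Qed.

Lemma measurable_udens l : 0 < l -> measurable_fun setT (udens l).
Proof.
move=> l0; apply: measurable_funM; last exact: continuous_measurable_fun (law_continuous l0).
apply: measurable_funM; first exact: measurable_powR.
by apply: measurableT_comp => //; exact: measurable_funM.
Qed.

Lemma regular_density l (A : set R) : 0 < l -> measurable A -> A `<=` `]0, +oo[ ->
  (\int[m]_t (w t * \1_A (xi t))%:E = \int[mu]_(x in A) (udens l x)%:E)%E.
Proof.
move=> l0 mA A0; have [i1 i2] := regular_law_integrable l0.
have Apos x : A x -> 0 < x by move=> /A0; rewrite /= in_itv /= andbT.
have f0 := fdens_ge0 (law_fin l0) i1 i2.
have mf : measurable_fun (setT : set (measurableTypeR R)) (fdens (regular_law l)).
  exact: measurable_fun_lebesgue (continuous_measurable_fun (law_continuous l0)).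
have mid : measurable_fun setT (id : measurableTypeR R -> R) by exact: measurable_id.
pose h (x : R) := \1_A x * (x `^ (- N%:R) * expR (l * x)).
have h0 x : 0 <= h x by rewrite mulr_ge0 ?mulr_ge0 ?powR_ge0 ?expR_ge0// indicE.
have mh : measurable_fun setT h.
  apply: measurable_funM; first exact: measurable_indic.
  apply: measurable_funM; first exact: measurable_powR.
  by apply: measurableT_comp => //; exact: measurable_funM.
have mhE : measurable_fun setT (EFin \o h) by exact/measurable_EFinP.
have h0E x : (0 <= (EFin \o h) x)%E by rewrite lee_fin.
transitivity (\int[regular_law l]_x (h x)%:E)%E.
  rewrite /regular_law /tilted (ge0_integral_wlaw _ _ _ _ mhE h0E).
  apply: eq_integral => t _; rewrite -EFinM; congr EFin; rewrite /h /tilt !indicE.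
  case: (boolP (xi t \in A)); last by rewrite !mul0r !mulr0.
  rewrite inE => /Apos x0; rewrite mulr1 mul1r powRN powR_mulrn ?(ltW x0)// expRN.
  by rewrite mulrACA mulfK ?expf_neq0 ?gt_eqF// mulVf ?mulr1// gt_eqF// expR_gt0.
transitivity (\int[wlaw mu mf f0 mid]_x (h x)%:E)%E.
  apply: eq_measure_integral => B mB _.
  exact: (fourier_inversion (law_fin l0) i1 i2 mB).
rewrite (ge0_integral_wlaw _ _ _ _ mhE h0E) [RHS]integral_mkcond.
apply: eq_integral => x _; rewrite patchE /= /h /udens indicE.
case: ifPn => xA; last by rewrite mul0r mule0.
by rewrite mul1r -EFinM mulrC.
Qed.

Let udens_integrable l x y : 0 < l -> 0 < x -> mu.-integrable `[x, y] (EFin \o udens l).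
Proof.
move=> l0 x0; apply: continuous_compact_integrable; first exact: segment_compact.
apply: continuous_in_subspaceT => t; rewrite inE /= in_itv /= => /andP[xt _].
exact: udens_continuous (lt_le_trans x0 xt).
Qed.

(** Both are continuous densities of the same measure. This leaves the choice
    of the abscissa free at every point. *)
Lemma udens_indep l l' x : 0 < l -> 0 < l' -> 0 < x -> udens l x = udens l' x.
Proof.
move=> l0 l0' x0; apply: eq_continuous_density.
- exact: udens_continuous.
- exact: udens_continuous.
- exact: measurable_udens.
- exact: measurable_udens.
- by move=> y _; exact: udens_integrable.
- by move=> y _; exact: udens_integrable.
- move=> y _; have sub : `[x, y] `<=` `]0%R, +oo[.
    by move=> t; rewrite /= !in_itv /= andbT => /andP[+ _]; exact: lt_le_trans.
  have mI : measurable (`[x, y]%classic : set R) by exact: measurable_itv.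
  have E1 := regular_density l0 mI sub.
  have E2 := regular_density l0' mI sub.
  have E := etrans (esym E1) E2.
  exact: (congr1 (@fine R) E).
Qed.

Section Expansion.
Variables (n : nat) (c al : nat -> R) (rho : R -> R).
Hypothesis al_gt : forall k, 1 < al k + N%:R.
Hypotheses (rho_gt0 : forall t, 0 < t -> 0 < rho t)
  (rho_int : locally_integrable `]0%R, +oo[ rho)
  (rho_ndecr : exists2 r, 0 < r & forall x y, 0 < x -> x <= y -> y < r -> rho y <= rho x).
Hypothesis remainder_bound : exists2 C : R, 0 < C &
  \forall z \near within [set z : R[i] | 0 < cRe z] (nbhs (0 : R[i]^o)),
    cmod (cderive N (fun z => (Phi z)^-1 -
       \sum_(0 <= k < n.+1) ((c k)%:C * cpow z (al k)%:C)^-1) z) <= C * rho (cmod z).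

Notation p k := (al k + N%:R).
Let e k : R := (\prod_(i < N) (al k + i%:R)) / c k / Gamma_pos (p k).
Let D (z : R[i]) : R[i] := L N z - singular_part n c al z.

Let singular_partE z : 0 < cRe z ->
  singular_part n c al z = \sum_(0 <= k < n.+1) (e k)%:C * gammaL (p k) z.
Proof.
move=> z0; apply: eq_bigr => k _; have p1 := ltW (al_gt k).
rewrite gammaL_pow// mulrA -real_complexM /e divfK//.
by rewrite gt_eqF// Gamma_pos_gt0.
Qed.

Let cRe_sum (f : nat -> R[i]) : cRe (\sum_(0 <= k < n.+1) f k) = \sum_(0 <= k < n.+1) cRe (f k).
Proof. exact: (big_morph _ (@cReD R)). Qed.
Let cIm_sum (f : nat -> R[i]) : cIm (\sum_(0 <= k < n.+1) f k) = \sum_(0 <= k < n.+1) cIm (f k).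
Proof. exact: (big_morph _ (@cImD R)). Qed.

Let cReD_vertical l t : 0 < l -> cRe (D (l +i* t)) =
  fcos (regular_law l) t - \sum_(0 <= k < n.+1) e k * fcos (gamma_law (p k) l) t.
Proof.
move=> l0; rewrite /D singular_partE// cReD cReN cRe_sum regular_law_fcos//; congr (_ - _).
by apply: eq_bigr => k _; rewrite cReZ (gammaL_fcos (al_gt k) l0).
Qed.

Let cImD_vertical l t : 0 < l -> cIm (D (l +i* t)) =
  - (fsin (regular_law l) t - \sum_(0 <= k < n.+1) e k * fsin (gamma_law (p k) l) t).
Proof.
move=> l0; rewrite /D singular_partE// cImD cImN cIm_sum regular_law_fsin//.
rewrite opprB addrC opprK -sumrN; congr (_ + _).
by apply: eq_bigr => k _; rewrite cImZ (gammaL_fsin (al_gt k) l0) mulrN opprK.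
Qed.

Let mcmodD l : 0 < l -> measurable_fun setT (fun t : R => cmod (D (l +i* t))).
Proof.
move=> l0; under eq_fun do rewrite cmodE cReD_vertical// cImD_vertical// sqrrN.
apply: (measurableT_comp (f := @Num.sqrt R)); first exact: continuous_measurable_fun (@sqrt_continuous R).
have m1 := continuous_measurable_fun (fcos_continuous (law_fin l0)).
have m2 := continuous_measurable_fun (fsin_continuous (law_fin l0)).
have g1 k := continuous_measurable_fun (fcos_continuous (gamma_law_fin (al_gt k) l0)).
have g2 k := continuous_measurable_fun (fsin_continuous (gamma_law_fin (al_gt k) l0)).
apply: measurable_funD; apply: measurable_funX; apply: measurable_funB => //;
  apply: measurable_sum => k; exact: measurable_funM.
Qed.

Let gamma_powN k l t : 0 < l -> 0 <= t ->
  cmod ((e k)%:C * gammaL (p k) (l +i* t)) <=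
  `|e k| * (Gamma_pos (p k) * (Num.min l 1 / 2) `^ (- p k)) * (1 + t) `^ (- p k).
Proof.
move=> l0 t0; rewrite cmodM cmod_real -mulrA ler_wpM2l//.
exact: cmod_gammaL.
Qed.

Let integrable_cmodD l : 0 < l -> mu.-integrable `[0%R, +oo[ (fun t => (cmod (D (l +i* t)))%:E).
Proof.
move=> l0; pose K k := `|e k| * (Gamma_pos (p k) * (Num.min l 1 / 2) `^ (- p k)).
have mi := @lebesgue_measurable_itv R `[0, +oo[.
have i1 : mu.-integrable `[0%R, +oo[ (EFin \o (fun t => cmod (L N (l +i* t)) +
    \sum_(0 <= k < n.+1) K k * (1 + t) `^ (- p k))).
  have i2 : mu.-integrable `[0%R, +oo[ (fun t => (\sum_(0 <= k < n.+1) (K k * (1 + t) `^ (- p k))%:E)%E).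
    apply: integrable_sum => // k _.
    by have := integrableZl mi (K k) (integrable_powN (al_gt k)); exact: eq_integrable.
  have := integrableD mi (integrable_cmod_laplace l0) i2; apply: eq_integrable => // t _.
  by rewrite /= sumEFin.
apply: (integrable_bound mi _ _ i1); first exact: measurable_fun_lebesgue (mcmodD l0).
move=> t; rewrite /= in_itv /= andbT => t0; rewrite ger0_norm ?cmod_ge0//.
apply: le_trans (cmodB _ _) _; rewrite lerD2l singular_partE//.
elim/big_ind2: _ => [|u a v b ua vb|k _]; first by rewrite cmod0.
  by apply: le_trans (cmodD _ _) _; exact: lerD.
exact: gamma_powN.
Qed.

(** Away from 0 both the transform and the powers [|l + i t|^(- p k)], with [p
    k > 1], have integrals bounded uniformly in [l]. *)
Let remainder_tail r : 0 < r -> exists2 K, 0 <= K & forall l, 0 < l ->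
  \int[mu]_(t in `[r, +oo[) cmod (D (l +i* t)) <= K.
Proof.
move=> r0; have [KL KL0 HL] := laplace_tail_bound r0.
have r1 : 0 < 1 + r by rewrite addr_gt0.
pose r' := r / (1 + r); have r'0 : 0 < r' by rewrite divr_gt0.
pose K k := `|e k| * (Gamma_pos (p k) * r' `^ (- p k)).
have G0 k : 0 < Gamma_pos (p k) by apply: Gamma_pos_gt0; exact: ltW.
have K0 k : 0 <= K k by rewrite !mulr_ge0 ?powR_ge0// ltW.
have mi := @lebesgue_measurable_itv R `[r, +oo[.
have sub0 : `[r, +oo[ `<=` `[0%R, +oo[ by apply: subset_itv => //; rewrite bnd_simp ltW.
pose S (t : R) := \sum_(0 <= k < n.+1) K k * (1 + t) `^ (- p k).
have iS : mu.-integrable `[r, +oo[ (EFin \o S).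
  have i2 : mu.-integrable `[r, +oo[ (fun t => (\sum_(0 <= k < n.+1) (K k * (1 + t) `^ (- p k))%:E)%E).
    apply: integrable_sum => // k _.
    apply: (integrableS (lebesgue_measurable_itv `[0%R, +oo[) mi sub0).
    have := integrableZl (lebesgue_measurable_itv _) (K k) (integrable_powN (al_gt k)).
    exact: eq_integrable.
  by move: i2; apply: eq_integrable => // t _; rewrite /= sumEFin.
have S0 t : 0 <= S t by rewrite sumr_ge0// => k _; rewrite mulr_ge0 ?powR_ge0.
have IS0 : 0 <= \int[mu]_(t in `[r, +oo[) S t by exact: Rintegral_ge0.
exists (KL + \int[mu]_(t in `[r, +oo[) S t); first by rewrite addr_ge0.
move=> l l0; have [iL HLl] := HL l l0.
apply: le_trans (_ : _ <= \int[mu]_(t in `[r, +oo[) (cmod (L N (l +i* t)) + S t)) _; last first.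
  by rewrite RintegralD// lerD2r.
apply: le_Rintegral => //.
- apply: (integrableS (lebesgue_measurable_itv `[0%R, +oo[) mi sub0).
  exact: integrable_cmodD.
- by have := integrableD mi iL iS; exact: eq_integrable.
move=> t; rewrite /= in_itv /= andbT => rt.
apply: le_trans (cmodB _ _) _; rewrite lerD2l singular_partE// /S.
elim/big_ind2: _ => [|u a v b ua vb|k _]; first by rewrite cmod0.
  by apply: le_trans (cmodD _ _) _; exact: lerD.
have t0 : 0 < t := lt_le_trans r0 rt.
have p1 := ltW (al_gt k); have p0 : 0 <= p k := le_trans ler01 p1.
rewrite gammaL_pow// !cmodM !cmod_real (ger0_norm (ltW (G0 k))) cmod_cpow// /K -!mulrA.
rewrite ler_wpM2l// ler_wpM2l ?(ltW (G0 k))//.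
have t1 : 0 < 1 + t by rewrite addr_gt0.
rewrite -powRM ?(ltW r'0) ?(ltW t1)//.
have rt' : r' * (1 + t) <= cmod (l +i* t).
  apply: (@le_trans _ _ t); last exact: le_trans (ler_norm _) (normIm_le (l +i* t)).
  by rewrite /r' mulrAC ler_pdivrMr// !mulrDr !mulr1 mulrC lerD2r.
have rt0 : 0 < r' * (1 + t) by rewrite mulr_gt0.
rewrite !powRN lef_pV2 ?posrE ?powR_gt0//; last exact: lt_le_trans rt'.
by apply: ge0_ler_powR; rewrite ?nnegrE ?(ltW rt0) ?cmod_ge0.
Qed.

Let remainder_head : exists C r, [/\ 0 < C, 0 < r, r <= 1,
  (forall x y, 0 < x -> x <= y -> y < r -> rho y <= rho x) &
  (forall z, 0 < cRe z -> cmod z < r -> cmod (D z) <= C * rho (cmod z))].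
Proof.
have [r1 r10 H1] := rho_ndecr; have [C C0] := remainder_bound.
rewrite /within /= => /nbhs_cmodP[r2 r20 H2].
exists C, (Num.min 1 (Num.min r1 r2)); split => //.
- by rewrite !lt_min ltr01 r10.
- by rewrite ge_min lexx.
- by move=> x y x0 xy; rewrite !lt_min => /and3P[_ yr _]; exact: H1.
move=> z z0; rewrite !lt_min => /and3P[_ _ zr].
have := H2 z; rewrite add0r => /(_ zr z0); rewrite cderive_remainder//.
by rewrite cmodM cmodX cmodN cmod1 expr1n mul1r.
Qed.

Let integrable_rho x y : 0 < x -> mu.-integrable `[x, y] (EFin \o rho).
Proof. exact: locally_integrable_itv. Qed.

(** The half-line is cut at [l] and at a fixed [q]. Below [l] the remainder is
    at most [C0 rho l], since [|l + i t| >= l] and [rho] is non-increasing near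
    0. Between [l] and [q] it is at most [C0 rho t]. Beyond [q] its integral is
    bounded by a constant, hence by a multiple of the integral of [rho] over [q
    / 2, q]. *)
Let remainder_integral : exists C l1, [/\ 0 <= C, 0 < l1 & forall l, 0 < l -> l <= l1 ->
  \int[mu]_(t in `[0%R, +oo[) cmod (D (l +i* t)) <=
  C * (l * rho l + \int[mu]_(t in `[l, 1]) rho t)].
Proof.
have [C0 [r [C00 r0 r1 mono H]]] := remainder_head.
(* with this q, |l + i t| < r as soon as l <= q and t < q *)
pose q := r / 4; have q0 : 0 < q by rewrite divr_gt0.
have [K K0 HK] := remainder_tail q0.
pose kap := q / 2 * rho q; have kap0 : 0 < kap by rewrite mulr_gt0 ?divr_gt0// rho_gt0.
have qr : q < r by rewrite /q; lra.
have q1 : q <= 1 by rewrite (le_trans (ltW qr)).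
have q2 : q / 2 <= q by lra.
have qq : q - q / 2 = q / 2 by field.
exists (C0 + K / kap), (q / 2); split; rewrite ?divr_gt0// ?addr_ge0 ?divr_ge0 ?(ltW kap0) ?(ltW C00)//.
move=> l l0 lq; have lq' : l <= q by lra.
have rl0 := rho_gt0 l0.
pose g t := cmod (D (l +i* t)).
have mg (A : set (measurableTypeR R)) : measurable_fun A g.
  exact: measurable_fun_lebesgue (mcmodD l0).
have ig (A : set (measurableTypeR R)) : measurable A -> A `<=` `[0%R, +oo[ -> mu.-integrable A (EFin \o g).
  move=> mA sA; apply: (integrableS _ mA sA (integrable_cmodD l0)).
  exact: lebesgue_measurable_itv.
have m1 := @lebesgue_measurable_itv R `[0, l[; have m2 := @lebesgue_measurable_itv R `[l, q[.
have m3 := @lebesgue_measurable_itv R `[q, +oo[; have m12 := @lebesgue_measurable_itv R `[0, q[.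
have U1 : `[0%R, l[ `|` `[l, q[ = `[0%R, q[%classic :> set R.
  apply/seteqP; split => t /=; rewrite !in_itv /=.
    by move=> [/andP[-> /lt_le_trans]|/andP[lt ->]]; [exact|rewrite andbT (le_trans (ltW l0))].
  by move=> /andP[-> ->]; have [|] := ltP t l; [left|right].
have U2 : `[0%R, q[ `|` `[q, +oo[ = `[0%R, +oo[%classic :> set R.
  apply/seteqP; split => t /=; rewrite !in_itv /= ?andbT.
    by move=> [/andP[]//|]; apply: le_trans; exact: ltW.
  by move=> ->; have [|] := ltP t q; [left|right].
have dis (x : R) y A : [disjoint `[x, y[%classic : set R & [set` Interval (BLeft y) A]].
  apply/disj_set2P; apply/seteqP; split => // t /= []; rewrite !in_itv /=.
  by move=> /andP[_ ty] /andP[/(lt_le_trans ty)]; rewrite ltxx.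
have I : \int[mu]_(t in `[0%R, +oo[) g t = \int[mu]_(t in `[0%R, l[) g t +
    \int[mu]_(t in `[l, q[) g t + \int[mu]_(t in `[q, +oo[) g t.
  rewrite -U2 Rintegral_setU//; last by rewrite U2; apply: ig => //; exact: lebesgue_measurable_itv.
  congr (_ + _); rewrite -U1 Rintegral_setU// U1; apply: ig => // t /=; rewrite !in_itv /= andbT.
  by move=> /andP[].
have zbnd t : 0 <= t -> t < q -> cmod (l +i* t) < r.
  move=> t0 tq; apply: le_lt_trans (cmod_le _) _.
  by rewrite /= (ger0_norm (ltW l0)) (ger0_norm t0); rewrite /q in lq' tq; lra.
have zl t : l <= cmod (l +i* t) by exact: le_trans (ler_norm _) (normRe_le (l +i* t)).
have zt t : t <= cmod (l +i* t) by exact: le_trans (ler_norm _) (normIm_le (l +i* t)).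
have I1 : \int[mu]_(t in `[0%R, l[) g t <= C0 * (l * rho l).
  apply: le_trans (_ : _ <= \int[mu]_(t in `[0%R, l[) (C0 * rho l)) _; last first.
    rewrite Rintegral_cst// (_ : fine _ = l); first by rewrite -mulrA [rho l * _]mulrC.
    have E : mu `[0%R, l[%classic = l%:E by rewrite lebesgue_measure_itv /= lte_fin l0 sube0.
    exact: (congr1 (@fine R) E).
  apply: le_Rintegral => //.
  - by apply: ig => // t /=; rewrite !in_itv /= andbT => /andP[].
  - apply: (integrable_finite (K := `|C0 * rho l|)) => //.
    have : (mu `[0%R, l[%classic < +oo)%E.
      by rewrite lebesgue_measure_itv /=; case: ifP => _; rewrite ?ltry.
    exact.
  move=> t; rewrite /= in_itv /= => /andP[t0 tl].
  have zr := zbnd t t0 (lt_le_trans tl lq').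
  apply: le_trans (H (l +i* t) l0 zr) _; rewrite ler_wpM2l ?(ltW C00)//.
  exact: mono.
have irho := integrable_rho 1 l0.
have m4 := @lebesgue_measurable_itv R `[l, 1].
have rho0 t : `[l, 1]%classic t -> 0 <= rho t.
  by rewrite /= in_itv /= => /andP[lt _]; apply: ltW; apply: rho_gt0; exact: lt_le_trans lt.
have sub_rho (A : set (measurableTypeR R)) : measurable A -> A `<=` `[l, 1] ->
    mu.-integrable A (EFin \o rho) /\
    \int[mu]_(t in A) rho t <= \int[mu]_(t in `[l, 1]) rho t.
  move=> mA sA; have iA := integrableS m4 mA sA irho; split => //.
  apply: fine_le; [exact: integrable_fin_num iA|exact: integrable_fin_num irho|].
  apply: ge0_subset_integral => //.
  by case/integrableP : irho.
have I2 : \int[mu]_(t in `[l, q[) g t <= C0 * \int[mu]_(t in `[l, 1]) rho t.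
  have sA : `[l, q[ `<=` `[l, 1].
    by move=> t; rewrite /= !in_itv /= => /andP[-> tq]; rewrite ltW// (lt_le_trans tq).
  have [i2 le2] := sub_rho _ m2 sA.
  apply: le_trans (_ : _ <= \int[mu]_(t in `[l, q[) (C0 * rho t)) _; last first.
    by rewrite RintegralZl// ler_wpM2l ?(ltW C00).
  apply: le_Rintegral => //.
  - by apply: ig => // t /=; rewrite !in_itv /= andbT => /andP[+ _]; apply: le_trans; exact: ltW.
  - by have := integrableZl m2 C0 i2; exact: eq_integrable.
  move=> t; rewrite /= in_itv /= => /andP[lt tq]; have t0 := lt_le_trans l0 lt.
  have zr := zbnd t (ltW t0) tq.
  by apply: le_trans (H (l +i* t) l0 zr) _; rewrite ler_wpM2l ?(ltW C00)// mono.
have I3 : \int[mu]_(t in `[q, +oo[) g t <= K / kap * \int[mu]_(t in `[l, 1]) rho t.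
  apply: le_trans (HK l l0) _; rewrite mulrAC ler_pdivlMr// ler_wpM2l//.
  have sA : `[q / 2, q] `<=` `[l, 1].
    move=> t; rewrite /= !in_itv /= => /andP[qt tq].
    by rewrite (le_trans lq qt) (le_trans tq).
  have [i4 le4] := sub_rho _ (@lebesgue_measurable_itv R `[q / 2, q]) sA.
  apply: le_trans le4.
  have -> : kap = \int[mu]_(t in `[q / 2, q]) rho q.
    by rewrite Rintegral_itv_cst// qq mulrC.
  apply: le_Rintegral => //.
  - by apply: (integrable_finite (K := `|rho q|)) => //; exact: itv_fin.
  move=> t; rewrite /= in_itv /= => /andP[qt tq]; apply: mono => //.
  by apply: lt_le_trans qt; rewrite divr_gt0.
have lr0 : 0 <= l * rho l by rewrite mulr_ge0// ltW.
have kk : 0 <= K / kap by rewrite divr_ge0// ltW.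
rewrite -/(g _) I; move: I1 I2 I3 lr0 kk; move: (Rintegral _ _ _) (Rintegral _ _ _) (Rintegral _ _ _) (Rintegral _ _ _) => x1 x2 x3 x4.
move: (l * rho l) (K / kap) => y z; nra.
Qed.

Let fker_diff l x t : 0 < l ->
  fker (regular_law l) x t - \sum_(0 <= k < n.+1) e k * fker (gamma_law (p k) l) x t =
  cos (t * x) * cRe (D (l +i* t)) - sin (t * x) * cIm (D (l +i* t)).
Proof.
move=> l0; rewrite cReD_vertical// cImD_vertical// /fker mulrN opprK !mulrBr !mulr_sumr.
rewrite (_ : \sum_(0 <= k < n.+1) _ =
  \sum_(0 <= k < n.+1) cos (t * x) * (e k * fcos (gamma_law (p k) l) t) +
  \sum_(0 <= k < n.+1) sin (t * x) * (e k * fsin (gamma_law (p k) l) t)); last first.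
  by rewrite -big_split; apply: eq_bigr => k _ /=; ring.
by rewrite opprD addrACA.
Qed.

Let fker_integrable (nu : {measure set R -> \bar R}) x : (nu setT < +oo)%E ->
  mu.-integrable `[0%R, +oo[ (EFin \o fcos nu) -> mu.-integrable `[0%R, +oo[ (EFin \o fsin nu) ->
  mu.-integrable `[0%R, +oo[ (EFin \o fker nu x).
Proof.
move=> nuf i1 i2; have mi := @lebesgue_measurable_itv R `[0, +oo[.
have ipsi : mu.-integrable `[0%R, +oo[ (EFin \o (fun t => `|fcos nu t| + `|fsin nu t|)).
  by have := integrableD mi (integrable_norm i1) (integrable_norm i2); exact: eq_integrable.
apply: (integrable_bound mi _ _ ipsi).
  exact: measurable_fun_lebesgue (measurable_fker nuf x).
by move=> t _; exact: fker_le.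
Qed.

(** By [gammaL_pow] the singular part is a combination of transforms of gamma
    laws, and [gamma_inversion] turns it into the powers of [x] in the
    expansion. What is left is the inverse transform of the remainder, bounded
    by [remainder_integral]. At the point [x] the abscissa is [l = 1 / x],
    which keeps the factor [exp (l x)] bounded and produces [eps1]. *)
Lemma density_expansion : exists2 C, 0 < C & \forall x \near +oo,
  `|udens 1 x - \sum_(0 <= k < n.+1) invGamma (al k) / c k * x `^ (al k - 1)| <=
  C * eps1 N rho x.
Proof.
have [C [l1 [C0 l10 HI]]] := remainder_integral.
have pi0 := pi_gt0 R; have e0 := expR_gt0 (1 : R).
pose C' := expR 1 * (pi^-1 * (2 * C)) + 1.
have C'0 : 0 < C'.
  rewrite ltr_wpDl// mulr_ge0 ?(ltW e0)// mulr_ge0 ?mulr_ge0//.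
  by rewrite invr_ge0 ltW.
exists C' => //.
near=> x.
have x1 : 1 < x by near: x; apply: nbhs_pinfty_gt; rewrite num_real.
have x0 : 0 < x := lt_trans ltr01 x1.
pose l := x^-1; have l0 : 0 < l by rewrite invr_gt0.
have ll1 : l <= l1.
  have x2 : l1^-1 <= x by near: x; apply: nbhs_pinfty_ge; rewrite num_real.
  by rewrite /l -[l1]invrK lef_pV2// posrE invr_gt0.
have lx : l * x = 1 by rewrite mulVf// gt_eqF.
have mi := @lebesgue_measurable_itv R `[0, +oo[.
have [j1 j2] := regular_law_integrable l0.
have ik := fker_integrable x (law_fin l0) j1 j2.
have igk k : mu.-integrable `[0%R, +oo[ (EFin \o fker (gamma_law (p k) l) x).
  apply: fker_integrable; [exact: gamma_law_fin|exact: integrable_gamma_fcos|exact: integrable_gamma_fsin].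
pose S := \int[mu]_(t in `[0%R, +oo[) (fker (regular_law l) x t -
     \sum_(0 <= k < n.+1) e k * fker (gamma_law (p k) l) x t).
have iek k : mu.-integrable `[0%R, +oo[ (EFin \o (fun t => e k * fker (gamma_law (p k) l) x t)).
  by have := integrableZl mi (e k) (igk k); exact: eq_integrable.
have isum : mu.-integrable `[0%R, +oo[ (EFin \o (fun t => \sum_(0 <= k < n.+1) e k * fker (gamma_law (p k) l) x t)).
  have := @integrable_sum _ _ _ mu _ mi _ (index_iota 0 n.+1) xpredT _ (fun k _ => iek k).
  by apply: eq_integrable => // t _; rewrite /= sumEFin.
have SE : S = \int[mu]_(t in `[0%R, +oo[) fker (regular_law l) x t -
    \sum_(0 <= k < n.+1) e k * \int[mu]_(t in `[0%R, +oo[) fker (gamma_law (p k) l) x t.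
  rewrite /S RintegralB//; congr (_ - _).
  have E k : (\int[mu]_(t in `[0%R, +oo[) (e k * fker (gamma_law (p k) l) x t)%:E)%E =
      (e k * \int[mu]_(t in `[0%R, +oo[) fker (gamma_law (p k) l) x t)%:E.
    by rewrite -RintegralZl// /Rintegral fineK//; exact: integrable_fin_num (iek k).
  rewrite {1}/Rintegral; under eq_integral do rewrite -sumEFin.
  by rewrite integral_sum//; under eq_bigr do rewrite E; rewrite sumEFin.
have diffE : udens 1 x - \sum_(0 <= k < n.+1) invGamma (al k) / c k * x `^ (al k - 1) =
    x `^ (- N%:R) * expR 1 * (pi^-1 * S).
  rewrite (udens_indep ltr01 l0 x0) /udens lx SE mulrBr /fdens mulrBr; congr (_ - _).
  rewrite !mulr_sumr; apply: eq_bigr => k _.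
  have pk1 := ltW (al_gt k).
  rewrite (invGammaE pk1) [pi^-1 * _]mulrCA -[pi^-1 * _]/(fdens _ x).
  rewrite -(gamma_inversion (al_gt k) l0 x0) lx /e.
  have xp : x `^ (- N%:R) * x `^ (p k - 1) = x `^ (al k - 1).
    rewrite -powRD; last by rewrite (gt_eqF x0) implybT.
    by congr (_ `^ _); ring.
  have ee : expR 1 * expR (- 1) = 1 :> R by rewrite -expRD subrr expR0.
  rewrite -xp; transitivity (\prod_(i < N) (al k + i%:R) / c k / Gamma_pos (p k) *
    (x `^ (- N%:R) * x `^ (p k - 1)) * (expR 1 * expR (- 1))); last by ring.
  by rewrite ee mulr1; ring.
have Sle : `|S| <= 2 * C * (l * rho l + \int[mu]_(t in `[l, 1]) rho t).
  have iD := integrable_cmodD l0.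
  apply: le_trans (_ : _ <= \int[mu]_(t in `[0%R, +oo[) (2 * cmod (D (l +i* t)))) _; last first.
    by rewrite RintegralZl// -mulrA ler_wpM2l// HI.
  have iB := integrableB mi ik isum.
  have iB' : mu.-integrable `[0%R, +oo[ (EFin \o (fun t => fker (regular_law l) x t -
     \sum_(0 <= k < n.+1) e k * fker (gamma_law (p k) l) x t)).
    by move: iB; exact: eq_integrable.
  apply: le_trans (le_normr_Rintegral mi iB') _.
  apply: le_Rintegral => //.
  - by have := integrable_norm iB'.
  - by have := integrableZl mi (2 : R) iD; exact: eq_integrable.
  move=> t _; rewrite fker_diff//.
  apply: le_trans (ler_normB _ _) _; rewrite !normrM mulr_natl mulr2n.
  apply: lerD.
    by apply: le_trans (normRe_le _); rewrite ler_piMl// ler_norml cos_geN1 cos_le1.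
  by apply: le_trans (normIm_le _); rewrite ler_piMl// ler_norml sin_geN1 sin_le1.
have epsE : eps1 N rho x = x ^- N * (l * rho l + \int[mu]_(t in `[l, 1]) rho t).
  rewrite /eps1 /orint (_ : \int[mu]_(t in `[1, x^-1]) rho t = 0); last first.
    rewrite set_itv_ge ?Rintegral_set0// bnd_simp -ltNge.
    by rewrite invf_lt1.
  by rewrite subr0 mulrDr exprSr invfM -mulrA.
have J0 : 0 <= l * rho l + \int[mu]_(t in `[l, 1]) rho t.
  apply: addr_ge0; first by rewrite mulr_ge0// ltW// rho_gt0.
  by apply: Rintegral_ge0 => t; rewrite /= in_itv /= => /andP[lt _]; apply: ltW; apply: rho_gt0; exact: lt_le_trans lt.
rewrite diffE epsE powRN powR_mulrn ?(ltW x0)// !normrM.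
have xN : 0 < x ^- N by rewrite invr_gt0 exprn_gt0.
rewrite (ger0_norm (ltW xN)) (ger0_norm (ltW e0)) (ger0_norm (_ : 0 <= pi^-1)) ?invr_ge0 ?(ltW pi0)//.
rewrite [leRHS]mulrCA -[leLHS]mulrA ler_wpM2l ?(ltW xN)//.
have pi10 : 0 < pi^-1 :> R by rewrite invr_gt0.
rewrite /C' mulrDl mul1r; apply: ler_wpDr => //.
rewrite -[leRHS]mulrA ler_wpM2l ?(ltW e0)// -mulrA ler_wpM2l ?(ltW pi10)//.
Unshelve. all: by end_near. Qed.

End Expansion.

End RegularPotential.

(** * Overshoot of a level: paths *)

Section Passage.
Context d (Omega : measurableType d) (R : realType) (P : probability Omega R).
Variables (Y : R -> Omega -> R) (zeta : Omega -> \bar R) (X : R -> Omega -> option R).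
Hypotheses (Ysub : is_subordinator P Y) (mzeta : measurable_fun setT zeta)
  (zeta_gt0 : forall w, (0 < zeta w)%E)
  (XE : forall (t : R) w, 0 <= t ->
     X t w = if (t%:E < zeta w)%E then Some (Y t w) else None).

Let Ymono w u v : 0 <= u -> u <= v -> Y u w <= Y v w.
Proof. exact: (subord_ndecr Ysub). Qed.

Lemma lifetimeE w : lifetime X w = zeta w.
Proof.
apply/eqP; rewrite eq_le; apply/andP; split.
  have [zr|zr] : zeta w \is a fin_num \/ zeta w = +oo%E.
  - by have := zeta_gt0 w; case: (zeta w) => [r|//|//] _; [left|right].
  - rewrite -(fineK zr); apply: ereal_inf_lbound => /=; exists (fine (zeta w)) => //.
    have r0 : 0 <= fine (zeta w) by rewrite fine_ge0// ltW.
    by split => //; rewrite XE// fineK// ltxx.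
  - by rewrite zr leey.
apply: le_ereal_inf_tmp => _ [t [t0 /=]] + <-; rewrite XE//.
by case: ifPn => //; rewrite -leNgt.
Qed.

Variable s : R.
Hypothesis s0 : 0 < s.
Notation T := (passage_time X s).

Lemma passage_le t w : 0 <= t -> (t%:E < zeta w)%E -> s < Y t w -> (T w <= t%:E)%E.
Proof.
move=> t0 tz sY; apply: ereal_inf_lbound; exists t => //; split => //.
by exists (Y t w) => //; rewrite XE// tz.
Qed.

Lemma passage_lt e w : (T w < e)%E ->
  exists t, [/\ 0 <= t, (t%:E < zeta w)%E, s < Y t w & (t%:E < e)%E].
Proof.
move=> /ereal_inf_lt[_ [t [t0 [y Xy sy]] <-] te]; exists t; split => //.
  by move: Xy; rewrite XE//; case: ifP.
by move: Xy; rewrite XE//; case: ifP => // _ [->].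
Qed.

Lemma passage_ge t w : 0 <= t -> Y t w <= s -> (t%:E <= T w)%E.
Proof.
move=> t0 Yt; apply: le_ereal_inf_tmp => _ [u [u0 [y Xy sy]] <-].
rewrite lee_fin leNgt; apply/negP => ut.
have : Y u w = y by move: Xy; rewrite XE//; case: ifP => // _ [].
by move=> uy; have := Ymono w u0 (ltW ut); rewrite uy leNgt (le_lt_trans Yt sy).
Qed.

Lemma passage_ge0 w : (0%:E <= T w)%E.
Proof. by apply: le_ereal_inf_tmp => _ [u [u0 _] <-]; rewrite lee_fin. Qed.

Lemma passage_fin w : (T w < zeta w)%E -> (fine (T w))%:E = T w.
Proof.
move=> Tz; rewrite fineK// ge0_fin_numE ?passage_ge0//.
exact: lt_le_trans Tz (leey _).
Qed.

(** The left limit of a non-decreasing path is the supremum of its earlier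
    values. *)
Lemma left_limitP t w : 0 < t -> (t%:E <= zeta w)%E ->
  (forall u, 0 <= u -> u < t -> Y u w <= left_limit X t w) /\
  (forall e, 0 < e -> exists u0, [/\ 0 <= u0, u0 < t &
     forall u, u0 <= u -> u < t -> left_limit X t w - e < Y u w]).
Proof.
move=> t0 tz; set L := left_limit X t w.
have cY : Y u w @[u --> t^'-] --> L.
  have c1 : cvg (Y u w @[u --> t^'-]) by exact: (subord_llim Ysub).
  suff -> : L = lim (Y u w @[u --> t^'-]) by exact: c1.
  rewrite /L /left_limit gt_eqF//; apply: cvg_lim => //.
  apply: cvg_trans c1; apply: near_eq_cvg; near=> u.
  have u0 : 0 < u by near: u; exact: nbhs_left_gt.
  have ut : u < t by near: u; exact: nbhs_left_lt.
  by rewrite XE ?(ltW u0)// (lt_le_trans _ tz)// lte_fin.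
split=> [u u0 ut|e e0].
  rewrite leNgt; apply/negP => LY.
  have e0 : 0 < Y u w - L by rewrite subr_gt0.
  have H : \forall v \near t^'-, `|L - Y v w| < Y u w - L.
    exact: (@cvgr_dist_lt _ _ _ _ _ _ _ cY _ e0).
  near (t^'-) => v.
  have uv : u < v by near: v; exact: nbhs_left_gt.
  have : `|L - Y v w| < Y u w - L by near: v; exact: H.
  have := Ymono w u0 (ltW uv); rewrite ltr_norml => h /andP[h1 _]; lra.
have H : \forall v \near t^'-, `|L - Y v w| < e.
  exact: (@cvgr_dist_lt _ _ _ _ _ _ _ cY _ e0).
near (t^'-) => v.
have v0 : 0 < v by near: v; exact: nbhs_left_gt.
have vt : v < t by near: v; exact: nbhs_left_lt.
have Hv : `|L - Y v w| < e by near: v; exact: H.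
exists v; split => //; first exact: ltW.
move=> u vu ut; have := Ymono w (ltW v0) vu.
move: Hv; rewrite ltr_norml => /andP[_ h1] h; lra.
Unshelve. all: by end_near. Qed.

(** The undershoot, with a negative default value when the level is not passed
    before the lifetime. *)
Definition undershoot w : R :=
  if (T w < zeta w)%E then left_limit X (fine (T w)) w else -1.

Lemma left_limit0 w : left_limit X 0 w = 0.
Proof. by rewrite /left_limit eqxx. Qed.

(** The undershoot exceeds [c] when some position before the passage time does.
    A rational time [q] witnesses this, and [q' > q] with [Y q' <= s]
    guarantees that [q] precedes the passage. Measurability of the undershoot
    follows. *)
Lemma undershoot_gtP c w : 0 <= c -> undershoot w > c <->
  exists q q' : rat, [/\ 0 <= ratr q :> R, (q < q')%R, ((ratr q' : R)%:E < zeta w)%E, c < Y (ratr q) w & Y (ratr q') w <= s] /\ (T w < zeta w)%E.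
Proof.
move=> c0; rewrite /undershoot; split.
  case: ifP => [Tz cL|_]; last by move=> h; have := lt_trans (le_lt_trans c0 h) (ltrN10 R); rewrite ltxx.
  have Tf := passage_fin Tz; set t := fine (T w) in cL Tf.
  have t0 : 0 < t.
    rewrite lt_neqAle; apply/andP; split; last by rewrite -lee_fin Tf passage_ge0.
    by apply/eqP => t0; move: cL; rewrite -t0 left_limit0 ltNge c0.
  have tz : (t%:E <= zeta w)%E by rewrite Tf ltW.
  have [_ H] := left_limitP t0 tz.
  have e0 : 0 < left_limit X t w - c by rewrite subr_gt0.
  have [u0 [u00 u0t Hu]] := H _ e0.
  have [q] := rat_in_itvoo u0t; rewrite in_itv /= => /andP[q1 q2].
  have [q'] := rat_in_itvoo q2; rewrite in_itv /= => /andP[q3 q4].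
  exists q, q'; split => //; split => //.
  - exact: le_trans u00 (ltW q1).
  - by rewrite -(ltr_rat R).
  - by apply: lt_le_trans tz; rewrite lte_fin.
  - by have := Hu _ (ltW q1) q2; rewrite subKr.
  - rewrite leNgt; apply/negP => sY.
    have := @passage_le (ratr q') w (le_trans u00 (le_trans (ltW q1) (ltW q3))).
    rewrite (lt_le_trans _ tz) ?lte_fin// => /(_ isT sY).
    by rewrite -Tf lee_fin leNgt q4.
move=> [q [q' [[q0 qq' q'z cY Ys] Tz]]]; rewrite Tz.
have Tf := passage_fin Tz; set t := fine (T w) in Tf *.
have qq'' : ratr q < ratr q' :> R by rewrite ltr_rat.
have q't : ratr q' <= t.
  by rewrite -lee_fin Tf; apply: passage_ge => //; exact: le_trans q0 (ltW qq'').
have t0 : 0 < t by apply: lt_le_trans q't; exact: le_lt_trans qq''.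
have tz : (t%:E <= zeta w)%E by rewrite Tf ltW.
have [H _] := left_limitP t0 tz.
by apply: lt_le_trans cY (H _ q0 _); exact: lt_le_trans q't.
Qed.

Lemma passage_finiteP w : (T w < zeta w)%E <->
  exists q : rat, [/\ 0 <= ratr q :> R, ((ratr q : R)%:E < zeta w)%E & s < Y (ratr q) w].
Proof.
split=> [/passage_lt[t [t0 tz sY _]]|[q [q0 qz sY]]]; last first.
  exact: le_lt_trans (passage_le q0 qz sY) qz.
have [r tr rz] : exists2 r : R, t < r & (r%:E <= zeta w)%E.
  move: tz; case: (zeta w) => [z|_|//]; last by exists (t + 1); rewrite ?ltrDl ?leey.
  by rewrite lte_fin => tz; exists z.
have [q] := rat_in_itvoo tr; rewrite in_itv /= => /andP[q1 q2].
exists q; split.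
- exact: le_trans t0 (ltW q1).
- by apply: lt_le_trans rz; rewrite lte_fin.
- by apply: lt_le_trans sY _; apply: Ymono => //; exact: ltW.
Qed.

Let measurable_Y_gt t c : 0 <= t -> measurable [set w | c < Y t w].
Proof.
move=> t0; have := subord_meas Ysub t0 => /(_ measurableT _ (measurable_itv `]c, +oo[)).
by rewrite setTI; congr measurable; apply/seteqP; split => w /=; rewrite in_itv /= andbT.
Qed.

Let measurable_zeta_gt t : measurable [set w | (t%:E < zeta w)%E].
Proof.
have := @measurable_lte _ Omega R setT measurableT (cst t%:E) zeta (measurable_cst _) mzeta.
by rewrite setTI.
Qed.

Lemma measurable_passage : measurable [set w | (T w < zeta w)%E].
Proof.
pose F (q : rat) := if 0 <= ratr q :> R then
  [set w | ((ratr q : R)%:E < zeta w)%E] `&` [set w | s < Y (ratr q) w] else set0.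
have -> : [set w | (T w < zeta w)%E] = \bigcup_q F q.
  apply/seteqP; split => w /=.
    by move=> /passage_finiteP[q [q0 qz sY]]; exists q => //; rewrite /F q0; split.
  by move=> [q _]; rewrite /F; case: ifP => // q0 [qz sY]; apply/passage_finiteP; exists q.
apply: bigcupT_measurable_rat => q; rewrite /F; case: ifP => q0 //.
by apply: measurableI; [exact: measurable_zeta_gt|exact: measurable_Y_gt].
Qed.

Lemma undershoot_ge w : (T w < zeta w)%E -> 0 <= undershoot w.
Proof.
move=> Tz; rewrite /undershoot Tz; have Tf := passage_fin Tz; set t := fine (T w) in Tf *.
have : 0 <= t by rewrite -lee_fin Tf passage_ge0.
rewrite le_eqVlt => /predU1P[<-|t0]; first by rewrite left_limit0.
have tz : (t%:E <= zeta w)%E by rewrite Tf ltW.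
have [H _] := left_limitP t0 tz.
by apply: le_trans (H 0 (lexx _) t0); rewrite (subord_0 Ysub).
Qed.

Lemma measurable_undershoot : measurable_fun setT undershoot.
Proof.
apply: (measurability _ (RGenOInfty.measurableE R)) => // _ [_ [c ->] <-]; rewrite setTI.
have [c0|c0] := leP 0 c; last first.
  have [c1|c1] := ltP c (-1).
    rewrite (_ : _ @^-1` _ = setT)//; apply/seteqP; split => // w _ /=.
    rewrite in_itv /= andbT; have [Tz|Tz] := boolP (T w < zeta w)%E.
      exact: lt_le_trans (undershoot_ge Tz).
    by rewrite /undershoot (negbTE Tz).
  rewrite (_ : _ @^-1` _ = [set w | (T w < zeta w)%E]); first exact: measurable_passage.
  apply/seteqP; split => w /=; rewrite in_itv /= andbT.
    by rewrite /undershoot; case: ifP => // _; rewrite ltNge c1.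
  by move=> Tz; exact: lt_le_trans (undershoot_ge Tz).
pose F (q q' : rat) := if 0 <= ratr q :> R then if (q < q')%R then
  ([set w | ((ratr q' : R)%:E < zeta w)%E] `&` [set w | c < Y (ratr q) w]) `\`
  [set w | s < Y (ratr q') w] else set0 else set0.
have -> : undershoot @^-1` `]c, +oo[ = [set w | (T w < zeta w)%E] `&` \bigcup_q \bigcup_q' F q q'.
  apply/seteqP; split => w /=; rewrite in_itv /= andbT.
    move=> /(undershoot_gtP _ c0)[q [q' [[q0 qq' q'z cY Ys] Tz]]]; split => //.
    exists q => //; exists q' => //; rewrite /F q0 qq'; split => //=.
    by apply/negP; rewrite -leNgt.
  move=> [Tz [q _ [q' _]]]; rewrite /F; case: ifP => // q0; case: ifP => // qq' [[q'z cY]] /=.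
  move=> /negP; rewrite -leNgt => Ys; apply/(undershoot_gtP _ c0).
  by exists q, q'.
apply: measurableI; first exact: measurable_passage.
do 2 apply: bigcupT_measurable_rat => ?.
rewrite /F; case: ifP => // q0; case: ifP => // qq'.
apply: measurableD; last by apply: measurable_Y_gt; apply: le_trans q0 _; rewrite ler_rat ltW.
by apply: measurableI; [exact: measurable_zeta_gt|exact: measurable_Y_gt].
Qed.

Lemma undershoot_inE (B : set R) : B `<=` `]0, 1[ ->
  undershoot_in X s B = (fun w => undershoot w / s) @^-1` B.
Proof.
move=> B01; apply/seteqP; split => w; rewrite /undershoot_in /= lifetimeE /undershoot.
  by move=> [->].
case: ifP => // _ /B01; rewrite /= in_itv /= => /andP[h _].
by move: h; rewrite pmulr_lgt0 ?invr_gt0// ltr0N1.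
Qed.

(** By right-continuity, a path below [s] stays so for a positive time. *)
Lemma passage_gt t w : 0 <= t -> Y t w < s -> (t%:E < T w)%E.
Proof.
move=> t0 Yt.
have cY : Y u w @[u --> t^'+] --> Y t w by exact: (subord_rcont Ysub).
have e0 : 0 < s - Y t w by rewrite subr_gt0.
have H : \forall u \near t^'+, `|Y t w - Y u w| < s - Y t w.
  exact: (@cvgr_dist_lt _ _ _ _ _ _ _ cY _ e0).
near (t^'+) => u.
have tu : t < u by near: u; exact: nbhs_right_gt.
have Hu : `|Y t w - Y u w| < s - Y t w by near: u; exact: H.
apply: (@lt_le_trans _ _ u%:E); first by rewrite lte_fin.
apply: passage_ge; first exact: le_trans t0 (ltW tu).
by move: Hu; rewrite ltr_norml => /andP[h _]; lra.
Unshelve. all: by end_near. Qed.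

(** As the mesh [h] tends to 0, the event that the undershoot lies in [ ]p, q]
    ] is bracketed between two versions of this event. The choice of [b]
    settles whether reaching [s] exactly counts: a path may sit at [s] at its
    passage time, but also reach [s] without passing it. *)
Definition grid_jump (b : bool) (h p q : R) (k : nat) : set Omega :=
  [set w | [/\ p < Y (k%:R * h) w <= q,
     (if b then s <= Y (k.+1%:R * h) w else s < Y (k.+1%:R * h) w) &
     ((k.+1%:R * h)%:E < zeta w)%E]].

Definition grid_cross b h p q := \bigcup_k grid_jump b h p q k.

Lemma small_invn (e : R) : 0 < e -> exists n, forall m, (n <= m)%N -> m.+1%:R^-1 < e.
Proof.
move=> e0; exists (Num.bound e^-1) => m nm.
rewrite invf_plt ?posrE//; apply: lt_le_trans (archi_boundP _) _; first by rewrite invr_ge0 ltW.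
by rewrite ler_nat leqW.
Qed.

Lemma grid_cell (h t : R) : 0 < h -> 0 < t -> exists k : nat, k%:R * h < t <= k.+1%:R * h.
Proof.
move=> h0 t0; have ex : exists k : nat, t <= k.+1%:R * h.
  exists (Num.bound (t / h)); rewrite -ler_pdivrMr//; apply: ltW.
  apply: lt_le_trans (archi_boundP _) _; first by rewrite divr_ge0// ltW.
  by rewrite ler_nat.
exists (ex_minn ex); case: ex_minnP => k -> min; rewrite andbT.
case: k min => [|k] min; first by rewrite mul0r.
by rewrite ltNge; apply/negP => /min; rewrite ltnn.
Qed.

Let grid_gap (t c h u : R) : t <= c + h -> h < t - u -> u <= c.
Proof. by move=> *; lra. Qed.

(** On finer and finer grids, the last grid points before the passage time
    approach it, so that the left limit is at most [q]. *)
Lemma grid_cross_limsup p q w : 0 <= p -> q < s ->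
  (forall n, exists2 m, (n <= m)%N & grid_cross false m.+1%:R^-1 p q w) ->
  (T w < zeta w)%E /\ p < undershoot w <= q.
Proof.
move=> p0 qs H.
have cell m : grid_cross false m.+1%:R^-1 p q w -> exists k : nat,
    [/\ p < Y (k%:R * m.+1%:R^-1) w <= q, ((k%:R * m.+1%:R^-1)%:E < T w)%E,
        (T w <= (k.+1%:R * m.+1%:R^-1)%:E)%E & (T w < zeta w)%E].
  move=> [k _ [Yk Yk1 kz]]; exists k; have h0 : 0 <= m.+1%:R^-1 :> R by rewrite invr_ge0.
  have T1 := passage_le (mulr_ge0 (ler0n _ _) h0) kz Yk1.
  split => //; last exact: le_lt_trans T1 kz.
  apply: passage_gt; first by rewrite mulr_ge0.
  by case/andP : Yk => _ /le_lt_trans; apply.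
have [m0 _ /cell[k0 [Yk0 kT0 _ Tz]]] := H 0%N.
split => //; rewrite /undershoot Tz; have Tf := passage_fin Tz; set t := fine (T w) in Tf *.
rewrite -Tf lte_fin in kT0.
have kh0 (k m : nat) : 0 <= k%:R * m.+1%:R^-1 :> R by rewrite mulr_ge0// invr_ge0.
have t0 : 0 < t := le_lt_trans (kh0 _ _) kT0.
have tz : (t%:E <= zeta w)%E by rewrite Tf ltW.
have [L1 L2] := left_limitP t0 tz.
apply/andP; split.
  by case/andP : Yk0 => pY _; apply: lt_le_trans pY (L1 _ (kh0 _ _) kT0).
rewrite leNgt; apply/negP => qL.
have e0 : 0 < left_limit X t w - q by rewrite subr_gt0.
have [u0 [u00 u0t Hu]] := L2 _ e0.
have d0 : 0 < t - u0 by rewrite subr_gt0.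
have [n Hn] := small_invn d0.
have [m nm /cell[k [Yk kT Tk _]]] := H n.
rewrite -Tf lte_fin in kT; rewrite -Tf lee_fin in Tk.
have : u0 <= k%:R * m.+1%:R^-1.
  by move: Tk; rewrite -natr1 mulrDl mul1r => Tk; exact: grid_gap Tk (Hn m nm).
move=> /Hu /(_ kT); rewrite subKr.
by case/andP : Yk => _ Yq /(le_lt_trans Yq); rewrite ltxx.
Qed.

(** When the mesh is small, the last grid point before the passage time is
    close enough to it for the path to be above [p], and the next grid point
    still precedes the lifetime. *)
Lemma grid_cross_liminf p q w : 0 <= p -> (T w < zeta w)%E -> p < undershoot w <= q ->
  exists n, forall m, (n <= m)%N -> grid_cross true m.+1%:R^-1 p q w.
Proof.
move=> p0 Tz; rewrite /undershoot Tz; have Tf := passage_fin Tz; set t := fine (T w) in Tf *.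
move=> /andP[pL Lq].
have t0 : 0 < t.
  rewrite lt_neqAle; apply/andP; split; last by rewrite -lee_fin Tf passage_ge0.
  by apply/eqP => t0; move: pL; rewrite -t0 left_limit0 ltNge p0.
have tz : (t%:E <= zeta w)%E by rewrite Tf ltW.
have [L1 L2] := left_limitP t0 tz.
have e0 : 0 < left_limit X t w - p by rewrite subr_gt0.
have [u0 [u00 u0t Hu]] := L2 _ e0.
have [r tr rz] : exists2 r : R, t < r & (r%:E <= zeta w)%E.
  move: Tz; rewrite -Tf; case: (zeta w) => [z|_|//]; last by exists (t + 1); rewrite ?ltrDl ?leey.
  by rewrite lte_fin => tz'; exists z.
have d0 : 0 < Num.min (t - u0) (r - t) by rewrite lt_min !subr_gt0 u0t.
have [n Hn] := small_invn d0.
exists n => m nm; have h0 : 0 < m.+1%:R^-1 :> R by rewrite invr_gt0.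
have [k /andP[kt tk]] := grid_cell h0 t0.
have := Hn m nm; rewrite lt_min => /andP[h1 h2].
have k0 : 0 <= k%:R * m.+1%:R^-1 :> R by rewrite mulr_ge0// ltW.
have kh1 : k.+1%:R * m.+1%:R^-1 = k%:R * m.+1%:R^-1 + m.+1%:R^-1 :> R by rewrite -natr1 mulrDl mul1r.
exists k => //; split.
- apply/andP; split; last exact: le_trans (L1 _ k0 kt) Lq.
  have := Hu _ _ kt; rewrite subKr; apply.
  by move: tk; rewrite kh1 => tk; exact: grid_gap tk h1.
- apply: le_trans (Ymono w (ltW t0) tk).
  by rewrite leNgt; apply/negP => /(passage_gt (ltW t0)); rewrite -Tf ltxx.
- apply: lt_le_trans rz; rewrite lte_fin kh1.
  by move: kt h2; set a := k%:R / _; set h := m.+1%:R^-1; clearbody a h => *; lra.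
Qed.

(** After such a jump the path stays above [q]. *)
Lemma grid_jump_disjoint b h p q : 0 < h -> q < s ->
  trivIset setT (grid_jump b h p q).
Proof.
move=> h0 qs; have aux i j w : (i < j)%N -> grid_jump b h p q i w -> ~ grid_jump b h p q j w.
  move=> ij [_ Yi _] [/andP[_ Yj] _ _].
  have Yi' : s <= Y (i.+1%:R * h) w by case: b Yi => // /ltW.
  have : Y (i.+1%:R * h) w <= Y (j%:R * h) w.
    by apply: Ymono; rewrite ?mulr_ge0 ?ler_wpM2r ?(ltW h0)// ler_nat.
  by rewrite leNgt (le_lt_trans Yj (lt_le_trans qs Yi')).
apply/trivIsetP => i j _ _ ij; apply/seteqP; split => // w /= [wi wj].
by case: (ltngtP i j) ij => // ij _; [exact: (aux i j w)|exact: (aux j i w)].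
Qed.

Lemma grid_jumpE b h p q k : grid_jump b h p q k =
  Y (k%:R * h) @^-1` `]p, q] `&` Y (k.+1%:R * h) @^-1` [set` Interval (BSide b s) +oo%O]
  `&` [set w | ((k.+1%:R * h)%:E < zeta w)%E].
Proof.
apply/seteqP; split => w; rewrite /grid_jump /= !in_itv /=; case: b; rewrite ?andbT.
- by case.
- by case.
- by case; case.
- by case; case.
Qed.

Lemma measurable_grid_jump b h p q k : 0 < h -> measurable (grid_jump b h p q k).
Proof.
move=> h0; have k0 j : 0 <= j%:R * h by rewrite mulr_ge0// ltW.
have mY j (B : set R) : measurable B -> measurable (Y (j%:R * h) @^-1` B).
  by move=> mB; have := subord_meas Ysub (k0 j) => /(_ measurableT _ mB); rewrite setTI.
rewrite grid_jumpE; apply: measurableI; last exact: measurable_zeta_gt.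
by apply: measurableI; apply: mY; exact: measurable_itv.
Qed.

End Passage.

(** * Tails of the increments over short times *)

Section ExponentialIncrement.
Context {R : realType}.

(** The remainder of [exp] is quadratic, so that [(e^{A h} - 1) / h --> A]. *)
Lemma cvg_cexp_increment (A : R[i]) :
  (fun n : nat => n.+1%:R * cRe (cexp (A * (n.+1%:R^-1)%:C) - 1)) @ \oo --> cRe A /\
  (fun n : nat => n.+1%:R * cIm (cexp (A * (n.+1%:R^-1)%:C) - 1)) @ \oo --> cIm A.
Proof.
pose K := 5 * cmod A ^+ 2 * expR (cmod A).
have bnd (n : nat) : n.+1%:R * cmod (cexp (A * (n.+1%:R^-1)%:C) - 1 - A * (n.+1%:R^-1)%:C) <=
    K * n.+1%:R^-1.
  set h := n.+1%:R^-1; have h0 : 0 < h by rewrite invr_gt0.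
  have h1 : h <= 1 by rewrite invf_le1// ler1n.
  have nE : n.+1%:R = h^-1 by rewrite /h invrK.
  rewrite nE; clearbody h.
  apply: (@le_trans _ _ (h^-1 * (5 * (cmod A * h) ^+ 2 * expR (cmod A)))).
    rewrite ler_wpM2l ?invr_ge0 ?(ltW h0)//; apply: le_trans (cexp_bound2 _) _.
    rewrite cmodM cmod_real (gtr0_norm h0).
    have m0 := cmod_ge0 A.
    rewrite ler_wpM2l ?mulr_ge0 ?exprn_ge0 ?mulr_ge0 ?(ltW h0)//.
    by rewrite ler_expR ler_piMr.
  rewrite le_eqVlt; apply/orP; left; apply/eqP; rewrite /K; field.
  by rewrite gt_eqF.
have lim0 (c : R) : (fun n : nat => c + K * n.+1%:R^-1) @ \oo --> c.
  rewrite -[X in _ --> X]addr0; apply: cvgD; first exact: cvg_cst.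
  by rewrite -(mulr0 K); apply: cvgM; [exact: cvg_cst|exact: cvg_harmonic].
have lim0' (c : R) : (fun n : nat => c - K * n.+1%:R^-1) @ \oo --> c.
  rewrite -[X in _ --> X]subr0; apply: cvgB; first exact: cvg_cst.
  by rewrite -(mulr0 K); apply: cvgM; [exact: cvg_cst|exact: cvg_harmonic].
have sq (u : nat -> R) (c : R) : (forall n, `|u n - c| <= K * n.+1%:R^-1) -> u @ \oo --> c.
  move=> H; apply: (squeeze_cvgr _ (lim0' c) (lim0 c)); apply: nearW => n.
  by have := H n; rewrite ler_distl.
split; apply: sq => n; apply: le_trans (bnd n).
- apply: (@le_trans _ _ (n.+1%:R * `|cRe (cexp (A * (n.+1%:R^-1)%:C) - 1 - A * (n.+1%:R^-1)%:C)|)).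
    set B := cexp _ - 1; clearbody B; have -> : n.+1%:R * cRe B - cRe A = n.+1%:R * cRe (B - A * (n.+1%:R^-1)%:C).
      by rewrite (cReD B) cReN cReZr mulrBr mulrCA mulfV ?mulr1.
    by rewrite normrM (ger0_norm (ler0n R n.+1)).
  by rewrite ler_wpM2l// normRe_le.
- apply: (@le_trans _ _ (n.+1%:R * `|cIm (cexp (A * (n.+1%:R^-1)%:C) - 1 - A * (n.+1%:R^-1)%:C)|)).
    set B := cexp _ - 1; clearbody B; have -> : n.+1%:R * cIm B - cIm A = n.+1%:R * cIm (B - A * (n.+1%:R^-1)%:C).
      by rewrite (cImD B) cImN cImZr mulrBr mulrCA mulfV ?mulr1.
    by rewrite normrM (ger0_norm (ler0n R n.+1)).
  by rewrite ler_wpM2l// normIm_le.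
Qed.

Lemma fcos0_mass (nu : {measure set R -> \bar R}) : (nu setT < +oo)%E ->
  nu setT = (fcos nu 0)%:E.
Proof.
move=> fin; rewrite /fcos /Rintegral.
under eq_integral do rewrite mul0r cos0.
by rewrite integral_cst// mul1e fineK// ge0_fin_numE.
Qed.

End ExponentialIncrement.

Section LevyTail.
Context {R : realType}.
Variable Pi : {measure set R -> \bar R}.
Hypothesis levy : is_levy_measure Pi.

Lemma levy_tail_fin (y : R) : 0 < y -> (Pi `[y, +oo[%classic < +oo)%E.
Proof.
move=> y0; have [_ _ fin] := levy; pose c := Num.min 1 y.
have c0 : 0 < c by rewrite lt_min ltr01.
have sub : `[y, +oo[%classic `<=` `]0%R, +oo[%classic.
  by move=> x /=; rewrite !in_itv /= !andbT; exact: lt_le_trans.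
have H : (c%:E * Pi `[y, +oo[%classic < +oo)%E.
  apply: le_lt_trans fin; rewrite -integral_cst//.
  apply: (@le_trans _ _ (\int[Pi]_(x in `[y, +oo[) (Num.min 1 x)%:E)%E).
  - apply: ge0_le_integral => //.
    + by move=> x _; rewrite lee_fin ltW.
    + by apply/measurable_EFinP; apply: measurable_minr => //; exact: measurable_funTS.
    + move=> x; rewrite /= in_itv /= andbT lee_fin => yx.
      by rewrite le_min ge_min lexx /= ge_min yx orbT.
  - apply: ge0_subset_integral => //.
    by apply/measurable_EFinP; apply: measurable_minr => //; exact: measurable_funTS.
    by move=> x; rewrite /= in_itv /= andbT lee_fin le_min ler01 => /ltW ->.
case: (Pi `[y, +oo[%classic) (measure_ge0 Pi `[y, +oo[%classic) H => [r _ _|_|//].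
  exact: ltry.
by rewrite mulry gtr0_sg// mul1e.
Qed.

Lemma levy_fin (y : R) (B : set R) : 0 < y -> measurable B -> B `<=` `[y, +oo[%classic ->
  (Pi B < +oo)%E.
Proof.
move=> y0 mB sB; apply: le_lt_trans (levy_tail_fin y0).
by apply: le_measure; rewrite ?inE.
Qed.

Variables (b M : R).
Hypotheses (b0 : 0 <= b) (M0 : 0 < M).
Notation D := `]0, +oo[%classic.

Definition jump_weight (x : R) : R := if 0 < x then 1 - expR (- (M * x)) else 0.
Definition drift_weight (x : R) : R := b * M.

Lemma measurable_jump_weight : measurable_fun setT jump_weight.
Proof.
apply: measurable_fun_ifT => //; first exact: measurable_fun_ltr.
apply: measurable_funB => //; apply: measurableT_comp => //.
by apply: measurableT_comp => //; exact: measurable_funM.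
Qed.
Lemma jump_weight_ge0 x : 0 <= jump_weight x.
Proof.
rewrite /jump_weight; case: ifP => // x0.
by rewrite subr_ge0 expR_le1 oppr_le0 mulr_ge0// ltW.
Qed.
Lemma measurable_drift_weight : measurable_fun setT drift_weight.
Proof. exact: measurable_cst. Qed.
Lemma drift_weight_ge0 x : 0 <= drift_weight x.
Proof. by rewrite mulr_ge0// ltW. Qed.

Definition jump_law : {measure set R -> \bar R} :=
  wlaw Pi measurable_jump_weight jump_weight_ge0 (@measurable_id _ R setT).
Definition drift_law : {measure set R -> \bar R} :=
  wlaw (\d_(0 : R)) measurable_drift_weight drift_weight_ge0 (@measurable_id _ R setT).

(** The finite measure [(1 - e^{- M x}) Pi (dx) + b M delta_0 (dx)], whose
    Laplace transform at [z] is [Phi (z + M) - Phi z]. *)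
Definition increment_law : {measure set R -> \bar R} := measure_add jump_law drift_law.

Let DE (x : R) : (x \in D) = (0 < x).
Proof. by rewrite mem_setE in_itv /= andbT. Qed.

Let integrable_jump (f : R -> R) : measurable_fun setT f -> (forall x, `|f x| <= 1) ->
  Pi.-integrable setT (fun x => (jump_weight x * f x)%:E) /\
  \int[Pi]_x (jump_weight x * f x) = \int[Pi]_(x in D) ((1 - expR (- (M * x))) * f x).
Proof.
move=> mf f1; have iw : Pi.-integrable setT (EFin \o jump_weight).
  have := integrable_1BexpR levy (ltW M0).
  rewrite integrable_mkcond//; apply: eq_integrable => // x _.
  rewrite patchE DE /jump_weight /=; by case: ifP.
split.
  apply: (integrable_bound measurableT _ _ iw).
    by apply: measurable_funM => //; exact: measurable_jump_weight.
  by move=> x _; rewrite normrM (ger0_norm (jump_weight_ge0 x)) ler_piMr ?jump_weight_ge0.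
rewrite [RHS]/Rintegral integral_mkcond; congr fine; apply: eq_integral => x _.
by rewrite patchE DE /jump_weight /=; case: ifP => //; rewrite mul0r.
Qed.

Let drift_integral (f : R -> R) : measurable_fun setT f -> (forall x, `|f x| <= 1) ->
  (\d_(0 : R)).-integrable setT (fun x => (drift_weight x * f x)%:E) /\
  \int[\d_(0:R)]_x (drift_weight x * f x) = b * M * f 0.
Proof.
move=> mf f1; have mdf : measurable_fun setT (fun x => drift_weight x * f x).
  by apply: measurable_funM => //; exact: measurable_drift_weight.
split; last first.
  rewrite /Rintegral integral_dirac//=; last exact/measurable_EFinP.
  by rewrite indicT mul1r.
apply: (@integrable_finite _ _ _ _ _ _ (b * M)) => //.
- by rewrite /= diracT ltry.
- by move=> x _; rewrite normrM (ger0_norm (drift_weight_ge0 x)) ler_piMr ?drift_weight_ge0.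
Qed.

Lemma integral_increment_law (f : R -> R) : measurable_fun setT f ->
  (forall x, `|f x| <= 1) ->
  \int[increment_law]_x f x =
    b * M * f 0 + \int[Pi]_(x in D) ((1 - expR (- (M * x))) * f x).
Proof.
move=> mf f1; have [ij jE] := integrable_jump mf f1; have [id dE] := drift_integral mf f1.
have i1 := integrable_wlaw measurable_jump_weight jump_weight_ge0 (@measurable_id _ R setT) mf ij.
have i2 := integrable_wlaw measurable_drift_weight drift_weight_ge0 (@measurable_id _ R setT) mf id.
rewrite -dE -jE addrC.
rewrite -(integral_wlaw measurable_jump_weight jump_weight_ge0 (@measurable_id _ R setT) mf ij).
rewrite -(integral_wlaw measurable_drift_weight drift_weight_ge0 (@measurable_id _ R setT) mf id).
rewrite /Rintegral integral_measure_add//= fineD//; exact: integrable_fin_num.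
Qed.

Let increment_lawE (B : set R) : increment_law B =
  (\int[Pi]_(x in B) (jump_weight x)%:E + \int[\d_(0%R : R)]_(x in B) (drift_weight x)%:E)%E.
Proof. exact: measure_addE. Qed.

Let drift0 (B : set R) : measurable B -> ~ B 0 ->
  (\int[\d_(0%R : R)]_(x in B) (drift_weight x)%:E = 0)%E.
Proof.
move=> mB B0; rewrite integral_dirac//.
  by rewrite diracE memNset// mul0e.
by apply/measurable_EFinP; exact: measurable_cst.
Qed.

Lemma increment_law_fin : (increment_law setT < +oo)%E.
Proof.
have m1 : measurable_fun setT (fun _ : R => 1 : R) by exact: measurable_cst.
have n1 (x : R) : `|1 : R| <= 1 by rewrite normr1.
have [/integrableP[_ ij] _] := integrable_jump m1 n1.
have [/integrableP[_ id] _] := drift_integral m1 n1.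
rewrite increment_lawE lte_add_pinfty//.
  apply: le_lt_trans ij.
  rewrite le_eqVlt; apply/orP; left; apply/eqP; apply: eq_integral => x _ /=.
  by rewrite mulr1 ger0_norm// jump_weight_ge0.
apply: le_lt_trans id.
rewrite le_eqVlt; apply/orP; left; apply/eqP; apply: eq_integral => x _ /=.
by rewrite mulr1 ger0_norm// drift_weight_ge0.
Qed.

Lemma increment_law_neg (B : set R) : measurable B -> (forall x, B x -> x < 0) ->
  increment_law B = 0.
Proof.
move=> mB B0; rewrite increment_lawE.
rewrite integral0_eq ?add0e; last first.
  by move=> x /B0 x0; rewrite /jump_weight ltNge (ltW x0).
by rewrite drift0// => /B0; rewrite ltxx.
Qed.

Lemma increment_law_le (B : set R) : measurable B -> B `<=` D ->
  (increment_law B <= Pi B)%E.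
Proof.
move=> mB BD; rewrite increment_lawE.
rewrite drift0 ?adde0//; last by move=> /BD; rewrite /= in_itv /= ltxx.
rewrite -[leRHS]mul1e -integral_cst//; apply: ge0_le_integral => //.
- by move=> x _; rewrite lee_fin jump_weight_ge0.
- by apply/measurable_EFinP; apply: measurable_funTS; exact: measurable_jump_weight.
move=> x _; rewrite lee_fin /jump_weight; by case: ifP => // _; rewrite gerBl expR_ge0.
Qed.

Lemma increment_law_ge (y : R) (B : set R) : 0 < y -> measurable B ->
  B `<=` `[y, +oo[%classic ->
  ((1 - expR (- (M * y)))%:E * Pi B <= increment_law B)%E.
Proof.
move=> y0 mB BD; rewrite increment_lawE.
apply: (@le_trans _ _ (\int[Pi]_(x in B) (jump_weight x)%:E)%E); last first.
  by rewrite leeDl// integral_ge0// => x _; rewrite lee_fin drift_weight_ge0.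
rewrite -integral_cst//; apply: ge0_le_integral => //.
- by move=> x _; rewrite lee_fin subr_ge0 expR_le1 oppr_le0 mulr_ge0// ltW.
- by apply/measurable_EFinP; apply: measurable_funTS; exact: measurable_jump_weight.
move=> x /BD; rewrite /= in_itv /= andbT => yx; rewrite lee_fin /jump_weight (lt_le_trans y0 yx).
by rewrite lerB// ler_expR lerN2 ler_wpM2l// ltW.
Qed.

End LevyTail.

Section SurvivalLaw.
Context d (Omega : measurableType d) (R : realType) (P : probability Omega R).
Variables (Y : R -> Omega -> R) (zeta : Omega -> \bar R).
Hypotheses (Ysub : is_subordinator P Y) (mzeta : measurable_fun setT zeta).

(** The transition kernel of the killed process started at 0, a defective
    probability. *)
Definition survival_law (t : R) (B : set R) : \bar R :=
  P (Y t @^-1` B `&` [set w | (t%:E < zeta w)%E]).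

Lemma measurable_alive_at (t : R) : measurable [set w | (t%:E < zeta w)%E].
Proof.
have := @measurable_lte _ Omega R setT measurableT (cst t%:E) zeta (measurable_cst _) mzeta.
by rewrite setTI.
Qed.

Lemma measurable_position (t : R) (B : set R) : 0 <= t -> measurable B ->
  measurable (Y t @^-1` B).
Proof.
by move=> t0 mB; have := subord_meas Ysub t0 => /(_ measurableT _ mB); rewrite setTI.
Qed.

Lemma survival_lawS (t : R) (A B : set R) : 0 <= t -> measurable A -> measurable B ->
  A `<=` B -> (survival_law t A <= survival_law t B)%E.
Proof.
move=> t0 mA mB AB; apply: le_measure; rewrite ?inE.
- by apply: measurableI; [exact: measurable_position|exact: measurable_alive_at].
- by apply: measurableI; [exact: measurable_position|exact: measurable_alive_at].
- by move=> w [/AB].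
Qed.

Lemma survival_law_le1 (t : R) (B : set R) : 0 <= t -> measurable B ->
  (survival_law t B <= 1)%E.
Proof.
move=> t0 mB; apply: probability_le1.
by apply: measurableI; [exact: measurable_position|exact: measurable_alive_at].
Qed.

Lemma survival_law_fin (t : R) (B : set R) : 0 <= t -> measurable B ->
  survival_law t B \is a fin_num.
Proof.
move=> t0 mB; rewrite ge0_fin_numE ?measure_ge0//.
exact: le_lt_trans (survival_law_le1 t0 mB) (ltry _).
Qed.

Definition is_alive (t : R) (w : Omega) : R := if (t%:E < zeta w)%E then 1 else 0.

Lemma is_alive_ge0 t w : 0 <= is_alive t w. Proof. by rewrite /is_alive; case: ifP. Qed.
Lemma is_alive_le1 t w : is_alive t w <= 1. Proof. by rewrite /is_alive; case: ifP. Qed.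

Lemma measurable_is_alive (t : R) : measurable_fun setT (is_alive t).
Proof.
by apply: measurable_fun_ifT => //; apply: measurable_fun_lte => //; exact: measurable_cst.
Qed.

Lemma integral_is_alive (t c : R) (B : set R) : 0 <= t -> 0 <= c -> measurable B ->
  (\int[P]_(w in Y t @^-1` B) (c * is_alive t w)%:E = c%:E * survival_law t B)%E.
Proof.
move=> t0 c0 mB; have mYB := measurable_position t0 mB.
under eq_integral do rewrite EFinM.
rewrite ge0_integralZl_EFin//; last 2 first.
- by move=> w _; rewrite lee_fin is_alive_ge0.
- by apply/measurable_EFinP; apply: measurable_funTS; exact: measurable_is_alive.
congr (_ * _)%E; rewrite /survival_law setIC -integral_indic//; last exact: measurable_alive_at.
apply: eq_integral => w _; congr EFin; rewrite /is_alive indicE.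
by case: ifPn => tz; [rewrite mem_set|rewrite memNset//; exact/negP].
Qed.

End SurvivalLaw.

Section Tails.
Context d (Omega : measurableType d) (R : realType) (P : probability Omega R).
Variables (Y : R -> Omega -> R) (zeta : Omega -> \bar R) (X : R -> Omega -> option R).
Hypotheses (Ysub : is_subordinator P Y) (mzeta : measurable_fun setT zeta)
  (XE : forall (t : R) w, 0 <= t ->
     X t w = if (t%:E < zeta w)%E then Some (Y t w) else None).
Variables (a b : R) (Pi : {measure set R -> \bar R}).
Hypotheses (b0 : 0 <= b) (levy : is_levy_measure Pi)
  (Xchar : forall (t : R) (z : R[i]), 0 <= t -> 0 <= cRe z ->
     cintegral P setT (fun w => if X t w is Some y then cexp (- z * y%:C) else 0) =
     cexp (- levy_khintchine a b Pi z * t%:C)).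
Notation Phi := (levy_khintchine a b Pi).
Notation alive_at := (is_alive zeta).
Notation Q := (survival_law P Y zeta).

Section Transform.
Variables (t : R) (z : R[i]).
Hypotheses (t0 : 0 <= t) (z0 : 0 <= cRe z).
Let fC w := alive_at t w * (expR (- (cRe z * Y t w)) * cos (cIm z * Y t w)).
Let fS w := alive_at t w * (expR (- (cRe z * Y t w)) * sin (cIm z * Y t w)).

Let mY : measurable_fun setT (Y t). Proof. exact: (subord_meas Ysub t0). Qed.
Let mE : measurable_fun setT (fun w => expR (- (cRe z * Y t w))).
Proof. by apply: measurableT_comp => //; apply: measurableT_comp => //; exact: measurable_funM. Qed.

Let mfC : measurable_fun setT fC.
Proof.
apply: measurable_funM; first exact: measurable_is_alive.
apply: measurable_funM => //; apply: measurableT_comp; last exact: measurable_funM.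
exact: continuous_measurable_fun (@continuous_cos R).
Qed.

Let mfS : measurable_fun setT fS.
Proof.
apply: measurable_funM; first exact: measurable_is_alive.
apply: measurable_funM => //; apply: measurableT_comp; last exact: measurable_funM.
exact: continuous_measurable_fun (@continuous_sin R).
Qed.

Let f_le1 w (c : R) : `|c| <= 1 -> `|alive_at t w * (expR (- (cRe z * Y t w)) * c)| <= 1.
Proof.
move=> c1; rewrite !normrM (ger0_norm (is_alive_ge0 _ _ _)) (ger0_norm (expR_ge0 _)).
have e1 : expR (- (cRe z * Y t w)) <= 1.
  by rewrite expR_le1 oppr_le0 mulr_ge0// (subordinator_ge0 Ysub).
rewrite mulr_ile1 ?is_alive_ge0 ?is_alive_le1 ?mulr_ge0 ?expR_ge0//.
by rewrite mulr_ile1 ?expR_ge0.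
Qed.

Let P1 : (P setT < +oo)%E. Proof. by rewrite probability_setT ltry. Qed.

Lemma integrable_survival_cos : P.-integrable setT (fun w => (fC w)%:E).
Proof.
apply: (integrable_finite (K := 1)) => // w _; apply: f_le1.
by rewrite ler_norml cos_geN1 cos_le1.
Qed.

Lemma integrable_survival_sin : P.-integrable setT (fun w => (fS w)%:E).
Proof.
apply: (integrable_finite (K := 1)) => // w _; apply: f_le1.
by rewrite ler_norml sin_geN1 sin_le1.
Qed.

Let termE w : (if X t w is Some y then cexp (- z * y%:C) else 0) = fC w +i* (- fS w).
Proof.
rewrite XE// /fC /fS /is_alive; case: ifP => _; last by rewrite !mul0r oppr0.
rewrite !mul1r /cexp cReZr cImZr cReN cImN !mulNr cosN sinN.
by rewrite mulrN.
Qed.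

Lemma integral_survival_cos : \int[P]_w fC w = cRe (cexp (- Phi z * t%:C)).
Proof.
rewrite -Xchar// /cintegral; apply: eq_Rintegral => w _.
by rewrite termE.
Qed.

Lemma integral_survival_sin : \int[P]_w fS w = - cIm (cexp (- Phi z * t%:C)).
Proof.
rewrite -Xchar// /cintegral; have := integrable_survival_sin => iS.
have -> : \int[P]_w fS w = \int[P]_w (- 1 * - fS w) by apply: eq_Rintegral => w _; rewrite mulrNN mul1r.
rewrite RintegralZl ?mulN1r//; last first.
  by have := integrableN iS; apply: eq_integrable.
by congr (- _); apply: eq_Rintegral => w _; rewrite termE.
Qed.

End Transform.

Variable M : R.
Hypothesis M0 : 0 < M.

Section PreLaw.
Variable n : nat.
Notation h := (n.+1%:R^-1 : R).
Let h0 : 0 <= h. Proof. by rewrite invr_ge0. Qed.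
Let mY : measurable_fun setT (Y h). Proof. exact: (subord_meas Ysub h0). Qed.

Definition short_weight w : R := n.+1%:R * (alive_at h w * (1 - expR (- (M * Y h w)))).

Lemma measurable_short_weight : measurable_fun setT short_weight.
Proof.
apply: measurable_funM => //; apply: measurable_funM; first exact: measurable_is_alive.
apply: measurable_funB => //; apply: measurableT_comp => //; apply: measurableT_comp => //.
exact: measurable_funM.
Qed.

Lemma short_weight_ge0 w : 0 <= short_weight w.
Proof.
rewrite /short_weight mulr_ge0// mulr_ge0 ?is_alive_ge0// subr_ge0 expR_le1 oppr_le0.
by rewrite mulr_ge0 ?(ltW M0)// (subordinator_ge0 Ysub).
Qed.

(** The measure [(1 - e^{- M x}) P (X_h in dx) / h] with [h = 1 / (n + 1)]. The
    weight tames the mass [1 / h] that accumulates at 0, so that these measures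
    converge, to [increment_law]. *)
Definition short_law : {measure set R -> \bar R} :=
  wlaw P measurable_short_weight short_weight_ge0 mY.

Lemma short_law_le (B : set R) : measurable B ->
  (short_law B <= n.+1%:R%:E * Q h B)%E.
Proof.
move=> mB; rewrite /short_law /= /wlaw -(integral_is_alive Ysub mzeta h0 (ler0n R n.+1) mB).
have mYB := measurable_position Ysub h0 mB.
apply: ge0_le_integral => //.
- by move=> w _; rewrite lee_fin short_weight_ge0.
- by apply/measurable_EFinP; apply: measurable_funTS; exact: measurable_short_weight.
- apply/measurable_EFinP; apply: measurable_funTS; apply: measurable_funM => //.
  exact: measurable_is_alive.
- by move=> w _; rewrite lee_fin /short_weight ler_wpM2l// ler_piMr ?is_alive_ge0// gerBl expR_ge0.
Qed.

Lemma short_law_ge (y : R) (B : set R) : 0 < y -> measurable B ->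
  B `<=` `[y, +oo[%classic ->
  ((1 - expR (- (M * y)))%:E * (n.+1%:R%:E * Q h B) <= short_law B)%E.
Proof.
move=> y0 mB By; rewrite muleA -EFinM.
have k0 : 0 <= 1 - expR (- (M * y)).
  by rewrite subr_ge0 expR_le1 oppr_le0 mulr_ge0// ltW.
rewrite /short_law /= /wlaw -(integral_is_alive Ysub mzeta h0 (mulr_ge0 k0 (ler0n R n.+1)) mB).
have mYB := measurable_position Ysub h0 mB.
apply: ge0_le_integral => //.
- by move=> w _; rewrite lee_fin mulr_ge0 ?is_alive_ge0// mulr_ge0.
- apply/measurable_EFinP; apply: measurable_funTS; apply: measurable_funM => //.
  exact: measurable_is_alive.
- by apply/measurable_EFinP; apply: measurable_funTS; exact: measurable_short_weight.
move=> w /By; rewrite /= in_itv /= andbT => yY; rewrite lee_fin /short_weight.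
rewrite [leRHS]mulrCA [leLHS]mulrC ler_wpM2l ?is_alive_ge0// mulrC ler_wpM2l//.
by rewrite lerB// ler_expR lerN2 ler_wpM2l// ltW.
Qed.

Let integrable_short (f : R -> R) : measurable_fun setT f -> (forall x, `|f x| <= 1) ->
  P.-integrable setT (fun w => (short_weight w * f (Y h w))%:E).
Proof.
have P1 : (P setT < +oo)%E by rewrite probability_setT ltry.
move=> mf f1; apply: (integrable_finite (K := n.+1%:R)) => //.
- by apply: measurable_funM; [exact: measurable_short_weight|exact: measurableT_comp].
move=> w _; rewrite normrM (ger0_norm (short_weight_ge0 w)) -[leRHS]mulr1.
apply: ler_pM => //; first exact: short_weight_ge0.
rewrite /short_weight ler_piMr// mulr_ile1 ?is_alive_ge0 ?is_alive_le1// ?gerBl ?expR_ge0//.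
by rewrite subr_ge0 expR_le1 oppr_le0 mulr_ge0 ?(ltW M0)// (subordinator_ge0 Ysub).
Qed.

Lemma short_law_fcos (t : R) : fcos short_law t =
  n.+1%:R * (cRe (cexp (- Phi (0 +i* t) * h%:C)) - cRe (cexp (- Phi (M +i* t) * h%:C))).
Proof.
have z1 : 0 <= cRe (0 +i* t : R[i]) by [].
have z2 : 0 <= cRe (M +i* t) by exact: ltW.
have mc : measurable_fun setT (fun x : R => cos (t * x)).
  apply: measurableT_comp; first exact: continuous_measurable_fun (@continuous_cos R).
  exact: measurable_funM.
have c1 (x : R) : `|cos (t * x)| <= 1 by rewrite ler_norml cos_geN1 cos_le1.
rewrite /fcos (integral_wlaw measurable_short_weight short_weight_ge0 mY mc (integrable_short mc c1)).
have i1 := integrable_survival_cos h0 z1; have i2 := integrable_survival_cos h0 z2.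
rewrite -(integral_survival_cos h0 z1) -(integral_survival_cos h0 z2) /= -RintegralB//.
rewrite -RintegralZl//; last exact: (integrableB measurableT i1 i2).
apply: eq_Rintegral => w _; rewrite /short_weight mul0r oppr0 expR0 mul1r; ring.
Qed.

Lemma short_law_fsin (t : R) : fsin short_law t =
  - (n.+1%:R * (cIm (cexp (- Phi (0 +i* t) * h%:C)) - cIm (cexp (- Phi (M +i* t) * h%:C)))).
Proof.
have z1 : 0 <= cRe (0 +i* t : R[i]) by [].
have z2 : 0 <= cRe (M +i* t) by exact: ltW.
have ms : measurable_fun setT (fun x : R => sin (t * x)).
  apply: measurableT_comp; first exact: continuous_measurable_fun (@continuous_sin R).
  exact: measurable_funM.
have s1 (x : R) : `|sin (t * x)| <= 1 by rewrite ler_norml sin_geN1 sin_le1.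
rewrite /fsin (integral_wlaw measurable_short_weight short_weight_ge0 mY ms (integrable_short ms s1)).
have i1 := integrable_survival_sin h0 z1; have i2 := integrable_survival_sin h0 z2.
have -> : cIm (cexp (- Phi (M +i* t) * h%:C)) = - \int[P]_w (alive_at h w * (expR (- (cRe (M +i* t) * Y h w)) * sin (cIm (M +i* t) * Y h w))).
  by rewrite (integral_survival_sin h0 z2) opprK.
have -> : cIm (cexp (- Phi (0 +i* t) * h%:C)) = - \int[P]_w (alive_at h w * (expR (- (cRe (0 +i* t : R[i]) * Y h w)) * sin (cIm (0 +i* t : R[i]) * Y h w))).
  by rewrite (integral_survival_sin h0 z1) opprK.
have flip (x y c : R) : - (c * (- x - - y)) = c * (x - y) by ring.
rewrite flip /= -RintegralB//.
rewrite -RintegralZl//; last exact: (integrableB measurableT i1 i2).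
apply: eq_Rintegral => w _; rewrite /short_weight mul0r oppr0 expR0 mul1r; ring.
Qed.

Lemma short_law_fin : (short_law setT < +oo)%E.
Proof.
apply: le_lt_trans (short_law_le _) _ => //.
rewrite -(fineK (survival_law_fin Ysub mzeta h0 measurableT)) -EFinM; exact: ltry.
Qed.

End PreLaw.

Lemma increment_law_fcos (t : R) :
  fcos (increment_law Pi b0 M0) t = cRe (Phi (M +i* t)) - cRe (Phi (0 +i* t)).
Proof.
have z1 : 0 <= cRe (0 +i* t : R[i]) by [].
have z2 : 0 <= cRe (M +i* t) by exact: ltW.
have mc : measurable_fun setT (fun x : R => cos (t * x)).
  apply: measurableT_comp; first exact: continuous_measurable_fun (@continuous_cos R).
  exact: measurable_funM.
have c1 (x : R) : `|cos (t * x)| <= 1 by rewrite ler_norml cos_geN1 cos_le1.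
rewrite /fcos (integral_increment_law levy b0 M0 mc c1) mulr0 cos0 mulr1.
have [i1 _] := cintegrable_levy levy z1; have [i2 _] := cintegrable_levy levy z2.
have Re_eq z : cRe (Phi z) = a + b * cRe z + \int[Pi]_(x in `]0%R, +oo[) cRe (1 - cexp (- z * x%:C)).
  by rewrite /levy_khintchine /cintegral !cReD cReZ.
rewrite (Re_eq (M +i* t)) (Re_eq (0 +i* t)).
have sub (u v w x : R) : u + v + w - (u + b * 0 + x) = v + (w - x) by ring.
rewrite (sub a (b * M)) -RintegralB//; congr (_ + _); apply: eq_Rintegral => x _.
rewrite !cReD !cReN /cexp !cReZr !cImZr !cReN !cImN /= !mulNr !cosN mul0r oppr0 expR0.
by ring.
Qed.

Lemma increment_law_fsin (t : R) :
  fsin (increment_law Pi b0 M0) t = cIm (Phi (0 +i* t)) - cIm (Phi (M +i* t)).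
Proof.
have z1 : 0 <= cRe (0 +i* t : R[i]) by [].
have z2 : 0 <= cRe (M +i* t) by exact: ltW.
have ms : measurable_fun setT (fun x : R => sin (t * x)).
  apply: measurableT_comp; first exact: continuous_measurable_fun (@continuous_sin R).
  exact: measurable_funM.
have s1 (x : R) : `|sin (t * x)| <= 1 by rewrite ler_norml sin_geN1 sin_le1.
rewrite /fsin (integral_increment_law levy b0 M0 ms s1) mulr0 sin0 mulr0 add0r.
have [_ i1] := cintegrable_levy levy z1; have [_ i2] := cintegrable_levy levy z2.
have Im_eq z : cIm (Phi z) = b * cIm z + \int[Pi]_(x in `]0%R, +oo[) cIm (1 - cexp (- z * x%:C)).
  by rewrite /levy_khintchine /cintegral !cImD cImZ add0r.
rewrite (Im_eq (0 +i* t)) (Im_eq (M +i* t)).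
have sub (u v w : R) : u + v - (u + w) = v - w by ring.
rewrite (sub (b * t)) -RintegralB//; apply: eq_Rintegral => x _.
rewrite !cImD !cImN /cexp !cReZr !cImZr !cReN !cImN /= !mulNr !sinN mul0r oppr0 expR0.
by ring.
Qed.

Notation L := (increment_law Pi b0 M0).

(** Both transforms are differences between the values on the lines [Re z = M]
    and [Re z = 0], and [(1 - exp (- h Phi z)) / h] tends to [Phi z]. *)
Lemma cvg_short_law (t : R) :
  (fun n => fcos (short_law n) t) @ \oo --> fcos L t /\
  (fun n => fsin (short_law n) t) @ \oo --> fsin L t.
Proof.
have [c1 s1] := cvg_cexp_increment (- Phi (0 +i* t)).
have [c2 s2] := cvg_cexp_increment (- Phi (M +i* t)).
split.
  have -> : fcos L t = cRe (- Phi (0 +i* t)) - cRe (- Phi (M +i* t)).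
    by rewrite increment_law_fcos !cReN; ring.
  apply: cvg_trans (cvgB c1 c2); apply: near_eq_cvg; apply: nearW => n.
  transitivity ((n.+1%:R * cRe (cexp (- Phi (0 +i* t) * (n.+1%:R^-1)%:C) - 1) -
    n.+1%:R * cRe (cexp (- Phi (M +i* t) * (n.+1%:R^-1)%:C) - 1))) => //.
  rewrite short_law_fcos; set A := cexp _; set B := cexp _; clearbody A B.
  by rewrite (cReD A) (cReD B) !cReN; ring.
have -> : fsin L t = - (cIm (- Phi (0 +i* t)) - cIm (- Phi (M +i* t))).
  by rewrite increment_law_fsin !cImN; ring.
apply: cvg_trans (cvgN (cvgB s1 s2)); apply: near_eq_cvg; apply: nearW => n.
transitivity (- (n.+1%:R * cIm (cexp (- Phi (0 +i* t) * (n.+1%:R^-1)%:C) - 1) -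
    n.+1%:R * cIm (cexp (- Phi (M +i* t) * (n.+1%:R^-1)%:C) - 1))) => //.
  rewrite short_law_fsin; set A := cexp _; set B := cexp _; clearbody A B.
by rewrite (cImD A) (cImD B) !cImN; ring.
Qed.

Lemma short_law_bounded : exists2 K : R, (L setT <= K%:E)%E &
  forall n, (short_law n setT <= K%:E)%E.
Proof.
have [c1 _] := cvg_short_law 0.
have [K [_ HK]] : bounded_fun (fun n => fcos (short_law n) 0).
  by apply: cvg_seq_bounded; apply/cvg_ex; exists (fcos L 0).
exists (Num.max (fcos L 0) (K + 1)).
  by rewrite (fcos0_mass (increment_law_fin levy b0 M0)) lee_fin le_max lexx.
move=> n; rewrite (fcos0_mass (short_law_fin n)) lee_fin le_max; apply/orP; right.
have K1 : K < K + 1 by rewrite ltrDl.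
exact: le_trans (ler_norm _) (HK _ K1 n I).
Qed.

Lemma portmanteau_short_law (p q e : R) : p < q -> 0 < e -> \forall n \near \oo,
  fine (L `]p, q[%classic) - e <= fine (short_law n `]p, q[%classic).
Proof.
move=> pq e0; have [K LK nK] := short_law_bounded.
apply: (portmanteau_open nK LK) => // t _; by have [] := cvg_short_law t.
Qed.

(** No mass escapes to infinity. Upper bounds come from here, since
    [portmanteau_short_law] only gives lower bounds. *)
Lemma short_law_mass (e : R) : 0 < e -> \forall n \near \oo,
  fine (short_law n setT) <= fine (L setT) + e.
Proof.
move=> e0; have [c1 _] := cvg_short_law 0.
have H : \forall n \near \oo, `|fcos L 0 - fcos (short_law n) 0| < e.
  exact: (@cvgr_dist_lt _ _ _ _ _ _ _ c1 _ e0).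
apply: filterS H => n; rewrite (fcos0_mass (short_law_fin n)).
rewrite (fcos0_mass (increment_law_fin levy b0 M0)) /= ltr_norml => /andP[h _]; lra.
Qed.

Lemma short_time_tail_ge (y r e : R) : 0 < y -> y < r -> 0 < e -> \forall n \near \oo,
  (1 - expR (- (M * y))) * fine (Pi `]y, r[%classic) - e <=
  n.+1%:R * fine (Q n.+1%:R^-1 `]y, +oo[%classic).
Proof.
move=> y0 yr e0; apply: filterS (portmanteau_short_law yr e0) => n H.
have h0 : 0 <= n.+1%:R^-1 :> R by rewrite invr_ge0.
have sub : `]y, r[%classic `<=` `[y, +oo[%classic.
  by move=> x /=; rewrite !in_itv /= andbT => /andP[/ltW].
have fP : Pi `]y, r[%classic \is a fin_num.
  by rewrite ge0_fin_numE//; exact: (levy_fin levy y0 (measurable_itv _) sub).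
have fL (B : set R) : measurable B -> L B \is a fin_num.
  move=> mB; rewrite ge0_fin_numE//; apply: le_lt_trans (increment_law_fin levy b0 M0).
  by apply: le_measure; rewrite ?inE.
have fS (B : set R) : measurable B -> short_law n B \is a fin_num.
  move=> mB; rewrite ge0_fin_numE//; apply: le_lt_trans (short_law_fin n).
  by apply: le_measure; rewrite ?inE.
have fQ (B : set R) (mB : measurable B) := survival_law_fin Ysub mzeta h0 mB.
have mI : measurable (`]y, r[%classic : set R) by exact: measurable_itv.
have mJ : measurable (`]y, +oo[%classic : set R) by exact: measurable_itv.
apply: le_trans (le_trans H _).
  rewrite lerB// -[leLHS]/(fine (_%:E)) EFinM fineK//.
  by apply: fine_le; rewrite ?fin_numM ?fL//; exact: increment_law_ge.
have := short_law_le n mI => /(fine_le (fS _ mI)); rewrite fin_numM ?fQ// => /(_ isT).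
move/le_trans; apply; rewrite fineM ?fQ// ler_wpM2l//.
apply: fine_le; rewrite ?fQ//; apply: survival_lawS => //.
by move=> x /=; rewrite !in_itv /= andbT => /andP[].
Qed.

(** The tail is the total mass minus the mass of [ ]-1, y[ ], which is bounded
    from below. *)
Lemma short_time_tail_le (y e : R) : 0 < y -> 0 < e -> \forall n \near \oo,
  (1 - expR (- (M * y))) * (n.+1%:R * fine (Q n.+1%:R^-1 `[y, +oo[%classic)) <=
  fine (Pi `[y, +oo[%classic) + e.
Proof.
move=> y0 e0; have e20 : 0 < e / 2 by rewrite divr_gt0.
have y1 : -1 < y by apply: lt_trans y0; rewrite ltrN10.
apply: filterS2 (portmanteau_short_law y1 e20) (short_law_mass e20) => n H1 H2.
have h0 : 0 <= n.+1%:R^-1 :> R by rewrite invr_ge0.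
have fL (B : set R) : measurable B -> L B \is a fin_num.
  move=> mB; rewrite ge0_fin_numE//; apply: le_lt_trans (increment_law_fin levy b0 M0).
  by apply: le_measure; rewrite ?inE.
have fS (B : set R) : measurable B -> short_law n B \is a fin_num.
  move=> mB; rewrite ge0_fin_numE//; apply: le_lt_trans (short_law_fin n).
  by apply: le_measure; rewrite ?inE.
have fQ (B : set R) (mB : measurable B) := survival_law_fin Ysub mzeta h0 mB.
have mJ : measurable (`[y, +oo[%classic : set R) by exact: measurable_itv.
have mI : measurable (`]-1, y[%classic : set R) by exact: measurable_itv.
have mK : measurable (`]-oo, -1]%classic : set R) by exact: measurable_itv.
have dj : [disjoint `]-1, y[%classic & `[y, +oo[%classic : set R].
  apply/disj_set2P; apply/seteqP; split => // x /=; rewrite !in_itv /= andbT.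
  by move=> [/andP[_ xy]]; rewrite leNgt xy.
have S1 : fine (short_law n `[y, +oo[%classic) + fine (short_law n `]-1, y[%classic) <=
    fine (short_law n setT).
  rewrite -fineD ?fS// addrC -measureU//; last exact/disj_set2P.
  by apply: fine_le; rewrite ?fS//; [exact: measurableU|apply: le_measure; rewrite ?inE//; exact: measurableU].
have L1 : fine (L setT) <= fine (L `]-1, y[%classic) + fine (Pi `[y, +oo[%classic).
  have -> : [set: R] = (`]-1, y[ `|` `[y, +oo[) `|` `]-oo, -1].
    apply/seteqP; split => // x _ /=; rewrite !in_itv /= andbT.
    have [xy|yx] := ltP x y; last by left; right.
    by have [x1|x1] := ltP (-1) x; [left; left|right].
  rewrite -fineD ?fL//; last by rewrite ge0_fin_numE//; exact: levy_tail_fin.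
  apply: fine_le; rewrite ?fL ?fin_numD ?fL//.
  - by apply: measurableU => //; exact: measurableU.
  - by rewrite ge0_fin_numE//; exact: levy_tail_fin.
  apply: le_trans (measureU2 _ _ _) _ => //; first exact: measurableU.
  rewrite [X in (_ + X)%E]increment_law_neg//; last first.
    by move=> x; rewrite /= in_itv /= => /le_lt_trans; apply; exact: ltrN10.
  rewrite adde0; apply: le_trans (measureU2 _ _ _) _ => //; rewrite leeD2l//.
  apply: increment_law_le => // x /=; rewrite !in_itv /= !andbT; exact: lt_le_trans.
have := @short_law_ge n y _ y0 mJ (@subset_refl _ _).
move=> /(fine_le _ (fS _ mJ)); rewrite fin_numM ?fin_numM ?fQ// => /(_ isT).
rewrite fineM ?fin_numM ?fQ// fineM ?fQ// => S2.
move: H1 H2 S1 L1 S2 => /=; lra.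
Qed.

End Tails.

Section ShortTime.
Context d (Omega : measurableType d) (R : realType) (P : probability Omega R).
Variables (Y : R -> Omega -> R) (zeta : Omega -> \bar R) (X : R -> Omega -> option R).
Hypotheses (Ysub : is_subordinator P Y) (mzeta : measurable_fun setT zeta)
  (XE : forall (t : R) w, 0 <= t ->
     X t w = if (t%:E < zeta w)%E then Some (Y t w) else None).
Variables (a b : R) (Pi : {measure set R -> \bar R}).
Hypotheses (b0 : 0 <= b) (levy : is_levy_measure Pi)
  (Xchar : forall (t : R) (z : R[i]), 0 <= t -> 0 <= cRe z ->
     cintegral P setT (fun w => if X t w is Some y then cexp (- z * y%:C) else 0) =
     cexp (- levy_khintchine a b Pi z * t%:C)).
Notation Q := (survival_law P Y zeta).

Let expRN_small (y e : R) : 0 < y -> 0 < e -> exists2 M, 0 < M & expR (- (M * y)) <= e.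
Proof.
move=> y0 e0; exists (e^-1 / y); first by rewrite divr_gt0// invr_gt0.
rewrite divfK ?gt_eqF// expRN -[leRHS]invrK lef_pV2 ?posrE ?expR_gt0 ?invr_gt0//.
by apply: le_trans (expR_ge1Dx _); rewrite lerDr ler01.
Qed.

(** [P (X_h > y) / h] tends to the tail of the Levy measure; the two bounds are
    kept apart because [y] may be an atom. *)
Lemma survival_tail_ge (y e : R) : 0 < y -> 0 < e -> \forall n \near \oo,
  fine (Pi `]y, +oo[%classic) - e <= n.+1%:R * fine (Q n.+1%:R^-1 `]y, +oo[%classic).
Proof.
move=> y0 e0; set T := fine (Pi `]y, +oo[%classic).
have sub : `]y, +oo[%classic `<=` `[y, +oo[%classic.
  by move=> x /=; rewrite !in_itv /= !andbT => /ltW.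
have fT : Pi `]y, +oo[%classic \is a fin_num.
  by rewrite ge0_fin_numE//; exact: (levy_fin levy y0 (measurable_itv _) sub).
have T0 : 0 <= T by rewrite fine_ge0.
have e30 : 0 < e / 3 by rewrite divr_gt0.
have [r yr Hr] : exists2 r, y < r & T - e / 3 <= fine (Pi `]y, r[%classic).
  pose F (n : nat) : set R := `]y, y + n.+1%:R[%classic.
  have UF : \bigcup_n F n = `]y, +oo[%classic.
    apply/seteqP; split => x; rewrite /F /= ?in_itv /= ?andbT.
      by move=> [n _ /=]; rewrite in_itv /= => /andP[].
    move=> yx; exists (Num.bound (x - y)) => //=; rewrite in_itv /= yx /= -ltrBlDl.
    apply: lt_le_trans (archi_boundP _) _; first by rewrite subr_ge0 ltW.
    by rewrite ler_nat.
  have cF : (Pi \o F) x @[x --> \oo] --> Pi (\bigcup_n F n).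
    apply: nondecreasing_cvg_mu => //.
    - by move=> i; exact: measurable_itv.
    - by rewrite UF; exact: measurable_itv.
    - move=> n m nm; apply/subsetPset => x; rewrite /F /= !in_itv /= => /andP[-> xn] /=.
      by apply: lt_le_trans xn _; rewrite lerD2l ler_nat ltnS.
  rewrite UF -(fineK fT) in cF.
  have cf : (fine \o (Pi \o F)) x @[x --> \oo] --> T by exact: fine_cvg cF.
  have H : \forall n \near \oo, `|T - fine (Pi (F n))| < e / 3.
    exact: (@cvgr_dist_lt _ _ _ _ _ _ _ cf _ e30).
  case: H => n _ /(_ n (leqnn n)) /= H; exists (y + n.+1%:R); first by rewrite ltrDl.
  by move: H; rewrite ltr_norml => /andP[_]; rewrite /F; lra.
have T1 : 0 < T + 1 by rewrite ltr_wpDl.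
have d0 : 0 < e / 3 / (T + 1) by rewrite divr_gt0.
(* for this M the weight 1 - exp (- M x) is almost 1 on [y, +oo[ *)
have [M M0 HM] := expRN_small y0 d0.
apply: filterS (short_time_tail_ge Ysub mzeta XE b0 levy Xchar M0 y0 yr e30) => n.
apply: le_trans; move: HM; rewrite ler_pdivlMr// => HM.
have x0 := expR_ge0 (- (M * y)).
have rT : fine (Pi `]y, r[%classic) <= T.
  have srT : `]y, r[%classic `<=` `]y, +oo[%classic by move=> x /=; rewrite !in_itv /= andbT => /andP[].
  apply: fine_le => //; last by apply: le_measure; rewrite ?inE.
  rewrite ge0_fin_numE//; exact: (levy_fin levy y0 (measurable_itv _) (subset_trans srT sub)).
move: (fine (Pi `]y, r[%classic)) Hr rT (expR _) x0 HM => x Hr rT E x0 HM.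
have : E * x <= E * (T + 1) by rewrite ler_wpM2l//; lra.
lra.
Qed.

Lemma survival_tail_le (y e : R) : 0 < y -> 0 < e -> \forall n \near \oo,
  n.+1%:R * fine (Q n.+1%:R^-1 `[y, +oo[%classic) <= fine (Pi `[y, +oo[%classic) + e.
Proof.
move=> y0 e0; set T := fine (Pi `[y, +oo[%classic).
have T0 : 0 <= T by rewrite fine_ge0.
have e20 : 0 < e / 2 by rewrite divr_gt0.
have T1 : 0 < T + e by rewrite ltr_wpDl.
have d0 : 0 < e / 2 / (T + e) by rewrite divr_gt0.
(* for this M the weight 1 - exp (- M x) is almost 1 on [y, +oo[ *)
have [M M0 HM] := expRN_small y0 d0.
apply: filterS (short_time_tail_le Ysub mzeta XE b0 levy Xchar M0 y0 e20) => n.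
rewrite -/T; move: HM; rewrite ler_pdivlMr//; move: (expR _) => E HM H.
have E1 : E <= 2^-1.
  rewrite -(ler_pM2r T1); apply: le_trans HM _; rewrite mulrC ler_pM2l ?invr_gt0//; lra.
rewrite leNgt; apply/negP; move: (n.+1%:R * _) H => q H qT.
have : (1 - E) * (T + e) < (1 - E) * q by rewrite ltr_pM2l//; lra.
lra.
Qed.

End ShortTime.

(** * Riemann sums of the potential measure *)

Section RiemannSums.

Let sum_le1 (R : realType) (u v g s e : \bar R) : u \is a fin_num ->
  (u + v <= g + s)%E -> (g <= u + e)%E -> (v <= s + e)%E.
Proof.
move=> fu H1 H2; rewrite -(leeD2lE _ _ fu); apply: le_trans H1 _.
by rewrite addeA addeAC leeD2r.
Qed.

Let sum_le2 (R : realType) (u v g s e : \bar R) : g \is a fin_num ->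
  (g + s <= u + v + e)%E -> (u <= g)%E -> (s <= v + e)%E.
Proof.
move=> fg H1 H2; rewrite -(leeD2lE _ _ fg); apply: le_trans H1 _.
by rewrite addeA leeD2r// leeD2r.
Qed.

Context d (Omega : measurableType d) (R : realType) (P : probability Omega R).
Variables (Y : R -> Omega -> R) (zeta : Omega -> \bar R) (X : R -> Omega -> option R).
Hypotheses (Ysub : is_subordinator P Y) (mzeta : measurable_fun setT zeta)
  (XE : forall (t : R) w, 0 <= t ->
     X t w = if (t%:E < zeta w)%E then Some (Y t w) else None).
Notation mu := (@lebesgue_measure R).
Notation T := (Omega * measurableTypeR R)%type.
Notation Q := (survival_law P Y zeta).
Notation U := (potential P X).

Let phi (A : set R) (z : T) : \bar R := (alive zeta z * \1_A (path Y z))%:E.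

Let mphi (A : set R) : measurable A -> measurable_fun setT (phi A).
Proof.
move=> mA; apply/measurable_EFinP; apply: measurable_funM; first exact: measurable_alive.
by apply: (measurableT_comp (measurable_indic mA)); exact: (measurable_path Ysub).
Qed.

Let phi_ge0 (A : set R) z : (0 <= phi A z)%E.
Proof. by rewrite lee_fin mulr_ge0 ?alive_ge0// indicE. Qed.

Let phi_section (A : set R) (t : R) : measurable A -> 0 <= t ->
  fubini_G P (phi A) t = Q t A.
Proof.
move=> mA t0; rewrite /fubini_G /survival_law.
have mE : measurable (Y t @^-1` A `&` [set w | (t%:E < zeta w)%E]).
  by apply: measurableI; [exact: (measurable_position Ysub)|exact: measurable_alive_at].
rewrite -[in RHS](setIT (_ `&` _)) -integral_indic//; apply: eq_integral => w _.
rewrite /phi /alive /path /= t0 max_l//=; congr EFin; rewrite !indicE.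
have [tz|tz] := boolP (t%:E < zeta w)%E; last first.
  by rewrite mul0r memNset// => -[_]; exact/negP.
rewrite mul1r; have [Ay|Ay] := pselect (A (Y t w)); first by rewrite !mem_set.
by rewrite !memNset// => -[].
Qed.

Lemma measurable_survival_law (A : set R) : measurable A ->
  @measurable_fun _ _ (measurableTypeR R) _ `[0, +oo[ (fun t => Q t A).
Proof.
move=> mA; have H := @measurable_fun_fubini_tonelli_G _ _ _ _ _ P (phi A) (mphi mA) (phi_ge0 A).
apply: eq_measurable_fun (measurable_funTS H) => t.
by rewrite inE /= in_itv /= andbT => t0; exact: phi_section.
Qed.

Lemma potential_survival (A : set R) : measurable A ->
  U A = (\int[mu]_(t in `[0%R, +oo[) Q t A)%E.
Proof.
move=> mA; rewrite (potentialE Ysub mzeta XE mA) /ptime.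
rewrite (@fubini_tonelli2 _ _ _ _ _ P mu _ (mphi mA) (phi_ge0 A)).
rewrite [RHS]integral_mkcond; apply: eq_integral => t _; rewrite patchE; case: ifPn.
  by rewrite inE /= in_itv /= andbT => t0; exact: phi_section.
rewrite notin_setE /= in_itv /= andbT => /negP t0.
by apply: integral0_eq => w _; rewrite /phi /alive /= (negbTE t0) mul0r.
Qed.

Lemma survival_lawU (t : R) (A B : set R) : 0 <= t -> measurable A -> measurable B ->
  A `&` B = set0 -> Q t (A `|` B) = (Q t A + Q t B)%E.
Proof.
move=> t0 mA mB AB; rewrite /survival_law preimage_setU setIUl measureU//.
- by apply: measurableI; [exact: (measurable_position Ysub)|exact: measurable_alive_at].
- by apply: measurableI; [exact: (measurable_position Ysub)|exact: measurable_alive_at].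
apply/seteqP; split => // w /= [[Aw _] [Bw _]].
by have : (A `&` B) (Y t w) by []; rewrite AB.
Qed.

Lemma potentialU (A B : set R) : measurable A -> measurable B ->
  A `&` B = set0 -> U (A `|` B) = (U A + U B)%E.
Proof.
move=> mA mB AB; rewrite !potential_survival//; last exact: measurableU.
rewrite -ge0_integralD//; first last.
- exact: measurable_survival_law.
- exact: measurable_survival_law.
apply: eq_integral => t; rewrite inE /= in_itv /= andbT => t0.
exact: survival_lawU.
Qed.

Let F (x t : R) := Q t `]-oo, x]%classic.

Let F_anti (x s t : R) : 0 <= s -> s <= t -> (F x t <= F x s)%E.
Proof.
move=> s0 st; have t0 := le_trans s0 st; apply: le_measure; rewrite ?inE.
- by apply: measurableI; [exact: (measurable_position Ysub)|exact: measurable_alive_at].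
- by apply: measurableI; [exact: (measurable_position Ysub)|exact: measurable_alive_at].
move=> w /=; rewrite !in_itv /= => -[Yx tz]; split.
  exact: le_trans (subord_ndecr Ysub w s0 st) Yx.
by apply: le_lt_trans tz; rewrite lee_fin.
Qed.

Variable h : R.
Hypothesis h0 : 0 < h.
Let cell (k : nat) : set R := `[k%:R * h, k.+1%:R * h[%classic.
Let kh0 (k : nat) : 0 <= k%:R * h. Proof. by rewrite mulr_ge0// ltW. Qed.
Let Sk (k : nat) : k.+1%:R * h = k%:R * h + h. Proof. by rewrite -natr1 mulrDl mul1r. Qed.

Let cell_cover : \bigcup_k cell k = `[0, +oo[%classic.
Proof.
apply/seteqP; split => t; rewrite /cell /= ?in_itv /= ?andbT.
  by move=> [k _ /=]; rewrite in_itv /= => /andP[+ _]; exact: le_trans.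
move=> t0; exists (Num.truncn (t / h)) => //=; rewrite in_itv /=.
have /andP[h1 h2] := truncn_itv (divr_ge0 t0 (ltW h0)).
by rewrite -ler_pdivlMr// h1 -ltr_pdivrMr.
Qed.

Let cell_disj : trivIset setT cell.
Proof.
apply: ltn_trivIset => i j ij; apply/seteqP; split => // t; rewrite /cell /= !in_itv /=.
move=> [/andP[_ t1] /andP[t2 _]].
have : j.+1%:R * h <= i%:R * h by rewrite ler_pM2r// ler_nat.
by rewrite leNgt (le_lt_trans t2 t1).
Qed.

Let mu_cell k : mu (cell k) = h%:E.
Proof.
have -> : (mu (cell k) = (k.+1%:R * h)%:E - (k%:R * h)%:E)%E.
  rewrite /cell lebesgue_measure_itv /= lte_fin Sk ltrDl h0//.
by rewrite -EFinB Sk addrAC subrr add0r.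
Qed.

Let mcell k : @measurable _ (measurableTypeR R) (cell k).
Proof. exact: lebesgue_measurable_itv. Qed.

Let integral_cells (x : R) :
  U `]-oo, x]%classic = (\sum_(k <oo) \int[mu]_(t in cell k) F x t)%E.
Proof.
rewrite potential_survival// -cell_cover; apply: ge0_integral_bigcup => //.
by rewrite cell_cover; exact: measurable_survival_law.
Qed.

Let mFcell x k : @measurable_fun _ _ (measurableTypeR R) _ (cell k) (F x).
Proof.
apply: measurable_funS (measurable_survival_law _) => //.
by move=> t; rewrite /cell /= !in_itv /= andbT => /andP[+ _]; exact: le_trans.
Qed.

Let cell_cst k (c : \bar R) : (0 <= c)%E -> (\int[mu]_(t in cell k) c = h%:E * c)%E.
Proof. move=> c0; transitivity (c * mu (cell k))%E; last by rewrite mu_cell muleC.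
by apply: integral_cst. Qed.

Let cell_le x k : (\int[mu]_(t in cell k) F x t <= h%:E * F x (k%:R * h))%E.
Proof.
have F0 t : (0 <= F x t)%E by [].
rewrite -(cell_cst k (F0 _)); apply: ge0_le_integral => //.
by move=> t; rewrite /cell /= in_itv /= => /andP[kt _]; exact: F_anti.
Qed.

Let cell_ge x k : (h%:E * F x (k.+1%:R * h) <= \int[mu]_(t in cell k) F x t)%E.
Proof.
have F0 t : (0 <= F x t)%E by [].
rewrite -(cell_cst k (F0 _)); apply: ge0_le_integral => //.
move=> t; rewrite /cell /= in_itv /= => /andP[kt tk]; apply: F_anti; last exact: ltW.
exact: le_trans kt.
Qed.

Let G (x : R) := (\sum_(k <oo) h%:E * F x (k%:R * h))%E.

Let hF_ge0 x t : (0 <= h%:E * F x t)%E.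
Proof. by rewrite mule_ge0// lee_fin ltW. Qed.

Let G_ge x : (U `]-oo, x]%classic <= G x)%E.
Proof.
rewrite integral_cells; apply: lee_nneseries => k _; last exact: cell_le.
by move=> _; apply: integral_ge0.
Qed.

Let G_le x : (G x <= U `]-oo, x]%classic + h%:E)%E.
Proof.
rewrite /G nneseries_recl//.
rewrite addeC; apply: leeD.
  rewrite integral_cells -(nneseries_addn (f := fun k => (h%:E * F x (k%:R * h))%E) 1); last first.
    by move=> k; exact: hF_ge0.
  apply: lee_nneseries => [k _ _|k _]; first exact: hF_ge0.
  by rewrite addn1; exact: cell_ge.
rewrite mul0r -[leRHS]mule1 lee_wpmul2l//; first by rewrite lee_fin ltW.
exact: (survival_law_le1 Ysub mzeta).
Qed.

Hypothesis U_fin : forall x, (U `]-oo, x]%classic < +oo)%E.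

(** Since [t |-> P (X_t <= x)] is non-increasing, its Riemann sum of mesh [h]
    overestimates its integral by at most [h]; the sums for [ ]p, q] ] are
    differences of two such sums. *)
Lemma riemann_sum_potential (p q : R) : p <= q ->
  (U `]p, q]%classic <= \sum_(k <oo) (h%:E * Q (k%:R * h) `]p, q]%classic) + h%:E)%E /\
  (\sum_(k <oo) (h%:E * Q (k%:R * h) `]p, q]%classic) <= U `]p, q]%classic + h%:E)%E.
Proof.
move=> pq; set S := (\sum_(k <oo) _)%E.
have split_itv : `]-oo, q]%classic = `]-oo, p]%classic `|` `]p, q]%classic.
  apply/seteqP; split => x /=; rewrite !in_itv /=.
    by move=> xq; have [xp|px] := leP x p; [left|right; rewrite xq].
  by move=> [/le_trans|/andP[_]//]; apply.
have dj : `]-oo, p]%classic `&` `]p, q]%classic = set0.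
  apply/seteqP; split => // x /=; rewrite !in_itv /= => -[xp /andP[px _]].
  by move: xp; rewrite leNgt px.
have UE : U `]-oo, q]%classic = (U `]-oo, p]%classic + U `]p, q]%classic)%E.
  by rewrite split_itv potentialU.
have GE : G q = (G p + S)%E.
  rewrite /G /S -nneseriesD//; last first.
    by move=> k _ _; rewrite mule_ge0// lee_fin ltW.
  apply: eq_eseriesr => k _; rewrite -ge0_muleDr//; congr (_ * _)%E.
  by rewrite /F split_itv survival_lawU.
have U0 : (0 <= U `]-oo, p]%classic)%E.
  by apply: integral_ge0 => w _; apply: integral_ge0 => t _; rewrite lee_fin.
have fU : U `]-oo, p]%classic \is a fin_num by rewrite ge0_fin_numE.
have fG : G p \is a fin_num.
  rewrite ge0_fin_numE; last exact: le_trans U0 (G_ge p).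
  by apply: le_lt_trans (G_le p) _; rewrite lte_add_pinfty// ltry.
split.
  by apply: (sum_le1 fU _ (G_le p)); rewrite -UE -GE; exact: G_ge.
by apply: (sum_le2 fG _ (G_ge p)); rewrite -UE -GE; exact: G_le.
Qed.

End RiemannSums.

(** * The law of the undershoot *)

Section Sandwich.

(** An error [e / 2 / (u + 1)] on the tail and an error [h] on the Riemann sum
    cost at most [e] on the product. *)
Let arith_le (R : realType) (T u e S h : R) : 0 <= u -> 0 < e -> 0 <= T -> S <= u + h ->
  0 <= S -> h <= 1 -> T * h <= e / 2 -> (T + e / 2 / (u + 1)) * S <= T * u + e.
Proof.
move=> u0 e0 T0 S2 S0 h1 Th; have u1 : 0 < u + 1 by rewrite ltr_wpDl.
have d0 : 0 < e / 2 / (u + 1) by rewrite !divr_gt0.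
have d1 : e / 2 / (u + 1) * (u + 1) = e / 2 by rewrite divfK// gt_eqF.
have H1 : e / 2 / (u + 1) * S <= e / 2.
  by rewrite -[leRHS]d1 ler_wpM2l ?(ltW d0)//; lra.
have H2 : T * S <= T * (u + h) by rewrite ler_wpM2l.
rewrite mulrDl; lra.
Qed.

Let arith_ge (R : realType) (T u e S h : R) : 0 <= u -> 0 < e -> 0 <= T -> u - h <= S ->
  S <= u + h -> 0 <= S -> h <= 1 -> T * h <= e / 2 ->
  T * u - e <= (T - e / 2 / (u + 1)) * S.
Proof.
move=> u0 e0 T0 S1 S2 S0 h1 Th; have u1 : 0 < u + 1 by rewrite ltr_wpDl.
have d0 : 0 < e / 2 / (u + 1) by rewrite !divr_gt0.
have d1 : e / 2 / (u + 1) * (u + 1) = e / 2 by rewrite divfK// gt_eqF.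
have H1 : e / 2 / (u + 1) * S <= e / 2.
  by rewrite -[leRHS]d1 ler_wpM2l ?(ltW d0)//; lra.
have H2 : T * (u - h) <= T * S by rewrite ler_wpM2l.
rewrite mulrBl; lra.
Qed.
Context d (Omega : measurableType d) (R : realType) (P : probability Omega R).
Variables (Y : R -> Omega -> R) (zeta : Omega -> \bar R) (X : R -> Omega -> option R).
Hypotheses (Ysub : is_subordinator P Y) (mzeta : measurable_fun setT zeta)
  (zeta_gt0 : forall w, (0 < zeta w)%E)
  (XE : forall (t : R) w, 0 <= t ->
     X t w = if (t%:E < zeta w)%E then Some (Y t w) else None)
  (indep : indep_process_rv P Y zeta).
Variable rate : R.
Hypothesis zeta_exp : forall t : R, 0 <= t ->
  P [set w | (t%:E < zeta w)%E] = (expR (- (rate * t)))%:E.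
Variables (a b : R) (Pi : {measure set R -> \bar R}).
Hypotheses (b0 : 0 <= b) (levy : is_levy_measure Pi)
  (Xchar : forall (t : R) (z : R[i]), 0 <= t -> 0 <= cRe z ->
     cintegral P setT (fun w => if X t w is Some y then cexp (- z * y%:C) else 0) =
     cexp (- levy_khintchine a b Pi z * t%:C)).
Notation Q := (survival_law P Y zeta).
Notation U := (potential P X).
Hypothesis U_fin : forall x, (U `]-oo, x]%classic < +oo)%E.
Notation EY t B := (P (Y t @^-1` B)).

Let measurable_after (t : R) : measurable [set z : \bar R | (t%:E < z)%E].
Proof.
have := @measurable_lte _ (\bar R) R setT measurableT (cst t%:E) id (measurable_cst _) (@measurable_id _ _ _).
by rewrite setTI.
Qed.

Lemma survival_lawE (t : R) (B : set R) : 0 <= t -> measurable B ->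
  Q t B = (EY t B * (expR (- (rate * t)))%:E)%E.
Proof.
move=> t0 mB; rewrite -zeta_exp//.
have := @indep 1%N (fun=> t) (fun=> B) _ (fun _ => t0) (fun _ => mB) (measurable_after t).
have -> : \bigcap_(i < 1) (Y t @^-1` B) = Y t @^-1` B.
  by apply/seteqP; split => w /=; [apply; exact: (ltnSn 0)|move=> Yw i _].
by [].
Qed.

(** The Markov property at a point of the grid, obtained from the times [0 <= t
    <= t + h]. *)
Lemma grid_increments (t h : R) (B1 B2 : set R) : 0 <= t -> 0 <= h ->
  measurable B1 -> measurable B2 ->
  P (Y t @^-1` B1 `&` [set w | B2 (Y (t + h) w - Y t w)]) = (EY t B1 * EY h B2)%E.
Proof.
move=> t0 h0 mB1 mB2.
pose ts (i : nat) : R := if i is i'.+1 then (if i' is _.+1 then t + h else t) else 0.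
pose Bs (i : nat) : set R := if i is 0%N then B1 else B2.
have ts0 : 0 <= ts 0%N by [].
have tsS i : ts i <= ts i.+1 by case: i => [|[|i]] //=; rewrite lerDl.
have mBs i : measurable (Bs i) by case: i.
have := subord_indep Ysub 2 ts0 tsS mBs.
rewrite !big_ord_recl big_ord0 mule1 /= (subord_stat Ysub t0 h0 mB2).
have -> : [set w | B1 (Y t w - Y 0 w)] = Y t @^-1` B1.
  by apply/seteqP; split => w /=; rewrite (subord_0 Ysub) subr0.
move=> <-.
  congr (P _); apply/seteqP; split => w /=.
    move=> [w1 w2] i; case: i => [|[|//]] _ /=; rewrite /Bs /ts //.
    by rewrite (subord_0 Ysub) subr0.
  move=> H; split; last exact: (H 1%N).
  by have := H 0%N isT; rewrite /Bs /ts /= (subord_0 Ysub) subr0.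
Qed.

Variable s : R.
Notation under := (undershoot zeta X s).

Section Grid.
Variables (p q : R) (n : nat).
Hypotheses (pq : p <= q) (qs : q < s).
Notation h := (n.+1%:R^-1 : R).
Let h0 : 0 < h. Proof. by rewrite invr_gt0. Qed.
Let kh0 (k : nat) : 0 <= k%:R * h. Proof. by rewrite mulr_ge0// ltW. Qed.
Let Sk (k : nat) : k.+1%:R * h = k%:R * h + h. Proof. by rewrite -natr1 mulrDl mul1r. Qed.

Let jump_prob bb k : P (grid_jump Y zeta s bb h p q k) =
  (P (Y (k%:R * h) @^-1` `]p, q] `&`
      Y (k.+1%:R * h) @^-1` [set` Interval (BSide bb s) +oo%O]) *
   (expR (- (rate * (k%:R * h))))%:E * (expR (- (rate * h)))%:E)%E.
Proof.
rewrite grid_jumpE -muleA -EFinM -expRD -opprD -mulrDr -Sk -zeta_exp//.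
pose ts (i : nat) : R := if i is 0%N then k%:R * h else k.+1%:R * h.
pose Bs (i : nat) : set R := if i is 0%N then `]p, q]%classic else [set` Interval (BSide bb s) +oo%O].
have ts0 i : 0 <= ts i by case: i => [|i]; exact: kh0.
have mBs i : measurable (Bs i) by case: i => [|i]; exact: measurable_itv.
have := @indep 2%N ts Bs _ ts0 mBs (measurable_after (k.+1%:R * h)).
have -> : \bigcap_(i < 2) (Y (ts i) @^-1` Bs i) = Y (k%:R * h) @^-1` `]p, q] `&`
      Y (k.+1%:R * h) @^-1` [set` Interval (BSide bb s) +oo%O].
  apply/seteqP; split => w /=; first by move=> H; split; [exact: (H 0%N)|exact: (H 1%N)].
  by move=> [w1 w2] [|[|//]].
by [].
Qed.

Let mJ c : measurable (`]c, +oo[%classic : set R). Proof. exact: measurable_itv. Qed.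
Let mJ' c : measurable (`[c, +oo[%classic : set R). Proof. exact: measurable_itv. Qed.
Let mI : measurable (`]p, q]%classic : set R). Proof. exact: measurable_itv. Qed.

Let mYd (k : nat) (B : set R) : measurable B ->
  measurable [set w | B (Y (k%:R * h + h) w - Y (k%:R * h) w)].
Proof.
move=> mB; have k1 : 0 <= k%:R * h + h by rewrite addr_ge0// ltW.
have mf : measurable_fun setT (fun w => Y (k%:R * h + h) w - Y (k%:R * h) w).
  by apply: measurable_funB; [exact: (subord_meas Ysub k1)|exact: (subord_meas Ysub (kh0 k))].
by have := mf measurableT _ mB; rewrite setTI.
Qed.

Let QQ (k : nat) (B : set R) : measurable B ->
  (P (Y (k%:R * h) @^-1` `]p, q] `&` [set w | B (Y (k%:R * h + h) w - Y (k%:R * h) w)%R]) *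
   (expR (- (rate * (k%:R * h))))%:E * (expR (- (rate * h)))%:E =
   Q h B * Q (k%:R * h) `]p, q]%classic)%E.
Proof.
move=> mB; rewrite grid_increments// ?(ltW h0)// !survival_lawE// ?(ltW h0)//.
by rewrite [RHS]muleC muleACA !muleA.
Qed.

(** From a position at most [q], reaching [s] takes an increment of at least [s
    - q]. This increment is independent of the past, and the exponential
    lifetime splits at the grid point. *)
Lemma jump_le k : (P (grid_jump Y zeta s true h p q k) <=
  Q h `[(s - q)%R, +oo[%classic * Q (k%:R * h) `]p, q]%classic)%E.
Proof.
rewrite -QQ// jump_prob lee_wpmul2r ?lee_fin ?expR_ge0// lee_wpmul2r ?lee_fin ?expR_ge0//.
apply: le_measure; rewrite ?inE.
- by apply: measurableI; apply: (measurable_position Ysub) => //; exact: measurable_itv.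
- by apply: measurableI; [apply: (measurable_position Ysub)|exact: mYd].
move=> w /= [Yk]; rewrite Sk; split => //; move: Yk b1; rewrite /= !in_itv /= !andbT.
by move=> /andP[_ Yq] sY; lra.
Qed.

(** From a position above [p], an increment larger than [s - p] leads above
    [s]. *)
Lemma jump_ge k : (Q h `](s - p)%R, +oo[%classic * Q (k%:R * h) `]p, q]%classic <=
  P (grid_jump Y zeta s false h p q k))%E.
Proof.
rewrite -QQ// jump_prob lee_wpmul2r ?lee_fin ?expR_ge0// lee_wpmul2r ?lee_fin ?expR_ge0//.
apply: le_measure; rewrite ?inE.
- by apply: measurableI; [apply: (measurable_position Ysub)|exact: mYd].
- by apply: measurableI; apply: (measurable_position Ysub) => //; exact: measurable_itv.
move=> w /= [Yk]; rewrite Sk; split => //; move: Yk b1; rewrite /= !in_itv /= !andbT.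
by move=> /andP[pY _] sY; lra.
Qed.

Let mjump bb k : measurable (grid_jump Y zeta s bb h p q k).
Proof. exact: (measurable_grid_jump Ysub mzeta). Qed.

Lemma measurable_grid_cross bb : measurable (grid_cross Y zeta s bb h p q).
Proof. by apply: bigcupT_measurable => k; exact: mjump. Qed.

Let cross_prob bb : P (grid_cross Y zeta s bb h p q) =
  (\sum_(k <oo) P (grid_jump Y zeta s bb h p q k))%E.
Proof.
apply: measure_semi_bigcup; [exact: mjump|exact: (grid_jump_disjoint Ysub)|].
exact: measurable_grid_cross.
Qed.

Let u := fine (U `]p, q]%classic).

Let U0 A : (0 <= U A)%E.
Proof. by apply: integral_ge0 => w _; apply: integral_ge0 => t _; rewrite lee_fin. Qed.

Lemma potential_itv_fin : U `]p, q]%classic \is a fin_num.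
Proof.
rewrite ge0_fin_numE//; apply: le_lt_trans (U_fin q).
have -> : `]-oo, q]%classic = `]-oo, p]%classic `|` `]p, q]%classic.
  apply/seteqP; split => x /=; rewrite !in_itv /=.
    by move=> xq; have [xp|px] := leP x p; [left|right; rewrite xq].
  by move=> [/le_trans|/andP[_]//]; apply.
rewrite (potentialU Ysub mzeta XE)//; first by rewrite leeDr.
apply/seteqP; split => // x /=; rewrite !in_itv /= => -[xp /andP[px _]].
by move: xp; rewrite leNgt px.
Qed.

Let S := (\sum_(k <oo) (h%:E * Q (k%:R * h) `]p, q]%classic))%E.

Lemma riemann_sum_bounds : S \is a fin_num /\ u - h <= fine S <= u + h.
Proof.
have [H1 H2] := riemann_sum_potential Ysub mzeta XE h0 U_fin pq; rewrite -/S in H1 H2.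
have fS : S \is a fin_num.
  rewrite ge0_fin_numE; first by apply: le_lt_trans H2 _; rewrite -(fineK potential_itv_fin) -EFinD ltry.
  by apply: nneseries_ge0 => k _ _; rewrite mule_ge0// lee_fin ltW.
split => //; move: H1 H2; rewrite -(fineK potential_itv_fin) -(fineK fS) -!EFinD !lee_fin -/u /= => H1 H2.
by rewrite lerBlDr H1.
Qed.

Let fQ (B : set R) : measurable B -> Q h B \is a fin_num.
Proof. by move=> mB; apply: (survival_law_fin Ysub mzeta) => //; exact: ltW. Qed.

Let hn : n.+1%:R * h = 1. Proof. by rewrite mulfV. Qed.

Let series_scale (c : R) : 0 <= c ->
  (\sum_(k <oo) (c%:E * Q (k%:R * h) `]p, q]%classic))%E = ((n.+1%:R * c) * fine S)%:E.
Proof.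
move=> c0; have [fS _] := riemann_sum_bounds; rewrite EFinM (fineK fS) /S -nneseriesZl//; last first.
  by move=> k _; rewrite mule_ge0// lee_fin ltW.
by apply: eq_eseriesr => k _; rewrite muleA -EFinM mulrAC hn mul1r.
Qed.

Lemma cross_le : fine (P (grid_cross Y zeta s true h p q)) <=
  (n.+1%:R * fine (Q h `[(s - q)%R, +oo[%classic)) * fine S.
Proof.
have [fS _] := riemann_sum_bounds; have t0 : 0 <= fine (Q h `[(s - q)%R, +oo[%classic) by rewrite fine_ge0.
rewrite -[leRHS]/(fine (_%:E)) -series_scale//; apply: fine_le.
- by rewrite fin_num_measure//; exact: measurable_grid_cross.
- by rewrite series_scale.
rewrite cross_prob; apply: lee_nneseries => // k _.
by rewrite (fineK (fQ (mJ' _))) jump_le.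
Qed.

Lemma cross_ge : (n.+1%:R * fine (Q h `](s - p)%R, +oo[%classic)) * fine S <=
  fine (P (grid_cross Y zeta s false h p q)).
Proof.
have [fS _] := riemann_sum_bounds; have t0 : 0 <= fine (Q h `](s - p)%R, +oo[%classic) by rewrite fine_ge0.
rewrite -[leLHS]/(fine (_%:E)) -series_scale//; apply: fine_le.
- by rewrite series_scale.
- by rewrite fin_num_measure//; exact: measurable_grid_cross.
rewrite cross_prob; apply: lee_nneseries => [k _ _|k _]; first by rewrite mule_ge0// lee_fin.
by rewrite (fineK (fQ (mJ _))) jump_ge.
Qed.

End Grid.

Section Limit.
Variables (p q : R).
Hypotheses (p0 : 0 <= p) (pq : p <= q) (qs : q < s).
Notation E := [set w | p < under w <= q].
Let u := fine (U `]p, q]%classic).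
Let TL := fine (Pi `](s - p)%R, +oo[%classic).
Let TU := fine (Pi `[(s - q)%R, +oo[%classic).
Let u0 : 0 <= u.
Proof.
apply: fine_ge0; apply: integral_ge0 => w _; apply: integral_ge0 => t _; rewrite lee_fin.
by rewrite indicE.
Qed.
Let TL0 : 0 <= TL. Proof. exact: fine_ge0. Qed.
Let TU0 : 0 <= TU. Proof. exact: fine_ge0. Qed.

Let mcross n bb : measurable (grid_cross Y zeta s bb n.+1%:R^-1 p q).
Proof. exact: measurable_grid_cross. Qed.

Let mE : measurable E.
Proof.
have mU := measurable_undershoot Ysub mzeta XE s.
have := mU measurableT _ (measurable_itv `]p, q]); rewrite setTI.
by congr measurable; apply/seteqP; split => w; rewrite /= in_itv.
Qed.

Let passed w : E w -> (passage_time X s w < zeta w)%E.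
Proof.
rewrite /= /undershoot; case: ifP => // _ /andP[pN _].
by have := lt_trans (le_lt_trans p0 pN) (ltrN10 R); rewrite ltxx.
Qed.

Let small (T e : R) : 0 <= T -> 0 < e -> \forall n \near \oo,
  [/\ n.+1%:R^-1 <= 1 :> R & T * n.+1%:R^-1 <= e].
Proof.
move=> T0 e0; have T1 : 0 < T + 1 by rewrite ltr_wpDl.
have d0 : 0 < e / (T + 1) by rewrite divr_gt0.
have [N HN] := small_invn d0; exists N => // m /= Nm; split.
  by rewrite invf_le1// ler1n.
have h0 : 0 <= m.+1%:R^-1 :> R by rewrite invr_ge0.
have := HN m Nm; rewrite ltr_pdivlMr//; move: (m.+1%:R^-1) h0 => h h0 H; lra.
Qed.

Let cross_true_le (e : R) : 0 < e -> \forall n \near \oo,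
  fine (P (grid_cross Y zeta s true n.+1%:R^-1 p q)) <= TU * u + e.
Proof.
move=> e0; have u1 : 0 < u + 1 by rewrite ltr_wpDl.
have e20 : 0 < e / 2 by rewrite divr_gt0.
have d0 : 0 < e / 2 / (u + 1) by rewrite divr_gt0.
have sq0 : 0 < s - q by rewrite subr_gt0.
apply: filterS2 (small TU0 e20) (survival_tail_le Ysub mzeta XE b0 levy Xchar sq0 d0) => n [h1 Th] H.
apply: le_trans (cross_le n pq qs) _.
have [_ /andP[S1 S2]] := riemann_sum_bounds n pq.
have S0 : 0 <= fine (\sum_(k <oo) (n.+1%:R^-1%:E * Q (k%:R * n.+1%:R^-1) `]p, q]%classic))%E.
  by apply: fine_ge0; apply: nneseries_ge0 => k _ _; rewrite mule_ge0// lee_fin invr_ge0.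
apply: le_trans (ler_wpM2r S0 H) _.
exact: (arith_le u0 e0 TU0 S2 S0 h1 Th).
Qed.

Let cross_false_ge (e : R) : 0 < e -> \forall n \near \oo,
  TL * u - e <= fine (P (grid_cross Y zeta s false n.+1%:R^-1 p q)).
Proof.
move=> e0; have u1 : 0 < u + 1 by rewrite ltr_wpDl.
have e20 : 0 < e / 2 by rewrite divr_gt0.
have d0 : 0 < e / 2 / (u + 1) by rewrite divr_gt0.
have sp0 : 0 < s - p by rewrite subr_gt0 (le_lt_trans pq).
apply: filterS2 (small TL0 e20) (survival_tail_ge Ysub mzeta XE b0 levy Xchar sp0 d0) => n [h1 Th] H.
apply: le_trans (cross_ge n pq qs).
have [_ /andP[S1 S2]] := riemann_sum_bounds n pq.
have S0 : 0 <= fine (\sum_(k <oo) (n.+1%:R^-1%:E * Q (k%:R * n.+1%:R^-1) `]p, q]%classic))%E.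
  by apply: fine_ge0; apply: nneseries_ge0 => k _ _; rewrite mule_ge0// lee_fin invr_ge0.
apply: le_trans (ler_wpM2r S0 H).
exact: (arith_ge u0 e0 TL0 S1 S2 S0 h1 Th).
Qed.

(** The event is contained in the inferior limit of the events seen on the
    grids, to which Fatou's lemma applies. *)
Lemma undershoot_itv_le : (P E <= (TU * u)%:E)%E.
Proof.
apply/lee_addgt0Pr => e e0; rewrite -EFinD.
pose D n := \bigcap_(m in [set m | (n <= m)%N]) grid_cross Y zeta s true m.+1%:R^-1 p q.
have mD n : measurable (D n) by apply: bigcap_measurable => [|m _]; [exists n => /=|].
have sub : E `<=` \bigcup_n D n.
  move=> w Ew; have [N HN] := grid_cross_liminf Ysub XE p0 (passed Ew) Ew.
  by exists N => // m; exact: HN.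
have mU : measurable (\bigcup_n D n) by exact: bigcupT_measurable.
apply: (@le_trans _ _ (P (\bigcup_n D n))); first by apply: le_measure; rewrite ?inE.
have cD : (P \o D) x @[x --> \oo] --> P (\bigcup_n D n).
  apply: nondecreasing_cvg_mu => // n m nm; apply/subsetPset => w Dw k mk.
  by apply: Dw => /=; exact: leq_trans mk.
rewrite -(cvg_lim _ cD)//; apply: lime_le; first by apply/cvg_ex; exists (P (\bigcup_n D n)).
apply: nearW => n /=; have [N _ HN] := cross_true_le e0.
pose m := maxn n N; have /= H := HN m (leq_maxr _ _).
apply: (@le_trans _ _ (P (grid_cross Y zeta s true m.+1%:R^-1 p q))).
  apply: le_measure; rewrite ?inE// => w; apply => /=; exact: leq_maxl.
by rewrite -(fineK (fin_num_measure P _ (mcross m true))) lee_fin.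
Qed.

(** The event contains the superior limit of the events seen on the grids,
    whose probability is at least the superior limit of their probabilities. *)
Lemma undershoot_itv_ge : ((TL * u)%:E <= P E)%E.
Proof.
apply/lee_addgt0Pr => e e0; rewrite -leeBlDr// -EFinB.
pose D n := \bigcup_(m in [set m | (n <= m)%N]) grid_cross Y zeta s false m.+1%:R^-1 p q.
have mD n : measurable (D n) by apply: bigcup_measurable => m _.
have sub : \bigcap_n D n `<=` E.
  move=> w Dw; have [|_ //] := grid_cross_limsup Ysub XE p0 qs (w := w).
  by move=> n; have [m nm Cm] := Dw n I; exists m.
have mI : measurable (\bigcap_n D n) by exact: bigcapT_measurable.
apply: (@le_trans _ _ (P (\bigcap_n D n))); last by apply: le_measure; rewrite ?inE.
have cD : (P \o D) x @[x --> \oo] --> P (\bigcap_n D n).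
  apply: nonincreasing_cvg_mu => //.
    by apply: le_lt_trans (probability_le1 P (mD 0%N)) (ltry _).
  move=> n m nm; apply/subsetPset => w [k mk Ck]; exists k => //=; exact: leq_trans mk.
rewrite -(cvg_lim _ cD)//; apply: lime_ge; first by apply/cvg_ex; exists (P (\bigcap_n D n)).
apply: nearW => n /=; have [N _ HN] := cross_false_ge e0.
pose m := maxn n N; have /= H := HN m (leq_maxr _ _).
apply: (@le_trans _ _ (P (grid_cross Y zeta s false m.+1%:R^-1 p q))); last first.
  apply: le_measure; rewrite ?inE// => w Cw; exists m => //=; exact: leq_maxl.
by rewrite -(fineK (fin_num_measure P _ (mcross m false))) lee_fin.
Qed.

End Limit.

End Sandwich.

Section UndershootDensity.
Context {R : realType}.
Notation mu := (@lebesgue_measure R).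

Lemma measurable_fun_lebesgue_in (D E : set R) (f : R -> R) : measurable D ->
  measurable_fun D f -> E `<=` D -> @measurable_fun _ _ (measurableTypeR R) R E f.
Proof.
move=> mD mf ED; have mg := (measurable_restrictT f mD).1 mf.
have mg' : @measurable_fun _ _ (measurableTypeR R) R E (f \_ D) by exact: measurable_fun_lebesgue.
apply: eq_measurable_fun mg' => x.
by rewrite inE => /ED Dx; rewrite patchE mem_set.
Qed.

Lemma measure_itvU (m : {measure set R -> \bar R}) (p x q : R) : p <= x -> x <= q ->
  m `]p, q]%classic = (m `]p, x]%classic + m `]x, q]%classic)%E.
Proof.
move=> px xq; rewrite -measureU; [|exact: measurable_itv|exact: measurable_itv|].
  congr (m _); apply/seteqP; split => y /=; rewrite !in_itv /=.
    by move=> /andP[-> yq]; have [yx|yx] := leP y x; [left|right].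
  by move=> [/andP[-> /le_trans->//]|/andP[/(le_lt_trans px)-> ->]].
apply/seteqP; split => // y /=; rewrite !in_itv /= => -[/andP[_ h1] /andP[h2 _]].
by move: h1; rewrite leNgt h2.
Qed.

Lemma integral_scale (u : R -> R) (s p q : R) : 0 < s -> p <= q ->
  {within `[(s * p), (s * q)], continuous u} ->
  (\int[mu]_(x in `[(s * p)%R, (s * q)%R]) (u x)%:E =
   \int[mu]_(x in `[p, q]) (u (s * x) * s)%:E)%E.
Proof.
move=> s0 pq cu; pose F (x : R) := s * x.
have dF x : is_derive x (1 : R) F s.
  by apply: (dderive_eq (dderiveZ s (dderive_id x))) => //; rewrite mulr1.
have F'E : F^`()%classic = cst s.
  by apply/funext => x; rewrite derive1E; exact: (@derive_val _ _ _ _ _ _ _ (dF x)).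
have cF : continuous F by move=> x; exact: mulrl_continuous.
rewrite (@integration_by_substitution_increasing R F u p q pq).
- by apply: eq_integral => x _; rewrite F'E.
- by move=> x y _ _ xy; rewrite /F ltr_pM2l.
- by rewrite F'E => x _; exact: cvg_cst.
- by rewrite F'E; exact: is_cvg_cst.
- by rewrite F'E; exact: is_cvg_cst.
- split.
  + by move=> x _; exact: (@ex_derive _ _ _ _ _ _ _ (dF x)).
  + exact: (cvg_at_right_filter (cF p)).
  + exact: (cvg_at_left_filter (cF q)).
- exact: cu.
Qed.

(** The tail is monotone, so that preimages of half-lines are intervals. *)
Lemma measurable_levy_tail (Pi : {measure set R -> \bar R}) : is_levy_measure Pi ->
  measurable_fun (`]0, +oo[%classic : set R) (levy_tail Pi).
Proof.
move=> levy; apply: (measurability _ (RGenOInfty.measurableE R)) => // _ [_ [c ->] <-].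
apply: is_interval_measurable => x y [x0 cx] [y0 cy] z /andP[xz zy].
move: x0 y0 cx cy; rewrite /= !in_itv /= !andbT => x0 y0 cx cy.
have z0 : 0 < z by exact: lt_le_trans xz.
have sub (t : R) : `]t, +oo[%classic `<=` `[t, +oo[%classic.
  by move=> v /=; rewrite !in_itv /= !andbT => /ltW.
have fin (t : R) : 0 < t -> Pi `]t, +oo[%classic \is a fin_num.
  by move=> t0; rewrite ge0_fin_numE//; exact: (levy_fin levy t0 (measurable_itv _) (@sub t)).
split => //; apply: lt_le_trans cy _; apply: fine_le; rewrite ?fin//.
apply: le_measure; rewrite ?inE//.
by move=> v /=; rewrite !in_itv /= !andbT; exact: le_lt_trans.
Qed.

Context d (Omega : measurableType d) (P : probability Omega R).
Variables (W : Omega -> R) (Pi : {measure set R -> \bar R}) (U : set R -> \bar R).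
Variables (u : R -> R) (s : R).
Hypotheses (mW : measurable_fun setT W) (levy : is_levy_measure Pi)
  (Uu : is_continuous_density U u) (s0 : 0 < s).
Hypotheses
  (W_le : forall p q : R, 0 <= p -> p <= q -> q < s ->
    (P [set w | p < W w <= q]%R <=
      (fine (Pi `[(s - q)%R, +oo[%classic) * fine (U `]p, q]%classic))%:E)%E)
  (W_ge : forall p q : R, 0 <= p -> p <= q -> q < s ->
    ((fine (Pi `](s - p)%R, +oo[%classic) * fine (U `]p, q]%classic))%:E <=
      P [set w | p < W w <= q]%R)%E).
Notation f := (fun x => s * levy_tail Pi (s - s * x) * u (s * x)).
Notation D := (`]0, 1[%classic : set R).

Let mD : measurable D. Proof. exact: measurable_itv. Qed.

Let u_ge0 (x : R) : 0 < x -> 0 <= u x. Proof. by case: Uu => _ + _; apply. Qed.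
Let u_cont (p q : R) : 0 < p -> {within `[p, q], continuous u}.
Proof.
case: Uu => cu _ _ p0; apply: continuous_in_subspaceT => x.
rewrite inE /= in_itv /= => /andP[px _]; apply: cu.
by rewrite in_itv /= andbT (lt_le_trans p0).
Qed.

Let mu_pos : measurable_fun (`]0, +oo[%classic : set R) u.
Proof.
case: Uu => cu _ _; apply: open_continuous_measurable_fun; first exact: interval_open.
by move=> x; rewrite inE; exact: cu.
Qed.

Let comp_pos (h k : R -> R) : measurable_fun (`]0, +oo[%classic : set R) h ->
  measurable_fun setT k -> (forall x, D x -> 0 < k x) -> measurable_fun D (fun x => h (k x)).
Proof.
move=> mh mk kpos; apply: (@measurable_comp _ _ _ _ _ _ (`]0, +oo[%classic : set R) h D k) => //.
- by move=> _ [x Dx <-]; rewrite /= in_itv /= andbT kpos.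
- exact: measurable_funTS.
Qed.

Let mus : measurable_fun D (fun x => u (s * x)).
Proof.
apply: (@comp_pos u (fun x => s * x)) => //; first exact: measurable_funM.
by move=> x; rewrite /= in_itv /= => /andP[x0 _]; exact: mulr_gt0.
Qed.

Let mf : measurable_fun D f.
Proof.
apply: measurable_funM => //; apply: measurable_funM => //.
apply: (@comp_pos (levy_tail Pi) (fun x => s - s * x)).
- exact: measurable_levy_tail.
- by apply: measurable_funB => //; exact: measurable_funM.
- by move=> x; rewrite /= in_itv /= => /andP[_ x1]; rewrite subr_gt0 gtr_pMr.
Qed.

Let f_ge0 (x : R) : D x -> 0 <= f x.
Proof.
rewrite /= in_itv /= => /andP[x0 x1]; rewrite mulr_ge0 ?mulr_ge0 ?(ltW s0)//.
  exact: fine_ge0.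
by apply: u_ge0; rewrite mulr_gt0.
Qed.

Let V (p q : R) := fine (U `]p, q]%classic).

Let scaled (p q : R) : 0 < p -> p <= q -> q < 1 ->
  (\int[mu]_(x in `]p, q]) (u (s * x) * s)%:E = (V (s * p) (s * q))%:E)%E /\
  0 <= V (s * p) (s * q).
Proof.
move=> p0 pq q1; have sp : 0 < s * p by rewrite mulr_gt0.
have sub : `]p, q]%classic `<=` D.
  by move=> x; rewrite /= !in_itv /= => /andP[px xq]; rewrite (lt_trans p0 px) (le_lt_trans xq q1).
have mg : measurable_fun D (fun x => u (s * x) * s) by apply: measurable_funM.
have UE : U `](s * p), (s * q)]%classic = (\int[mu]_(x in `](s * p)%R, (s * q)%R]) (u x)%:E)%E.
  case: Uu => _ _; apply; first exact: measurable_itv.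
  by move=> x; rewrite /= !in_itv /= andbT => /andP[/(lt_trans sp)].
have subU : `](s * p), (s * q)]%classic `<=` `]0, +oo[%classic.
  by move=> x; rewrite /= !in_itv /= andbT => /andP[/(lt_trans sp)].
rewrite integral_itv_obnd_cbnd; last first.
  apply/measurable_EFinP; exact: measurable_fun_lebesgue_in mD mg sub.
rewrite -integral_scale//; last exact: u_cont.
have E : (\int[mu]_(x in `[(s * p)%R, (s * q)%R]) (u x)%:E = U `](s * p)%R, (s * q)%R]%classic)%E.
  rewrite UE integral_itv_obnd_cbnd//; apply/measurable_EFinP.
  exact: measurable_fun_lebesgue_in (measurable_itv _) mu_pos subU.
have fin : (\int[mu]_(x in `[(s * p)%R, (s * q)%R]) (u x)%:E)%E \is a fin_num.
  apply: integrable_fin_num; first exact: lebesgue_measurable_itv.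
  apply: continuous_compact_integrable; first exact: segment_compact.
  exact: u_cont.
rewrite E /V fineK -?E//; split => //; apply: fine_ge0; apply: integral_ge0 => x.
by rewrite /= in_itv /= => /andP[h _]; rewrite lee_fin u_ge0// (lt_le_trans sp).
Qed.

Let g (x : R) := levy_tail Pi (s - s * x).
Let gt (x : R) := fine (Pi `[(s - s * x)%R, +oo[%classic).

Let after (x : R) : x < 1 -> 0 < s - s * x.
Proof. by move=> x1; rewrite subr_gt0 gtr_pMr. Qed.

Let fin_closed (x : R) : x < 1 -> Pi `[(s - s * x)%R, +oo[%classic \is a fin_num.
Proof. by move=> /after x1; rewrite ge0_fin_numE//; exact: levy_tail_fin. Qed.

Let fin_open (x : R) : x < 1 -> Pi `](s - s * x)%R, +oo[%classic \is a fin_num.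
Proof.
move=> /after x1; rewrite ge0_fin_numE//; apply: (levy_fin levy x1) => //.
by move=> v /=; rewrite !in_itv /= !andbT => /ltW.
Qed.

Let g_le (x y : R) : x <= y -> y < 1 -> g x <= g y.
Proof.
move=> xy y1; have x1 := le_lt_trans xy y1; apply: fine_le; rewrite ?fin_open//.
apply: le_measure; rewrite ?inE//.
move=> v /=; rewrite !in_itv /= !andbT; apply: le_lt_trans.
by rewrite lerB// ler_pM2l.
Qed.

Let g_gt (x : R) : x < 1 -> g x <= gt x.
Proof.
move=> x1; apply: fine_le; rewrite ?fin_open ?fin_closed//.
by apply: le_measure; rewrite ?inE// => v /=; rewrite !in_itv /= !andbT => /ltW.
Qed.

Let gt_g (x y : R) : x < y -> y < 1 -> gt x <= g y.
Proof.
move=> xy y1; have x1 := lt_trans xy y1; apply: fine_le; rewrite ?fin_open ?fin_closed//.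
apply: le_measure; rewrite ?inE//.
move=> v /=; rewrite !in_itv /= !andbT; apply: lt_le_trans.
by rewrite ltrD2l ltrN2 ltr_pM2l.
Qed.

Let mone : measurable_fun setT (fun _ : Omega => 1 : R).
Proof. exact: measurable_cst. Qed.
Let one_ge0 (w : Omega) : 0 <= (fun=> 1 : R) w. Proof. by []. Qed.
Let mWs : measurable_fun setT (fun w => W w / s).
Proof. exact: measurable_funM. Qed.

Let nu1 : {measure set R -> \bar R} := wlaw P mone one_ge0 mWs.

Let nu1E B : measurable B -> nu1 B = P ((fun w => W w / s) @^-1` B).
Proof.
move=> mB; rewrite /nu1 /= /wlaw integral_cst ?mul1e//.
by have := mWs measurableT mB; rewrite setTI.
Qed.

Let fs : R -> R := f \_ D.

Let mfs : @measurable_fun _ _ (measurableTypeR R) R setT fs.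
Proof. by apply: measurable_fun_lebesgue; exact: (measurable_restrictT f mD).1. Qed.

Let fs_ge0 (x : R) : 0 <= fs x.
Proof. by rewrite /fs patchE; case: ifPn => // /set_mem; exact: f_ge0. Qed.

Let mid : @measurable_fun _ _ (measurableTypeR R) R setT (fun x => x).
Proof. exact: (@measurable_id _ (measurableTypeR R) setT). Qed.

Let nu2 : {measure set R -> \bar R} := wlaw mu mfs fs_ge0 mid.

Let nu2E B : B `<=` D -> nu2 B = (\int[mu]_(x in B) (f x)%:E)%E.
Proof.
move=> BD; rewrite /nu2 /= /wlaw preimage_id; apply: eq_integral => x.
by rewrite inE => /BD Dx; rewrite /fs patchE mem_set.
Qed.

Let subD (p q : R) : 0 < p -> q < 1 -> `]p, q]%classic `<=` D.
Proof.
by move=> p0 q1 x; rewrite /= !in_itv /= => /andP[px xq]; rewrite (lt_trans p0 px) (le_lt_trans xq q1).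
Qed.

Let nu1_bounds (p q : R) : 0 < p -> p <= q -> q < 1 ->
  ((g p * V (s * p) (s * q))%:E <= nu1 `]p, q]%classic)%E /\
  (nu1 `]p, q]%classic <= (gt q * V (s * p) (s * q))%:E)%E.
Proof.
move=> p0 pq q1; rewrite nu1E; last exact: measurable_itv.
have -> : (fun w => W w / s) @^-1` `]p, q] = [set w | s * p < W w <= s * q].
  by apply/seteqP; split => w; rewrite /= in_itv /= ltr_pdivlMr// ler_pdivrMr// ![_ * s]mulrC.
have sp : 0 <= s * p by rewrite mulr_ge0 ?ltW.
have spq : s * p <= s * q by rewrite ler_pM2l.
have sq : s * q < s by rewrite gtr_pMr.
by split; [exact: W_ge|exact: W_le].
Qed.

Let nu2_bounds (p q : R) : 0 < p -> p <= q -> q < 1 ->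
  ((g p * V (s * p) (s * q))%:E <= nu2 `]p, q]%classic)%E /\
  (nu2 `]p, q]%classic <= (gt q * V (s * p) (s * q))%:E)%E.
Proof.
move=> p0 pq q1; have sub := subD p0 q1; rewrite nu2E//.
have mI : @measurable _ (measurableTypeR R) `]p, q]%classic by exact: lebesgue_measurable_itv.
have mg : measurable_fun D (fun x => u (s * x) * s) by apply: measurable_funM.
have mgl : @measurable_fun _ _ (measurableTypeR R) R `]p, q] (fun x => u (s * x) * s).
  exact: measurable_fun_lebesgue_in mD mg sub.
have mfl : @measurable_fun _ _ (measurableTypeR R) R `]p, q] f.
  exact: measurable_fun_lebesgue_in mD mf sub.
have us0 x : `]p, q]%classic x -> 0 <= u (s * x) * s.
  by move=> /sub /=; rewrite in_itv /= => /andP[x0 _]; rewrite mulr_ge0 ?u_ge0 ?(ltW s0)// mulr_gt0.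
have Z c : 0 <= c -> (c%:E * \int[mu]_(x in `]p, q]) (u (s * x) * s)%:E =
    \int[mu]_(x in `]p, q]) (c * (u (s * x) * s))%:E)%E.
  move=> c0; under [RHS]eq_integral do rewrite EFinM.
  by rewrite ge0_integralZl_EFin//; exact/measurable_EFinP.
have fE x : f x = g x * (u (s * x) * s) by rewrite /g; ring.
have g0 x : 0 <= g x by exact: fine_ge0.
have gt0 x : 0 <= gt x by exact: fine_ge0.
have [E0 _] := scaled p0 pq q1.
split.
  have -> : (g p * V (s * p) (s * q))%:E = (\int[mu]_(x in `]p, q]) (g p * (u (s * x) * s))%:E)%E.
    by rewrite -Z// E0.
  apply: ge0_le_integral => //.
  - by move=> x xI; rewrite lee_fin mulr_ge0// us0.
  - by apply/measurable_EFinP; apply: measurable_funM.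
  - exact/measurable_EFinP.
  - move=> x xI; rewrite lee_fin fE ler_wpM2r ?us0//; move: xI; rewrite /= in_itv /= => /andP[px xq].
    by apply: g_le; [exact: ltW|exact: le_lt_trans q1].
have -> : (gt q * V (s * p) (s * q))%:E = (\int[mu]_(x in `]p, q]) (gt q * (u (s * x) * s))%:E)%E.
  by rewrite -Z// E0.
apply: ge0_le_integral => //.
- by move=> x xI; rewrite lee_fin f_ge0//; exact: sub.
- exact/measurable_EFinP.
- by apply/measurable_EFinP; apply: measurable_funM.
- move=> x xI; rewrite lee_fin fE ler_wpM2r ?us0//; move: xI; rewrite /= in_itv /= => /andP[px xq].
  by apply: le_trans (g_le xq q1) (g_gt q1).
Qed.

Let V_le (p0 q0 : R) : 0 < p0 -> p0 <= q0 -> q0 < 1 -> exists K, 0 <= K /\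
  forall x y : R, p0 <= x -> x <= y -> y <= q0 -> V (s * x) (s * y) <= K * (y - x).
Proof.
move=> p00 pq q1; have sp : 0 < s * p0 by rewrite mulr_gt0.
have spq : s * p0 <= s * q0 by rewrite ler_pM2l.
have [c cI Hc] := EVT_max spq (u_cont sp).
have c0 : 0 < c by move: cI; rewrite in_itv /= => /andP[h _]; exact: lt_le_trans h.
exists (u c * s); split; first by rewrite mulr_ge0 ?u_ge0 ?ltW.
move=> x y px xy yq; have x0 := lt_le_trans p00 px; have y1 := le_lt_trans yq q1.
have [E _] := scaled x0 xy y1; rewrite -lee_fin -E.
have mg : measurable_fun D (fun x => u (s * x) * s) by apply: measurable_funM.
have sub := subD x0 y1.
have us0 z : `]x, y]%classic z -> 0 <= u (s * z) * s.
  by move=> /sub /=; rewrite in_itv /= => /andP[z0 _]; rewrite mulr_ge0 ?u_ge0 ?(ltW s0)// mulr_gt0.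
apply: (@le_trans _ _ (\int[mu]_(z in `]x, y]) (u c * s)%:E)%E).
  apply: ge0_le_integral => //.
  - by apply/measurable_EFinP; exact: measurable_fun_lebesgue_in mD mg sub.
  - move=> z; rewrite /= in_itv /= lee_fin => /andP[xz zy]; rewrite ler_wpM2r ?(ltW s0)//.
    apply: Hc; rewrite in_itv /= !ler_pM2l//.
    by rewrite (le_trans px (ltW xz)) (le_trans zy yq).
have -> : (\int[mu]_(z in `]x, y]) (u c * s)%:E = (u c * s)%:E * mu `]x, y]%classic)%E.
  by apply: integral_cst; exact: lebesgue_measurable_itv.
have -> : (mu `]x, y]%classic = (y - x)%:E)%E.
  rewrite lebesgue_measure_itv /= lte_fin; case: ltP => [_|yx]; first by rewrite EFinB.
  have xy' : x = y by apply/eqP; rewrite eq_le xy yx.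
  by rewrite xy' subrr.
by rewrite -EFinM.
Qed.

Let nu_eq (p q : R) : 0 < p -> p <= q -> q < 1 -> nu1 `]p, q]%classic = nu2 `]p, q]%classic.
Proof.
move=> p0 pq q1; have [K [K0 HK]] := V_le p0 pq q1.
have finb (m : {measure set R -> \bar R}) c : (m `]p, q]%classic <= c%:E)%E ->
    forall x y, p <= x -> y <= q -> m `]x, y]%classic \is a fin_num.
  move=> H x y px yq; rewrite ge0_fin_numE//; apply: le_lt_trans (ltry c).
  apply: le_trans H; apply: le_measure; rewrite ?inE; [exact: measurable_itv|exact: measurable_itv|].
  by move=> z /=; rewrite !in_itv /= => /andP[xz zy]; rewrite (le_lt_trans px xz) (le_trans zy yq).
have f1 := finb nu1 _ (nu1_bounds p0 pq q1).2.
have f2 := finb nu2 _ (nu2_bounds p0 pq q1).2.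
pose Df x := fine (nu1 `]p, x]%classic) - fine (nu2 `]p, x]%classic).
pose H x := K * (gt x + g x).
have DH (x y : R) : p <= x -> x <= y -> y <= q -> `|Df y - Df x| <= (y - x) * (H y - H x).
  move=> px xy yq; have x0 := lt_le_trans p0 px; have y1 := le_lt_trans yq q1.
  have [/eqP->|xny] := boolP (x == y); first by rewrite !subrr normr0 mul0r.
  have ltxy : x < y by rewrite lt_neqAle xny.
  have dE (m : {measure set R -> \bar R}) :
      (forall x y, p <= x -> y <= q -> m `]x, y]%classic \is a fin_num) ->
      fine (m `]p, y]%classic) = fine (m `]p, x]%classic) + fine (m `]x, y]%classic).
    by move=> fm; rewrite (measure_itvU m px xy) fineD// fm// (le_trans xy).
  have -> : Df y - Df x = fine (nu1 `]x, y]%classic) - fine (nu2 `]x, y]%classic).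
    by rewrite /Df (dE nu1)// (dE nu2)//; ring.
  have [a1 b1] := nu1_bounds x0 xy y1; have [a2 b2] := nu2_bounds x0 xy y1.
  move: a1 b1 a2 b2; rewrite -(fineK (f1 x y px yq)) -(fineK (f2 x y px yq)) !lee_fin.
  move: (fine (nu1 _)) (fine (nu2 _)) => A B a1 b1 a2 b2 /=.
  apply: (@le_trans _ _ ((gt y - g x) * V (s * x) (s * y))).
    by rewrite mulrBl ler_norml; apply/andP; split; lra.
  have gg : 0 <= gt y - g x by rewrite subr_ge0 (le_trans (g_le xy y1) (g_gt y1)).
  apply: le_trans (ler_wpM2l gg (HK x y px xy yq)) _.
  have -> : (y - x) * (H y - H x) = (gt y + g y - (gt x + g x)) * (K * (y - x)).
    by rewrite /H; ring.
  rewrite ler_wpM2r ?mulr_ge0 ?subr_ge0//.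
  have := gt_g ltxy y1; lra.
have := small_increments_cst pq DH; rewrite /Df !set_itvoc0 !measure0 subrr => /eqP.
rewrite subr_eq0 => /eqP E.
by rewrite -(fineK (f1 p q (lexx _) (lexx _))) -(fineK (f2 p q (lexx _) (lexx _))) E.
Qed.

(** Write [g x] for the tail at [s - s x], a non-decreasing function of [x].
    Both measures of [ ]p, q] ] lie between [g p] and [g (q+)] times [U ( ]s p,
    s q] )]. The latter is at most a multiple of [q - p], so the difference of
    the measures is of second order and [small_increments_cst] applies. *)
Lemma undershoot_density (B : set R) : measurable B -> B `<=` D ->
  P ((fun w => W w / s) @^-1` B) = (\int[mu]_(x in B) (f x)%:E)%E.
Proof.
move=> mB BD; rewrite -nu1E// -nu2E//.
pose a (n : nat) : R := n.+2%:R^-1; pose b n : R := 1 - a n.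
have a0 n : 0 < a n by rewrite invr_gt0.
have a_anti n k : (n <= k)%N -> a k <= a n.
  by move=> nk; rewrite /a lef_pV2 ?posrE// ler_nat !ltnS.
apply: (@measure_eq_itvoc _ nu1 nu2 a b) => //.
- move=> n p q ap pq qb; apply: nu_eq => //; first exact: lt_le_trans ap.
  by apply: le_lt_trans qb _; rewrite /b ltrBlDr ltrDl.
- move=> n; apply: (@le_lt_trans _ _ (1%:E)%E); last exact: ltry.
  by rewrite nu1E; [apply: probability_le1|exact: measurable_itv];
    have := mWs measurableT (measurable_itv `]a n, b n]); rewrite setTI.
- by move=> n k nk; rewrite lerB// a_anti.
move=> x /BD /=; rewrite in_itv /= => /andP[x0 x1].
have d0 : 0 < Num.min x (1 - x) by rewrite lt_min x0 subr_gt0.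
have [n Hn] := small_invn d0; exists n => //=.
have := Hn n.+1 (leqnSn n); rewrite lt_min => /andP[h1 h2].
by rewrite /b /a in_itv /= h1 /= lerBrDr -lerBrDl ltW.
Qed.

Lemma measurable_undershoot_density : measurable_fun D f.
Proof. exact: mf. Qed.

End UndershootDensity.

(** * Expansions on closed subintervals of the unit interval *)

Section UnitInterval.
Context {R : realType}.
Notation mu := (@lebesgue_measure R).

Lemma powR_le_ends (a b x e : R) : 0 < a -> a <= x -> x <= b -> x `^ e <= a `^ e + b `^ e.
Proof.
move=> a0 ax xb; have x0 := lt_le_trans a0 ax; have b0 := lt_le_trans x0 xb.
have [e0|e0] := leP 0 e.
  by rewrite ler_wpDl ?powR_ge0// ge0_ler_powR// nnegrE ltW.
rewrite ler_wpDr ?powR_ge0// -[e]opprK powRN [leRHS]powRN lef_pV2 ?posrE ?powR_gt0//.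
by rewrite ge0_ler_powR ?oppr_ge0 ?(ltW e0)// nnegrE ltW.
Qed.

Lemma Rintegral_sum (D : set (measurableTypeR R)) (r : seq nat) (c : nat -> R) (h : nat -> R -> R) :
  measurable D -> (forall k, mu.-integrable D (EFin \o h k)) ->
  mu.-integrable D (EFin \o (fun x => \sum_(k <- r) c k * h k x)) /\
  \int[mu]_(x in D) (\sum_(k <- r) c k * h k x) = \sum_(k <- r) c k * \int[mu]_(x in D) h k x.
Proof.
move=> mD ih; elim: r => [|k r [IH1 IH2]].
  split; last by rewrite big_nil; under eq_Rintegral do rewrite big_nil; rewrite /Rintegral integral0.
  have -> : EFin \o (fun x : R => \sum_(k <- [::]) c k * h k x) = cst 0%E.
    by apply/funext => x /=; rewrite big_nil.
  exact: integrable0.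
have iZ : mu.-integrable D (EFin \o (fun x => c k * h k x)).
  by have := integrableZl mD (c k) (ih k); exact: eq_integrable.
split.
  by apply: eq_integrable (integrableD mD iZ IH1) => // x _ /=; rewrite big_cons EFinD.
under eq_Rintegral do rewrite big_cons.
by rewrite RintegralD// IH2 RintegralZl// big_cons.
Qed.

Variables (Pi : {measure set R -> \bar R}) (N n : nat) (c alpha : nat -> R) (rho u : R -> R).
Hypotheses (levy : is_levy_measure Pi) (c0_gt0 : 0 < c 0%N)
  (a0_ge0 : 0 <= alpha 0%N) (a0_le1 : alpha 0%N <= 1)
  (rho_gt0 : forall t, 0 < t -> 0 < rho t)
  (rho_int : locally_integrable `]0, +oo[ rho)
  (rho_ndecr : exists2 r, 0 < r & forall x y, 0 < x -> x <= y -> y < r -> rho y <= rho x)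
  (u_expansion : exists2 C, 0 < C & \forall x \near +oo,
     `|u x - \sum_(0 <= k < n.+1) invGamma (alpha k) / c k * x `^ (alpha k - 1)|
       <= C * eps1 N rho x).
Notation tail := (levy_tail Pi).
Notation al := (alpha 0%N).
Notation f s x := (s * tail (s - s * x) * u (s * x)).
Notation lead s x :=
  (sin (pi * alpha 0%N) / pi * x `^ (-1 + alpha 0%N) * (1 - x) `^ (- alpha 0%N)
   + (0 < alpha 0%N)%R%:R * (\sum_(1 <= k < n.+1)
       c 0%N * s `^ (alpha k - alpha 0%N) / c k
       * invGamma (alpha k) * invGamma (1 - alpha 0%N)
       * x `^ (-1 + alpha k) * (1 - x) `^ (- alpha 0%N))
   + \sum_(0 <= k < n.+1)
       s `^ alpha k / c k * invGamma (alpha k)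
       * x `^ (-1 + alpha k) * eps2 Pi (c 0%N) (alpha 0%N) (s - s * x)).

Let lead_ring (c0 S X1 G1 G A Xe ci : R) :
  c0 * (S * X1) * G1 * (G * ci * (A * Xe)) = c0 * ci * (S * A) * (G * G1 * Xe * X1).
Proof. by ring. Qed.

Let term_ring (i c0 S X1 G1 G A Xe ci : R) :
  i * (c0 * (S * X1) * G1) * (G * ci * (A * Xe)) = i * (c0 * (A * S) * ci * G * G1 * Xe * X1).
Proof. by ring. Qed.

(** The terms of the statement arise by multiplying the expansions of [u (s x)]
    and of the tail at [s - s x]; the coefficient of the leading one comes from
    the reflection formula. *)
Lemma expansion_product (s x : R) : 0 < s -> 0 < x -> x < 1 ->
  s * tail (s - s * x) *
    \sum_(0 <= k < n.+1) invGamma (alpha k) / c k * (s * x) `^ (alpha k - 1) = lead s x.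
Proof.
move=> s0 x0 x1; have x10 : 0 < 1 - x by rewrite subr_gt0.
have tE : tail (s - s * x) = (0 < al)%R%:R * (c 0%N * (s `^ (- al) * (1 - x) `^ (- al)) * invGamma (1 - al))
    + eps2 Pi (c 0%N) al (s - s * x).
  rewrite /eps2 -powRM ?(ltW s0) ?(ltW x10)//.
  have -> : s * (1 - x) = s - s * x by rewrite mulrBr mulr1.
  by rewrite [RHS]addrC subrK.
have pE k : s * (s * x) `^ (alpha k - 1) = s `^ alpha k * x `^ (-1 + alpha k).
  rewrite powRM ?(ltW s0) ?(ltW x0)// mulrA [alpha k - 1]addrC; congr (_ * _).
  rewrite -{1}(powRr1 (ltW s0)) -powRD; first by congr (_ `^ _); ring.
  by rewrite (gt_eqF s0) implybT.
have -> : s * tail (s - s * x) * \sum_(0 <= k < n.+1) invGamma (alpha k) / c k * (s * x) `^ (alpha k - 1) =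
  \sum_(0 <= k < n.+1) (tail (s - s * x) * (invGamma (alpha k) / c k * (s `^ alpha k * x `^ (-1 + alpha k)))).
  rewrite mulr_sumr; apply: eq_bigr => k _; rewrite -pE; ring.
under eq_bigr do rewrite tE mulrDl.
rewrite big_split /=; congr (_ + _); last by apply: eq_bigr => k _; ring.
rewrite big_ltn//; congr (_ + _).
  have refl := invGamma_reflection a0_ge0 a0_le1.
  move: (a0_ge0); rewrite le_eqVlt => /predU1P[<-|a0]; first by rewrite ltxx mulr0 sin0 !mul0r.
  rewrite -refl a0 mul1r.
  have sE : s `^ (- al) * s `^ al = 1.
    by rewrite powRN mulVf// gt_eqF// powR_gt0.
  have cE : c 0%N / c 0%N = 1 by rewrite mulfV// gt_eqF.
  by rewrite lead_ring sE cE !mul1r.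
rewrite mulr_sumr; apply: eq_bigr => k _.
have -> : s `^ (alpha k - al) = s `^ alpha k * s `^ (- al).
  by rewrite -powRD// (gt_eqF s0) implybT.
exact: term_ring.
Qed.

Variables (p q : R).
Hypotheses (p0 : 0 < p) (pq : p <= q) (q1 : q < 1).

Lemma expansion_pointwise : exists2 C : R, 0 < C &
  \forall s \near +oo, forall x, x \in `[p, q] -> `|f s x - lead s x| <= C * eps3 Pi N rho s x.
Proof.
have [C C0 [M [_ HM]]] := u_expansion; exists C => //.
near=> s => x; rewrite in_itv /= => /andP[px xq].
have s0 : 0 < s by near: s; apply: nbhs_pinfty_gt; rewrite num_real.
have x0 := lt_le_trans p0 px; have x1 := le_lt_trans xq q1.
have sM : M < s * x.
  apply: (@lt_le_trans _ _ (s * p)); last by rewrite ler_pM2l.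
  rewrite -ltr_pdivrMr//; near: s; apply: nbhs_pinfty_gt; rewrite num_real.
  by [].
rewrite -expansion_product// -mulrBr normrM.
have t0 : 0 <= s * tail (s - s * x) by rewrite mulr_ge0 ?(ltW s0)// fine_ge0.
rewrite (ger0_norm t0) /eps3 mulrCA ler_wpM2l//.
exact: HM.
Unshelve. all: by end_near. Qed.

(** As [rho] is non-increasing near 0, each factor of [eps1] is bounded on the
    interval by its value at one of the ends. This makes the supremum of the
    error terms a genuine one: that of an unbounded set is 0 by convention. *)
Let eps1_bound : exists2 s0, 0 < s0 & forall s, s0 <= s -> exists K, forall x, p <= x -> x <= q ->
  0 <= eps1 N rho (s * x) <= K.
Proof.
have [r r0 mono] := rho_ndecr.
exists ((Num.min r 2^-1)^-1 * 2 / p).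
  by rewrite !divr_gt0// mulr_gt0// invr_gt0 lt_min r0 invr_gt0/=.
move=> s Hs; pose m := Num.min r 2^-1.
have m0 : 0 < m by rewrite lt_min r0 invr_gt0/=.
have sp : m^-1 * 2 <= s * p by rewrite -ler_pdivrMr.
have sp0 : 0 < s * p by apply: lt_le_trans sp; rewrite mulr_gt0// invr_gt0.
have s0 : 0 < s by rewrite -(pmulr_lgt0 _ p0).
have q0 := lt_le_trans p0 pq.
pose y1 := (s * q)^-1; have y10 : 0 < y1 by rewrite invr_gt0 mulr_gt0.
exists ((s * p) ^- N.+1 * rho y1 + (s * p) ^- N * \int[mu]_(t in `[y1, 1]) rho t).
move=> x px xq; have x0 := lt_le_trans p0 px.
have sx0 : 0 < s * x by rewrite mulr_gt0.
have spx : s * p <= s * x by rewrite ler_pM2l.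
pose y := (s * x)^-1; have y0 : 0 < y by rewrite invr_gt0.
have ym : y < m.
  rewrite /y invf_plt ?posrE//; apply: lt_le_trans spx; apply: lt_le_trans sp.
  by rewrite ltr_pMr ?invr_gt0// ltr1n.
have yr : y < r by apply: lt_le_trans ym _; rewrite /m ge_min lexx.
have yh : y < 1 by apply: lt_trans (_ : 2^-1 < 1); [apply: lt_le_trans ym _; rewrite /m ge_min lexx orbT|rewrite invf_lt1// ltr1n].
have y1y : y1 <= y by rewrite /y1 /y lef_pV2 ?posrE ?mulr_gt0// ler_pM2l.
have oE : orint (s * x)^-1 1 rho = \int[mu]_(t in `[y, 1]) rho t.
  rewrite /orint (_ : \int[mu]_(t in `[1, (s * x)^-1]) rho t = 0) ?subr0//.
  by rewrite set_itv_ge ?Rintegral_set0// bnd_simp -ltNge.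
have I0 : 0 <= \int[mu]_(t in `[y, 1]) rho t.
  apply: Rintegral_ge0 => t; rewrite /= in_itv /= => /andP[yt _]; apply: ltW; apply: rho_gt0.
  exact: lt_le_trans yt.
have I1 : \int[mu]_(t in `[y, 1]) rho t <= \int[mu]_(t in `[y1, 1]) rho t.
  have i1 := locally_integrable_itv (1 : R) rho_int y10.
  have i2 := locally_integrable_itv (1 : R) rho_int y0.
  apply: fine_le.
  - by apply: integrable_fin_num i2; exact: lebesgue_measurable_itv.
  - by apply: integrable_fin_num i1; exact: lebesgue_measurable_itv.
  apply: ge0_subset_integral; try exact: lebesgue_measurable_itv.
  - by case/integrableP : i1.
  - move=> t; rewrite /= in_itv /= => /andP[yt _]; rewrite lee_fin; apply: ltW; apply: rho_gt0.
    exact: lt_le_trans yt.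
  - by move=> t; rewrite /= !in_itv /= => /andP[yt ->]; rewrite (le_trans y1y yt).
have pw k : 0 <= (s * x) ^- k <= (s * p) ^- k.
  rewrite invr_ge0 exprn_ge0 ?(ltW sx0)//= lef_pV2 ?posrE ?exprn_gt0//.
  by rewrite lerXn2r// nnegrE ltW.
have ry : rho y <= rho y1 by exact: mono.
have rho0 := ltW (rho_gt0 y0).
have /andP[a1 a2] := pw N.+1; have /andP[b1 b2] := pw N.
by rewrite /eps1 oE -/y addr_ge0 ?mulr_ge0//= lerD// ler_pM.
Qed.

Let tail_ge0 t : 0 <= tail t. Proof. exact: fine_ge0. Qed.

Let tail_le x y : 0 < x -> x <= y -> tail y <= tail x.
Proof.
move=> x0 xy; have fin (t : R) : 0 < t -> Pi `]t, +oo[%classic \is a fin_num.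
  move=> t0; rewrite ge0_fin_numE//; apply: (levy_fin levy t0 (measurable_itv _)).
  by move=> v /=; rewrite !in_itv /= !andbT => /ltW.
apply: fine_le; rewrite ?fin// ?(lt_le_trans x0)//.
apply: le_measure; rewrite ?inE//.
by move=> v /=; rewrite !in_itv /= !andbT; exact: le_lt_trans.
Qed.

Let s_in s x : 0 < s -> x \in `[p, q] -> [/\ 0 < x, x < 1, s - s * q <= s - s * x & 0 < s - s * q].
Proof.
move=> s0; rewrite in_itv /= => /andP[px xq]; split.
- exact: lt_le_trans px.
- exact: le_lt_trans xq q1.
- by rewrite lerB// ler_pM2l.
- by rewrite subr_gt0 gtr_pMr.
Qed.

Let eps3_sup : \forall s \near +oo, forall x, x \in `[p, q] ->
  0 <= eps3 Pi N rho s x <= sup [set eps3 Pi N rho s x | x in `[p, q]].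
Proof.
have [s1 s10 H] := eps1_bound; near=> s.
have ss1 : s1 <= s by near: s; apply: nbhs_pinfty_ge; rewrite num_real.
have s0 := lt_le_trans s10 ss1; have [K HK] := H s ss1.
have b0 x : x \in `[p, q] -> 0 <= eps3 Pi N rho s x <= s * tail (s - s * q) * K.
  move=> xI; have [x0 x1 sx sq] := s_in s0 xI; move: xI; rewrite in_itv /= => /andP[px xq].
  have /andP[e0 eK] := HK x px xq; rewrite /eps3 !mulr_ge0 ?(ltW s0)//=.
  by apply: ler_pM; rewrite ?mulr_ge0 ?(ltW s0)// ler_wpM2l ?(ltW s0)// tail_le.
move=> x xI; have /andP[-> _] := b0 x xI => /=.
apply: ub_le_sup; last by exists x.
by exists (s * tail (s - s * q) * K) => _ [t tI <-]; have /andP[] := b0 t tI.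
Unshelve. all: by end_near. Qed.

Let mI : @measurable _ (measurableTypeR R) `[p, q]. Proof. exact: lebesgue_measurable_itv. Qed.

Let mpow (e : R) : measurable_fun setT (fun x : R => x `^ e).
Proof. exact: measurable_powR. Qed.

Let mpow1 (e : R) : measurable_fun setT (fun x : R => (1 - x) `^ e).
Proof. by apply: (measurableT_comp (mpow e)); exact: measurable_funB. Qed.

Let bounded_integrable (g : R -> R) (K : R) : measurable_fun setT g ->
  (forall x, x \in `[p, q] -> `|g x| <= K) -> mu.-integrable `[p, q] (EFin \o g).
Proof.
move=> mg gK; apply: (integrable_finite (K := K)) => //; first exact: itv_fin.
  exact: measurable_fun_lebesgue.
Qed.

Let pow_bound (e x : R) : x \in `[p, q] -> 0 <= x `^ e <= p `^ e + q `^ e.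
Proof.
by rewrite in_itv /= => /andP[px xq]; rewrite powR_ge0 powR_le_ends.
Qed.

Let pow1_bound (e x : R) : x \in `[p, q] -> 0 <= (1 - x) `^ e <= (1 - q) `^ e + (1 - p) `^ e.
Proof.
rewrite in_itv /= => /andP[px xq]; rewrite powR_ge0 powR_le_ends ?subr_gt0// lerB//.
Qed.

Let int_beta (e1 e2 : R) :
  mu.-integrable `[p, q] (EFin \o (fun x => x `^ e1 * (1 - x) `^ e2)).
Proof.
apply: (bounded_integrable (K := (p `^ e1 + q `^ e1) * ((1 - q) `^ e2 + (1 - p) `^ e2))).
  exact: measurable_funM.
move=> x xI; have /andP[a1 a2] := pow_bound e1 xI; have /andP[b1 b2] := pow1_bound e2 xI.
by rewrite ger0_norm ?mulr_ge0// ler_pM.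
Qed.

Let int_eps2 (e s : R) : 0 < s ->
  mu.-integrable `[p, q] (EFin \o (fun x => x `^ e * eps2 Pi (c 0%N) al (s - s * x))).
Proof.
move=> s0; pose D : set R := `]0, 1[%classic; have mD : measurable D by exact: measurable_itv.
have mt : measurable_fun D (fun x => tail (s - s * x)).
  apply: (@measurable_comp _ _ _ _ _ _ (`]0, +oo[%classic : set R) tail D (fun x => s - s * x)) => //.
  - move=> _ [x + <-]; rewrite /D /= !in_itv /= andbT => /andP[_ x1].
    by rewrite subr_gt0 gtr_pMr.
  - exact: measurable_levy_tail.
  - by apply: measurable_funTS; apply: measurable_funB => //; exact: measurable_funM.
have me : measurable_fun D (fun x => x `^ e * eps2 Pi (c 0%N) al (s - s * x)).
  apply: measurable_funM; first exact: measurable_funTS (mpow e).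
  apply: measurable_funB => //; apply: measurable_funTS; apply: measurable_funM => //.
  apply: measurable_funM => //; apply: measurable_funM => //.
  apply: (measurableT_comp (mpow (- al))); apply: measurable_funB => //; exact: measurable_funM.
have sub : `[p, q]%classic `<=` D.
  by move=> x; rewrite /D /= !in_itv /= => /andP[px xq]; rewrite (lt_le_trans p0 px) (le_lt_trans xq q1).
pose T := tail (s - s * q) + `|c 0%N * invGamma (1 - al)| * ((s - s * q) `^ (- al) + (s - s * p) `^ (- al)).
apply: (integrable_finite (K := (p `^ e + q `^ e) * T)) => //; first exact: itv_fin.
  exact: measurable_fun_lebesgue_in mD me sub.
move=> x xI; have xI' : x \in `[p, q] by [].
have [x0 x1 sx sq] := s_in s0 xI'; have /andP[a1 a2] := pow_bound e xI'.
rewrite normrM (ger0_norm a1) ler_pM//.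
have xp : s - s * x <= s - s * p.
  by rewrite lerB// ler_pM2l//; move: xI'; rewrite in_itv /= => /andP[].
have b2 := powR_le_ends (- al) sq sx xp; have b1 := powR_ge0 (s - s * x) (- al).
rewrite /eps2; apply: le_trans (ler_normB _ _) _; rewrite (ger0_norm (tail_ge0 _)) lerD ?tail_le//.
rewrite normrM ger0_norm// -[leRHS]mul1r; apply: ler_pM => //; first by case: (0 < al).
by rewrite -mulrA [_ `^ _ * _]mulrC mulrA normrM (ger0_norm b1) ler_wpM2l.
Qed.

Let ak (s : R) k := c 0%N * s `^ (alpha k - al) / c k * invGamma (alpha k) * invGamma (1 - al).
Let bk (s : R) k := s `^ alpha k / c k * invGamma (alpha k).

Lemma integral_lead (s : R) : 0 < s ->
  mu.-integrable `[p, q] (EFin \o (fun x => lead s x)) /\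
  \int[mu]_(x in `[p, q]) (lead s x) =
  sin (pi * al) / pi * \int[mu]_(x in `[p, q]) (x `^ (-1 + al) * (1 - x) `^ (- al))
  + (0 < al)%R%:R * (\sum_(1 <= k < n.+1)
      c 0%N * s `^ (alpha k - al) / c k * invGamma (alpha k) * invGamma (1 - al)
      * \int[mu]_(x in `[p, q]) (x `^ (-1 + alpha k) * (1 - x) `^ (- al)))
  + \sum_(0 <= k < n.+1) s `^ alpha k / c k * invGamma (alpha k)
      * \int[mu]_(x in `[p, q]) (x `^ (-1 + alpha k) * eps2 Pi (c 0%N) al (s - s * x)).
Proof.
move=> s0.
have [iA EA] := Rintegral_sum (index_iota 1 n.+1) (ak s) mI (fun k => int_beta (-1 + alpha k) (- al)).
have [iB EB] := Rintegral_sum (index_iota 0 n.+1) (bk s) mI (fun k => int_eps2 (-1 + alpha k) s0).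
have i0 := int_beta (-1 + al) (- al).
have i0Z : mu.-integrable `[p, q] (EFin \o (fun x => sin (pi * al) / pi * (x `^ (-1 + al) * (1 - x) `^ (- al)))).
  by have := integrableZl mI (sin (pi * al) / pi) i0; exact: eq_integrable.
have iAZ : mu.-integrable `[p, q] (EFin \o (fun x => (0 < al)%R%:R * \sum_(k <- index_iota 1 n.+1) ak s k * (x `^ (-1 + alpha k) * (1 - x) `^ (- al)))).
  by have := integrableZl mI ((0 < al)%R%:R : R) iA; exact: eq_integrable.
have iS : mu.-integrable `[p, q] (EFin \o (fun x => sin (pi * al) / pi * (x `^ (-1 + al) * (1 - x) `^ (- al)) +
   (0 < al)%R%:R * \sum_(k <- index_iota 1 n.+1) ak s k * (x `^ (-1 + alpha k) * (1 - x) `^ (- al)))).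
  by have := integrableD mI i0Z iAZ; exact: eq_integrable.
have lE x : lead s x = sin (pi * al) / pi * (x `^ (-1 + al) * (1 - x) `^ (- al)) +
   (0 < al)%R%:R * (\sum_(k <- index_iota 1 n.+1) ak s k * (x `^ (-1 + alpha k) * (1 - x) `^ (- al))) +
   \sum_(k <- index_iota 0 n.+1) bk s k * (x `^ (-1 + alpha k) * eps2 Pi (c 0%N) al (s - s * x)).
  congr (_ + _ * _ + _); first by rewrite mulrA.
    by apply: eq_bigr => k _; rewrite /ak [RHS]mulrA.
  by apply: eq_bigr => k _; rewrite /bk [RHS]mulrA.
split.
  by apply: eq_integrable (integrableD mI iS iB) => // x _; rewrite /= lE.
under eq_Rintegral do rewrite lE.
by rewrite RintegralD// RintegralD// RintegralZl// RintegralZl// EA EB.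
Qed.

Lemma expansion_integral : (forall s, 0 < s -> measurable_fun (`]0, 1[%classic : set R) (fun x => f s x)) ->
  exists2 C : R, 0 < C & \forall s \near +oo,
  `|\int[mu]_(x in `[p, q]) f s x -
    (sin (pi * al) / pi * \int[mu]_(x in `[p, q]) (x `^ (-1 + al) * (1 - x) `^ (- al))
  + (0 < al)%R%:R * (\sum_(1 <= k < n.+1)
      c 0%N * s `^ (alpha k - al) / c k * invGamma (alpha k) * invGamma (1 - al)
      * \int[mu]_(x in `[p, q]) (x `^ (-1 + alpha k) * (1 - x) `^ (- al)))
  + \sum_(0 <= k < n.+1) s `^ alpha k / c k * invGamma (alpha k)
      * \int[mu]_(x in `[p, q]) (x `^ (-1 + alpha k) * eps2 Pi (c 0%N) al (s - s * x)))|
  <= C * sup [set eps3 Pi N rho s x | x in `[p, q]].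
Proof.
move=> mf; have [C C0 HC] := expansion_pointwise; exists C => //.
near=> s.
have s0 : 0 < s by near: s; apply: nbhs_pinfty_gt; rewrite num_real.
have H1 : forall x, x \in `[p, q] -> `|f s x - lead s x| <= C * eps3 Pi N rho s x by near: s.
have H2 : forall x, x \in `[p, q] ->
  0 <= eps3 Pi N rho s x <= sup [set eps3 Pi N rho s x | x in `[p, q]] by near: s; exact: eps3_sup.
have [iL <-] := integral_lead s0.
set K := sup _ in H2 *.
have HK x : x \in `[p, q] -> `|f s x - lead s x| <= C * K.
  move=> xI; apply: le_trans (H1 x xI) _; rewrite ler_wpM2l ?(ltW C0)//.
  by have /andP[] := H2 x xI.
have pI : p \in `[p, q] by rewrite in_itv /= lexx.
have K0 : 0 <= K by have /andP[h1 h2] := H2 p pI; exact: le_trans h2.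
have sub : `[p, q]%classic `<=` (`]0, 1[%classic : set R).
  by move=> x; rewrite /= !in_itv /= => /andP[px xq]; rewrite (lt_le_trans p0 px) (le_lt_trans xq q1).
have mfl : @measurable_fun _ _ (measurableTypeR R) R `[p, q] (fun x => f s x).
  exact: measurable_fun_lebesgue_in (measurable_itv _) (mf s s0) sub.
have mL : @measurable_fun _ _ (measurableTypeR R) R `[p, q] (fun x => lead s x).
  by case/integrableP : iL => /measurable_EFinP.
have mfL : @measurable_fun _ _ (measurableTypeR R) R `[p, q] (fun x => f s x - lead s x).
  exact: measurable_funB.
have ifL : mu.-integrable `[p, q] (EFin \o (fun x => f s x - lead s x)).
  by apply: (integrable_finite (K := C * K)) => //; exact: itv_fin.
have -> : \int[mu]_(x in `[p, q]) f s x =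
    \int[mu]_(x in `[p, q]) (f s x - lead s x) + \int[mu]_(x in `[p, q]) lead s x.
  by rewrite -RintegralD//; apply: eq_Rintegral => x _; rewrite subrK.
rewrite addrK; apply: le_trans (le_Rintegral_bound pq mfL HK) _.
by rewrite ler_piMr ?mulr_ge0 ?(ltW C0)// lerBlDr ler_wpDr ?(ltW p0)// ltW.
Unshelve. all: by end_near. Qed.

End UnitInterval.

(** * The potential density and the theorem *)

(** On [ ]-oo, x] ] the indicator of the position is at most [exp x] times [exp
    (- path)]. *)
Lemma potential_itv_lty d (Omega : measurableType d) (R : realType) (P : probability Omega R)
    (Y : R -> Omega -> R) (zeta : Omega -> \bar R) (X : R -> Omega -> option R)
    (Ysub : is_subordinator P Y) (mzeta : measurable_fun setT zeta)
    (XE : forall (t : R) w, 0 <= t ->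
       X t w = if (t%:E < zeta w)%E then Some (Y t w) else None) :
  (ptime P).-integrable setT (fun z => (alive zeta z * expR (- (1 * path Y z)))%:E) ->
  forall x : R, (potential P X `]-oo, x]%classic < +oo)%E.
Proof.
move=> i1 x; rewrite (potentialE Ysub mzeta XE); last exact: measurable_itv.
have iZ := integrableZl measurableT (expR x) i1.
apply: (@le_lt_trans _ _ (\int[ptime P]_z (expR x * (alive zeta z * expR (- (1 * path Y z))))%:E)%E).
  apply: ge0_le_integral => //.
  - by move=> z _; rewrite lee_fin mulr_ge0 ?alive_ge0// indicE.
  - apply/measurable_EFinP; apply: measurable_funM; first exact: measurable_alive.
    by apply: (measurableT_comp (measurable_indic (measurable_itv _))); exact: (measurable_path Ysub).
  - by case/integrableP : iZ.
  move=> z _; rewrite lee_fin mulrCA ler_wpM2l ?alive_ge0// mul1r -expRD indicE.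
  have [zx|_] := boolP (path Y z \in `]-oo, x]%classic); last exact: expR_ge0.
  move: zx; rewrite inE /= in_itv /= => zx.
  by rewrite (_ : true%:R = 1)// -[leLHS]expR0 ler_expR subr_ge0.
case/integrableP : iZ => _; apply: le_lt_trans.
rewrite le_eqVlt; apply/orP; left; apply/eqP; apply: eq_integral => z _ /=.
by rewrite ger0_norm// mulr_ge0 ?expR_ge0// mulr_ge0 ?alive_ge0 ?expR_ge0.
Qed.

Lemma truncated_exponents (R : realType) (n : nat) (al : nat -> R) :
  (forall k, (k < n)%N -> al k.+1 < al k) -> forall k, al n <= al (minn k n).
Proof.
move=> H; have aux j : (j <= n)%N -> al n <= al (n - j)%N.
  elim: j => [|j IH] jn; first by rewrite subn0.
  apply: le_trans (IH (ltnW jn)) _; have lt : (n - j.+1 < n)%N by rewrite ltn_subrL (leq_ltn_trans _ jn).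
  by have := H _ lt; rewrite subnSK// => /ltW.
move=> k; have := aux (n - minn k n)%N (leq_subr _ _).
by rewrite subKn// geq_minr.
Qed.

Theorem theorem3p4 (R : realType) (d : measure_display)
    (Omega : measurableType d) (P : probability Omega R)
    (X : R -> Omega -> option R) (a b : R) (Pi : {measure set R -> \bar R})
    (N n : nat) (c alpha : nat -> R) (rho : R -> R)
    (X_sub : is_killed_subordinator P X)
    (X_char : has_characteristics P X a b Pi)
    (X_neq0 : 0 < a \/ 0 < b \/ (0 < Pi `]0%R, +oo[%classic)%E)
    (N_gt0 : (0 < N)%N)
    (condA : condition_A (levy_khintchine a b Pi) N n c alpha rho)
    (condB : condition_B (levy_khintchine a b Pi) N) :
  exists2 u : R -> R, is_continuous_density (potential P X) u &
  [/\ forall (s : R) (B : set R), 0 < s -> measurable B -> B `<=` `]0, 1[ ->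
        P (undershoot_in X s B) =
        (\int[lebesgue_measure]_(x in B)
           (s * levy_tail Pi (s - s * x) * u (s * x))%:E)%E,
      forall p q : R, 0 < p -> p <= q -> q < 1 ->
        exists2 C : R, 0 < C & \forall s \near +oo, forall x, x \in `[p, q] ->
        `| s * levy_tail Pi (s - s * x) * u (s * x) -
           (sin (pi * alpha 0%N) / pi
              * x `^ (-1 + alpha 0%N) * (1 - x) `^ (- alpha 0%N)
            + (0 < alpha 0%N)%R%:R * (\sum_(1 <= k < n.+1)
                c 0%N * s `^ (alpha k - alpha 0%N) / c k
                * invGamma (alpha k) * invGamma (1 - alpha 0%N)
                * x `^ (-1 + alpha k) * (1 - x) `^ (- alpha 0%N))
            + \sum_(0 <= k < n.+1)
                s `^ alpha k / c k * invGamma (alpha k)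
                * x `^ (-1 + alpha k) * eps2 Pi (c 0%N) (alpha 0%N) (s - s * x)) |
        <= C * eps3 Pi N rho s x
    & forall p q : R, 0 < p -> p <= q -> q < 1 ->
        exists2 C : R, 0 < C & \forall s \near +oo,
        `| fine (P (undershoot_in X s `[p, q]%classic)) -
           (sin (pi * alpha 0%N) / pi
              * \int[lebesgue_measure]_(x in `[p, q])
                  (x `^ (-1 + alpha 0%N) * (1 - x) `^ (- alpha 0%N))
            + (0 < alpha 0%N)%R%:R * (\sum_(1 <= k < n.+1)
                c 0%N * s `^ (alpha k - alpha 0%N) / c k
                * invGamma (alpha k) * invGamma (1 - alpha 0%N)
                * \int[lebesgue_measure]_(x in `[p, q])
                    (x `^ (-1 + alpha k) * (1 - x) `^ (- alpha 0%N)))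
            + \sum_(0 <= k < n.+1)
                s `^ alpha k / c k * invGamma (alpha k)
                * \int[lebesgue_measure]_(x in `[p, q])
                    (x `^ (-1 + alpha k)
                     * eps2 Pi (c 0%N) (alpha 0%N) (s - s * x))) |
        <= C * sup [set eps3 Pi N rho s x | x in `[p, q]]].
Proof.
have [Y [zeta [Ysub [mzeta zeta_gt0 [rate rate0 zeta_exp]] indep XE]]] := X_sub.
have [a0 b0 levy Xchar] := X_char.
have [[c0_gt0 c_neq0] [a0_ge0 a0_le1 al_decr al_gt]
  [rho_gt0 rho_int rho_ndecr _] remainder] := condA.
have iw l (l0 : 0 < l) := integrable_alive Ysub mzeta XE a0 b0 levy X_neq0 Xchar l0.
have LPhi z (z0 : 0 < cRe z) := laplace_potential Ysub mzeta XE a0 b0 levy X_neq0 Xchar z0.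
have mal := measurable_alive mzeta.
have mpa := measurable_path Ysub.
have al0 := alive_ge0 zeta.
have pa0 := path_ge0 Ysub.
pose u : R -> R := udens (ptime P) mal mpa al0 pa0 N 1.
have Udens : is_continuous_density (potential P X) u.
  split.
  - move=> x; rewrite in_itv /= andbT => x0.
    exact: (udens_continuous iw LPhi condB ltr01 x0).
  - by move=> x x0; exact: (udens_ge0 mal mpa al0 pa0 iw LPhi condB x ltr01).
  - move=> A mA sA; rewrite (potentialE Ysub mzeta XE mA).
    exact: (regular_density mal mpa al0 pa0 iw LPhi condB ltr01 mA sA).
have U_fin := potential_itv_lty Ysub mzeta XE (iw 1 ltr01).
have dens (s : R) (B : set R) : 0 < s -> measurable B -> B `<=` `]0, 1[ ->
    P (undershoot_in X s B) =
    (\int[lebesgue_measure]_(x in B) (s * levy_tail Pi (s - s * x) * u (s * x))%:E)%E.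
  move=> s0 mB sB; rewrite (undershoot_inE zeta_gt0 XE s0 sB).
  apply: (undershoot_density (measurable_undershoot Ysub mzeta XE s) levy Udens s0) => //.
    move=> p q p0 pq qs.
    exact: (undershoot_itv_le Ysub mzeta XE indep zeta_exp b0 levy Xchar U_fin p0 pq qs).
  move=> p q p0 pq qs.
  exact: (undershoot_itv_ge Ysub mzeta XE indep zeta_exp b0 levy Xchar U_fin p0 pq qs).
(* The sequences are made constant after the index n, which makes the lower
   bound on the exponents hold for all indices. *)
pose al' k := alpha (minn k n); pose c' k := c (minn k n).
have trunc k : (0 <= k < n.+1)%N -> al' k = alpha k /\ c' k = c k.
  by rewrite ltnS => /= kn; rewrite /al' /c' (minn_idPl kn).
have al'_gt k : 1 < al' k + N%:R.
  by rewrite -ltrBlDr; apply: lt_le_trans al_gt (truncated_exponents al_decr k).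
have remainder' : exists2 C : R, 0 < C &
  \forall z \near within [set z : R[i] | 0 < cRe z] (nbhs (0 : R[i]^o)),
    cmod (cderive N (fun z => (levy_khintchine a b Pi z)^-1 -
        \sum_(0 <= k < n.+1) ((c' k)%:C * cpow z (al' k)%:C)^-1) z)
    <= C * rho (cmod z).
  case: remainder => C C0 H; exists C => //; move: H.
  suff -> : (fun z => (levy_khintchine a b Pi z)^-1 -
        \sum_(0 <= k < n.+1) ((c' k)%:C * cpow z (al' k)%:C)^-1) =
      (fun z => (levy_khintchine a b Pi z)^-1 -
        \sum_(0 <= k < n.+1) ((c k)%:C * cpow z (alpha k)%:C)^-1) by [].
  apply/funext => z; congr (_ - _); apply: eq_big_nat => k /trunc[-> ->] //.
have u_exp : exists2 C, 0 < C & \forall x \near +oo,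
     `|u x - \sum_(0 <= k < n.+1) invGamma (alpha k) / c k * x `^ (alpha k - 1)|
       <= C * eps1 N rho x.
  have [C C0 H] := density_expansion mal mpa al0 pa0 iw LPhi condB al'_gt rho_gt0 rho_int
    rho_ndecr remainder'.
  exists C => //; apply: filterS H => x; rewrite -/u.
  suff -> : \sum_(0 <= k < n.+1) invGamma (al' k) / c' k * x `^ (al' k - 1) =
    \sum_(0 <= k < n.+1) invGamma (alpha k) / c k * x `^ (alpha k - 1) by [].
  by apply: eq_big_nat => k /trunc[-> ->].
exists u => //; split => // p q p0 pq q1.
  by apply: expansion_pointwise.
have mf s (s0 : 0 < s) := measurable_undershoot_density levy Udens s0.
have sub : `[p, q]%classic `<=` `]0, 1[%classic.
  by move=> x; rewrite /= !in_itv /= => /andP[px xq]; rewrite (lt_le_trans p0 px) (le_lt_trans xq q1).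
have [C C0 H] := expansion_integral levy c0_gt0 a0_ge0 a0_le1 rho_gt0 rho_int rho_ndecr
  u_exp p0 pq q1 mf.
exists C => //; near=> s.
have s0 : 0 < s by near: s; apply: nbhs_pinfty_gt; rewrite num_real.
rewrite (dens s _ s0 (measurable_itv _) sub).
by near: s; exact: H.
Unshelve. all: by end_near. Qed.
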